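(* Suppose the running cost $f$ is strictly convex (case (I) of the context) and $0<\sigma_1\le\sigma_2$. Let $\theta(y)=c-f'(y)/\rho$ for $y\in[0,1]$, let $u(x,i;y)$ be the value function of the associated optimal stopping problem, let $b^*_1,b^*_2:\mathbb{R}\to[0,1]$ be the boundary functions defined in the context, and set $$F(x,y,i):=\int_0^y u(x,i;z)\,dz-\frac{f(y)}{\rho},\qquad (x,y,i)\in\mathcal{O}.$$ For $(x,y,i)\in\mathcal{O}$ let $\nu^*$ be the process $$\nu^*_t=\Big[y-\inf_{0\le s<t}b^*_{\varepsilon_s}(X_s)\Big]^+,\quad t>0,\qquad \nu^*_0=0 .$$ Then $\nu^*$ is optimal for the singular control problem $V(x,y,i)=\sup_{\nu\in\mathcal{A}_y}\mathcal{J}_{x,y,i}(\nu)$, i.e. $V(x,y,i)=\mathcal{J}_{x,y,i}(\nu^* )$ for every $(x,y,i)\in\mathcal{O}$, and $F\equiv V$ on $\mathcal{O}$.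
   Context: Let $(\Omega,\mathcal{F},\mathbb{P})$ be a complete probability space carrying a one-dimensional Brownian motion $W$ and an independent continuous-time Markov chain $\varepsilon$ with state space $\{1,2\}$ and generator $\begin{pmatrix}-\lambda_1&\lambda_1\\ \lambda_2&-\lambda_2\end{pmatrix}$, $\lambda_1,\lambda_2>0$; $\mathbb{F}$ is the augmented filtration generated by $(W,\varepsilon)$. With $\sigma_1,\sigma_2>0$, the price is $dX_t=\sigma_{\varepsilon_t}dW_t$, $X_0=x\in\mathbb{R}$. Let $\rho>0$, $c>0$ be constants and $\mathcal{O}:=\mathbb{R}\times[0,1]\times\{1,2\}$. $\mathbb{E}_{(x,i)}$ and $\mathbb{E}_{(x,y,i)}$ denote expectations given $X_0=x,\varepsilon_0=i$ (and $Y_0=y$). Running cost, case (I): $f:\mathbb{R}\to\mathbb{R}_+$ is increasing, $f(0)=0$, and $f$ is strictly convex and continuously differentiable on $[0,1]$. Control problem: for $y\in[0,1]$, $\mathcal{A}_y$ is the set of processes $\nu:\Omega\times\mathbb{R}_+\to\mathbb{R}_+$ that are nondecreasing, left-continuous, $\mathbb{F}$-adapted, with $\nu_0=0$ and $y-\nu_t\ge0$ for all $t\ge0$ a.s. Set $Y^\nu_t=y-\nu_t$ and $$\mathcal{J}_{x,y,i}(\nu)=\mathbb{E}_{(x,y,i)}\Big[\int_0^\infty e^{-\rho t}(X_t-c)\,d\nu_t-\int_0^\infty e^{-\rho t}f(Y^\nu_t)\,dt\Big],$$ where $\int_0^t\cdots d\nu_s$ means the Stieltjes integral over $[0,t)$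 (so that a jump of $\nu$ at time $0$, i.e. $\nu_{0+}>0$, is counted). $V(x,y,i)=\sup_{\nu\in\mathcal{A}_y}\mathcal{J}_{x,y,i}(\nu)$. Stopping problem: $u(x,i;y)=\sup_{\tau\ge0}\mathbb{E}_{(x,i)}[e^{-\rho\tau}(X_\tau-\theta(y))]$, supremum over all $\mathbb{P}_{(x,i)}$-a.s. finite $\mathbb{F}$-stopping times. Boundaries: let $\Phi_i(\alpha)=-\frac12\sigma_i^2\alpha^2+\rho+\lambda_i$, let $0<\alpha_3<\alpha_4$ be the two positive roots of $\Phi_1(\alpha)\Phi_2(\alpha)=\lambda_1\lambda_2$, $\alpha_5=\sqrt{2(\rho+\lambda_2)/\sigma_2^2}$, and $a_1=-\frac{\alpha_4\Phi_1(\alpha_3)-\alpha_3\Phi_1(\alpha_4)}{\lambda_1(\alpha_4-\alpha_3)}+\frac{\lambda_2}{\rho+\lambda_2}$, $a_2=\frac{\Phi_1(\alpha_3)-\Phi_1(\alpha_4)}{\lambda_1(\alpha_4-\alpha_3)}$, $a_3=\frac{\alpha_3\alpha_4[\Phi_1(\alpha_4)-\Phi_1(\alpha_3)]}{\lambda_1(\alpha_4-\alpha_3)}$, $a_4=\frac{\alpha_3\Phi_1(\alpha_3)-\alpha_4\Phi_1(\alpha_4)}{\lambda_1(\alpha_4-\alpha_3)}+\frac{\lambda_2}{\rho+\lambda_2}$. If $\sigma_1<\sigma_2$, let $(z_1^*,z_2^* )$ be the unique solution in $(0,\infty)\times(0,\hat z_2)$ of $$\Big(a_1+\tfrac{\rho}{\rho+\lambda_2}\cosh(\alpha_5v)\Big)u-\tfrac{\rho}{\rho+\lambda_2}\Big[\tfrac1{\alpha_5}\sinh(\alpha_5v)-v\cosh(\alpha_5v)\Big]+a_2=0,$$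 $$\Big(a_3-\tfrac{\rho\alpha_5}{\rho+\lambda_2}\sinh(\alpha_5v)\Big)u-\tfrac{\rho}{\rho+\lambda_2}\big[v\alpha_5\sinh(\alpha_5v)-\cosh(\alpha_5v)\big]+a_4=0$$ in the unknowns $(u,v)$, where $\hat z_2$ is the unique positive zero of $v\mapsto a_1+\frac{\rho}{\rho+\lambda_2}\cosh(\alpha_5v)$; put $x_1^*(y)=z_1^*+\theta(y)$, $x_2^*(y)=z_2^*+x_1^*(y)$. If $\sigma_1=\sigma_2=\sigma$, put $x_1^*(y)=x_2^*(y)=\frac{\sigma}{\sqrt{2\rho}}+\theta(y)$. Each $x_i^*$ is continuous and strictly decreasing on $[0,1]$, and $b^*_i(x):=1$ if $x\le x_i^*(1)$, $b_i^*(x):=(x_i^* )^{-1}(x)$ if $x\in(x_i^*(1),x_i^*(0))$, $b^*_i(x):=0$ if $x\ge x_i^*(0)$. *)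

(* Defs.v *)
From HB Require Import structures.
From mathcomp Require Import all_boot all_order all_algebra.
From mathcomp Require Import all_classical all_reals all_analysis.

Set Implicit Arguments.
Unset Strict Implicit.
Unset Printing Implicit Defensive.

Import Order.TTheory GRing.Theory Num.Theory.
Import numFieldNormedType.Exports.

Local Open Scope classical_set_scope.
Local Open Scope ring_scope.

(* Processes are functions of a time in [R], but only their values at times
   t >= 0 are used. *)

(* The regimes 1 and 2 are the ordinals 0 and 1. *)
Definition reg1 : 'I_2 := ord0.
Definition reg2 : 'I_2 := ord_max.

Section Filtrations.
Context d (Omega : measurableType d) (R : realType) (P : probability Omega R).

(* [G] is the sigma-algebra put on the state space [T] of the process. *)
Definition process_sigma (T : Type) (G : set (set T)) (Z : R -> Omega -> T)
    (I : set R) : set (set Omega) :=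
  <<s [set A | exists s, I s /\ exists2 B, G B & A = Z s @^-1` B] >>.

Definition independent_systems (G H : set (set Omega)) : Prop :=
  forall A B, G A -> H B -> P (A `&` B) = (P A * P B)%E.

Definition augmented_filtration (W : R -> Omega -> R) (eps : R -> Omega -> 'I_2)
    (t : R) : set (set Omega) :=
  <<s process_sigma measurable W `[0, t]
      `|` process_sigma setT eps `[0, t]
      `|` [set N | P.-negligible N] >>.

Definition adapted (F : R -> set (set Omega)) (Z : R -> Omega -> R) : Prop :=
  forall t, 0 <= t -> forall B, measurable B -> F t (Z t @^-1` B).

Definition stopping_time (F : R -> set (set Omega)) (tau : Omega -> \bar R) :=
  (forall w, 0 <= tau w)%E /\
  (forall t, 0 <= t -> F t [set w | (tau w <= t%:E)%E]).

Definition cond_expectation (D : set Omega) (Z : Omega -> \bar R) : \bar R :=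
  ((fine (P D))^-1%:E * \int[P]_(w in D) Z w)%E.

End Filtrations.

Section DrivingProcesses.
Context d (Omega : measurableType d) (R : realType) (P : probability Omega R).

Record brownian_motion (W : R -> Omega -> R) : Prop := BrownianMotion {
  bm_measurable : forall t, 0 <= t -> measurable_fun setT (W t) ;
  bm_start : {ae P, forall w, W 0 w = 0} ;
  bm_continuous : {ae P, forall w, {within `[0, +oo[, continuous (W ^~ w)}} ;
  bm_gaussian : forall s t, 0 <= s -> s < t -> forall B, measurable B ->
    pushforward P (W t \- W s) B = normal_prob 0 (Num.sqrt (t - s)) B ;
  bm_independent : forall s t, 0 <= s -> s < t ->
    independent_systems P (process_sigma measurable W `[0, s])
      [set (W t \- W s) @^-1` B | B in measurable] }.

Definition exp_mx (A : 'M[R]_2) : 'M[R]_2 :=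
  \matrix_(i, j) limn (series (fun k => (k`!%:R^-1 *: A ^+ k) i j)).

Definition generator (lambda : 'I_2 -> R) : 'M[R]_2 :=
  \matrix_(i, j) if i == j then - lambda i else lambda i.

(* Since the state space is discrete, the path is right-continuous with left
   limits iff it is locally constant on each side of every time. *)
Definition cadlag_path (T : Type) (e : R -> T) : Prop :=
  (forall t, 0 <= t -> \forall s \near t^'+, e s = e t) /\
  (forall t, 0 < t -> exists j, \forall s \near t^'-, e s = j).

Record markov_chain (Q : 'M[R]_2) (eps : R -> Omega -> 'I_2) : Prop :=
  MarkovChain {
  mc_measurable : forall t i, 0 <= t -> measurable [set w | eps t w = i] ;
  mc_cadlag : {ae P, forall w, cadlag_path (eps ^~ w)} ;
  mc_markov : forall s t, 0 <= s -> 0 <= t ->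
    forall A, process_sigma setT eps `[0, s] A -> forall i j,
    P (A `&` [set w | eps s w = i] `&` [set w | eps (s + t) w = j]) =
    (P (A `&` [set w | eps s w = i]) * (exp_mx (t *: Q) i j)%:E)%E }.

End DrivingProcesses.

Section Ito.
Context d (Omega : measurableType d) (R : realType) (P : probability Omega R).
Variables (F : R -> set (set Omega)) (W : R -> Omega -> R).

(* The integrand equal to [sp_value k] on ]sp_time k, sp_time k.+1], k < sp_size *)
Record simple_process := SimpleProcess {
  sp_size : nat ;
  sp_time : nat -> R ;
  sp_value : nat -> Omega -> R ;
  sp_time_ge0 : 0 <= sp_time 0%N ;
  sp_time_nd : nondecreasing_seq sp_time ;
  sp_value_meas :
    forall k B, measurable B -> F (sp_time k) (sp_value k @^-1` B) ;
  sp_value_bnd : forall k, exists M, forall w, `|sp_value k w| <= M }.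

Definition simple_path (S : simple_process) (s : R) (w : Omega) : R :=
  \sum_(k < sp_size S)
    sp_value S k w * (sp_time S k < s <= sp_time S k.+1)%R%:R.

Definition simple_integral (S : simple_process) (t : R) (w : Omega) : R :=
  \sum_(k < sp_size S) sp_value S k w *
    (W (Num.min (sp_time S k.+1) t) w - W (Num.min (sp_time S k) t) w).

(* [M] is a continuous version of the Ito integral of [H] against [W]: the
   L2-limit of the integrals of simple processes approximating [H] in
   L2(dP x dt) on [0, t]. *)
Definition ito_integral (H M : R -> Omega -> R) : Prop :=
  [/\ adapted F M,
      {ae P, forall w, {within `[0, +oo[, continuous (M ^~ w)}} &
      forall t, 0 <= t -> exists S : nat -> simple_process,
        (fun n => \int[P]_w \int[lebesgue_measure]_(s in `[0%R, t])
           ((simple_path (S n) s w - H s w) ^+ 2)%:E)%E @ \oo --> 0%E /\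
        (fun n => \int[P]_w
           ((simple_integral (S n) t w - M t w) ^+ 2)%:E)%E @ \oo --> 0%E].

(* dX_t = sigma_(eps_t) dW_t, X_0 = x *)
Definition price_process (sigma : 'I_2 -> R) (eps : R -> Omega -> 'I_2) (x : R)
    (X : R -> Omega -> R) : Prop :=
  {ae P, forall w, X 0 w = x} /\
  ito_integral (fun t w => sigma (eps t w)) (fun t w => X t w - x).

End Ito.

Section Stieltjes.
Context {R : realType}.
Implicit Types g h : R -> R.

Definition increasing_path g : Prop :=
  [/\ g 0 = 0,
      forall s t, 0 <= s -> s <= t -> g s <= g t &
      forall t, 0 < t -> g s @[s --> t^'-] --> g t].

(* The library's Stieltjes measures take a right-continuous distribution
   function, so the left-continuous path [g] is replaced by its right limits
   g(t+), extended by 0 on t < 0: the measure then gives [0, t[ the mass g(t)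
   and {0} the mass g(0+). *)
Definition right_limits g (hg : increasing_path g) (t : R) : R :=
  if t < 0 then 0 else inf [set g s | s in `]t, +oo[].

Section cumulative.
Variables (g : R -> R) (hg : increasing_path g).

Let g_ge0 s : 0 <= s -> 0 <= g s.
Proof. by case: hg => g0 gnd _ s0; rewrite -g0; exact: gnd. Qed.

Let lb t : 0 <= t -> has_inf [set g s | s in `]t, +oo[].
Proof.
move=> t0; split.
  by exists (g (t + 1)), (t + 1) => //=; rewrite in_itv/= andbT ltrDl.
exists 0 => _ [s /= + <-]; rewrite in_itv/= andbT => ts.
by apply: g_ge0; rewrite (le_trans t0)// ltW.
Qed.

Let right_limits_le t s : 0 <= t -> t < s -> right_limits hg t <= g s.
Proof.
move=> t0 ts; rewrite /right_limits ltNge t0/=.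
apply: ge_inf; first by case: (lb t0).
by exists s => //=; rewrite in_itv/= andbT.
Qed.

Lemma right_limits_nd : nondecreasing (right_limits hg).
Proof.
move=> s t st; rewrite {2}/right_limits; case: ltP => t0.
  by rewrite /right_limits (le_lt_trans st t0).
apply: lb_le_inf; first by case: (lb t0).
move=> _ [r /= + <-]; rewrite in_itv/= andbT => tr.
have [s0|s0] := ltP s 0.
  by rewrite /right_limits s0; apply: g_ge0; rewrite (le_trans t0)// ltW.
by apply: right_limits_le => //; exact: le_lt_trans tr.
Qed.

Lemma right_limits_rc : right_continuous (right_limits hg).
Proof.
move=> t; have [t0|t0] := ltP t 0.
  apply: cvg_near_cst; near=> s.
  have s0 : s < 0 by near: s; exact: nbhs_right_lt.
  by rewrite /right_limits s0 t0.
apply/cvgrPdist_le => e e0.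
have [_ [s /= + <-] gs] := inf_adherent e0 (lb t0).
rewrite in_itv/= andbT => ts.
have {}gs : g s < right_limits hg t + e by rewrite /right_limits (ltNge t 0) t0.
near=> r.
have tr : t < r by near: r; exact: nbhs_right_gt.
have rs : r < s by near: r; exact: nbhs_right_lt.
rewrite distrC ger0_norm ?subr_ge0; last by apply: right_limits_nd; exact: ltW.
rewrite lerBlDl (le_trans _ (ltW gs))// right_limits_le//.
by rewrite (le_trans t0)// ltW.
Unshelve. all: by end_near. Qed.

HB.instance Definition _ := isCumulative.Build R _ R (right_limits hg)
  right_limits_nd right_limits_rc.

End cumulative.

(* The Stieltjes integral of [h] against [g] over [0, +oo[, jump at 0
   included; the value off [increasing_path] is irrelevant. *)
Definition stieltjes_integral h g : \bar R :=
  match pselect (increasing_path g) with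
  | left hg => (\int[lebesgue_stieltjes_measure (right_limits hg)]_(t in
                  `[0%R, +oo[) (h t)%:E)%E
  | right _ => 0%E
  end.

End Stieltjes.

Section RunningCost.
Context {R : realType}.
Implicit Types f : R -> R.

(* Derivative relative to [0, 1], hence one-sided at 0 and 1. *)
Definition unit_quotient f (y z : R) : R := (f z - f y) / (z - y).

Definition unit_derive f (y : R) : R :=
  lim (unit_quotient f y z @[z --> within `[0, 1] y^']).

Definition C1_on_unit f : Prop :=
  (forall y, 0 <= y <= 1 ->
     cvg (unit_quotient f y z @[z --> within `[0, 1] y^'])) /\
  {within `[0, 1], continuous (unit_derive f)}.

Definition strictly_convex_on_unit f : Prop :=
  forall a b t, 0 <= a <= 1 -> 0 <= b <= 1 -> a != b -> 0 < t < 1 ->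
    f (t * a + (1 - t) * b) < t * f a + (1 - t) * f b.

Definition convex_running_cost f : Prop :=
  [/\ forall y, 0 <= f y,
      {homo f : a b / a <= b},
      f 0 = 0,
      strictly_convex_on_unit f &
      C1_on_unit f].

Definition theta (rho c : R) f (y : R) : R := c - unit_derive f y / rho.

End RunningCost.

Section Boundaries.
Context {R : realType}.
Variables (rho c : R) (sigma lambda : 'I_2 -> R).

Definition cosh (v : R) : R := (expR v + expR (- v)) / 2.
Definition sinh (v : R) : R := (expR v - expR (- v)) / 2.

Definition Phi (i : 'I_2) (a : R) : R :=
  - (sigma i ^+ 2 * a ^+ 2) / 2 + rho + lambda i.

Definition characteristic_root (a : R) : Prop :=
  Phi reg1 a * Phi reg2 a = lambda reg1 * lambda reg2.

Definition alpha34 : R * R :=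
  xget (0, 0) [set p | 0 < p.1 < p.2 /\
    (characteristic_root p.1 /\ characteristic_root p.2)].
Definition alpha3 : R := alpha34.1.
Definition alpha4 : R := alpha34.2.
Definition alpha5 : R :=
  Num.sqrt (2 * (rho + lambda reg2) / sigma reg2 ^+ 2).

Let denom : R := lambda reg1 * (alpha4 - alpha3).
Let kappa : R := rho / (rho + lambda reg2).

Definition coef1 : R :=
  - ((alpha4 * Phi reg1 alpha3 - alpha3 * Phi reg1 alpha4) / denom)
  + lambda reg2 / (rho + lambda reg2).
Definition coef2 : R := (Phi reg1 alpha3 - Phi reg1 alpha4) / denom.
Definition coef3 : R :=
  alpha3 * alpha4 * (Phi reg1 alpha4 - Phi reg1 alpha3) / denom.
Definition coef4 : R :=
  (alpha3 * Phi reg1 alpha3 - alpha4 * Phi reg1 alpha4) / denom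
  + lambda reg2 / (rho + lambda reg2).

Definition hat_z2 : R :=
  xget 0 [set v | 0 < v /\ coef1 + kappa * cosh (alpha5 * v) = 0].

Definition boundary_system (u v : R) : Prop :=
  (coef1 + kappa * cosh (alpha5 * v)) * u
    - kappa * (alpha5^-1 * sinh (alpha5 * v) - v * cosh (alpha5 * v))
    + coef2 = 0 /\
  (coef3 - kappa * alpha5 * sinh (alpha5 * v)) * u
    - kappa * (v * alpha5 * sinh (alpha5 * v) - cosh (alpha5 * v))
    + coef4 = 0.

Definition z_star : R * R :=
  xget (0, 0) [set p | [/\ 0 < p.1, 0 < p.2 < hat_z2 &
                           boundary_system p.1 p.2]].

Definition x_star (f : R -> R) (i : 'I_2) (y : R) : R :=
  if sigma reg1 < sigma reg2 then
    let x1 := z_star.1 + theta rho c f y in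
    if i == reg1 then x1 else z_star.2 + x1
  else sigma reg1 / Num.sqrt (2 * rho) + theta rho c f y.

Definition b_star (f : R -> R) (i : 'I_2) (x : R) : R :=
  if x <= x_star f i 1 then 1
  else if x_star f i 0 <= x then 0
  else 'pinv_(fun=> 0) `[0, 1] (x_star f i) x.

End Boundaries.

Section Problems.
Context d (Omega : measurableType d) (R : realType) (P : probability Omega R).
Variables (W : R -> Omega -> R) (eps : R -> Omega -> 'I_2).
Variables (X : R -> R -> Omega -> R).
Variables (rho c : R) (f : R -> R).

Local Notation F := (augmented_filtration P W eps).

Definition initial_regime (i : 'I_2) : set Omega := [set w | eps 0 w = i].

Definition stopping_value (x : R) (i : 'I_2) (y : R) : \bar R :=
  ereal_sup [set
    cond_expectation P (initial_regime i) (fun w =>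
      (expR (- rho * fine (tau w)) *
        (X x (fine (tau w)) w - theta rho c f y))%:E)
    | tau in [set tau : Omega -> \bar R | stopping_time F tau /\
        {ae P, forall w, initial_regime i w -> tau w \is a fin_num}]].

Definition admissible (y : R) (nu : R -> Omega -> R) : Prop :=
  adapted F nu /\
  {ae P, forall w, increasing_path (nu ^~ w) /\
                   forall t, 0 <= t -> 0 <= y - nu t w}.

Definition objective (x y : R) (i : 'I_2) (nu : R -> Omega -> R) : \bar R :=
  cond_expectation P (initial_regime i) (fun w =>
    stieltjes_integral (fun t => expR (- rho * t) * (X x t w - c))%R (nu ^~ w)
    - \int[lebesgue_measure]_(t in `[0%R, +oo[)
        (expR (- rho * t) * f (y - nu t w))%:E)%E.

Definition control_value (x y : R) (i : 'I_2) : \bar R :=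
  ereal_sup [set objective x y i nu | nu in admissible y].

Definition candidate_value (x y : R) (i : 'I_2) : \bar R :=
  ((\int[lebesgue_measure]_(z in `[0%R, y]) stopping_value x i z)
   - (f y / rho)%:E)%E.

Definition optimal_control (b : 'I_2 -> R -> R) (x y : R) (t : R) (w : Omega)
    : R :=
  if t <= 0 then 0
  else Num.max 0 (y - inf [set b (eps s w) (X x s w) | s in `[0, t[]).

End Problems.

(* Main.v *)
(* Under a control [nu], let tau(z) be the first time at which [nu] exceeds
   y - z, for z in ]0, y[. Changing variables in the Stieltjes integral and in
   the running cost, path by path, and applying Fubini, one finds that J(nu) is
   -f(y)/rho plus the integral over z of E[e^(-rho tau(z)) (X_tau(z) - theta z)].
   So J(nu) <= F(x, y, i), with equality when every tau(z) is optimal for its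
   stopping problem; and for nu^* the time tau(z) is the hitting time of the
   stopping region { x >= x_i^*(z) }.

   The stopping value is w_i(x - theta z) for an explicit C^1 solution w of the
   free boundary problem. The verification avoids stochastic calculus: the price
   enters only through moment bounds and orthogonality of its increments, a
   Dynkin formula is obtained by Taylor expansion along dyadic times, and it is
   applied to difference quotients of an antiderivative of w, which are C^2. *)

Require Import Defs.
From HB Require Import structures.
From mathcomp Require Import all_boot all_order all_algebra.
From mathcomp Require Import all_classical all_reals all_analysis.
From mathcomp Require Import measurable_realfun.
From mathcomp Require Import ring lra.

Set Implicit Arguments.
Unset Strict Implicit.
Unset Printing Implicit Defensive.

Import Order.TTheory GRing.Theory Num.Theory.
Import numFieldNormedType.Exports.

Local Open Scope classical_set_scope.
Local Open Scope ring_scope.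

(** * Expectations and normal moments *)

Section Expectation.
Context d (T : measurableType d) (R : realType) (P : probability T R).
Implicit Types U V : T -> R.

(** The obstacle is that the price is known only through the definition of its Ito integral: for
    each time separately, an L2-limit of simple integrals. Freezing the volatility over a step of
    length [h] costs a mean-square error of order [h ^+ 2], so a smooth function of the state
    follows its generator up to [h] to the power [3 / 2] per step; over [T / h] steps the errors add
    up to order [sqrt h] and vanish. The filtration is completed but not known to be
    right-continuous, so first passage times only have [tau < t] in [F t]. Dynkin's formula is
    therefore proved for such optional times, which covers both the hitting times and the passage
    times of an arbitrary control. Times may be infinite. Doob's inequality dominates the price at
    the discount rate [rho / 2], and the other half of the discount makes infinite times contribute
    zero. The thresholds are values of [xget]: an intermediate value argument shows that the
    boundary system has a solution, and everything else is derived from the equations and signs that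
    the selected solution satisfies. *)

Definition L1 U := P.-integrable setT (EFin \o U).
(** Expectations are real numbers so that [ring] and [lra] apply to them; the price is an [L1] side
    condition in most identities. *)
Definition E U : R := \int[P]_w U w.

Lemma L1_measurable U : L1 U -> measurable_fun setT U.
Proof. by move=> /measurable_int /measurable_EFinP. Qed.

Lemma L1_le U V : measurable_fun setT U -> (forall w, `|U w| <= V w) ->
  L1 V -> L1 U.
Proof.
move=> mU UV iV; apply: le_integrable iV => //; first exact/measurable_EFinP.
by move=> w _; rewrite /= lee_fin (le_trans (UV w))// ler_norm.
Qed.

Lemma L1_cst r : L1 (fun=> r).
Proof. exact: finite_measure_integrable_cst. Qed.

Lemma L1_bounded U M : measurable_fun setT U -> (forall w, `|U w| <= M) -> L1 U.
Proof. by move=> mU UM; apply: (L1_le mU UM); exact: L1_cst. Qed.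

Lemma L1D U V : L1 U -> L1 V -> L1 (fun w => U w + V w).
Proof. by move=> iU iV; have := integrableD measurableT iU iV. Qed.

Lemma L1B U V : L1 U -> L1 V -> L1 (fun w => U w - V w).
Proof. by move=> iU iV; have := integrableB measurableT iU iV. Qed.

Lemma L1Z r U : L1 U -> L1 (fun w => r * U w).
Proof. by move=> iU; have := integrableZl measurableT r iU. Qed.

Lemma L1_abs U : L1 U -> L1 (fun w => `|U w|).
Proof. exact: integrable_norm. Qed.

Lemma L1_sum (I : Type) (s : seq I) (Q : pred I) (F : I -> T -> R) :
  (forall i, Q i -> L1 (F i)) -> L1 (fun w => \sum_(i <- s | Q i) F i w).
Proof.
move=> iF; elim: s => [|i s ih].
  by under [X in L1 X]eq_fun do rewrite big_nil; exact: L1_cst.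
under [X in L1 X]eq_fun do rewrite big_cons.
have [Qi|//] := boolP (Q i).
by apply: L1D => //; exact: iF.
Qed.

Lemma L1Mb U V M : measurable_fun setT V -> (forall w, `|V w| <= M) ->
  L1 U -> L1 (fun w => V w * U w).
Proof.
move=> mV VM iU; apply: (@L1_le _ (fun w => M * `|U w|)).
- by apply: measurable_funM => //; exact: L1_measurable.
- by move=> w; rewrite normrM ler_wpM2r.
- by apply: L1Z; exact: L1_abs.
Qed.

Lemma L1_indic A U : measurable A -> L1 U -> L1 (fun w => \1_A w * U w).
Proof.
move=> mA; apply: (@L1Mb _ _ 1); first exact: measurable_indic.
by move=> w; rewrite indicE; case: (w \in A); rewrite ?normr1 ?normr0.
Qed.

Lemma EZ r U : L1 U -> E (fun w => r * U w) = r * E U.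
Proof. by move=> iU; rewrite /E RintegralZl. Qed.

Lemma ED U V : L1 U -> L1 V -> E (fun w => U w + V w) = E U + E V.
Proof. by move=> iU iV; rewrite /E RintegralD. Qed.

Lemma EB U V : L1 U -> L1 V -> E (fun w => U w - V w) = E U - E V.
Proof. by move=> iU iV; rewrite /E RintegralB. Qed.

Lemma E_cst r : E (fun=> r) = r.
Proof. by rewrite /E Rintegral_cst//= [X in fine X]probability_setT mulr1. Qed.

Lemma E_le U V : L1 U -> L1 V -> (forall w, U w <= V w) -> E U <= E V.
Proof. by move=> iU iV UV; apply: le_Rintegral. Qed.

Lemma E_ge0 U : (forall w, 0 <= U w) -> 0 <= E U.
Proof. by move=> U0; apply: Rintegral_ge0. Qed.

Lemma E_abs U : L1 U -> `|E U| <= E (fun w => `|U w|).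
Proof. by move=> iU; apply: le_normr_Rintegral. Qed.

Lemma E_le_abs U V : measurable_fun setT U -> L1 V ->
  (forall w, `|U w| <= V w) -> `|E U| <= E V.
Proof.
move=> mU iV UV; have iU := L1_le mU UV iV.
by apply: (le_trans (E_abs iU)); apply: E_le => //; exact: L1_abs.
Qed.

Lemma E_sum (I : Type) (s : seq I) (Q : pred I) (F : I -> T -> R) :
  (forall i, Q i -> L1 (F i)) ->
  E (fun w => \sum_(i <- s | Q i) F i w) = \sum_(i <- s | Q i) E (F i).
Proof.
move=> iF; elim: s => [|i s ih].
  by under [X in E X]eq_fun do rewrite big_nil; rewrite E_cst big_nil.
under [X in E X]eq_fun do rewrite big_cons.
rewrite big_cons; have [Qi|//] := boolP (Q i).
by rewrite ED ?ih//; [exact: iF|exact: L1_sum].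
Qed.

Lemma E_EFin U : L1 U -> (\int[P]_w (U w)%:E = (E U)%:E)%E.
Proof. by move=> iU; rewrite /E /Rintegral fineK// integrable_fin_num. Qed.

Lemma E_ae U V : measurable_fun setT U -> measurable_fun setT V ->
  {ae P, forall w, U w = V w} -> E U = E V.
Proof.
move=> mU mV UV; congr fine; apply: ae_eq_integral => //.
- exact/measurable_EFinP.
- exact/measurable_EFinP.
- by apply: filterS UV => w /= -> _.
Qed.

Lemma L1_ge0_lty U : measurable_fun setT U -> (forall w, 0 <= U w) ->
  (\int[P]_w (U w)%:E < +oo)%E -> L1 U.
Proof.
move=> mU U0 fU; apply/integrableP; split; first exact/measurable_EFinP.
by under eq_integral => w _ do rewrite /= ger0_norm//.
Qed.

End Expectation.

(** * Integration against a measure with a density *)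

Section Density.
Context d (T : measurableType d) (R : realType).
Variables (N : {finite_measure set T -> \bar R})
  (mu : {sigma_finite_measure set T -> \bar R}).

(** The density formula makes [N] absolutely continuous, and functions with equal integrals over all
    measurable sets agree almost everywhere, so [p] is the Radon-Nikodym derivative. *)
Lemma ge0_integral_density (p : T -> R) (f : T -> \bar R) :
  measurable_fun setT p ->
  (forall A, measurable A -> N A = \int[mu]_(x in A) (p x)%:E)%E ->
  measurable_fun setT f -> (forall x, 0 <= f x)%E ->
  (\int[N]_x f x = \int[mu]_x (f x * (p x)%:E))%E.
Proof.
move=> mp Np mf f0.
have mp' : measurable_fun setT (EFin \o p) by exact/measurable_EFinP.
have Nmu : N `<< mu.
  apply/null_content_dominatesP => A mA A0; rewrite Np//.
  by apply: null_set_integral => //; exact: measurable_funTS.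
rewrite -(Radon_Nikodym_SigmaFinite.change_of_variables Nmu)//.
have mg := measurable_int _ (Radon_Nikodym_SigmaFinite.f_integrable Nmu).
apply: ae_eq_integral => //.
- exact: emeasurable_funM.
- exact: emeasurable_funM.
- apply: ae_eqe_mul2l; apply: integral_ae_eq => //.
    exact: Radon_Nikodym_SigmaFinite.f_integrable.
  by move=> A _ mA; rewrite -Radon_Nikodym_SigmaFinite.f_integral ?Np.
Qed.

End Density.

(** * Moments of centred normal laws *)

Section NormalMoments.
Context (R : realType).
Notation mu := (@lebesgue_measure R).
Implicit Types s r x : R.

Lemma ge0_integral_normal s (f : R -> \bar R) :
  measurable_fun setT f -> (forall x, 0 <= f x)%E ->
  (\int[normal_prob 0 s]_x f x = \int[mu]_x (f x * (normal_pdf 0 s x)%:E))%E.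
Proof.
move=> mf f0; pose N : probability _ R := normal_prob 0 s.
apply: (ge0_integral_density (N := N)) => //; exact: measurable_normal_pdf.
Qed.

(* Comparing the densities of two centred normal laws through the pointwise
   bounds [c <= exp (k x^2)] or [1 + k x^2 <= exp (k x^2)] gives all the
   moments needed below from the single fact that densities integrate to 1. *)
Lemma normal_integral_le s m r (q : R -> R) C : 0 <= C ->
  measurable_fun setT q -> (forall x, 0 <= q x) ->
  (forall x, q x * normal_pdf 0 s x <= C * normal_pdf m r x) ->
  (\int[normal_prob 0 s]_x (q x)%:E <= C%:E)%E.
Proof.
move=> C0 mq q0 qC; rewrite ge0_integral_normal//; last first.
  exact/measurable_EFinP.
rewrite -[leRHS]mule1 -(integral_normal_pdf m r) -ge0_integralZl//.
- apply: ge0_le_integral => //.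
  + by move=> x _; rewrite -EFinM lee_fin mulr_ge0// normal_pdf_ge0.
  + apply: emeasurable_funM; apply/measurable_EFinP => //.
    exact: measurable_normal_pdf.
  + apply: emeasurable_funM; apply/measurable_EFinP => //.
    exact: measurable_normal_pdf.
  + by move=> x _; rewrite -!EFinM lee_fin.
- by apply/measurable_EFinP; exact: measurable_normal_pdf.
- by move=> x _; rewrite lee_fin normal_pdf_ge0.
Qed.

(** The factors [s] and [r] cancel the normalising constants and leave the exponential of a
    quadratic. *)
Lemma normal_pdf_ratio s r x : 0 < s -> 0 < r ->
  s * normal_pdf 0 s x =
  r * normal_pdf 0 r x * expR ((r ^- 2 - s ^- 2) / 2 * x ^+ 2).
Proof.
move=> s0 r0.
have s1 : s != 0 by rewrite gt_eqF.
have r1 : r != 0 by rewrite gt_eqF.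
have peakE t : 0 < t -> t * normal_peak t = (Num.sqrt (pi *+ 2))^-1.
  move=> t0; rewrite /normal_peak -mulrnAr sqrtrM ?sqr_ge0// sqrtr_sqr.
  by rewrite gtr0_norm// invfM mulrA divff ?mul1r// gt_eqF.
rewrite !normal_pdfE// !mulrA !peakE// -[RHS]mulrA; congr (_ * _).
rewrite /normal_fun -expRD; congr expR.
by field; rewrite r1 s1.
Qed.

Lemma expR_ge_sqr4 x : 0 <= x -> x ^+ 2 / 4 <= expR x.
Proof.
move=> x0; have -> : x = x / 2 + x / 2 by field.
rewrite expRD; have h := expR_ge1Dx (x / 2).
have : (1 + x / 2) * (1 + x / 2) <= expR (x / 2) * expR (x / 2).
  by apply: ler_pM => //; lra.
by apply: le_trans; nra.
Qed.

(** Comparison with the law of standard deviation [2 * s]. The true moment is [3 * s ^+ 4]; only the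
    order in [s] matters for the remainder estimates. *)
Lemma normal_moment4_le s : 0 < s ->
  (\int[normal_prob 0 s]_x (x ^+ 4)%:E <= (64 * s ^+ 4)%:E)%E.
Proof.
move=> s0; apply: (@normal_integral_le _ 0 (2 * s)).
- by rewrite mulr_ge0// exprn_ge0// ltW.
- exact: measurable_funX.
- by move=> x; rewrite exprn_even_ge0.
- move=> x; have s2 : 0 < 2 * s by lra.
  have := normal_pdf_ratio x s2 s0.
  set k := (_ / 2 * _) => ratio.
  have sn0 : s != 0 by rewrite gt_eqF.
  have kE : k = 3 / 8 * (x / s) ^+ 2 by rewrite /k; field.
  have k0 : 0 <= k by rewrite kE mulr_ge0// sqr_ge0.
  have h := expR_ge_sqr4 k0.
  have p0 := normal_pdf_ge0 0 s x.
  have E : x ^+ 4 = 256 / 9 * s ^+ 4 * (k ^+ 2 / 4).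
    by rewrite kE; field.
  rewrite E.
  have -> : 64 * s ^+ 4 * normal_pdf 0 (2 * s) x =
    32 * s ^+ 4 * (normal_pdf 0 s x * expR k).
    apply: (mulfI sn0); have -> : s * (64 * s ^+ 4 * normal_pdf 0 (2 * s) x) =
      32 * s ^+ 4 * (2 * s * normal_pdf 0 (2 * s) x) by ring.
    by rewrite ratio; ring.
  have s40 : 0 <= s ^+ 4 by rewrite exprn_ge0// ltW.
  apply: (@le_trans _ _ (256 / 9 * s ^+ 4 * expR k * normal_pdf 0 s x)).
    have : 0 <= 256 / 9 * s ^+ 4.
      by apply: mulr_ge0; [rewrite divr_ge0 ?ler0n|exact: s40].
    move: (256 / 9 * s ^+ 4) => q q0.
    by apply: ler_wpM2r; [exact: p0|apply: ler_wpM2l; [exact: q0|exact: h]].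
  have -> : 32 * s ^+ 4 * (normal_pdf 0 s x * expR k) =
     32 * s ^+ 4 * expR k * normal_pdf 0 s x by ring.
  by rewrite !ler_wpM2r ?expR_ge0//; lra.
Qed.

Lemma normal_moment2_le s : 0 < s ->
  (\int[normal_prob 0 s]_x (x ^+ 2)%:E <= (s ^+ 2)%:E)%E.
Proof.
move=> s0.
(* For this [k] the product of [exp (k x^2)] and the density of deviation [s] is [r / s] times the
   density of deviation [r]. Integrating [1 + k x^2 <= exp (k x^2)] gives the bound, which tends to
   [s ^+ 2] as [r] decreases to [s]. *)
have bound r : s < r ->
    (\int[normal_prob 0 s]_x (x ^+ 2)%:E <= (2 * s * r ^+ 2 / (s + r))%:E)%E.
  move=> sr; have r0 : 0 < r by lra.
  have sn0 : s != 0 by rewrite gt_eqF.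
  have rn0 : r != 0 by rewrite gt_eqF.
  have rsn0 : r - s != 0 by lra.
  have srn0 : s + r != 0 by lra.
  pose k := (s ^- 2 - r ^- 2) / 2.
  have kE : k = (r - s) * (r + s) / (2 * s ^+ 2 * r ^+ 2) by rewrite /k; field; rewrite sn0 rn0.
  have k0 : 0 < k.
    by rewrite kE divr_gt0// ?mulr_gt0// ?exprn_gt0//; lra.
  have h : (\int[normal_prob 0 s]_x (1 + k * x ^+ 2)%:E <= (r / s)%:E)%E.
    apply: (@normal_integral_le _ 0 r).
    + by rewrite divr_ge0// ltW.
    + apply: measurable_funD => //; apply: measurable_funM => //.
    + by move=> x; rewrite addr_ge0// mulr_ge0 ?sqr_ge0// ltW.
    + move=> x; have := normal_pdf_ratio x r0 s0; rewrite -/k => ratio.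
      have -> : r / s * normal_pdf 0 r x = normal_pdf 0 s x * expR (k * x ^+ 2).
        by rewrite mulrAC ratio; field.
      by rewrite mulrC ler_wpM2l ?normal_pdf_ge0// expR_ge1Dx.
  move: h; under eq_integral do rewrite EFinD EFinM.
  rewrite ge0_integralD//; last 2 first.
  - by move=> x _; rewrite -EFinM lee_fin mulr_ge0// ?sqr_ge0// ltW.
  - by apply/measurable_EFinP; apply: measurable_funM.
  rewrite integral_cst// mul1e.
  rewrite [X in (X + _)%E](@probability_setT _ _ _ (normal_prob 0 s)).
  rewrite ge0_integralZl//; last 3 first.
  - by apply/measurable_EFinP; exact: measurable_funX.
  - by move=> x _; rewrite lee_fin sqr_ge0.
  - by rewrite lee_fin ltW.
  rewrite -leeBrDl// -lee_pdivlMl// => /le_trans; apply.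
  rewrite -EFinB -EFinM lee_fin.
  by rewrite le_eqVlt; apply/orP; left; apply/eqP; rewrite kE; field; rewrite sn0 rn0 rsn0 srn0.
apply/lee_addgt0Pr => e e0.
pose r := s + Num.min s (e / (3 * s)).
have m0 : 0 < Num.min s (e / (3 * s)) by rewrite lt_min s0 divr_gt0//; lra.
apply: (le_trans (bound r _)); first by rewrite /r; lra.
rewrite lee_fin ler_pdivrMr; last by rewrite /r; lra.
set m := Num.min s _ in r m0 *.
have ms : m <= s by rewrite ge_min lexx.
have me : m * (3 * s) <= e by rewrite -ler_pdivlMr ?mulr_gt0// ge_min lexx orbT.
rewrite /r; have -> : 2 * s * (s + m) ^+ 2 = 2 * s ^+ 3 + 4 * s ^+ 2 * m + 2 * s * m ^+ 2 by ring.
have -> : (s ^+ 2 + e) * (s + (s + m)) = 2 * s ^+ 3 + s ^+ 2 * m + e * (2 * s + m) by ring.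
have h1 : m * (3 * s) * (2 * s + m) <= e * (2 * s + m) by rewrite ler_wpM2r//; lra.
have : 0 <= s * m * (3 * s + m) by rewrite !mulr_ge0 //; lra.
nra.
Qed.

(** The comparison of [normal_moment2_le] run with [r < s], where [1 - k x^2 <= exp (- k x^2)]
    bounds the moment from below. *)
Lemma normal_moment2_ge s : 0 < s ->
  ((s ^+ 2)%:E <= \int[normal_prob 0 s]_x (x ^+ 2)%:E)%E.
Proof.
move=> s0; set M := (X in (_ <= X)%E).
have bound r : 0 < r -> r < s -> ((2 * s * r ^+ 2 / (s + r))%:E <= M)%E.
  move=> r0 rs.
  have sn0 : s != 0 by rewrite gt_eqF.
  have rn0 : r != 0 by rewrite gt_eqF.
  have rsn0 : s - r != 0 by lra.
  have srn0 : s + r != 0 by lra.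
  pose k := (r ^- 2 - s ^- 2) / 2.
  have kE : k = (s - r) * (r + s) / (2 * s ^+ 2 * r ^+ 2) by rewrite /k; field; rewrite sn0 rn0.
  have k0 : 0 < k.
    by rewrite kE divr_gt0// ?mulr_gt0// ?exprn_gt0//; lra.
  have mx2 : measurable_fun setT (fun x : R => (x ^+ 2)%:E).
    by apply/measurable_EFinP; exact: measurable_funX.
  have h : (\int[mu]_x (normal_pdf 0 s x)%:E <=
     \int[mu]_x ((r / s)%:E * (normal_pdf 0 r x)%:E
                 + k%:E * ((x ^+ 2)%:E * (normal_pdf 0 s x)%:E)))%E.
    apply: ge0_le_integral => //.
    + by move=> x _; rewrite lee_fin normal_pdf_ge0.
    + by apply/measurable_EFinP; exact: measurable_normal_pdf.
    + apply: emeasurable_funD.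
        by apply/measurable_EFinP; apply: measurable_funM => //; exact: measurable_normal_pdf.
      by apply: emeasurable_funM => //; apply: emeasurable_funM => //; apply/measurable_EFinP; exact: measurable_normal_pdf.
    + move=> x _; rewrite -!EFinM -EFinD lee_fin.
      have := normal_pdf_ratio x r0 s0.
      have -> : (s ^- 2 - r ^- 2) / 2 * x ^+ 2 = - (k * x ^+ 2) by rewrite /k; field; rewrite rn0 sn0.
      move=> ratio.
      have -> : r / s * normal_pdf 0 r x = normal_pdf 0 s x * expR (- (k * x ^+ 2)).
        by rewrite mulrAC ratio; field.
      have h1 := expR_ge1Dx (- (k * x ^+ 2)).
      have p0 := normal_pdf_ge0 0 s x.
      nra.
  move: h; rewrite integral_normal_pdf ge0_integralD//; last 4 first.
  - by move=> x _; rewrite -EFinM lee_fin mulr_ge0// ?normal_pdf_ge0// divr_ge0// ltW.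
  - by apply/measurable_EFinP; apply: measurable_funM => //; exact: measurable_normal_pdf.
  - by move=> x _; rewrite -!EFinM lee_fin mulr_ge0 ?(ltW k0)// mulr_ge0 ?sqr_ge0 ?normal_pdf_ge0.
  - by apply: emeasurable_funM => //; apply: emeasurable_funM => //; apply/measurable_EFinP; exact: measurable_normal_pdf.
  rewrite ge0_integralZl//; last 3 first.
  - by apply/measurable_EFinP; exact: measurable_normal_pdf.
  - by move=> x _; rewrite lee_fin normal_pdf_ge0.
  - by rewrite lee_fin divr_ge0// ltW.
  rewrite integral_normal_pdf mule1 ge0_integralZl//; last 3 first.
  - by apply: emeasurable_funM => //; apply/measurable_EFinP; exact: measurable_normal_pdf.
  - by move=> x _; rewrite -EFinM lee_fin mulr_ge0 ?sqr_ge0// normal_pdf_ge0.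
  - by rewrite lee_fin ltW.
  rewrite -ge0_integral_normal//; last by move=> x; rewrite lee_fin sqr_ge0.
  rewrite -/M -leeBlDl// -lee_pdivrMl//; apply: le_trans.
  rewrite -EFinB -EFinM lee_fin.
  by rewrite le_eqVlt; apply/orP; left; apply/eqP; rewrite kE; field; rewrite sn0 rn0 rsn0 /=; lra.
apply/lee_subgt0Pr => e e0.
pose m := Num.min (s / 2) (e / (3 * s)).
have m0 : 0 < m by rewrite lt_min !divr_gt0//; lra.
have ms : m <= s / 2 by rewrite ge_min lexx.
have me : m * (3 * s) <= e by rewrite -ler_pdivlMr ?mulr_gt0// ge_min lexx orbT.
apply: le_trans (bound (s - m) _ _); [|lra|lra].
rewrite -EFinB lee_fin ler_pdivlMr; last by lra.
have -> : 2 * s * (s - m) ^+ 2 = 2 * s ^+ 3 - 4 * s ^+ 2 * m + 2 * s * m ^+ 2 by ring.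
have -> : (s ^+ 2 - e) * (s + (s - m)) = 2 * s ^+ 3 - s ^+ 2 * m - e * (2 * s - m) by ring.
have h1 : m * (3 * s) * (2 * s - m) <= e * (2 * s - m) by rewrite ler_wpM2r//; lra.
have : 0 <= s * m * (3 * s - m) by rewrite !mulr_ge0 //; lra.
nra.
Qed.

Lemma normal_moment2 s : 0 < s ->
  (\int[normal_prob 0 s]_x (x ^+ 2)%:E = (s ^+ 2)%:E)%E.
Proof.
by move=> s0; apply/eqP; rewrite eq_le normal_moment2_le// normal_moment2_ge.
Qed.

End NormalMoments.

Section NormalMean.
Context (R : realType).
Implicit Types s m x : R.

Lemma L1_normal_sqr s : 0 < s -> L1 (normal_prob 0 s) (fun x => x ^+ 2).
Proof.
move=> s0; apply: L1_ge0_lty => //.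
- by move=> x; rewrite sqr_ge0.
- by rewrite (le_lt_trans (normal_moment2_le s0))// ltry.
Qed.

Lemma L1_normal_id s : 0 < s -> L1 (normal_prob 0 s) (fun x => x).
Proof.
move=> s0; apply: L1_le (L1D (L1_cst (normal_prob 0 s) 1) (L1_normal_sqr s0)).
- exact: measurable_id.
- by move=> x; rewrite ler_norml; apply/andP; split; nra.
Qed.

Lemma normal_moment1 s : 0 < s -> E (normal_prob 0 s) (fun x => x) = 0.
Proof.
move=> s0; set M := E _ _.
have s20 : 0 < s ^+ 2 by rewrite exprn_gt0.
(* [H] comes from the law of mean [m], whose likelihood ratio [exp y] integrates to at most [1]
   while [1 + y <= exp y]. At [m = M] it reads [2 * M ^+ 2 <= M ^+ 2]. *)
suff H m : 2 * m * M <= m ^+ 2.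
  have := H M; have := H (- M); have [//|] := eqVneq M 0; nra.
have sn0 : s != 0 by rewrite gt_eqF.
pose y x := (2 * x * m - m ^+ 2) / (2 * s ^+ 2).
have yE : y = fun x => m / s ^+ 2 * x - m ^+ 2 / (2 * s ^+ 2).
  by apply/funext => x; rewrite /y; field.
have iy : L1 (normal_prob 0 s) y.
  by rewrite yE; apply: L1B (L1_cst _ _); apply: L1Z; exact: L1_normal_id.
have my := L1_measurable iy.
have bnd : (\int[normal_prob 0 s]_x (expR (y x))%:E <= 1%:E)%E.
  apply: (@normal_integral_le _ s m s) => //.
  - exact: measurableT_comp.
  - move=> x; rewrite mul1r !normal_pdfE// /normal_fun mulrCA -expRD.
    rewrite ler_wpM2l ?normal_peak_ge0// ler_expR /y le_eqVlt; apply/orP; left.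
    by apply/eqP; field.
have iE : L1 (normal_prob 0 s) (fun x => expR (y x)).
  apply: L1_ge0_lty => //; first exact: measurableT_comp.
  by rewrite (le_lt_trans bnd)// ltry.
move: bnd; rewrite E_EFin// lee_fin => bnd.
have : E (normal_prob 0 s) (fun x => 1 + y x) <= 1.
  apply: le_trans bnd; apply: E_le => //.
    by apply: L1D => //; exact: L1_cst.
  by move=> x; exact: expR_ge1Dx.
rewrite ED//; last exact: L1_cst.
rewrite E_cst gerDl.
have -> : E (normal_prob 0 s) y = (2 * m * M - m ^+ 2) / (2 * s ^+ 2).
  rewrite yE.
  rewrite EB; [|by apply: L1Z; exact: L1_normal_id|exact: L1_cst].
  by rewrite EZ ?E_cst -/M; [field|exact: L1_normal_id].
by rewrite pmulr_lle0 ?invr_gt0 ?mulr_gt0// subr_le0.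
Qed.

End NormalMean.

(** * Expectations from independence and from proportional laws *)

Section Independence.
Context d (T : measurableType d) (R : realType) (P : probability T R).
Implicit Types U V : T -> R.

Lemma E_pushforward (N : probability (measurableTypeR R) R) U (g : R -> R) :
  measurable_fun setT U -> measurable_fun setT g ->
  (forall B, measurable B -> pushforward P U B = N B) ->
  L1 N g -> L1 P (fun w => g (U w)) /\ E P (fun w => g (U w)) = E N g.
Proof.
move=> mU mg UN ig; pose U' : T -> measurableTypeR R := U.
have mU' : measurable_fun setT U' by [].
have iU : L1 P (fun w => g (U w)).
  apply/integrableP; split.
    by apply/measurable_EFinP; exact: measurableT_comp.
  have -> : (\int[P]_x `|(g (U x))%:E| = \int[N]_x `|(g x)%:E|)%E.
    rewrite -(@eq_measure_integral _ _ _ _ _ (pushforward P U')).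
      rewrite ge0_integral_pushforward//.
      by apply: measurableT_comp => //; exact/measurable_EFinP.
    by move=> A mA _; exact: UN.
  by move/integrableP : ig => [].
split=> //; rewrite /E /Rintegral; congr fine.
rewrite -(@eq_measure_integral _ _ _ _ _ (pushforward P U')).
  rewrite integral_pushforward//; exact/measurable_EFinP.
by move=> A mA _; exact: UN.
Qed.

(** By uniqueness on rectangles the joint law is the product of the two laws; Tonelli gives
    integrability of the product, then Fubini its value. *)
Lemma indep_E U V : measurable_fun setT U -> measurable_fun setT V ->
  (forall A B, measurable A -> measurable B ->
     P (U @^-1` A `&` V @^-1` B) = (P (U @^-1` A) * P (V @^-1` B))%E) ->
  L1 P U -> L1 P V ->
  L1 P (fun w => U w * V w) /\ E P (fun w => U w * V w) = E P U * E P V.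
Proof.
move=> mU mV UV iU iV.
pose X : {mfun T >-> R} := HB.pack U (isMeasurableFun.Build _ _ _ _ _ mU).
pose Y : {mfun T >-> R} := HB.pack V (isMeasurableFun.Build _ _ _ _ _ mV).
pose muX : probability _ R := distribution P X.
pose muY : probability _ R := distribution P Y.
pose XY w := (U w, V w).
have mXY : measurable_fun setT XY by exact: measurable_fun_pair.
have prodE A : measurable A -> (muX \x muY)%E A = pushforward P XY A.
  move=> mA; apply: (product_measure_unique (m1 := muX) (m2 := muY)
    (m' := pushforward P XY)) => //.
have mm : measurable_fun setT (fun z : R * R => z.1 * z.2).
  exact: measurable_funM.
have mabsE : measurable_fun setT (fun x : R => `|x|%:E).
  by apply/measurable_EFinP; exact: normr_measurable.
have absE : (\int[P]_w `|(U w * V w)%:E| =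
             (\int[P]_w `|(U w)%:E|) * (\int[P]_w `|(V w)%:E|))%E.
  transitivity (\int[pushforward P XY]_z `|(z.1 * z.2)%:E|)%E.
    rewrite ge0_integral_pushforward//.
    by apply: measurableT_comp => //; exact/measurable_EFinP.
  rewrite -(@eq_measure_integral _ _ _ _ _ (muX \x muY)%E); last first.
    by move=> A mA _; exact: prodE.
  rewrite fubini_tonelli1//=; last first.
    by apply/measurable_EFinP; exact: measurableT_comp.
  rewrite /fubini_F /=.
  under eq_integral => x _.
    under eq_integral do rewrite normrM EFinM.
    rewrite ge0_integralZl//.
    over.
  rewrite ge0_integralZr//; last exact: integral_ge0.
  by congr (_ * _)%E; rewrite ge0_integral_distribution.
have iUV : L1 P (fun w => U w * V w).
  apply/integrableP; split.
    by apply/measurable_EFinP; exact: measurable_funM.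
  move: (iU) (iV) => /integrableP[_ fU] /integrableP[_ fV].
  rewrite [ltLHS]absE; rewrite lte_mul_pinfty//.
    exact: integral_ge0.
  by rewrite ge0_fin_numE//; exact: integral_ge0.
split => //.
have imm : (muX \x muY)%E.-integrable setT (EFin \o (fun z : R * R => z.1 * z.2)).
  apply/integrableP; split; first exact/measurable_EFinP.
  rewrite (@eq_measure_integral _ _ _ _ (pushforward P XY)); last first.
    by move=> A mA _; exact: prodE.
  rewrite ge0_integral_pushforward//; last first.
    by apply: measurableT_comp => //; exact/measurable_EFinP.
  by move/integrableP : iUV => [].
apply: EFin_inj; rewrite EFinM -!E_EFin//.
transitivity (\int[pushforward P XY]_z (z.1 * z.2)%:E)%E.
  rewrite integral_pushforward//; exact/measurable_EFinP.
rewrite -(@eq_measure_integral _ _ _ _ _ (muX \x muY)%E); last first.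
  by move=> A mA _; exact: prodE.
rewrite -integral12_prod_meas1//= /fubini_F /=.
have eX : (\int[P]_w (U w)%:E = \int[muX]_x x%:E)%E.
  by rewrite integral_distribution//; exact/measurable_EFinP.
have eY : (\int[P]_w (V w)%:E = \int[muY]_x x%:E)%E.
  by rewrite integral_distribution//; exact/measurable_EFinP.
have iY : muY.-integrable setT (EFin \o id).
  by apply: integrable_pushforward => //; exact/measurable_EFinP.
have iX : muX.-integrable setT (EFin \o id).
  by apply: integrable_pushforward => //; exact/measurable_EFinP.
under eq_integral => x _.
  under eq_integral do rewrite EFinM.
  rewrite integralZl// -eY (E_EFin iV).
  over.
by rewrite integralZr// -eX (E_EFin iV).
Qed.

(** Passes the Markov property from events to expectations: the laws of [U] restricted to [A] and to
    [B] are proportional. Signed integrands are split into the positive part [f1] and the negative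
    part [f2]. *)
Lemma E_indic_transfer U (A B : set T) p : 0 <= p ->
  measurable_fun setT U -> measurable A -> measurable B ->
  (forall C, measurable C ->
     P (U @^-1` C `&` A) = (p%:E * P (U @^-1` C `&` B))%E) ->
  L1 P U -> E P (fun w => \1_A w * U w) = p * E P (fun w => \1_B w * U w).
Proof.
move=> p0 mU mA mB UAB iU.
have PCoo (C : set T) : measurable C -> (P C < +oo)%E.
  by move=> mC; rewrite -ge0_fin_numE// fin_num_measure.
have aux (C : set T) (mC : measurable C) (f : R -> \bar R) :
    measurable_fun setT f -> (forall x, 0 <= f x)%E ->
    (\int[P]_w (f (U w) * (\1_C w)%:E) =
     \int[pushforward (mfrestr mC (PCoo C mC)) U]_x f x)%E.
  move=> mf f0; rewrite ge0_integral_pushforward//= preimage_setT.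
  rewrite [RHS](ge0_integral_density (mu := P) (p := \1_C))//.
  - by move=> S mS; rewrite integral_indic// setIC.
  - exact: measurableT_comp.
pose pp := NngNum p0.
have ge0_case (f : R -> R) : measurable_fun setT f -> (forall x, 0 <= f x) ->
    L1 P (fun w => f (U w)) ->
    E P (fun w => \1_A w * f (U w)) = p * E P (fun w => \1_B w * f (U w)).
  move=> mf f0 ifU; have mf' : measurable_fun setT (EFin \o f).
    exact/measurable_EFinP.
  have f0' x : (0 <= (EFin \o f) x)%E by rewrite lee_fin.
  apply: EFin_inj; rewrite EFinM -!E_EFin; [|exact: L1_indic..].
  under eq_integral do rewrite EFinM muleC.
  under [in RHS]eq_integral do rewrite EFinM muleC.
  rewrite (aux _ mA _ mf' f0') (aux _ mB _ mf' f0').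
  rewrite -(ge0_integral_mscale _ _ pp)//.
  apply: eq_measure_integral => C mC _.
  by rewrite /= /mscale /pushforward /mfrestr /mrestr/= UAB.
pose f1 (x : R) := (`|x| + x) / 2; pose f2 (x : R) := (`|x| - x) / 2.
have mabs : measurable_fun setT (fun x : R => `|x|) by exact: measurableT_comp.
have mf1 : measurable_fun setT f1.
  by apply: measurable_funM => //; apply: measurable_funD.
have mf2 : measurable_fun setT f2.
  by apply: measurable_funM => //; apply: measurable_funB.
have f1_ge0 x : 0 <= f1 x.
  by rewrite /f1; have := ler_norm (- x); rewrite normrN; lra.
have f2_ge0 x : 0 <= f2 x by rewrite /f2; have := ler_norm x; lra.
have if1 : L1 P (fun w => f1 (U w)).
  apply: L1_le (L1_abs iU); first exact: measurableT_comp.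
  by move=> w; rewrite ger0_norm// /f1; have := ler_norm (U w); lra.
have if2 : L1 P (fun w => f2 (U w)).
  apply: L1_le (L1_abs iU); first exact: measurableT_comp.
  move=> w; rewrite ger0_norm// /f2; have := ler_norm (- U w).
  by rewrite normrN; lra.
have split C : measurable C -> E P (fun w => \1_C w * U w) =
    E P (fun w => \1_C w * f1 (U w)) - E P (fun w => \1_C w * f2 (U w)).
  move=> mC; rewrite -EB; [|exact: L1_indic..].
  congr E; apply/funext => w; rewrite -mulrBr; congr (_ * _).
  by rewrite /f1 /f2; lra.
by rewrite !split// mulrBr !ge0_case//.
Qed.

End Independence.

(** * The free boundary problem *)

Section Calculus.
Context (R : realType).
Implicit Types (f g h df dg F : R -> R) (x u a b t : R).

Lemma is_derive_continuous f df : (forall x, is_derive x 1 f (df x)) ->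
  continuous f.
Proof.
move=> fd x; apply: differentiable_continuous; apply/derivable1_diffP.
by have [] := fd x.
Qed.

Lemma MVT_between f df a b : (forall x, is_derive x 1 f (df x)) ->
  exists2 t, `|t - a| <= `|b - a| /\ Num.min a b <= t <= Num.max a b &
             f b - f a = df t * (b - a).
Proof.
move=> fd; have cf := is_derive_continuous fd.
have cw (x y : R) : {within `[x, y], continuous f}.
  exact: continuous_subspaceT.
have [ab|ba|->] := ltgtP a b.
- have [t tab ->] := MVT ab (fun x _ => fd x) (cw a b).
  move: tab; rewrite in_itv/= => /andP[at_ tb].
  exists t => //; split; last by rewrite !ltW.
  by rewrite !ger0_norm ?subr_ge0 ?ltW// ltrD2r.
- have [t tab E] := MVT ba (fun x _ => fd x) (cw b a).
  move: tab; rewrite in_itv/= => /andP[bt ta].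
  exists t; last by rewrite -opprB E -mulrN opprB.
  split; last by rewrite !ltW.
  have : `|t - a| = a - t by rewrite ler0_norm ?subr_le0 ?ltW// opprB.
  have : `|b - a| = a - b by rewrite ler0_norm ?subr_le0 ?ltW// opprB.
  by move=> -> ->; rewrite lerD2l lerN2 ltW.
- by exists b; rewrite ?subrr ?mulr0// normr0; split => //; rewrite lexx.
Qed.

(** Two mean value steps, first for [F] minus its quadratic part, then for [f]. The sharp factor of
    the remainder is given up, as only the power of [t] counts. *)
Lemma taylor2_lipschitz F f df L :
  (forall x, is_derive x 1 F (f x)) -> (forall x, is_derive x 1 f (df x)) ->
  (forall x y, `|df x - df y| <= L * `|x - y|) ->
  forall x t, `|F (x + t) - F x - f x * t - df x / 2 * t ^+ 2| <= L * `|t| ^+ 3.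
Proof.
move=> Fd fd Lip x t.
pose G y := F y - f x * y - df x / 2 * (y - x) ^+ 2.
have Gd (y : R) : is_derive y 1 G (f y - f x - df x * (y - x)).
  by rewrite /G; apply: is_derive_eq; rewrite /GRing.scale/=; field.
have [y [yt _] E] := MVT_between x (x + t) Gd.
have [y' [yt' _] E'] := MVT_between x y fd.
have -> : F (x + t) - F x - f x * t - df x / 2 * t ^+ 2 = G (x + t) - G x.
  by rewrite /G; field.
rewrite E E' addrAC subrr add0r -mulrBl !normrM.
have -> : `|t| ^+ 3 = `|t| * `|t| * `|t| by ring.
move: yt; rewrite addrAC subrr add0r => yt.
rewrite !mulrA ler_wpM2r//; apply: ler_pM => //.
have L0 : 0 <= L * `|t|.
  have := Lip (x + t) x; rewrite addrAC subrr add0r.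
  by apply: le_trans.
apply: (le_trans (Lip _ _)).
(* The sign of [L] is not assumed: [0 <= L] follows from [Lip] as soon as [t] is nonzero. *)
have [te|t0] := eqVneq `|t| 0; last first.
  have Lp : 0 <= L by move: L0; rewrite pmulr_lge0// lt_neqAle eq_sym t0 normr_ge0.
  by rewrite ler_wpM2l// (le_trans yt').
move=> {E E'}; have : `|y' - x| <= 0.
  by apply: (le_trans yt'); rewrite (le_trans yt)// te.
move=> h; have -> : `|y' - x| = 0 by apply/eqP; rewrite eq_le h normr_ge0.
by rewrite te lexx.
Qed.

Definition glue u f g x := if x <= u then f x else g x.

Lemma glue_le u f g x : x <= u -> glue u f g x = f x.
Proof. by rewrite /glue => ->. Qed.

Lemma glue_ge u f g x : f u = g u -> u <= x -> glue u f g x = g x.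
Proof.
by rewrite /glue => fg; rewrite le_eqVlt => /predU1P[<-|ux];
  [rewrite lexx | rewrite leNgt ux].
Qed.

Lemma is_derive_near f g x l : (\forall y \near x, f y = g y) ->
  is_derive x 1 f l -> is_derive x 1 g l.
Proof.
move=> fg fd; have gd : derivable g x 1.
  by apply: (@near_eq_derivable _ _ _ f) => //; have [] := fd.
apply: DeriveDef => //.
by have [_ <-] := fd; rewrite (near_eq_derive _ fg).
Qed.

(** Each branch is given by a formula that is smooth beyond its own side, so both have two-sided
    derivatives at the junction; equal values and equal derivatives there suffice. *)
Lemma is_derive_glue u f g df dg : f u = g u -> df u = dg u ->
  (forall x, x <= u -> is_derive x 1 f (df x)) ->
  (forall x, u <= x -> is_derive x 1 g (dg x)) ->
  forall x, is_derive x 1 (glue u f g) (glue u df dg x).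
Proof.
move=> fgu dfgu fd gd x; have [xu|ux|->] := ltgtP x u.
- rewrite glue_le ?ltW//; apply: (@is_derive_near f); last exact/fd/ltW.
  by near=> y; rewrite glue_le// ltW//; near: y; exact: lt_nbhsl.
- rewrite glue_ge ?(ltW ux)//; apply: (@is_derive_near g); last exact/gd/ltW.
  near=> y; rewrite glue_ge// ltW//; near: y; exact: lt_nbhsr.
- rewrite glue_le//.
  have cf : h^-1 *: (f (h *: 1 + u) - f u) @[h --> 0^'] --> df u.
    by have [fdu <-] := fd u (lexx u); exact: fdu.
  have cg : h^-1 *: (g (h *: 1 + u) - g u) @[h --> 0^'] --> df u.
    by rewrite dfgu; have [gdu <-] := gd u (lexx u); exact: gdu.
  have cc : h^-1 *: (glue u f g (h *: 1 + u) - glue u f g u) @[h --> 0^'] --> df u.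
    apply/cvgrPdist_le => e e0.
    move/cvgrPdist_le : cf => /(_ _ e0) cf.
    move/cvgrPdist_le : cg => /(_ _ e0) cg.
    near=> h; rewrite [glue _ _ _ u]glue_le//.
    have [hu|hu] := leP (h *: 1 + u) u.
      by rewrite glue_le//; near: h.
    by rewrite (glue_ge fgu (ltW hu)) fgu; near: h.
  apply: DeriveDef; first by apply/cvg_ex; exists (df u).
  exact: cvg_lim cc.
Unshelve. all: by end_near. Qed.

(** The set [D] allows a right branch that is controlled only on part of its half-line: the middle
    piece of the solution is estimated up to the second threshold only. *)
Lemma lipschitz_glue (D : R -> Prop) u f g L : D u -> f u = g u ->
  (forall x y, x <= u -> y <= u -> `|f x - f y| <= L * `|x - y|) ->
  (forall x y, D x -> D y -> u <= x -> u <= y ->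
    `|g x - g y| <= L * `|x - y|) ->
  forall x y, D x -> D y -> `|glue u f g x - glue u f g y| <= L * `|x - y|.
Proof.
move=> Du fgu fL gL.
have cross x y : D y -> x <= u -> u <= y -> `|f x - g y| <= L * `|x - y|.
  move=> Dy xu uy; have -> : f x - g y = (f x - f u) + (g u - g y) by rewrite fgu; ring.
  have := fL x u xu (lexx u); have := gL u y Du Dy (lexx u) uy.
  rewrite (ler0_norm (_ : x - u <= 0)) ?subr_le0//.
  rewrite (ler0_norm (_ : u - y <= 0)) ?subr_le0//.
  rewrite (ler0_norm (_ : x - y <= 0)) ?subr_le0 ?(le_trans xu)//.
  have := ler_normD (f x - f u) (g u - g y); lra.
move=> x y Dx Dy; have [xu|/ltW ux] := leP x u; have [yu|/ltW uy] := leP y u.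
- by rewrite !glue_le//; exact: fL.
- by rewrite glue_le// glue_ge//; exact: cross.
- by rewrite distrC (distrC x) glue_le// glue_ge//; exact: cross.
- by rewrite !glue_ge//; exact: gL.
Qed.

Lemma expR_lipschitz m x y : x <= m -> y <= m ->
  `|expR x - expR y| <= expR m * `|x - y|.
Proof.
wlog xy : x y / x <= y => [H xm ym|xm ym].
  by have [/H|/ltW /H] := leP x y; last rewrite distrC (distrC x); apply.
rewrite !ler0_norm ?subr_le0 ?ler_expR// !opprB.
have -> : expR y - expR x = expR y * (1 - expR (x - y)).
  by rewrite mulrBr mulr1 -expRD; congr (_ - expR _); ring.
have h1 := expR_ge1Dx (x - y).
apply: (@le_trans _ _ (expR y * (y - x))).
  by rewrite ler_wpM2l ?expR_ge0//; lra.
by rewrite ler_wpM2r ?subr_ge0// ler_expR.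
Qed.

Lemma is_derive_expaff k a u x :
  is_derive x 1 (fun y => k * expR (a * (y - u))) (k * a * expR (a * (x - u))).
Proof.
have d1 : is_derive x 1 (fun y : R => a * (y - u)) a.
  by apply: is_derive_eq; rewrite /GRing.scale/=; ring.
have d2 : is_derive x 1 (fun y : R => expR (a * (y - u)))
    (expR (a * (x - u)) * a).
  exact: is_derive1_comp.
by apply: is_derive_eq; rewrite /GRing.scale/=; ring.
Qed.

Lemma nonincreasing_derive f df u : (forall x, is_derive x 1 f (df x)) ->
  (forall x, u <= x -> df x <= 0) ->
  forall x y, u <= x -> x <= y -> f y <= f x.
Proof.
move=> fd dle x y ux xy.
have [t [_ /andP[mt _]] E] := MVT_between x y fd.
rewrite -subr_le0 E mulr_le0_ge0 ?subr_ge0//; apply: dle.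
by rewrite (le_trans ux)// (le_trans _ mt)// min_l.
Qed.

End Calculus.

(* The expression in [ss_K] is an antiderivative of [(L - rho) w]: its
   monotonicity is the variational inequality, stated without the second
   derivative of [w], which jumps at the boundary. *)
Record stopping_solution (R : realType) (rho : R) (sigma lambda : 'I_2 -> R)
    (z : 'I_2 -> R) (w dw Iw : 'I_2 -> R -> R) (L : R) : Prop := {
  ss_Iw : forall i (x : R), is_derive x 1 (Iw i) (w i x) ;
  ss_w : forall i (x : R), is_derive x 1 (w i) (dw i x) ;
  ss_dw_lip : forall i x y, `|dw i x - dw i y| <= L * `|x - y| ;
  ss_dw_bnd : forall i x, `|dw i x| <= L ;
  ss_diff : forall i j x, `|w i x - w j x| <= L ;
  ss_K : forall i x y, x <= y ->
    sigma i ^+ 2 / 2 * dw i y - rho * Iw i y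
      + lambda i * (Iw (rev_ord i) y - Iw i y) <=
    sigma i ^+ 2 / 2 * dw i x - rho * Iw i x
      + lambda i * (Iw (rev_ord i) x - Iw i x) ;
  ss_K_eq : forall i x y, x <= y -> y <= z i ->
    sigma i ^+ 2 / 2 * dw i y - rho * Iw i y
      + lambda i * (Iw (rev_ord i) y - Iw i y) =
    sigma i ^+ 2 / 2 * dw i x - rho * Iw i x
      + lambda i * (Iw (rev_ord i) x - Iw i x) ;
  ss_stop : forall i x, z i <= x -> w i x = x ;
  ss_ge : forall i x, x <= w i x }.

(** * Inequalities for hyperbolic functions *)

Section Hyperbolic.
Context (R : realType).
Implicit Types s x : R.

Lemma cosh0 : cosh (0 : R) = 1.
Proof. by rewrite /cosh oppr0 expR0; field. Qed.

Lemma sinh0 : sinh (0 : R) = 0.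
Proof. by rewrite /sinh oppr0 subrr mul0r. Qed.

Lemma is_derive_expRN x : is_derive x 1 (fun y : R => expR (- y)) (- expR (- x)).
Proof.
have h := is_derive_expaff 1 (-1) 0 x.
rewrite (_ : (fun y => _) = fun y => 1 * expR (- 1 * (y - 0))); last first.
  by apply/funext => y; rewrite mul1r mulN1r subr0.
by apply: is_derive_eq; rewrite mul1r mulN1r mulN1r subr0.
Qed.

Lemma is_derive_cosh x : is_derive x 1 (@cosh R) (sinh x).
Proof.
have h := is_derive_expRN x; rewrite /cosh /sinh.
by apply: is_derive_eq; rewrite /GRing.scale/=; field.
Qed.

Lemma is_derive_sinh x : is_derive x 1 (@sinh R) (cosh x).
Proof.
have h := is_derive_expRN x; rewrite /cosh /sinh.
by apply: is_derive_eq; rewrite /GRing.scale/=; field.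
Qed.

Lemma ge0_of_derive (f df : R -> R) x : (forall y : R, is_derive y 1 f (df y)) ->
  f 0 = 0 -> (forall y, 0 <= y -> 0 <= df y) -> 0 <= x -> 0 <= f x.
Proof.
move=> fd f0 df0 x0; rewrite -oppr_le0.
have fd' (y : R) : is_derive y 1 (fun z => - f z) (- df y).
  exact: is_deriveN.
rewrite -oppr0 -[X in _ <= - X]f0.
apply: (@nonincreasing_derive R (fun z => - f z) (fun z => - df z) 0) => // y y0.
by rewrite oppr_le0 df0.
Qed.

Lemma sinh_ge0 s : 0 <= s -> 0 <= sinh s.
Proof.
by move=> s0; rewrite /sinh divr_ge0// subr_ge0 ler_expR; lra.
Qed.

Lemma cosh_ge0 s : 0 <= cosh s.
Proof. by rewrite /cosh divr_ge0// addr_ge0 ?expR_ge0. Qed.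

Lemma cosh_ge1 s : 1 <= cosh s.
Proof.
rewrite /cosh; have h := expR_gt0 s; rewrite expRN.
have E : (expR s + (expR s)^-1) / 2 - 1 = (expR s - 1) ^+ 2 / (2 * expR s).
  by field; rewrite gt_eqF.
by rewrite -subr_ge0 E divr_ge0 ?sqr_ge0// mulr_ge0// ltW.
Qed.

Lemma cosh_half_ge s : 1 + s <= 2 * cosh s.
Proof.
rewrite /cosh; have := expR_ge1Dx s; have := expR_ge0 (- s); lra.
Qed.

Lemma sinh_le_mul_cosh s : 0 <= s -> sinh s <= s * cosh s.
Proof.
move=> s0; rewrite -subr_ge0.
apply: (@ge0_of_derive (fun t => t * cosh t - sinh t) (fun t => t * sinh t)) => //.
- move=> y; have h1 := is_derive_cosh y; have h2 := is_derive_sinh y.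
  by apply: is_derive_eq; rewrite /GRing.scale/=; ring.
- by rewrite sinh0 mul0r subrr.
- by move=> y y0; rewrite mulr_ge0// sinh_ge0.
Qed.

Lemma cosh_le_mul_sinh s : 0 <= s -> cosh s - 1 <= s * sinh s.
Proof.
move=> s0; rewrite -subr_ge0.
apply: (@ge0_of_derive (fun t => t * sinh t - (cosh t - 1))
  (fun t => t * cosh t)) => //.
- move=> y; have h1 := is_derive_cosh y; have h2 := is_derive_sinh y.
  by apply: is_derive_eq; rewrite /GRing.scale/=; ring.
- by rewrite sinh0 cosh0 mul0r; ring.
- by move=> y y0; rewrite mulr_ge0// cosh_ge0.
Qed.

Lemma continuous_cosh : continuous (@cosh R).
Proof. by apply: is_derive_continuous => x; exact: is_derive_cosh. Qed.

Lemma continuous_sinh : continuous (@sinh R).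
Proof. by apply: is_derive_continuous => x; exact: is_derive_sinh. Qed.

End Hyperbolic.

(** * Roots of the characteristic equation *)

Section RootSigns.
Context (R : realType).
Implicit Types s l r A B : R.

Lemma ord2P (i : 'I_2) : i = reg1 \/ i = reg2.
Proof.
case: i => [[|[|//]] h]; [left|right]; exact/val_inj.
Qed.

Lemma rev_reg1 : rev_ord reg1 = reg2. Proof. exact/val_inj. Qed.
Lemma rev_reg2 : rev_ord reg2 = reg1. Proof. exact/val_inj. Qed.

(** [A] and [B] are squared characteristic roots. At each of them the two factors have positive
    product, hence equal signs; [E] and [E'] make both positive at [A] and negative at [B]. If
    [s1 * A] reached [r], the factors at [A] would be at most [l1] and less than [l2], and their
    product too small. *)
Lemma quadratic_root_signs s1 s2 l1 l2 r A B :
  0 < s1 -> s1 < s2 -> 0 < l1 -> 0 < l2 -> 0 < r -> 0 < A -> A < B ->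
  (r + l1 - s1 * A) * (r + l2 - s2 * A) = l1 * l2 ->
  (r + l1 - s1 * B) * (r + l2 - s2 * B) = l1 * l2 ->
  s1 * A < r /\ r + l1 - s1 * B < 0.
Proof.
move=> s10 s12 l10 l20 r0 A0 AB EA EB.
have s20 : 0 < s2 by lra.
have l120 : 0 < l1 * l2 by rewrite mulr_gt0.
have D0 : 0 < B - A by lra.
have s12D : 0 < s1 * s2 * (B - A) by rewrite !mulr_gt0.
set x := r + l1 - s1 * A in EA; set y := r + l2 - s2 * A in EA.
set x' := r + l1 - s1 * B in EB *; set y' := r + l2 - s2 * B in EB.
(* Difference of the two root equations, divided by [B - A]. *)
have E : s2 * x + s1 * y = s1 * s2 * (B - A).
  have : (B - A) * (s2 * x + s1 * y - s1 * s2 * (B - A)) = 0.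
    transitivity (x * y - x' * y'); first by rewrite /x /y /x' /y'; ring.
    by rewrite EA EB subrr.
  by move/eqP; rewrite mulf_eq0 (gt_eqF D0)/= subr_eq0 => /eqP.
have E' : s2 * x' + s1 * y' = - (s1 * s2 * (B - A)).
  transitivity (s2 * x + s1 * y - 2 * (s1 * s2 * (B - A))).
    by rewrite /x /y /x' /y'; ring.
  by rewrite E; ring.
have x0 : 0 < x.
  rewrite ltNge; apply/negP => xle.
  have yle : y <= 0 by rewrite leNgt; apply/negP => y0; nra.
  have : s2 * x <= 0 by rewrite pmulr_rle0.
  have : s1 * y <= 0 by rewrite pmulr_rle0.
  lra.
have y0 : 0 < y by rewrite -(pmulr_rgt0 _ x0) EA.
have x'0 : x' < 0.
  rewrite ltNge; apply/negP => xge.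
  have yge : 0 <= y' by rewrite leNgt; apply/negP => ylt; nra.
  have : 0 <= s2 * x' by rewrite pmulr_rge0.
  have : 0 <= s1 * y' by rewrite pmulr_rge0.
  lra.
split => //; rewrite ltNge; apply/negP => rA.
have xl : x <= l1 by rewrite /x; lra.
have yl : y < l2.
  rewrite /y; have : s1 * A < s2 * A by rewrite ltr_pM2r.
  lra.
have : x * y < l1 * l2.
  by apply: (@le_lt_trans _ _ (l1 * y)); [rewrite ler_wpM2r// ltW|rewrite ltr_pM2l].
by rewrite EA ltxx.
Qed.

(** The quadratic formula. The discriminant [D] is a square plus a positive term, and [k < m1 * m2]
    makes the smaller root positive. *)
Lemma quadratic_roots s1 s2 m1 m2 k :
  0 < s1 -> 0 < s2 -> 0 < m1 -> 0 < m2 -> 0 < k -> k < m1 * m2 ->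
  exists A B, [/\ 0 < A, A < B,
    (m1 - s1 * A) * (m2 - s2 * A) = k & (m1 - s1 * B) * (m2 - s2 * B) = k].
Proof.
move=> s10 s20 m10 m20 k0 km.
pose b := m1 * s2 + m2 * s1; pose D := (m1 * s2 - m2 * s1) ^+ 2 + 4 * (s1 * s2 * k).
have ssk : 0 < s1 * s2 * k by rewrite !mulr_gt0.
have D0 : 0 < D by rewrite /D ltr_wpDl ?sqr_ge0// mulr_gt0.
pose q := Num.sqrt D; have q0 : 0 < q by rewrite sqrtr_gt0.
have q2 : q ^+ 2 = D by rewrite sqr_sqrtr// ltW.
have b0 : 0 < b by rewrite /b addr_gt0// mulr_gt0.
have qb : q < b.
  rewrite -(@ltr_pXn2r _ 2%N)// ?nnegrE ?(ltW q0) ?(ltW b0)// q2 /D /b -subr_gt0.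
  rewrite (_ : _ - _ = 4 * (s1 * s2 * (m1 * m2 - k))); last by ring.
  by rewrite !mulr_gt0// subr_gt0.
have ss : 0 < 2 * (s1 * s2) by rewrite !mulr_gt0.
have s1n : s1 != 0 by rewrite gt_eqF.
have s2n : s2 != 0 by rewrite gt_eqF.
exists ((b - q) / (2 * (s1 * s2))), ((b + q) / (2 * (s1 * s2))); split.
- by rewrite divr_gt0// subr_gt0.
- by rewrite ltr_pM2r ?invr_gt0//; lra.
- have -> : (m1 - s1 * ((b - q) / (2 * (s1 * s2)))) *
            (m2 - s2 * ((b - q) / (2 * (s1 * s2)))) =
            (q ^+ 2 - (m1 * s2 - m2 * s1) ^+ 2) / (4 * (s1 * s2)).
    by rewrite /b; field; rewrite s1n s2n.
  by rewrite q2 /D; field; rewrite s1n s2n.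
- have -> : (m1 - s1 * ((b + q) / (2 * (s1 * s2)))) *
            (m2 - s2 * ((b + q) / (2 * (s1 * s2)))) =
            (q ^+ 2 - (m1 * s2 - m2 * s1) ^+ 2) / (4 * (s1 * s2)).
    by rewrite /b; field; rewrite s1n s2n.
  by rewrite q2 /D; field; rewrite s1n s2n.
Qed.

End RootSigns.

(** * The boundary system for distinct volatilities *)

Section FreeBoundary.
Context (R : realType) (rho : R) (sigma lambda : 'I_2 -> R).
Hypotheses (rho0 : 0 < rho) (lambda0 : forall i, 0 < lambda i).
Hypotheses (sigma10 : 0 < sigma reg1) (sigma12 : sigma reg1 < sigma reg2).

Let a := alpha3 rho sigma lambda.
Let b := alpha4 rho sigma lambda.
Let g := alpha5 rho sigma lambda.
Let k := rho / (rho + lambda reg2).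
(** Below both thresholds the coupled equations are solved by combinations of [exp (a x)] and
    [exp (b x)]; [p] and [q] are the ratios of the second component to the first for these two
    modes. *)
Let p := Phi rho sigma lambda reg1 a / lambda reg1.
Let q := Phi rho sigma lambda reg1 b / lambda reg1.
Let s1 := sigma reg1 ^+ 2 / 2.
Let s2 := sigma reg2 ^+ 2 / 2.
Let l1 := lambda reg1.
Let l2 := lambda reg2.

Let l10 : 0 < l1. Proof. exact: lambda0. Qed.
Let l20 : 0 < l2. Proof. exact: lambda0. Qed.
Let s10 : 0 < s1. Proof. by rewrite /s1 divr_gt0// exprn_gt0. Qed.
Let sigma20 : 0 < sigma reg2. Proof. exact: lt_trans sigma12. Qed.
Let s20 : 0 < s2. Proof. by rewrite /s2 divr_gt0// exprn_gt0. Qed.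
Let s12 : s1 < s2.
Proof. by rewrite ltr_pM2r ?invr_gt0// ltr_pXn2r ?nnegrE ?ltW. Qed.
Let r2 : 0 < rho + l2. Proof. exact: addr_gt0. Qed.
Let k0 : 0 < k. Proof. exact: divr_gt0. Qed.
Let k1 : 1 - k = l2 / (rho + l2).
Proof. by move: r2; rewrite /k /l2 => h; field; rewrite gt_eqF. Qed.

(** [alpha34] is selected by [xget]; exhibiting roots, as square roots of those in the squared
    unknown, shows that the selected pair satisfies its specification. *)
Let rootP : [/\ 0 < a, a < b, characteristic_root rho sigma lambda a &
                characteristic_root rho sigma lambda b].
Proof.
have m1 : 0 < rho + l1 by exact: addr_gt0.
have l12 : l1 * l2 < (rho + l1) * (rho + l2).
  have := mulr_gt0 rho0 rho0; have := mulr_gt0 rho0 l10.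
  have := mulr_gt0 rho0 l20; rewrite mulrDl !mulrDr; lra.
have [A [B [A0 AB EA EB]]] := @quadratic_roots R s1 s2 (rho + l1) (rho + l2)
  (l1 * l2) s10 s20 m1 r2 (mulr_gt0 l10 l20) l12.
have B0 : 0 < B by exact: lt_trans AB.
have char (Y : R) : 0 < Y -> (rho + l1 - s1 * Y) * (rho + l2 - s2 * Y) = l1 * l2 ->
    characteristic_root rho sigma lambda (Num.sqrt Y).
  move=> Y0; rewrite /characteristic_root /Phi sqr_sqrtr ?(ltW Y0)// => <-.
  by rewrite /s1 /s2 /l1 /l2; field.
have : [set t : R * R | 0 < t.1 < t.2 /\
    (characteristic_root rho sigma lambda t.1 /\
     characteristic_root rho sigma lambda t.2)]
    (alpha34 rho sigma lambda).
  rewrite /alpha34; apply: xgetPex.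
  exists (Num.sqrt A, Num.sqrt B) => /=; split; last by split; exact: char.
  by rewrite sqrtr_gt0 A0 ltr_sqrt.
by case=> /andP[? ?] [? ?]; split.
Qed.

Let a0 : 0 < a. Proof. by case: rootP. Qed.
Let ab : a < b. Proof. by case: rootP. Qed.
Let b0 : 0 < b. Proof. exact: lt_trans ab. Qed.
Let ba0 : 0 < b - a. Proof. by rewrite subr_gt0. Qed.
Let PhiE1 t : Phi rho sigma lambda reg1 t = rho + l1 - s1 * t ^+ 2.
Proof. by rewrite /Phi /s1 /l1; field. Qed.
Let PhiE2 t : Phi rho sigma lambda reg2 t = rho + l2 - s2 * t ^+ 2.
Proof. by rewrite /Phi /s2 /l2; field. Qed.

Let rootsE : (rho + l1 - s1 * a ^+ 2) * (rho + l2 - s2 * a ^+ 2) = l1 * l2 /\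
  (rho + l1 - s1 * b ^+ 2) * (rho + l2 - s2 * b ^+ 2) = l1 * l2.
Proof.
by case: rootP => _ _; rewrite /characteristic_root !PhiE1 !PhiE2.
Qed.

Let signs : s1 * a ^+ 2 < rho /\ rho + l1 - s1 * b ^+ 2 < 0.
Proof.
have [EA EB] := rootsE.
apply: (@quadratic_root_signs R s1 s2 l1 l2) => //.
  by rewrite exprn_gt0.
by rewrite ltr_pXn2r// ?nnegrE ltW.
Qed.

Let l1n : l1 != 0. Proof. by rewrite gt_eqF. Qed.
Let bn : b - a != 0. Proof. by rewrite gt_eqF. Qed.
Let an : a != 0. Proof. by rewrite gt_eqF. Qed.

Let rn : rho + l2 != 0. Proof. by rewrite gt_eqF. Qed.

Let p1 : 1 < p.
Proof.
rewrite /p ltr_pdivlMr// mul1r PhiE1; case: signs => + _; rewrite -/l1; lra.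
Qed.

Let q0 : q < 0.
Proof.
by rewrite /q pmulr_llt0 ?invr_gt0// PhiE1; case: signs.
Qed.

Let pE : l1 * p = rho + l1 - s1 * a ^+ 2.
Proof. by rewrite /p PhiE1 mulrC divfK. Qed.
Let qE : l1 * q = rho + l1 - s1 * b ^+ 2.
Proof. by rewrite /q PhiE1 mulrC divfK. Qed.
Let pE2 : p * (rho + l2 - s2 * a ^+ 2) = l2.
Proof. by apply: (mulfI l1n); rewrite mulrA pE; case: rootsE. Qed.
Let qE2 : q * (rho + l2 - s2 * b ^+ 2) = l2.
Proof. by apply: (mulfI l1n); rewrite mulrA qE; case: rootsE. Qed.

Let g2 : s2 * g ^+ 2 = rho + l2.
Proof.
rewrite /g /alpha5 sqr_sqrtr; last first.
  by rewrite divr_ge0 ?sqr_ge0// mulr_ge0// ltW.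
by rewrite /s2 /l2; field; rewrite gt_eqF.
Qed.
Let g0 : 0 < g.
Proof.
by rewrite sqrtr_gt0 divr_gt0// ?mulr_gt0// exprn_gt0.
Qed.
Let gn : g != 0. Proof. by rewrite gt_eqF. Qed.

Let A1 := Defs.coef1 rho sigma lambda.
Let A2 := coef2 rho sigma lambda.
Let A3 := coef3 rho sigma lambda.
Let A4 := coef4 rho sigma lambda.

(** The coefficients of the boundary system in terms of [p], [q] and [k], through
    [1 - k = l2 / (rho + l2)]. *)
Let A1E : A1 = - ((b * p - a * q) / (b - a)) + (1 - k).
Proof.
rewrite k1 /A1 /Defs.coef1 -/a -/b /p /q -/l1 -/l2; congr (- _ + _).
by field; rewrite l1n bn.
Qed.
Let A2E : A2 = (p - q) / (b - a).
Proof. by rewrite /A2 /coef2 -/a -/b /p /q -/l1; field; rewrite l1n bn. Qed.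
Let A3E : A3 = - (a * b * (p - q) / (b - a)).
Proof. by rewrite /A3 /coef3 -/a -/b /p /q -/l1; field; rewrite l1n bn. Qed.
Let A4E : A4 = (a * p - b * q) / (b - a) + (1 - k).
Proof.
rewrite k1 /A4 /coef4 -/a -/b /p /q -/l1 -/l2; congr (_ + _).
by field; rewrite l1n bn.
Qed.

Let A1k : A1 + k < 0.
Proof.
have -> : A1 + k = - ((b * (p - 1) + a * (1 - q)) / (b - a)).
  by rewrite A1E; field.
by rewrite oppr_lt0 divr_gt0// addr_gt0// mulr_gt0// subr_gt0// (lt_trans q0).
Qed.
Let A2_gt0 : 0 < A2.
Proof. rewrite A2E divr_gt0//; move: p1 q0; lra. Qed.
Let A3_lt0 : A3 < 0.
Proof.
rewrite A3E oppr_lt0 divr_gt0// !mulr_gt0//; move: p1 q0; lra.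
Qed.

Let zh := hat_z2 rho sigma lambda.

Let zhP : 0 < zh /\ A1 + k * cosh (g * zh) = 0.
Proof.
suff : exists v, 0 < v /\ A1 + k * cosh (g * v) = 0 by exact: xgetPex.
(* [M] comes from the linear lower bound [cosh_half_ge]: at this point [k * cosh (g * M)] already
   exceeds [- A1]. *)
pose M := - (2 * A1) / (k * g).
have A1n : A1 < 0 by move: A1k k0; lra.
have M0 : 0 < M by apply: divr_gt0; [move: A1n; lra|exact: mulr_gt0].
have cf : continuous (fun v : R => A1 + k * cosh (g * v)).
  apply: (@is_derive_continuous R _ (fun v => k * (g * sinh (g * v)))) => v.
  have h1 : is_derive v 1 (fun v : R => g * v) g.
    by apply: is_derive_eq; rewrite /GRing.scale/=; ring.
  have h2 : is_derive v 1 (fun v : R => cosh (g * v)) (sinh (g * v) * g).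
    by apply: is_derive1_comp; exact: is_derive_cosh.
  by apply: is_derive_eq; rewrite /GRing.scale/=; ring.
have fM : 0 <= A1 + k * cosh (g * M).
  have h := cosh_half_ge (g * M).
  have E : k * (g * M) = - (2 * A1).
    by rewrite /M; field; rewrite gn gt_eqF.
  have : k * (1 + g * M) <= k * (2 * cosh (g * M)) by rewrite ler_wpM2l// ltW.
  by rewrite mulrDr E; move: k0; lra.
have f0 : A1 + k * cosh (g * 0) < 0 by rewrite mulr0 cosh0 mulr1.
have [|v] := @IVT R (fun v => A1 + k * cosh (g * v)) 0 M 0 (ltW M0)
  (continuous_subspaceT cf).
  by rewrite ge_min (ltW f0)/= le_max fM orbT.
rewrite in_itv/= => /andP[v0 vM] fv; exists v; split => //.
rewrite lt_neqAle v0 andbT; apply/eqP => v0'.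
by move: fv f0; rewrite -v0' => ->; rewrite ltxx.
Qed.

(** The first boundary equation reads [D v * u + N v = 0], so that [u] is [- N v / D v]. *)
Let D v := A1 + k * cosh (g * v).
Let N v := k * (v * cosh (g * v) - sinh (g * v) / g) + A2.

Let N_gt0 v : 0 <= v -> 0 < N v.
Proof.
move=> v0; rewrite /N; have gv : 0 <= g * v by rewrite mulr_ge0// ltW.
have h := sinh_le_mul_cosh gv.
have -> : v * cosh (g * v) - sinh (g * v) / g =
   (g * v * cosh (g * v) - sinh (g * v)) / g by field.
rewrite ltr_wpDl// mulr_ge0 ?(ltW k0)// divr_ge0 ?(ltW g0)// subr_ge0//.
Qed.

(** Eliminating [u] turns the second equation into [H v = 0]. At [0] the function [H] equals
    [(p - 1) * (1 - q)], which is positive; at [zh], where [D] vanishes, it is negative. A zero in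
    between has [D v < 0], which makes [u] positive. *)
Let boundaryP : exists u v, [/\ 0 < u, 0 < v < zh &
  boundary_system rho sigma lambda u v].
Proof.
have [zh0 Dzh] := zhP.
pose H v := (A3 - k * g * sinh (g * v)) * N v
            - D v * (k * (cosh (g * v) - v * g * sinh (g * v)) + A4).
have cH : continuous H.
  have c1 : continuous (fun v : R => g * v).
    by move=> v; apply: cvgM; [exact: cvg_cst|exact: cvg_id].
  have cc : continuous (fun v : R => cosh (g * v)).
    by move=> v; apply: (@continuous_comp _ _ _ (fun v : R => g * v));
      [exact: c1|exact: continuous_cosh].
  have cs : continuous (fun v : R => sinh (g * v)).
    by move=> v; apply: (@continuous_comp _ _ _ (fun v : R => g * v));
      [exact: c1|exact: continuous_sinh].
  move=> v; rewrite /H /N /D.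
  have hc := cc v; have hs := cs v; have hv : (fun v : R => v) @ v --> v := cvg_id.
  apply: cvgB; first (apply: cvgM).
  - apply: cvgB; first exact: cvg_cst.
    by apply: cvgM => //; exact: cvg_cst.
  - apply: cvgD; last exact: cvg_cst.
    apply: cvgM; first exact: cvg_cst.
    by apply: cvgB; apply: cvgM => //; exact: cvg_cst.
  - apply: cvgM.
      by apply: cvgD; [exact: cvg_cst|apply: cvgM => //; exact: cvg_cst].
    apply: cvgD; last exact: cvg_cst.
    apply: cvgM; first exact: cvg_cst.
    apply: cvgB => //; apply: cvgM => //; apply: cvgM => //; exact: cvg_cst.
have H0 : 0 < H 0.
  rewrite /H /N /D !mulr0 sinh0 cosh0 !mul0r !mulr0 !subr0 mulr0 add0r !mulr1.
  have -> : A3 * A2 - (A1 + k) * (k + A4) =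
     (p - 1) * (1 - q).
    by rewrite A1E A2E A3E A4E; field.
  by rewrite mulr_gt0// subr_gt0// (lt_trans q0).
have Hz : H zh < 0.
  rewrite /H /D Dzh mul0r subr0 pmulr_llt0 ?N_gt0 ?(ltW zh0)//.
  have : 0 <= k * g * sinh (g * zh).
    apply: mulr_ge0; first exact: ltW (mulr_gt0 k0 g0).
    by apply/sinh_ge0/ltW; exact: mulr_gt0.
  by move: A3_lt0; lra.
have [|v] := @IVT R H 0 zh 0 (ltW zh0) (continuous_subspaceT cH).
  by rewrite ge_min (ltW Hz) orbT/= le_max (ltW H0).
rewrite in_itv/= => /andP[v0 vz] Hv.
have {}v0 : 0 < v.
  by rewrite lt_neqAle v0 andbT; apply/eqP => E; move: Hv H0; rewrite -E => ->; rewrite ltxx.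
have {}vz : v < zh.
  by rewrite lt_neqAle vz andbT; apply/eqP => E; move: Hz; rewrite -E Hv ltxx.
have Dv : D v < 0.
  rewrite -Dzh /D ltrD2l ltr_pM2l// -subr_gt0.
  have [t [_ /andP[tm _]] ->] := @MVT_between R _ _ (g * v) (g * zh) (@is_derive_cosh R).
  have gg : g * v < g * zh by rewrite ltr_pM2l.
  rewrite mulr_gt0 ?subr_gt0//.
  have t0 : 0 < t.
    by apply: lt_le_trans tm; rewrite lt_min !mulr_gt0.
  by rewrite /sinh divr_gt0// subr_gt0 ltr_expR; lra.
have Dn : D v != 0 by rewrite lt_eqF.
exists (N v / - D v), v; split.
- by rewrite divr_gt0 ?N_gt0 ?(ltW v0)// oppr_gt0.
- by rewrite v0.
- split.
  + rewrite -/k -/g -/A1 -/A2 -/(D v).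
    have -> : D v * (N v / - D v) = - N v.
      by rewrite invrN !mulrN mulrCA mulfV// mulr1.
    by rewrite /N; field.
  + rewrite -/k -/g -/A3 -/A4.
    apply: (mulfI Dn); rewrite mulr0 -[RHS]oppr0 -[in RHS]Hv /H.
    by move: Dn; generalize (D v) => dv dn; field.
Qed.

Let u := (z_star rho sigma lambda).1.
Let v := (z_star rho sigma lambda).2.

Let uvP : [/\ 0 < u, 0 < v & boundary_system rho sigma lambda u v].
Proof.
have : [set t : R * R | [/\ 0 < t.1, 0 < t.2 < zh &
    boundary_system rho sigma lambda t.1 t.2]] (z_star rho sigma lambda).
  rewrite /z_star; apply: xgetPex.
  by have [u' [v' H]] := boundaryP; exists (u', v').
by case=> ? /andP[? _] ?; split.
Qed.
Let u0 : 0 < u. Proof. by case: uvP. Qed.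
Let v0 : 0 < v. Proof. by case: uvP. Qed.
Let z2 := u + v.

(** Coefficients of the two modes of the first component, determined by smooth fit: value [u] and
    slope [1] at the threshold [u]. *)
Let C3 := (b * u - 1) / (b - a).
Let C4 := (1 - a * u) / (b - a).

Let C34 : C3 + C4 = u.
Proof. by rewrite /C3 /C4; field. Qed.
Let C34' : a * C3 + b * C4 = 1.
Proof. by rewrite /C3 /C4; field. Qed.

(** The two boundary equations rewritten as smooth fit of the second component at the first
    threshold: [eq1] matches values, [eq2] slopes. *)
Let eq1 : (1 - k) * u + k * (z2 * cosh (g * v) - sinh (g * v) / g) =
  p * C3 + q * C4.
Proof.
case: uvP => _ _ [+ _]; rewrite -/k -/g -/A1 -/A2 A1E A2E => H.
apply/eqP; rewrite -subr_eq0; apply/eqP.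
by rewrite -[RHS]H /C3 /C4 /z2; field; rewrite gn bn.
Qed.

Let eq2 : (1 - k) + k * (cosh (g * v) - g * z2 * sinh (g * v)) =
  a * (p * C3) + b * (q * C4).
Proof.
case: uvP => _ _ [_ +]; rewrite -/k -/g -/A3 -/A4 A3E A4E => H.
apply/eqP; rewrite -subr_eq0; apply/eqP.
by rewrite -[RHS]H /C3 /C4 /z2; field.
Qed.

(* [e] is the gap [w_2 - x] on the strip between the two thresholds. *)
Let e x := k * (z2 * cosh (g * (z2 - x)) - sinh (g * (z2 - x)) / g - x).
Let de x := k * (cosh (g * (z2 - x)) - g * z2 * sinh (g * (z2 - x)) - 1).

(** With [s = g * (z2 - x)] the gap is, up to a positive factor,
    [g * z2 * (cosh s - 1) - (sinh s - s)]. Since [s <= g * z2], this is at least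
    [s * cosh s - sinh s]. The sign of [de] follows similarly from [cosh s - 1 <= s * sinh s]. *)
Let e_ge0 x : u <= x -> x <= z2 -> 0 <= e x.
Proof.
move=> ux xz; rewrite /e mulr_ge0 ?(ltW k0)//.
set s := g * (z2 - x); have s0 : 0 <= s by apply: mulr_ge0; [exact: ltW g0|rewrite subr_ge0].
have -> : x = z2 - s / g by rewrite /s; field.
have h1 := sinh_le_mul_cosh s0; have h2 := cosh_ge1 s.
have h3 : s <= g * z2.
  by rewrite /s ler_pM2l// gerBl (le_trans (ltW u0)).
have -> : z2 * cosh s - sinh s / g - (z2 - s / g) =
  (g * z2 * (cosh s - 1) - (sinh s - s)) / g by field.
rewrite divr_ge0 ?(ltW g0)//.
have : s * (cosh s - 1) <= g * z2 * (cosh s - 1) by rewrite ler_wpM2r// subr_ge0.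
lra.
Qed.

Let de_le0 x : u <= x -> x <= z2 -> de x <= 0.
Proof.
move=> ux xz; rewrite /de mulr_ge0_le0 ?(ltW k0)//.
set s := g * (z2 - x); have s0 : 0 <= s by apply: mulr_ge0; [exact: ltW g0|rewrite subr_ge0].
have h1 := cosh_le_mul_sinh s0; have h2 := sinh_ge0 s0.
have h3 : s <= g * z2.
  by rewrite /s ler_pM2l// gerBl (le_trans (ltW u0)).
have : s * sinh s <= g * z2 * sinh s by rewrite ler_wpM2r.
lra.
Qed.

Let uz2 : u <= z2. Proof. by rewrite /z2 lerDl ltW. Qed.
Let z20 : 0 < z2. Proof. exact: addr_gt0. Qed.

Let eu : e u = (p - 1) * C3 + (q - 1) * C4.
Proof.
have -> : e u = (1 - k) * u + k * (z2 * cosh (g * v) - sinh (g * v) / g) - u.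
  by rewrite /e (_ : z2 - u = v)//; [ring|rewrite /z2; ring].
by rewrite eq1 -C34; ring.
Qed.

Let deu : de u = a * ((p - 1) * C3) + b * ((q - 1) * C4).
Proof.
have -> : de u = (1 - k) + k * (cosh (g * v) - g * z2 * sinh (g * v)) - 1.
  by rewrite /de (_ : z2 - u = v)//; [ring|rewrite /z2; ring].
by rewrite eq2 -[X in _ - X]C34'; ring.
Qed.

(** Put [X = (p - 1) * C3] and [Y = (q - 1) * C4]. From [e u = X + Y >= 0] and
    [de u = a X + b Y <= 0] one gets [(b - a) * Y <= 0], hence [X >= 0]; the signs of [p - 1] and
    [q - 1] give those of [C3] and [C4]. *)
Let C3_ge0 : 0 <= C3.
Proof.
have : 0 <= (p - 1) * C3 + (q - 1) * C4 by rewrite -eu e_ge0.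
have : a * ((p - 1) * C3) + b * ((q - 1) * C4) <= 0 by rewrite -deu de_le0.
have E3 : C3 = (b * u - 1) / (b - a) by [].
have : a * C3 + b * C4 = 1 := C34'.
move: p1 q0 a0 ab; set c := C4.
move=> p1' q0' a0' ab' E1 H1 H2.
have h1 : (b - a) * ((q - 1) * c) <= 0 by nra.
have c0 : 0 <= c.
  by rewrite leNgt; apply/negP => c0; move: h1; apply/negP; rewrite -ltNge mulr_gt0// nmulr_rgt0//; lra.
have h3 : 0 <= (p - 1) * C3 by nra.
by move: h3; rewrite pmulr_rge0// subr_gt0.
Qed.

Let C4_ge0 : 0 <= C4.
Proof.
have : 0 <= (p - 1) * C3 + (q - 1) * C4 by rewrite -eu e_ge0.
have : a * ((p - 1) * C3) + b * ((q - 1) * C4) <= 0 by rewrite -deu de_le0.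
move: p1 q0 a0 ab; set c := C4.
move=> p1' q0' a0' ab' H1 H2.
have h1 : (b - a) * ((q - 1) * c) <= 0 by nra.
by rewrite leNgt; apply/negP => c0; move: h1; apply/negP; rewrite -ltNge mulr_gt0// nmulr_rgt0//; lra.
Qed.

(** Hides the definitions behind existential constants: the construction of the solution uses these
    relations and signs only. *)
Lemma free_boundary_facts : exists a b g k p q C3 C4 : R,
  let z1 := (z_star rho sigma lambda).1 in
  let z2 := (z_star rho sigma lambda).1 + (z_star rho sigma lambda).2 in
  let e x := k * (z2 * cosh (g * (z2 - x)) - sinh (g * (z2 - x)) / g - x) in
  let de x := k * (cosh (g * (z2 - x)) - g * z2 * sinh (g * (z2 - x)) - 1) in
  [/\ [/\ 0 < a, a < b, 1 < p & q < 0],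
      [/\ l1 * p = rho + l1 - s1 * a ^+ 2, l1 * q = rho + l1 - s1 * b ^+ 2,
          p * (rho + l2 - s2 * a ^+ 2) = l2 &
          q * (rho + l2 - s2 * b ^+ 2) = l2],
      [/\ 0 < g, s2 * g ^+ 2 = rho + l2, 0 < k & (rho + l2) * k = rho],
      [/\ 0 < z1, z1 <= z2, 0 <= C3, 0 <= C4 &
        C3 + C4 = z1 /\ a * C3 + b * C4 = 1] &
      [/\ e z1 = (p - 1) * C3 + (q - 1) * C4,
          de z1 = a * ((p - 1) * C3) + b * ((q - 1) * C4),
          forall x, z1 <= x -> x <= z2 -> 0 <= e x &
          forall x, z1 <= x -> x <= z2 -> de x <= 0]].
Proof.
exists a, b, g, k, p, q, C3, C4; split=> //.
by split=> //; rewrite /k mulrC divfK.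
Qed.

End FreeBoundary.

(** * The explicit solution for distinct volatilities *)

Section StoppingSolution.
Context (R : realType) (rho : R) (sigma lambda : 'I_2 -> R).
Hypotheses (rho0 : 0 < rho) (lambda0 : forall i, 0 < lambda i).
Variables a b g k p q C3 C4 u z2 : R.
Let s1 := sigma reg1 ^+ 2 / 2.
Let s2 := sigma reg2 ^+ 2 / 2.
Let l1 := lambda reg1.
Let l2 := lambda reg2.
Let e x := k * (z2 * cosh (g * (z2 - x)) - sinh (g * (z2 - x)) / g - x).
Let de x := k * (cosh (g * (z2 - x)) - g * z2 * sinh (g * (z2 - x)) - 1).
Hypotheses (a0 : 0 < a) (ab : a < b) (q0 : q < 0).
Hypotheses (pE : l1 * p = rho + l1 - s1 * a ^+ 2)
  (qE : l1 * q = rho + l1 - s1 * b ^+ 2)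
  (pE2 : p * (rho + l2 - s2 * a ^+ 2) = l2)
  (qE2 : q * (rho + l2 - s2 * b ^+ 2) = l2).
Hypotheses (g0 : 0 < g) (g2 : s2 * g ^+ 2 = rho + l2) (k0 : 0 < k)
  (kE : (rho + l2) * k = rho).
Hypotheses (u0 : 0 < u) (uz2 : u <= z2) (C3_ge0 : 0 <= C3) (C4_ge0 : 0 <= C4)
  (C34 : C3 + C4 = u) (C34' : a * C3 + b * C4 = 1).
Hypotheses (eu : e u = (p - 1) * C3 + (q - 1) * C4)
  (deu : de u = a * ((p - 1) * C3) + b * ((q - 1) * C4))
  (e_ge0 : forall x, u <= x -> x <= z2 -> 0 <= e x)
  (de_le0 : forall x, u <= x -> x <= z2 -> de x <= 0).

Let b0 : 0 < b. Proof. exact: lt_trans ab. Qed.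
Let an : a != 0. Proof. by rewrite gt_eqF. Qed.
Let bn : b != 0. Proof. by rewrite gt_eqF. Qed.
Let gn : g != 0. Proof. by rewrite gt_eqF. Qed.
Let l10 : 0 < l1. Proof. exact: lambda0. Qed.
Let l20 : 0 < l2. Proof. exact: lambda0. Qed.
Let z20 : 0 < z2. Proof. exact: lt_le_trans uz2. Qed.

Let ez2 : e z2 = 0.
Proof. by rewrite /e subrr mulr0 cosh0 sinh0; ring. Qed.
Let dez2 : de z2 = 0.
Proof. by rewrite /de subrr mulr0 cosh0 sinh0; ring. Qed.

Let dde x := k * (g * (g * z2 * cosh (g * (z2 - x)) - sinh (g * (z2 - x)))).
Let Ie x := k * (cosh (g * (z2 - x)) / g ^+ 2 - z2 * sinh (g * (z2 - x)) / g
                 - x ^+ 2 / 2).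

Let is_derive_hyp (x : R) :
  is_derive x 1 (fun y => cosh (g * (z2 - y))) (- g * sinh (g * (z2 - x))) /\
  is_derive x 1 (fun y => sinh (g * (z2 - y))) (- g * cosh (g * (z2 - x))).
Proof.
have d1 : is_derive x 1 (fun y : R => g * (z2 - y)) (- g).
  by apply: is_derive_eq; rewrite /GRing.scale/=; ring.
split.
- have d2 := is_derive_cosh (g * (z2 - x)).
  have d3 : is_derive x 1 (fun y => cosh (g * (z2 - y)))
      (sinh (g * (z2 - x)) * - g) by exact: is_derive1_comp.
  by apply: is_derive_eq; rewrite mulrC.
- have d2 := is_derive_sinh (g * (z2 - x)).
  have d3 : is_derive x 1 (fun y => sinh (g * (z2 - y)))
      (cosh (g * (z2 - x)) * - g) by exact: is_derive1_comp.
  by apply: is_derive_eq; rewrite mulrC.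
Qed.

Let is_derive_e (x : R) : is_derive x 1 e (de x).
Proof.
have [h1 h2] := is_derive_hyp x.
by rewrite /e /de; apply: is_derive_eq; rewrite /GRing.scale/=; field.
Qed.

Let is_derive_de (x : R) : is_derive x 1 de (dde x).
Proof.
have [h1 h2] := is_derive_hyp x.
by rewrite /de /dde; apply: is_derive_eq; rewrite /GRing.scale/=; field.
Qed.

Let is_derive_Ie (x : R) : is_derive x 1 Ie (e x).
Proof.
have [h1 h2] := is_derive_hyp x.
by rewrite /e /Ie; apply: is_derive_eq; rewrite /GRing.scale/=; field.
Qed.

(** Constants of integration that make the antiderivatives continuous at the two thresholds. *)
Let c1 := C3 / a + C4 / b - u ^+ 2 / 2.
Let c2 := p * C3 / a + q * C4 / b - u ^+ 2 / 2 - Ie u.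
Let c3 := Ie z2 + c2.

Let ex2 c3 c4 x := c3 * expR (a * (x - u)) + c4 * expR (b * (x - u)).

Let is_derive_ex2 d3 d4 (x : R) :
  is_derive x 1 (ex2 d3 d4) (ex2 (d3 * a) (d4 * b) x).
Proof.
have h1 := is_derive_expaff d3 a u x; have h2 := is_derive_expaff d4 b u x.
by rewrite /ex2; apply: is_derive_eq.
Qed.

Let ex2u d3 d4 : ex2 d3 d4 u = d3 + d4.
Proof. by rewrite /ex2 subrr !mulr0 expR0 !mulr1. Qed.

(** Regime 1 stops above [u], regime 2 above [z2]. On the strip between them regime 1 has stopped,
    so the second component solves a scalar equation with source, of which [x + e x] is the solution
    fitting at [z2]. [I1], [J2] and [I2] are antiderivatives. *)
Let w1 := glue u (ex2 C3 C4) id.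
Let dw1 := glue u (ex2 (C3 * a) (C4 * b)) (fun=> 1).
Let I1 := glue u (ex2 (C3 / a) (C4 / b)) (fun x => x ^+ 2 / 2 + c1).
Let v2 := glue u (ex2 (p * C3) (q * C4)) (fun x => x + e x).
Let dv2 := glue u (ex2 (p * C3 * a) (q * C4 * b)) (fun x => 1 + de x).
Let J2 := glue u (ex2 (p * C3 / a) (q * C4 / b))
  (fun x => x ^+ 2 / 2 + Ie x + c2).
Let w2 := glue z2 v2 id.
Let dw2 := glue z2 dv2 (fun=> 1).
Let I2 := glue z2 J2 (fun x => x ^+ 2 / 2 + c3).

Let g1u : ex2 C3 C4 u = u. Proof. by rewrite ex2u. Qed.
Let gd1u : ex2 (C3 * a) (C4 * b) u = 1.
Proof. by rewrite ex2u; move: C34'; lra. Qed.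
Let gI1u : ex2 (C3 / a) (C4 / b) u = u ^+ 2 / 2 + c1.
Proof. by rewrite ex2u /c1; ring. Qed.
Let g2u : ex2 (p * C3) (q * C4) u = u + e u.
Proof. by rewrite ex2u eu; move: C34; lra. Qed.
Let gd2u : ex2 (p * C3 * a) (q * C4 * b) u = 1 + de u.
Proof. by rewrite ex2u deu; move: C34'; lra. Qed.
Let gI2u : ex2 (p * C3 / a) (q * C4 / b) u = u ^+ 2 / 2 + Ie u + c2.
Proof. by rewrite ex2u /c2; ring. Qed.
Let g2z : v2 z2 = z2. Proof. by rewrite /v2 glue_ge//= ez2 addr0. Qed.
Let gd2z : dv2 z2 = 1. Proof. by rewrite /dv2 glue_ge//= dez2 addr0. Qed.
Let gI2z : J2 z2 = z2 ^+ 2 / 2 + c3.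
Proof. by rewrite /J2 glue_ge// /c3; ring. Qed.

Let is_derive_sqr2 c (x : R) : is_derive x 1 (fun y => y ^+ 2 / 2 + c) x.
Proof. by apply: is_derive_eq; rewrite /GRing.scale/=; field. Qed.

Let is_derive_ex2' d3 d4 (x : R) :
  is_derive x 1 (ex2 (d3 / a) (d4 / b)) (ex2 d3 d4 x).
Proof.
have h := is_derive_ex2 (d3 / a) (d4 / b) x.
by apply: is_derive_eq; rewrite !divfK.
Qed.

Let is_derive_w1 (x : R) : is_derive x 1 w1 (dw1 x).
Proof.
by apply: is_derive_glue => // y _;
  first [exact: is_derive_ex2|exact: is_derive_id].
Qed.

Let is_derive_I1 (x : R) : is_derive x 1 I1 (w1 x).
Proof.
by apply: is_derive_glue => // y _;
  first [exact: is_derive_ex2'|exact: is_derive_sqr2].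
Qed.

Let is_derive_v2 (x : R) : is_derive x 1 v2 (dv2 x).
Proof.
apply: is_derive_glue => // y _; first [exact: is_derive_ex2|idtac].
by have h := is_derive_e y; apply: is_derive_eq.
Qed.

Let is_derive_J2 (x : R) : is_derive x 1 J2 (v2 x).
Proof.
apply: is_derive_glue => // y _; first [exact: is_derive_ex2'|idtac].
have h := is_derive_Ie y; apply: is_derive_eq.
by rewrite /GRing.scale/=; field.
Qed.

Let is_derive_w2 (x : R) : is_derive x 1 w2 (dw2 x).
Proof.
by apply: is_derive_glue => // y _;
  first [exact: is_derive_v2|exact: is_derive_id].
Qed.

Let is_derive_I2 (x : R) : is_derive x 1 I2 (w2 x).
Proof.
by apply: is_derive_glue => // y _;
  first [exact: is_derive_J2|exact: is_derive_sqr2].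
Qed.

Let ex2_lip d3 d4 x y : x <= u -> y <= u ->
  `|ex2 d3 d4 x - ex2 d3 d4 y| <= (`|d3| * a + `|d4| * b) * `|x - y|.
Proof.
move=> xu yu.
have aux d c : 0 < c -> `|d * expR (c * (x - u)) - d * expR (c * (y - u))|
    <= `|d| * c * `|x - y|.
  move=> c0; rewrite -mulrBr normrM -mulrA ler_wpM2l//.
  have := @expR_lipschitz R 0 (c * (x - u)) (c * (y - u)).
  rewrite expR0 mul1r -mulrBr (_ : x - u - (y - u) = x - y); last by ring.
  rewrite normrM (gtr0_norm c0); apply.
    by rewrite pmulr_rle0// subr_le0.
  by rewrite pmulr_rle0// subr_le0.
have -> : ex2 d3 d4 x - ex2 d3 d4 y =
  (d3 * expR (a * (x - u)) - d3 * expR (a * (y - u))) +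
  (d4 * expR (b * (x - u)) - d4 * expR (b * (y - u))) by rewrite /ex2; ring.
by rewrite (le_trans (ler_normD _ _))// mulrDl lerD// aux.
Qed.

Let ex2_bnd d3 d4 x : x <= u -> `|ex2 d3 d4 x| <= `|d3| + `|d4|.
Proof.
move=> xu; have aux d c : 0 < c -> `|d * expR (c * (x - u))| <= `|d|.
  move=> c0; rewrite normrM (ger0_norm (expR_ge0 _)) ler_piMr// -[leRHS]expR0.
  by rewrite ler_expR pmulr_rle0// subr_le0.
by rewrite (le_trans (ler_normD _ _))// lerD// aux.
Qed.

Let M := expR (g * (z2 - u)).
Let M1 : 1 <= M.
Proof.
by rewrite -expR0 ler_expR; apply: mulr_ge0; [exact: ltW g0|rewrite subr_ge0].
Qed.

Let hyp_bnd x : u <= x -> x <= z2 ->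
  `|cosh (g * (z2 - x))| <= M /\ `|sinh (g * (z2 - x))| <= M.
Proof.
move=> ux xz; have s0 : 0 <= g * (z2 - x).
  by apply: mulr_ge0; [exact: ltW g0|rewrite subr_ge0].
have sM : expR (g * (z2 - x)) <= M.
  by rewrite ler_expR ler_wpM2l ?(ltW g0)// lerD2l lerN2.
have n1 : expR (- (g * (z2 - x))) <= 1 by rewrite -expR0 ler_expR oppr_le0.
rewrite !ger0_norm ?cosh_ge0 ?sinh_ge0// /cosh /sinh.
have := expR_ge0 (- (g * (z2 - x))); move: M1; lra.
Qed.

Let Ld := k * (g * (g * z2 * M + M)).
Let Lb := k * (M + g * z2 * M + 1).
Let Lb0 : 0 <= Lb.
Proof.
apply: mulr_ge0; first exact: ltW k0.
have : 0 <= g * z2 * M by rewrite !mulr_ge0 ?(ltW g0) ?(ltW z20)// (le_trans ler01).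
by move: M1; lra.
Qed.
Let Ld0 : 0 <= Ld.
Proof.
apply: mulr_ge0; first exact: ltW k0.
apply: mulr_ge0; first exact: ltW g0.
have : 0 <= g * z2 * M by rewrite !mulr_ge0 ?(ltW g0) ?(ltW z20)// (le_trans ler01).
by move: M1; lra.
Qed.

Let de_lip x y : u <= x -> x <= z2 -> u <= y -> y <= z2 ->
  `|de x - de y| <= Ld * `|x - y|.
Proof.
move=> ux xz uy yz.
have [t [_ /andP[mt tM]] ->] := MVT_between y x is_derive_de.
rewrite normrM ler_wpM2r//.
have ut : u <= t by rewrite (le_trans _ mt)// le_min uy.
have tz : t <= z2 by rewrite (le_trans tM)// ge_max yz.
have [h1 h2] := hyp_bnd ut tz.
rewrite /dde (normrM k) (normrM g) (gtr0_norm k0) (gtr0_norm g0) /Ld.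
rewrite !ler_wpM2l ?(ltW k0) ?(ltW g0)//.
rewrite (le_trans (ler_normB _ _))// lerD// (normrM (g * z2)) (normrM g) (gtr0_norm g0) (gtr0_norm z20).
by rewrite ler_wpM2l// mulr_ge0 ?(ltW g0) ?(ltW z20).
Qed.

Let de_bnd x : u <= x -> x <= z2 -> `|de x| <= Lb.
Proof.
move=> ux xz; have [h1 h2] := hyp_bnd ux xz.
rewrite /de /Lb (normrM k) (gtr0_norm k0) ler_wpM2l ?(ltW k0)//.
rewrite (le_trans (ler_normB _ _))// normr1 lerD2r.
rewrite (le_trans (ler_normB _ _))// lerD// (normrM (g * z2)) (normrM g) (gtr0_norm g0) (gtr0_norm z20).
by rewrite ler_wpM2l// mulr_ge0 ?(ltW g0) ?(ltW z20).
Qed.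

Let L1c := `|C3 * a| * a + `|C4 * b| * b.
Let L2c := `|p * C3 * a| * a + `|q * C4 * b| * b + Ld.
Let B1c := `|C3 * a| + `|C4 * b| + 1.
Let B2c := `|p * C3 * a| + `|q * C4 * b| + 1 + Lb.
Let D2c := `|(p - 1) * C3| + `|(q - 1) * C4| + e u.
Let LL := L1c + L2c + B1c + B2c + D2c.

Let eu0 : 0 <= e u. Proof. exact: e_ge0. Qed.
Let nn : [/\ 0 <= L1c, 0 <= L2c, 0 <= B1c, 0 <= B2c & 0 <= D2c].
Proof.
have n1 (x c : R) : 0 < c -> 0 <= `|x| * c.
  by move=> c0; apply: mulr_ge0 => //; exact: ltW.
split.
- exact: addr_ge0 (n1 _ _ a0) (n1 _ _ b0).
- exact: addr_ge0 (addr_ge0 (n1 _ _ a0) (n1 _ _ b0)) Ld0.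
- exact: addr_ge0 (addr_ge0 (normr_ge0 _) (normr_ge0 _)) ler01.
- exact: addr_ge0 (addr_ge0 (addr_ge0 (normr_ge0 _) (normr_ge0 _)) ler01) Lb0.
- exact: addr_ge0 (addr_ge0 (normr_ge0 _) (normr_ge0 _)) eu0.
Qed.

Let dw1_lip x y : `|dw1 x - dw1 y| <= L1c * `|x - y|.
Proof.
apply: (@lipschitz_glue R (fun=> True)) => //; first exact: ex2_lip.
by move=> ? ? *; rewrite subrr normr0 mulr_ge0//; case: nn.
Qed.

Let dw2_lip x y : `|dw2 x - dw2 y| <= L2c * `|x - y|.
Proof.
apply: (@lipschitz_glue R (fun=> True)) => //; last first.
  by move=> ? ? *; rewrite subrr normr0 mulr_ge0//; case: nn.
apply: (@lipschitz_glue R (fun x => x <= z2)) => //.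
- move=> x' y' xu yu; apply: (le_trans (ex2_lip _ _ xu yu)).
  by rewrite ler_wpM2r// lerDl.
- move=> x' y' xz yz ux uy.
  rewrite (_ : _ - _ = de x' - de y'); last by ring.
  apply: (le_trans (de_lip ux xz uy yz)); rewrite ler_wpM2r// lerDr.
  by rewrite addr_ge0// mulr_ge0 ?normr_ge0 ?(ltW a0) ?(ltW b0).
Qed.

Let dw1_bnd x : `|dw1 x| <= B1c.
Proof.
rewrite /dw1 /B1c; have [xu|/ltW ux] := leP x u.
  by rewrite glue_le// (le_trans (ex2_bnd _ _ xu))// lerDl.
by rewrite glue_ge// normr1 lerDr addr_ge0.
Qed.

Let dw2_bnd x : `|dw2 x| <= B2c.
Proof.
have h3 : 0 <= `|p * C3 * a| + `|q * C4 * b| by rewrite addr_ge0.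
rewrite /dw2 /B2c; have [xz|/ltW zx] := leP x z2; last first.
  by rewrite glue_ge// normr1; move: Lb0; lra.
rewrite glue_le// /dv2; have [xu|/ltW ux] := leP x u.
  rewrite glue_le//; apply: (le_trans (ex2_bnd _ _ xu)); move: Lb0; lra.
rewrite glue_ge//; have := ler_normD 1 (de x); rewrite normr1.
have := de_bnd ux xz; move: h3; lra.
Qed.

Let e_noninc x : u <= x -> x <= z2 -> e x <= e u.
Proof.
move=> ux xz; have [t [_ /andP[mt tM]] E] := MVT_between u x is_derive_e.
rewrite -subr_le0 E mulr_le0_ge0 ?subr_ge0//; apply: de_le0.
  by rewrite (le_trans _ mt)// le_min lexx.
by rewrite (le_trans tM)// ge_max uz2.
Qed.

(** Below [u] the first claim says that the convex [w1] lies above its tangent of slope [1] at [u].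
    In [w2 - w1] the nonpositive coefficient goes with the exponential of larger rate [b], which
    decays faster to the left, so the sign at [u] persists. *)
Let w12 x : x <= w1 x /\ 0 <= w2 x - w1 x <= D2c.
Proof.
have d0 : 0 <= `|(p - 1) * C3| + `|(q - 1) * C4| by rewrite addr_ge0.
have [xu|/ltW ux] := leP x u.
  have xz : x <= z2 by exact: le_trans uz2.
  rewrite /w1 /w2 /v2 !glue_le//; split.
    rewrite /ex2; have h1 := expR_ge1Dx (a * (x - u)).
    have h2 := expR_ge1Dx (b * (x - u)).
    have : C3 * (1 + a * (x - u)) <= C3 * expR (a * (x - u)) by rewrite ler_wpM2l.
    have : C4 * (1 + b * (x - u)) <= C4 * expR (b * (x - u)) by rewrite ler_wpM2l.
    have -> : C3 * (1 + a * (x - u)) =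
      C3 + C4 - C4 + (a * C3 + b * C4) * (x - u) - C4 * b * (x - u) by ring.
    rewrite C34 C34'; lra.
  have -> : ex2 (p * C3) (q * C4) x - ex2 C3 C4 x =
    ex2 ((p - 1) * C3) ((q - 1) * C4) x by rewrite /ex2; ring.
  apply/andP; split; last first.
    rewrite (le_trans (ler_norm _))// (le_trans (ex2_bnd _ _ xu))//.
    by rewrite lerDl.
  rewrite /ex2.
  have hab : expR (b * (x - u)) <= expR (a * (x - u)).
    rewrite ler_expR; have : (b - a) * (x - u) <= 0.
      by rewrite mulr_ge0_le0 ?subr_ge0 ?subr_le0 ?(ltW ab).
    lra.
  have : (1 - q) * C4 * expR (b * (x - u)) <= (1 - q) * C4 * expR (a * (x - u)).
    by rewrite ler_wpM2l// mulr_ge0//; move: q0; lra.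
  have : 0 <= ((p - 1) * C3 + (q - 1) * C4) * expR (a * (x - u)).
    by rewrite mulr_ge0 ?expR_ge0// -eu.
  lra.
rewrite /w1 glue_ge//; split => //.
have [xz|/ltW zx] := leP x z2.
  rewrite /w2 glue_le// /v2 glue_ge//.
  have -> : x + e x - id x = e x by rewrite /=; ring.
  rewrite e_ge0//= (le_trans (e_noninc ux xz))// /D2c lerDr//.
by rewrite /w2 glue_ge// subrr lexx; case: nn.
Qed.

Let K1 x := s1 * dw1 x - rho * I1 x + l1 * (I2 x - I1 x).
Let K2 x := s2 * dw2 x - rho * I2 x + l2 * (I1 x - I2 x).

Let K1_le x : x <= u -> K1 x = 0.
Proof.
move=> xu; have xz : x <= z2 by exact: le_trans uz2.
rewrite /K1 /dw1 /I1 /I2 /J2 !glue_le// /ex2.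
set E3 := expR _; set E4 := expR _.
(* The last factors vanish by the characteristic relations [pE] and [qE], one for each mode. *)
have -> : s1 * (C3 * a * E3 + C4 * b * E4) - rho * (C3 / a * E3 + C4 / b * E4) +
  l1 * (p * C3 / a * E3 + q * C4 / b * E4 - (C3 / a * E3 + C4 / b * E4)) =
  C3 / a * E3 * (s1 * a ^+ 2 - rho - l1 + l1 * p) +
  C4 / b * E4 * (s1 * b ^+ 2 - rho - l1 + l1 * q) by field; rewrite an bn.
by rewrite pE qE; ring.
Qed.

Let K2_le x : x <= u -> K2 x = 0.
Proof.
move=> xu; have xz : x <= z2 by exact: le_trans uz2.
rewrite /K2 /dw2 /dv2 /I1 /I2 /J2 !glue_le// /ex2.
set E3 := expR _; set E4 := expR _.
have -> : s2 * (p * C3 * a * E3 + q * C4 * b * E4)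
  - rho * (p * C3 / a * E3 + q * C4 / b * E4) +
  l2 * (C3 / a * E3 + C4 / b * E4 - (p * C3 / a * E3 + q * C4 / b * E4)) =
  C3 / a * E3 * (l2 - p * (rho + l2 - s2 * a ^+ 2)) +
  C4 / b * E4 * (l2 - q * (rho + l2 - s2 * b ^+ 2)) by field; rewrite an bn.
by rewrite pE2 qE2; ring.
Qed.

Let s2E : s2 = (rho + l2) / g ^+ 2.
Proof. by rewrite -g2; field. Qed.

Let K2_mid x : u <= x -> x <= z2 -> K2 x = 0.
Proof.
(* On the strip [K2] is constant. The constant is not evaluated but compared at [u], where [K2_le]
   gives zero. *)
have aux y : u <= y -> y <= z2 ->
    K2 y = s2 * (1 - k) - (rho + l2) * c2 + l2 * c1.
  move=> uy yz; rewrite /K2 /dw2 /I2 (glue_le _ _ yz) (glue_le _ _ yz).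
  rewrite /dv2 /J2 /I1 !glue_ge// /de /Ie s2E.
  set cc := cosh _; set ss := sinh _.
  have -> : (rho + l2) / g ^+ 2 * (1 + k * (cc - g * z2 * ss - 1)) -
    rho * (y ^+ 2 / 2 + k * (cc / g ^+ 2 - z2 * ss / g - y ^+ 2 / 2) + c2) +
    l2 * (y ^+ 2 / 2 + c1 - (y ^+ 2 / 2 + k * (cc / g ^+ 2 - z2 * ss / g - y ^+ 2 / 2) + c2)) =
    (rho + l2) / g ^+ 2 * (1 - k) - (rho + l2) * c2 + l2 * c1
    + ((rho + l2) * k - rho) * (y ^+ 2 / 2) by field.
  by rewrite kE subrr mul0r addr0.
move=> ux xz; rewrite aux// -(aux u (lexx u) uz2); exact: K2_le.
Qed.

(** On the strip the derivative of [K1] is [l1 * e t - rho * t]. As [e] decreases, it is largest at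
    [u], where by [pE] and [qE] it equals [- s1 * (C3 * a ^+ 2 + C4 * b ^+ 2)]; here the signs of
    [C3] and [C4] enter. *)
Let K1_ge x y : u <= x -> x <= y -> K1 y <= K1 x.
Proof.
move=> ux xy; have uy := le_trans ux xy.
pose H t := s1 * 1 - rho * I1 t + l1 * (I2 t - I1 t).
have HE t : u <= t -> K1 t = H t by move=> ut; rewrite /K1 /dw1 glue_ge.
rewrite (HE x ux) (HE y uy).
have Hd (t : R) : is_derive t 1 H (- rho * w1 t + l1 * (w2 t - w1 t)).
  have := is_derive_I2 t; have := is_derive_I1 t.
  rewrite /H; move: I1 I2 (w1 t) (w2 t) => f1 f2 y1 y2 h1 h2.
  by apply: is_derive_eq; rewrite /GRing.scale/=; ring.
apply: (nonincreasing_derive Hd _ ux xy) => t ut.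
have -> : w1 t = t by rewrite /w1 glue_ge.
have [tz|/ltW zt] := leP t z2; last first.
  rewrite /w2 glue_ge// subrr mulr0 addr0 mulNr oppr_le0.
  by rewrite mulr_ge0 ?(ltW rho0)// (le_trans (ltW u0)).
rewrite /w2 glue_le// /v2 glue_ge// (_ : t + e t - t = e t); last by ring.
have h1 : l1 * e t <= l1 * e u by rewrite ler_wpM2l ?(ltW l10)// e_noninc.
have h2 : rho * u <= rho * t by rewrite ler_wpM2l ?(ltW rho0).
have h3 : l1 * e u - rho * u = - s1 * (C3 * a ^+ 2 + C4 * b ^+ 2).
  rewrite eu -C34.
  have -> : l1 * ((p - 1) * C3 + (q - 1) * C4) - rho * (C3 + C4) =
    C3 * (l1 * p - l1 - rho) + C4 * (l1 * q - l1 - rho) by ring.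
  by rewrite pE qE; ring.
have h4 : 0 <= s1 * (C3 * a ^+ 2 + C4 * b ^+ 2).
  apply: mulr_ge0; first by rewrite /s1; apply: divr_ge0; rewrite ?sqr_ge0.
  by apply: addr_ge0; apply: mulr_ge0; rewrite ?sqr_ge0.
move: h1 h2 h3 h4; lra.
Qed.

Let K2_ge x y : z2 <= x -> x <= y -> K2 y <= K2 x.
Proof.
move=> ux xy; have uy := le_trans ux xy.
pose H t := s2 * 1 - rho * I2 t + l2 * (I1 t - I2 t).
have HE t : z2 <= t -> K2 t = H t by move=> ut; rewrite /K2 /dw2 glue_ge.
rewrite (HE x ux) (HE y uy).
have Hd (t : R) : is_derive t 1 H (- rho * w2 t + l2 * (w1 t - w2 t)).
  have := is_derive_I2 t; have := is_derive_I1 t.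
  rewrite /H; move: I1 I2 (w1 t) (w2 t) => f1 f2 y1 y2 h1 h2.
  by apply: is_derive_eq; rewrite /GRing.scale/=; ring.
apply: (nonincreasing_derive Hd _ ux xy) => t zt.
rewrite /w1 /w2 !glue_ge ?(le_trans uz2)// subrr mulr0 addr0 mulNr.
by rewrite oppr_le0 mulr_ge0 ?(ltW rho0)// (le_trans (ltW z20)).
Qed.

Lemma stopping_solution_regimes :
  exists w dw Iw L, stopping_solution rho sigma lambda
    (fun i => if i == reg1 then u else z2) w dw Iw L.
Proof.
have [L1n L2n B1n B2n D2n] := nn.
have n21 : reg2 == reg1 = false by [].
have n12 : rev_ord reg1 == reg1 = false by [].
have n22 : rev_ord reg2 == reg1 by [].
exists (fun i => if i == reg1 then w1 else w2),
  (fun i => if i == reg1 then dw1 else dw2),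
  (fun i => if i == reg1 then I1 else I2), LL; split.
- by move=> i x; case: (ord2P i) => ->; rewrite ?eqxx ?n21.
- by move=> i x; case: (ord2P i) => ->; rewrite ?eqxx ?n21.
- move=> i x y; case: (ord2P i) => ->; rewrite ?eqxx ?n21.
    apply: (le_trans (dw1_lip x y)); rewrite ler_wpM2r// /LL; lra.
  apply: (le_trans (dw2_lip x y)); rewrite ler_wpM2r// /LL; lra.
- move=> i x; case: (ord2P i) => ->; rewrite ?eqxx ?n21.
    apply: (le_trans (dw1_bnd x)); rewrite /LL; lra.
  apply: (le_trans (dw2_bnd x)); rewrite /LL; lra.
- move=> i j x; have [_ /andP[h1 h2]] := w12 x.
  have LL0 : 0 <= LL by rewrite /LL; lra.
  have dd : `|w2 x - w1 x| <= LL.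
    by rewrite ger0_norm//; apply: (le_trans h2); rewrite /LL; lra.
  case: (ord2P i) => ->; case: (ord2P j) => ->; rewrite ?eqxx ?n21 ?subrr ?normr0//.
  by rewrite distrC.
- move=> i x y xy; case: (ord2P i) => ->; rewrite ?eqxx ?n21 ?n12 ?n22.
    change (K1 y <= K1 x).
    have [yu|/ltW uy] := leP y u; first by rewrite !K1_le// (le_trans xy).
    have [xu|/ltW ux] := leP x u; last exact: K1_ge.
    by have := K1_ge (lexx u) uy; rewrite (K1_le (lexx u)) (K1_le xu).
  change (K2 y <= K2 x).
  have K20 t : t <= z2 -> K2 t = 0.
    by move=> tz; have [/K2_le//|/ltW ut] := leP t u; exact: K2_mid.
  have [yu|/ltW uy] := leP y z2; first by rewrite !K20// (le_trans xy).
  have [xu|/ltW ux] := leP x z2; last exact: K2_ge.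
  by have := K2_ge (lexx z2) uy; rewrite (K20 z2)// (K20 x).
- move=> i x y xy; case: (ord2P i) => ->; rewrite ?eqxx ?n21 ?n12 ?n22.
    move=> yu; change (K1 y = K1 x); rewrite !K1_le//; exact: le_trans yu.
  move=> yz; change (K2 y = K2 x).
  have K20 t : t <= z2 -> K2 t = 0.
    by move=> tz; have [/K2_le//|/ltW ut] := leP t u; exact: K2_mid.
  by rewrite !K20// (le_trans xy).
- move=> i x; case: (ord2P i) => ->; rewrite ?eqxx ?n21 => h.
    by rewrite /w1 glue_ge.
  by rewrite /w2 glue_ge.
- move=> i x; have [h /andP[h1 _]] := w12 x.
  by case: (ord2P i) => ->; rewrite ?eqxx ?n21//; move: h h1; lra.
Qed.

End StoppingSolution.

(** * The explicit solution for equal volatilities *)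

Section SingleRegime.
Context (R : realType) (rho : R) (sigma lambda : 'I_2 -> R).
Hypotheses (rho0 : 0 < rho) (sigma10 : 0 < sigma reg1)
  (sigma12 : sigma reg2 = sigma reg1).

(** With equal volatilities the regime is irrelevant and both components coincide:
    [u * exp (a (x - u))] up to [u], the identity beyond. The rate [a] cancels the generator, and
    smooth fit is [u * a = 1]. *)
Lemma stopping_solution_single :
  exists w dw Iw L, stopping_solution rho sigma lambda
    (fun=> sigma reg1 / Num.sqrt (2 * rho)) w dw Iw L.
Proof.
have r20 : 0 < 2 * rho by rewrite mulr_gt0.
have sq0 : 0 < Num.sqrt (2 * rho) by rewrite sqrtr_gt0.
have sqn : Num.sqrt (2 * rho) != 0 by rewrite gt_eqF.
pose u := sigma reg1 / Num.sqrt (2 * rho).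
pose a := Num.sqrt (2 * rho) / sigma reg1.
have s1n : sigma reg1 != 0 by rewrite gt_eqF.
have u0 : 0 < u by exact: divr_gt0.
have a0 : 0 < a by exact: divr_gt0.
have an : a != 0 by rewrite gt_eqF.
have uE : u = a^-1 by rewrite /u /a; field; rewrite sqn s1n.
have aE : sigma reg1 ^+ 2 / 2 * a ^+ 2 = rho.
  rewrite /a exprMn sqr_sqrtr ?(ltW r20)//; field; exact: s1n.
have sE i : sigma i = sigma reg1 by case: (ord2P i) => ->.
pose E c x := c * expR (a * (x - u)).
have Eu c : E c u = c by rewrite /E subrr mulr0 expR0 mulr1.
have dE c (x : R) : is_derive x 1 (E c) (E (c * a) x).
  exact: is_derive_expaff.
have E_lip c x y : 0 <= c -> x <= u -> y <= u -> `|E c x - E c y| <= c * a * `|x - y|.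
  move=> c0 xu yu; rewrite /E -mulrBr normrM (ger0_norm c0) -mulrA ler_wpM2l//.
  have := @expR_lipschitz R 0 (a * (x - u)) (a * (y - u)).
  rewrite expR0 mul1r -mulrBr (_ : x - u - (y - u) = x - y); last by ring.
  rewrite normrM (gtr0_norm a0); apply.
    by rewrite pmulr_rle0// subr_le0.
  by rewrite pmulr_rle0// subr_le0.
pose w := glue u (E u) id; pose dw := glue u (E (u * a)) (fun=> 1).
have ua : u * a = 1 by rewrite uE mulVf.
pose I := glue u (E (u / a)) (fun x => x ^+ 2 / 2 + (u / a - u ^+ 2 / 2)).
have wd (x : R) : is_derive x 1 w (dw x).
  have h1 : E u u = id u by rewrite Eu.
  have h2 : E (u * a) u = 1 by rewrite Eu.
  apply: (@is_derive_glue R u (E u) id (E (u * a)) (fun=> 1) h1 h2).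
have Id (x : R) : is_derive x 1 I (w x).
  have h1 : E (u / a) u = u ^+ 2 / 2 + (u / a - u ^+ 2 / 2) by rewrite Eu; ring.
  have h2 : E u u = id u by rewrite Eu.
  have h3 (y : R) : y <= u -> is_derive y 1 (E (u / a)) (E u y).
    by move=> _; have h := dE (u / a) y; apply: is_derive_eq; rewrite divfK.
  have h4 (y : R) : u <= y ->
      is_derive y 1 (fun x => x ^+ 2 / 2 + (u / a - u ^+ 2 / 2)) (id y).
    by move=> _; apply: is_derive_eq; rewrite /GRing.scale/=; field.
  exact: (@is_derive_glue R u _ _ (E u) id h1 h2 h3 h4 x).
pose K x := sigma reg1 ^+ 2 / 2 * dw x - rho * I x.
have KE i x : sigma i ^+ 2 / 2 * dw x - rho * I x + lambda i * (I x - I x) = K x.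
  by rewrite sE subrr mulr0 addr0.
have K0 x : x <= u -> K x = 0.
  move=> xu; rewrite /K /dw /I !glue_le// /E.
  have -> : sigma reg1 ^+ 2 / 2 * (u * a * expR (a * (x - u))) -
    rho * (u / a * expR (a * (x - u))) =
    u / a * expR (a * (x - u)) * (sigma reg1 ^+ 2 / 2 * a ^+ 2 - rho) by field.
  by rewrite aE subrr mulr0.
have Kn x y : u <= x -> x <= y -> K y <= K x.
  move=> ux xy; pose H t := sigma reg1 ^+ 2 / 2 * 1 - rho * I t.
  have HE t : u <= t -> K t = H t.
    by move=> ut; rewrite /K /dw glue_ge// Eu.
  rewrite (HE x ux) (HE y (le_trans ux xy)).
  have Hd (t : R) : is_derive t 1 H (- rho * w t).
    move: (Id t); rewrite /H; generalize (w t); generalize I => f1 y1 h1.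
    by apply: is_derive_eq; rewrite /GRing.scale/=; ring.
  apply: (nonincreasing_derive Hd _ ux xy) => t ut.
  rewrite /w glue_ge ?Eu// mulNr oppr_le0.
  by rewrite mulr_ge0 ?(ltW rho0)// (le_trans (ltW u0)).
exists (fun=> w), (fun=> dw), (fun=> I), (a + 1); rewrite -/u; split=> //.
- move=> _ x y; apply: (@lipschitz_glue R (fun=> True)) => //.
  + by rewrite Eu.
  + move=> x' y' xu yu; rewrite ua (le_trans (E_lip _ _ _ ler01 xu yu))//.
    by rewrite ler_wpM2r// mul1r lerDl.
  + by move=> *; rewrite subrr normr0 mulr_ge0// addr_ge0// ltW.
- move=> _ x; rewrite /dw; have [xu|/ltW ux] := leP x u; last first.
    by rewrite glue_ge ?Eu// normr1 lerDr ltW.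
  rewrite glue_le// ua /E mul1r ger0_norm ?expR_ge0//.
  apply: (@le_trans _ _ 1); last by rewrite lerDr ltW.
  by rewrite -expR0 ler_expR pmulr_rle0// subr_le0.
- by move=> _ _ x; rewrite subrr normr0 addr_ge0// ltW.
- move=> i x y xy; rewrite !KE.
  have [yu|/ltW uy] := leP y u; first by rewrite !K0// (le_trans xy).
  have [xu|/ltW ux] := leP x u; last exact: Kn.
  by have := Kn u y (lexx u) uy; rewrite (K0 u)// (K0 x).
- by move=> i x y xy yu; rewrite !KE !K0// (le_trans xy).
- by move=> _ x ux; rewrite /w glue_ge ?Eu.
- move=> _ x; rewrite /w; have [xu|/ltW ux] := leP x u; last first.
    by rewrite glue_ge ?Eu.
  rewrite glue_le// /E; have h := expR_ge1Dx (a * (x - u)).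
  apply: (@le_trans _ _ (u * (1 + a * (x - u)))); last by rewrite ler_wpM2l// ltW.
  by rewrite mulrDr mulr1 mulrA ua mul1r addrC subrK.
Qed.

End SingleRegime.

Section Thresholds.
Context (R : realType) (rho : R) (sigma lambda : 'I_2 -> R).

(** Thresholds of the stopping problem with strike zero; the strike [theta y] only translates
    them. *)
Definition threshold (i : 'I_2) : R :=
  if sigma reg1 < sigma reg2 then
    if i == reg1 then (z_star rho sigma lambda).1
    else (z_star rho sigma lambda).1 + (z_star rho sigma lambda).2
  else sigma reg1 / Num.sqrt (2 * rho).

Lemma x_starE c f i y :
  x_star rho c sigma lambda f i y = threshold i + theta rho c f y.
Proof.
rewrite /x_star /threshold; case: ifP => // _.
by case: ifP => // _; ring.
Qed.

Lemma stopping_solution_exists : 0 < rho -> (forall i, 0 < lambda i) ->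
  0 < sigma reg1 -> sigma reg1 <= sigma reg2 ->
  exists w dw Iw L, stopping_solution rho sigma lambda threshold w dw Iw L.
Proof.
move=> rho0 lambda0 sigma10; rewrite le_eqVlt => /predU1P[s12|s12].
  rewrite /threshold s12 ltxx -s12; apply: stopping_solution_single => //.
have [a [b [g [k [p [q [C3 [C4]]]]]]]] :=
  free_boundary_facts rho0 lambda0 sigma10 s12.
case=> -[ha hab hp hq] [h1 h2 h3 h4] [hg hg2 hk hkE].
case=> hu huz hC3 hC4 [h34 h34'] [heu hdeu he hde].
rewrite /threshold s12.
exact: (stopping_solution_regimes rho0 lambda0 ha hab hq h1 h2 h3 h4 hg hg2
  hk hkE hu huz hC3 hC4 h34 h34' heu hdeu he hde).
Qed.

End Thresholds.

(** * The Markov chain and the filtrations *)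

Section PiExtension.
Context d (T : measurableType d) (R : realType) (P : probability T R).

Lemma negligible_measure0 (A B : set T) : measurable (A `&` B) ->
  P.-negligible A -> P (A `&` B) = 0%E.
Proof.
move=> mAB [N [mN N0 AN]]; apply/eqP; rewrite eq_le measure_ge0 andbT -N0.
by apply: le_measure; rewrite ?inE//; apply: subset_trans AN; apply: subIsetl.
Qed.

Hypothesis P_complete : measure_is_complete P.

(** Intersections [A1] with [A2], together with the negligible sets, form a pi-system that generates
    the augmented join, and the two finite measures in [A] agree on it. Serves both the independence
    of Brownian increments and the Markov property. *)
Lemma pi_extension (H1 H2 : set (set T)) (D F : set T) (p : R) :
  sigma_algebra setT H1 -> sigma_algebra setT H2 ->
  H1 `<=` measurable -> H2 `<=` measurable -> measurable D -> measurable F ->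
  0 <= p ->
  (forall A1 A2, H1 A1 -> H2 A2 ->
    P (A1 `&` A2 `&` F) = (p%:E * P (A1 `&` A2 `&` D))%E) ->
  forall A, <<s H1 `|` H2 `|` [set N | P.-negligible N] >> A ->
    P (A `&` F) = (p%:E * P (A `&` D))%E.
Proof.
move=> s1 s2 m1 m2 mD mF p0 H.
have sI (G : set (set T)) : sigma_algebra setT G -> setI_closed G /\ G setT.
  move=> sG; split; last by case: (sG) => G0 GC _; rewrite -(setD0 setT); exact: GC.
  by move=> A B GA GB; have := @measurableI _ (g_sigma_algebraType G) A B;
    rewrite /measurable/= !sigma_algebra_id//; apply.
have [I1 T1] := sI _ s1; have [I2 T2] := sI _ s2.
pose G := [set A | (exists A1 A2, [/\ H1 A1, H2 A2 & A = A1 `&` A2]) \/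
                   P.-negligible A].
have Gm : G `<=` measurable.
  move=> A [[A1 [A2 [h1 h2 ->]]]|]; last exact: P_complete.
  by apply: measurableI; [exact: m1|exact: m2].
have GI : setI_closed G.
  move=> A B [[A1 [A2 [h1 h2 ->]]]|nA].
    move=> [[B1 [B2 [k1 k2 ->]]]|nB].
      by left; exists (A1 `&` B1), (A2 `&` B2); split;
        [exact: I1|exact: I2|rewrite setIACA].
    by right; apply: negligibleS nB; exact: subIsetr.
  by move=> _; right; apply: negligibleS nA; exact: subIsetl.
pose mu1 := mrestr P mF.
pose mu2 := mscale (NngNum p0) (mrestr P mD).
move=> A sA.
suff : mu1 A = mu2 A by [].
apply: (@g_sigma_algebra_measure_unique _ R _ G Gm (fun=> setT)) => //.
- by move=> _; left; exists setT, setT; rewrite setIT.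
- by apply/seteqP; split => // x _; exists 0%N.
- move=> B [[A1 [A2 [h1 h2 ->]]]|nB].
    by rewrite /mu1 /mu2 /mscale/= /mrestr/= H.
  have mB : measurable B by exact: P_complete.
  transitivity (P (B `&` F)); first by [].
  transitivity (p%:E * P (B `&` D))%E; last by [].
  by rewrite !negligible_measure0 ?mule0//; exact: measurableI.
- by move=> _; rewrite /mu1/= /mrestr -ge0_fin_numE// fin_num_measure//;
    exact: measurableI.
- apply: (sub_sigma_algebra2 _ sA) => B [[h1|h2]|nB]; last by right.
    by left; exists B, setT; rewrite setIT.
  by left; exists setT, B; rewrite setTI.
Qed.

End PiExtension.

(** * The transition matrix of the chain *)

Section TransitionMatrix.
Context (R : realType) (lambda : 'I_2 -> R).
Hypothesis lambda0 : forall i, 0 < lambda i.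
Let Lam := lambda reg1 + lambda reg2.
Let Lam0 : 0 < Lam. Proof. exact: addr_gt0. Qed.

(** The generator satisfies [Q * Q = - Lam *: Q], so its exponential series sums to the identity
    plus a multiple of [Q]. *)
Definition transition (t : R) (i j : 'I_2) : R :=
  (i == j)%:R + generator lambda i j * ((1 - expR (- (Lam * t))) / Lam).

Let Q2 : generator lambda * generator lambda = - Lam *: generator lambda.
Proof.
apply/matrixP => i j; rewrite !mxE !big_ord_recl big_ord0 !mxE.
have e0 : ord0 = reg1 :> 'I_2 by [].
have e1 : lift ord0 ord0 = reg2 :> 'I_2 by exact/val_inj.
have n12 : (reg1 == reg2) = false by [].
have n21 : (reg2 == reg1) = false by [].
rewrite e0 e1; case: (ord2P i) => ->; case: (ord2P j) => ->;
  rewrite ?eqxx ?n12 ?n21 /Lam; ring.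
Qed.

Lemma exp_mxE t i j : exp_mx (t *: generator lambda) i j = transition t i j.
Proof.
pose Q := generator lambda; pose A := t *: Q.
have AS k : A ^+ k.+1 = (- (Lam * t)) ^+ k *: A.
  elim: k => [|k ih]; first by rewrite expr1 expr0 scale1r.
  rewrite exprS ih -scalerAr /A -scalerAl -scalerAr Q2 !scalerA.
  by congr (_ *: _); rewrite exprS; ring.
rewrite mxE; pose c := - (Q i j / Lam).
have Lamn : Lam != 0 by rewrite gt_eqF.
(* Entrywise, the matrix series is [c] times a scalar exponential series, corrected at index
   zero. *)
have term k : (k`!%:R^-1 *: A ^+ k) i j =
    c * exp_coeff (- (Lam * t)) k + ((i == j)%:R - c) * (k == 0%N)%:R.
  case: k => [|k].
    have -> : A ^+ 0 = 1%:M by exact: expr0.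
    have -> : exp_coeff (- (Lam * t)) 0%N = 1.
      by rewrite /exp_coeff/= fact0 divr1.
    by rewrite !mxE fact0 invr1 mul1r /= !mulr1 addrC subrK.
  rewrite AS mxE [(_ *: A) _ _]mxE [A _ _]mxE /exp_coeff /= mulr0 addr0 exprS.
  by rewrite /c -/Q; field; rewrite Lamn pnatr_eq0 -lt0n fact_gt0.
have -> : series (fun k => (k`!%:R^-1 *: A ^+ k) i j) =
    (fun n => c * series (exp_coeff (- (Lam * t))) n +
              ((i == j)%:R - c) * (0 < n)%N%:R).
  apply/funext => n; rewrite !seriesEnat /=.
  under eq_bigr do rewrite term.
  rewrite big_split/= -!mulr_sumr; congr (_ + _ * _).
  case: n => [|n]; first by rewrite big_nil.
  rewrite big_nat_recl// big1 ?addr0// => k _.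
have cexp := is_cvg_series_exp_coeff (- (Lam * t)).
have -> : transition t i j = c * expR (- (Lam * t)) + ((i == j)%:R - c) * 1.
  by rewrite /transition /c -/Q; field.
apply: cvg_lim => //; apply: cvgD.
  by apply: cvgM; [exact: cvg_cst|exact: cexp].
apply: cvgM; first exact: cvg_cst.
apply: cvg_near_cst; near=> n.
have -> : (0 < n)%N by near: n; exact: nbhs_infty_gt.
by [].
Unshelve. all: by end_near. Qed.

(** Jump probabilities over a time [h] are [lambda i * h] up to order [h ^+ 2], by [1 + s <= exp s]
    taken at [s] and at [- s]. *)
Lemma transition_bounds h : 0 <= h ->
  let a := (1 - expR (- (Lam * h))) / Lam in
  h - Lam * h ^+ 2 <= a /\ 0 <= a <= h.
Proof.
move=> h0 /=; set s := Lam * h.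
have s0 : 0 <= s by rewrite mulr_ge0// ltW.
have Lamn : Lam != 0 by rewrite gt_eqF.
have hE : h = s / Lam by rewrite /s; field.
have e1 : expR (- s) <= 1 by rewrite -expR0 ler_expR oppr_le0.
have e2 : 1 - s <= expR (- s) by have := expR_ge1Dx (- s).
have e3 : expR (- s) <= 1 - s + s ^+ 2.
  have h1 : expR (- s) * (1 + s) <= 1.
    rewrite -[leRHS](expRxMexpNx_1 s) mulrC ler_wpM2r ?expR_ge0//.
    exact: expR_ge1Dx.
  have h2 : 1 <= (1 - s + s ^+ 2) * (1 + s).
    have -> : (1 - s + s ^+ 2) * (1 + s) = 1 + s ^+ 3 by ring.
    by rewrite lerDl exprn_ge0.
  have s1 : 0 < 1 + s by lra.
  by rewrite -(ler_pM2r s1); exact: le_trans h2.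
split; last first.
  apply/andP; split; first by rewrite divr_ge0 ?(ltW Lam0)// subr_ge0.
  by rewrite ler_pdivrMr// mulrC -/s; lra.
rewrite ler_pdivlMr// (_ : _ * Lam = s - s ^+ 2); last by rewrite /s; ring.
lra.
Qed.

Lemma transitionE t i j : i != j ->
  transition t i i = 1 - lambda i * ((1 - expR (- (Lam * t))) / Lam) /\
  transition t i j = lambda i * ((1 - expR (- (Lam * t))) / Lam).
Proof.
by move=> ij; rewrite /transition !mxE !eqxx (negbTE ij)/=; split; ring.
Qed.

Lemma transition_ge0 t i j : 0 <= t -> 0 <= transition t i j.
Proof.
move=> t0; have [h1 /andP[a0 at_]] := transition_bounds t0.
have [<-|ij] := eqVneq i j; last first.
  by have [_ ->] := transitionE t ij; rewrite mulr_ge0// ltW.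
have ni : i != rev_ord i.
  by case: (ord2P i) => ->; rewrite ?rev_reg1 ?rev_reg2.
have [-> _] := transitionE t ni; rewrite subr_ge0 mulrA ler_pdivrMr// mul1r.
have h2 := expR_ge0 (- (Lam * t)).
have h3 : lambda i <= Lam.
  by case: (ord2P i) => ->; rewrite /Lam ?lerDl ?lerDr ltW.
apply: le_trans h3; rewrite ler_piMr ?(ltW (lambda0 i))//; lra.
Qed.

End TransitionMatrix.

(** * Brownian increments and the Markov property in the augmented filtration *)

Section Filtrations.
Context d (Omega : measurableType d) (R : realType) (P : probability Omega R).
Variables (W : R -> Omega -> R) (eps : R -> Omega -> 'I_2) (lambda : 'I_2 -> R).
Hypothesis P_complete : measure_is_complete P.
Hypothesis lambda0 : forall i, 0 < lambda i.
Hypothesis W_brownian : brownian_motion P W.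
Hypothesis eps_markov : markov_chain P (generator lambda) eps.
Hypothesis W_eps_independent : independent_systems P
  (process_sigma measurable W `[0, +oo[) (process_sigma setT eps `[0, +oo[).

Let psW t := process_sigma measurable W `[0, t].
Let psE t := process_sigma (@setT (set 'I_2)) eps `[0, t].
Let psE_all := process_sigma (@setT (set 'I_2)) eps `[0, +oo[.
Let neg := [set N | P.-negligible N].

(* [genG] adds the whole path of the chain; [W] is still a Brownian motion for
   this larger filtration. *)
Definition genF t : set (set Omega) := psW t `|` psE t `|` neg.
Definition genG t : set (set Omega) := psW t `|` psE_all `|` neg.

Notation F := (augmented_filtration P W eps).
Notation FT t := (g_sigma_algebraType (genF t)).
Notation GT t := (g_sigma_algebraType (genG t)).
(** Measurability for a sub-sigma-algebra is measurability on the type it generates, which makes the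
    usual closure lemmas available. *)
Definition Fmeas t (U : Omega -> R) := measurable_fun [set: FT t] (U : FT t -> R).
Definition Gmeas t (U : Omega -> R) := measurable_fun [set: GT t] (U : GT t -> R).

Lemma FmeasP t U : Fmeas t U <-> forall B, measurable B -> F t (U @^-1` B).
Proof.
split=> [mU B mB|H _ B mB]; last by rewrite setTI; exact: H.
by have := mU measurableT B mB; rewrite setTI.
Qed.

Let eps_pre s B : 0 <= s -> measurable (eps s @^-1` B).
Proof.
move=> s0; rewrite (_ : _ @^-1` _ = \bigcup_(i in B) [set w | eps s w = i]).
  by apply: fin_bigcup_measurable => // i _; exact: mc_measurable eps_markov _ _ s0.
apply/seteqP; split=> [w Bw|w [i Bi /= ->]]; last by [].
by exists (eps s w).
Qed.

Let gen (T : Type) (G : set (set T)) (Z : R -> Omega -> T) (I : set R) :=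
  [set A | exists s, I s /\ exists2 B, G B & A = Z s @^-1` B].

Let psW_meas (I : set R) : I `<=` `[0, +oo[ ->
  process_sigma measurable W I `<=` measurable.
Proof.
move=> I0; apply: smallest_sub; first exact: sigma_algebra_measurable.
move=> _ [s [Is [B mB ->]]]; rewrite -[X in measurable X]setTI.
apply: bm_measurable W_brownian _ _ _ _ _ => //.
by have := I0 _ Is; rewrite /= in_itv/= andbT.
Qed.

Let psE_meas (I : set R) : I `<=` `[0, +oo[ ->
  process_sigma (@setT (set 'I_2)) eps I `<=` measurable.
Proof.
move=> I0; apply: smallest_sub; first exact: sigma_algebra_measurable.
move=> _ [s [Is [B mB ->]]]; apply: eps_pre.
by have := I0 _ Is; rewrite /= in_itv/= andbT.
Qed.

Let itv_sub t : (`[0, t] : set R) `<=` `[0, +oo[.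
Proof. by move=> s /=; rewrite !in_itv/= => /andP[->]. Qed.

Let ps_sub (T : Type) (G : set (set T)) (Z : R -> Omega -> T) (I J : set R) :
  I `<=` J -> process_sigma G Z I `<=` process_sigma G Z J.
Proof.
move=> IJ; apply: sub_sigma_algebra2 => A [s [Is H]].
by exists s; split => //; exact: IJ.
Qed.

Lemma G_measurable t : <<s genG t >> `<=` measurable.
Proof.
apply: smallest_sub; first exact: sigma_algebra_measurable.
move=> A [[hW|hE]|hn].
- exact: psW_meas (@itv_sub t) _ hW.
- by apply: psE_meas hE.
- exact: P_complete.
Qed.

Lemma F_G t : F t `<=` <<s genG t >>.
Proof.
apply: sub_sigma_algebra2 => A [[hW|hE]|hn]; [by left;left| |by right].
by left; right; apply: ps_sub hE; exact: itv_sub.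
Qed.

Lemma F_measurable t : F t `<=` measurable.
Proof. by move=> A /F_G /G_measurable. Qed.

Lemma F_mono s t : s <= t -> F s `<=` F t.
Proof.
move=> st; have sub : (`[0, s] : set R) `<=` `[0, t].
  by move=> u /=; rewrite !in_itv/= => /andP[->/= /le_trans]; apply.
apply: sub_sigma_algebra2 => A [[hW|hE]|hn]; last by right.
- by left; left; exact: ps_sub sub _ hW.
- by left; right; exact: ps_sub sub _ hE.
Qed.

Lemma F_negligible t A : P.-negligible A -> F t A.
Proof. by move=> nA; apply: sub_sigma_algebra; right. Qed.

(** Augmentation lets events be altered on negligible sets; the adaptedness of the optimal control
    is obtained in this way. *)
Lemma F_ae_eq t A B : F t A -> {ae P, forall w, A w <-> B w} -> F t B.
Proof.
move=> FA AB.
have nAB : P.-negligible (~` [set w | A w <-> B w]) by exact: AB.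
have -> : B = (A `\` (A `\` B)) `|` (B `\` A).
  apply/seteqP; split=> w.
    by move=> Bw; have [Aw|nA] := pselect (A w); [left; split=> // -[]|right].
  by move=> [[Aw nAB']|[]//]; apply: contrapT => nB; apply: nAB'.
have n1 : F t (A `\` B).
  by apply: F_negligible; apply: negligibleS nAB => w [Aw nB] [/(_ Aw)].
have n2 : F t (B `\` A).
  by apply: F_negligible; apply: negligibleS nAB => w [Bw nA] [_ /(_ Bw)].
apply: (@measurableU _ (FT t)) => //; exact: (@measurableD _ (FT t)).
Qed.

Lemma Fmeas_measurable t U : Fmeas t U -> measurable_fun setT U.
Proof. by move=> /FmeasP mU _ B mB; rewrite setTI;
  apply: (@F_measurable t); exact: mU. Qed.

Lemma Gmeas_measurable t U : Gmeas t U -> measurable_fun setT U.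
Proof.
move=> mU _ B mB; apply: (@G_measurable t); exact: (mU measurableT B mB).
Qed.

Lemma Fmeas_Gmeas t U : Fmeas t U -> Gmeas t U.
Proof. by move=> mU _ B mB; apply: F_G; exact: mU. Qed.

Lemma Fmeas_mono s t U : s <= t -> Fmeas s U -> Fmeas t U.
Proof. by move=> st mU _ B mB; apply: (F_mono st); exact: mU. Qed.

Lemma Fmeas_W t : 0 <= t -> Fmeas t (W t).
Proof.
move=> t0; apply/FmeasP => B mB; apply: sub_sigma_algebra; left; left.
by apply: sub_sigma_algebra; exists t; split;
  [rewrite /= in_itv/= t0 lexx|exists B].
Qed.

Lemma F_eps t B : 0 <= t -> F t (eps t @^-1` B).
Proof.
move=> t0; apply: sub_sigma_algebra; left; right.
by apply: sub_sigma_algebra; exists t; split;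
  [rewrite /= in_itv/= t0 lexx|exists B].
Qed.

Lemma Fmeas_indic t A : F t A -> Fmeas t \1_A.
Proof. by move=> FA; apply: (@measurable_indic _ (FT t)). Qed.

Lemma Fmeas_eps t (c : 'I_2 -> R) : 0 <= t -> Fmeas t (fun w => c (eps t w)).
Proof.
by move=> t0; apply/FmeasP => B mB; exact: (F_eps (c @^-1` B) t0).
Qed.

Lemma Gmeas_eps s t (c : 'I_2 -> R) : 0 <= t -> Gmeas s (fun w => c (eps t w)).
Proof.
move=> t0 _ B mB; rewrite setTI; apply: sub_sigma_algebra; left; right.
apply: sub_sigma_algebra; exists t; split; first by rewrite /= in_itv/= t0.
by exists (c @^-1` B).
Qed.

Let dW t h w := W (t + h) w - W t w.

Let dW_meas t h : 0 <= t -> 0 <= h -> measurable_fun setT (dW t h).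
Proof.
move=> t0 h0; apply: measurable_funB; apply: bm_measurable W_brownian _ _ => //.
exact: addr_ge0.
Qed.

(** The increment is independent of the past of [W] and, with that past, of the whole chain;
    [pi_extension] joins the two and adds the negligible sets. *)
Lemma increment_indep t h A B : 0 <= t -> 0 < h ->
  <<s genG t >> A -> measurable B ->
  P (A `&` dW t h @^-1` B) = (P A * P (dW t h @^-1` B))%E.
Proof.
move=> t0 h0 GA mB; set C := dW t h @^-1` B.
have mC : measurable C.
  by rewrite /C -[X in measurable X]setTI; apply: dW_meas => //; exact: ltW.
have PC0 : P C \is a fin_num by exact: fin_num_measure.
have C_W : process_sigma measurable W `[0, +oo[ C.
  pose T := g_sigma_algebraType (gen measurable W `[0, +oo[).
  have mWT s : 0 <= s -> measurable_fun [set: T] (W s : T -> R).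
    move=> s0 _ D mD; rewrite setTI; apply: sub_sigma_algebra.
    by exists s; split; [rewrite /= in_itv/= s0|exists D].
  have m1 : measurable_fun [set: T] (dW t h : T -> R).
    by apply: measurable_funB; apply: mWT => //; rewrite addr_ge0// ltW.
  by have := m1 measurableT B mB; rewrite setTI.
have sW : sigma_algebra setT (psW t) by exact: smallest_sigma_algebra.
have sE : sigma_algebra setT psE_all by exact: smallest_sigma_algebra.
have th : t < t + h by rewrite ltrDl.
have := @pi_extension _ _ _ P P_complete _ _ setT C (fine (P C)) sW sE
  (psW_meas (@itv_sub t)) (psE_meas (@subset_refl _ _)) measurableT mC
  (fine_ge0 (measure_ge0 _ _)) _ A GA.
rewrite setIT fineK// muleC; apply => A1 A2 hW hE.
have hW' := ps_sub (@itv_sub t) hW.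
have -> : A1 `&` A2 `&` C = (A1 `&` C) `&` A2 by rewrite setIAC.
rewrite W_eps_independent//; last first.
  pose TT := g_sigma_algebraType (gen measurable W `[0, +oo[).
  by have := @measurableI _ TT A1 C; apply.
have -> : P (A1 `&` C) = (P A1 * P C)%E.
  by apply: (bm_independent W_brownian t0 th) => //; exists B.
by rewrite setIT W_eps_independent// (muleC (P A1)) muleA.
Qed.

Lemma increment_law t h B : 0 <= t -> 0 < h -> measurable B ->
  pushforward P (dW t h) B = normal_prob 0 (Num.sqrt h) B.
Proof.
move=> t0 h0 mB; have th : t < t + h by rewrite ltrDl.
have := bm_gaussian W_brownian t0 th mB.
by rewrite (_ : t + h - t = h)//; ring.
Qed.

Lemma increment_moments t h : 0 <= t -> 0 < h ->
  [/\ L1 P (dW t h), E P (dW t h) = 0,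
      L1 P (fun w => dW t h w ^+ 2) & E P (fun w => dW t h w ^+ 2) = h].
Proof.
move=> t0 h0; have s0 : 0 < Num.sqrt h by rewrite sqrtr_gt0.
have m1 : measurable_fun setT (dW t h) by apply: dW_meas => //; exact: ltW.
have law B (mB : measurable B) := increment_law t0 h0 mB.
have [i1 e1] := E_pushforward (N := normal_prob 0 (Num.sqrt h)) m1
  (@measurable_id _ _ setT) law (L1_normal_id s0).
have mx2 : measurable_fun setT (fun x : R => x ^+ 2) by exact: measurable_funX.
have [i2 e2] := E_pushforward (N := normal_prob 0 (Num.sqrt h)) m1
  mx2 law (L1_normal_sqr s0).
split=> //; first by rewrite e1 normal_moment1.
by rewrite e2 /E /Rintegral normal_moment2//= sqr_sqrtr// ltW.
Qed.

Lemma increment_moment4 t h : 0 <= t -> 0 < h ->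
  L1 P (fun w => dW t h w ^+ 4) /\ E P (fun w => dW t h w ^+ 4) <= 64 * h ^+ 2.
Proof.
move=> t0 h0; have s0 : 0 < Num.sqrt h by rewrite sqrtr_gt0.
have m1 : measurable_fun setT (dW t h) by apply: dW_meas => //; exact: ltW.
have law B (mB : measurable B) := increment_law t0 h0 mB.
have mx4 : measurable_fun setT (fun x : R => x ^+ 4) by exact: measurable_funX.
have i4 : L1 (normal_prob 0 (Num.sqrt h)) (fun x => x ^+ 4).
  apply: L1_ge0_lty => //; first by move=> x; rewrite exprn_even_ge0.
  by rewrite (le_lt_trans (normal_moment4_le s0))// ltry.
have [j4 e4] := E_pushforward (N := normal_prob 0 (Num.sqrt h)) m1 mx4 law i4.
split=> //; rewrite e4 -lee_fin -E_EFin//.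
apply: (le_trans (normal_moment4_le s0)).
by rewrite lee_fin (_ : 4 = 2 * 2)%N// exprM sqr_sqrtr// ltW.
Qed.

Lemma increment_indep_E t h U (g : R -> R) : 0 <= t -> 0 < h ->
  Gmeas t U -> L1 P U -> measurable_fun setT g -> L1 P (fun w => g (dW t h w)) ->
  L1 P (fun w => U w * g (dW t h w)) /\
  E P (fun w => U w * g (dW t h w)) = E P U * E P (fun w => g (dW t h w)).
Proof.
move=> t0 h0 GU iU mg ig.
have m1 : measurable_fun setT (dW t h) by apply: dW_meas => //; exact: ltW.
have mU := L1_measurable iU; have mgW := L1_measurable ig.
apply: indep_E => // A B mA mB; rewrite (_ : (fun w => _) @^-1` B = dW t h @^-1` (g @^-1` B))//.
apply: increment_indep => //.
  by have := GU measurableT A mA; rewrite setTI.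
by rewrite -[X in measurable X]setTI; exact: mg.
Qed.

(** The past of [W] is independent of the entire chain, so its probability factors out of both sides
    and the Markov property of the chain alone remains. *)
Lemma markov_F t h A i j : 0 <= t -> 0 <= h -> F t A ->
  P (A `&` ([set w | eps t w = i] `&` [set w | eps (t + h) w = j])) =
  ((transition lambda h i j)%:E * P (A `&` [set w | eps t w = i]))%E.
Proof.
move=> t0 h0 FA; set D := [set w | eps t w = i].
set D' := [set w | eps (t + h) w = j].
have mD : measurable D by exact: mc_measurable eps_markov _ _ t0.
have mD' : measurable D'.
  by apply: mc_measurable eps_markov _ _ _; exact: addr_ge0.
have sW : sigma_algebra setT (psW t) by exact: smallest_sigma_algebra.
have sE : sigma_algebra setT (psE t) by exact: smallest_sigma_algebra.
have p0 := transition_ge0 lambda0 i j h0.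
apply: (@pi_extension _ _ _ P P_complete _ _ D (D `&` D') _ sW sE
  (psW_meas (@itv_sub t)) (psE_meas (@itv_sub t)) mD (measurableI _ _ mD mD') p0
  _ A FA) => A1 A2 hW hE.
pose TE := g_sigma_algebraType (gen (@setT (set 'I_2)) eps `[0, +oo[).
have hE' : psE_all A2 by apply: ps_sub hE; exact: itv_sub.
have hD : psE_all D.
  apply: sub_sigma_algebra; exists t; split; first by rewrite /= in_itv/= t0.
  by exists [set i].
have hD' : psE_all D'.
  apply: sub_sigma_algebra; exists (t + h).
  split; first by rewrite /= in_itv/= addr_ge0.
  by exists [set j].
have hW' := ps_sub (@itv_sub t) hW.
have e1 : psE_all (A2 `&` (D `&` D')).
  have := @measurableI _ TE A2 (D `&` D'); apply => //.
  by have := @measurableI _ TE D D'; apply.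
have e2 : psE_all (A2 `&` D) by have := @measurableI _ TE A2 D; apply.
rewrite -!setIA (W_eps_independent hW' e1) (W_eps_independent hW' e2).
rewrite setIA (mc_markov eps_markov t0 h0 hE) exp_mxE//.
by rewrite (muleC (P (A2 `&` _))) muleCA.
Qed.

Lemma indic_eqE (e : Omega -> 'I_2) (i : 'I_2) w :
  \1_[set w | e w = i] w = (e w == i)%:R :> R.
Proof.
by rewrite indicE; congr ((nat_of_bool _)%:R); apply/idP/eqP => [|ei]; rewrite inE.
Qed.

Lemma markov_E t h U i j : 0 <= t -> 0 <= h -> Fmeas t U -> L1 P U ->
  E P (fun w => (eps t w == i)%:R * (eps (t + h) w == j)%:R * U w) =
  transition lambda h i j * E P (fun w => (eps t w == i)%:R * U w).
Proof.
move=> t0 h0 FU iU.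
pose D := [set w | eps t w = i]; pose D' := [set w | eps (t + h) w = j].
have mD : measurable D by exact: mc_measurable eps_markov _ _ t0.
have mD' : measurable D'.
  by apply: mc_measurable eps_markov _ _ _; exact: addr_ge0.
have -> : (fun w => (eps t w == i)%:R * (eps (t + h) w == j)%:R * U w) =
    (fun w => \1_(D `&` D') w * U w).
  by apply/funext => w; rewrite indicI /= !indic_eqE.
have -> : (fun w => (eps t w == i)%:R * U w) = (fun w => \1_D w * U w).
  by apply/funext => w; rewrite indic_eqE.
apply: E_indic_transfer => //.
- exact: transition_ge0.
- exact: L1_measurable iU.
- exact: measurableI.
- move=> C mC; apply: markov_F => //.
  by move/FmeasP : FU; apply.
Qed.

(** Linear in the elapsed time, which makes freezing the volatility over a step an error of higher
    order. *)
Lemma regime_change_prob s t : 0 <= s -> s <= t ->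
  E P (fun w => (eps t w != eps s w)%:R) <=
  2 * (lambda reg1 + lambda reg2) * (t - s).
Proof.
move=> s0 st; have h0 : 0 <= t - s by rewrite subr_ge0.
have t0 : 0 <= t by exact: le_trans st.
have mU (u : R) (c : 'I_2 -> R) : 0 <= u -> measurable_fun setT (fun w => c (eps u w)).
  by move=> u0; apply: (@Fmeas_measurable u); exact: Fmeas_eps.
have iI u i : 0 <= u -> L1 P (fun w => (eps u w == i)%:R).
  move=> u0; apply: (@L1_bounded _ _ _ _ _ 1).
    exact: (mU u (fun k => (k == i)%:R)).
  by move=> w; case: (_ == i); rewrite ?normr0 ?normr1.
have iII i j : L1 P (fun w => (eps s w == i)%:R * (eps t w == j)%:R * 1).
  apply: (@L1_bounded _ _ _ _ _ 1).
    apply: measurable_funM => //; apply: measurable_funM.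
      exact: (mU s (fun k => (k == i)%:R)).
    exact: (mU t (fun k => (k == j)%:R)).
  by move=> w; case: (_ == i); case: (_ == j); rewrite ?mulr1 ?mulr0 ?mul0r ?normr0 ?normr1.
have -> : (fun w => (eps t w != eps s w)%:R) =
  (fun w => (eps s w == reg1)%:R * (eps t w == reg2)%:R * 1 +
            (eps s w == reg2)%:R * (eps t w == reg1)%:R * 1) :> (Omega -> R).
  apply/funext => w; case: (ord2P (eps s w)) => ->; case: (ord2P (eps t w)) => ->;
  by rewrite ?eqxx /= ?mulr1 ?mulr0 ?mul0r ?addr0 ?add0r.
rewrite ED//.
have aux i j : i != j ->
    E P (fun w => (eps s w == i)%:R * (eps t w == j)%:R * 1) <= lambda i * (t - s).
  move=> ij; have := @markov_E s (t - s) (fun=> 1) i j s0 h0.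
  rewrite (_ : s + (t - s) = t); last by ring.
  move=> -> //; last 2 first.
  - exact: measurable_cst.
  - exact: L1_cst.
  have [_ ->] := transitionE lambda (t - s) ij.
  have [_ /andP[a0 ah]] := transition_bounds lambda0 h0.
  have e1 : E P (fun w => (eps s w == i)%:R * 1) <= 1.
    rewrite -[leRHS](E_cst P 1); apply: E_le; last 2 first.
    - exact: L1_cst.
    - by move=> w; case: (_ == i); rewrite ?mulr1.
    by under eq_fun do rewrite mulr1; exact: iI.
  have e0 : 0 <= E P (fun w => (eps s w == i)%:R * 1).
    by apply: E_ge0 => w; rewrite mulr1.
  have l0 := ltW (lambda0 i).
  apply: le_trans (_ : lambda i * (t - s) * 1 <= _); last by rewrite mulr1.
  by apply: ler_pM => //; [exact: mulr_ge0|rewrite ler_wpM2l].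
have h1 := @aux reg1 reg2 isT; have h2 := @aux reg2 reg1 isT.
have l1 := lambda0 reg1; have l2 := lambda0 reg2.
have : 0 <= lambda reg1 * (t - s) by rewrite mulr_ge0// ltW.
have : 0 <= lambda reg2 * (t - s) by rewrite mulr_ge0// ltW.
lra.
Qed.

End Filtrations.

(** * Square-integrable processes and the price *)

Section Grid.
Context (R : realType).
Implicit Types (n k : nat) (t : R).

Definition mesh n : R := (2 ^+ n)^-1.
Definition grid n k : R := k%:R * mesh n.
(** Index of the first grid time strictly after [t]: approximation from the right suits
    right-continuous paths and events [tau < t]. *)
Definition gnext n t : nat := (Num.truncn (t * 2 ^+ n)).+1.

Lemma mesh_gt0 n : 0 < mesh n.
Proof. by rewrite invr_gt0 exprn_gt0. Qed.

Lemma pow2_mesh n : 2 ^+ n * mesh n = 1 :> R.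
Proof. by rewrite divff// expf_neq0. Qed.

Lemma mesh_le1 n : mesh n <= 1.
Proof. by rewrite invf_le1 ?exprn_gt0// exprn_ege1// ler1n. Qed.

Lemma cvg_mesh : mesh n @[n --> \oo] --> (0 : R).
Proof.
rewrite (_ : mesh = fun n => (2^-1 : R) ^+ n); last first.
  by apply/funext => n; rewrite /mesh exprVn.
by apply: cvg_expr; rewrite ger0_norm// invf_lt1// ltr1n.
Qed.

Lemma grid0 n : grid n 0 = 0. Proof. by rewrite /grid mul0r. Qed.

Lemma gridS n k : grid n k.+1 = grid n k + mesh n.
Proof. by rewrite /grid -natr1 mulrDl mul1r. Qed.

Lemma grid_ge0 n k : 0 <= grid n k.
Proof. by rewrite mulr_ge0// ltW// mesh_gt0. Qed.

Lemma grid_le n j k : (j <= k)%N -> grid n j <= grid n k.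
Proof. by move=> jk; rewrite ler_pM2r ?mesh_gt0// ler_nat. Qed.

Lemma grid_nat n k : grid n (k * 2 ^ n) = k%:R.
Proof. by rewrite /grid natrM natrX -mulrA pow2_mesh mulr1. Qed.

Lemma grid_refine n k : grid n.+1 (k * 2) = grid n k.
Proof.
rewrite /grid natrM /mesh exprS invfM -mulrA; congr (_ * _).
by rewrite mulrA divff ?mul1r// pnatr_eq0.
Qed.

Lemma next_gt n t : t < grid n (gnext n t).
Proof.
rewrite -(ltr_pM2r (exprn_gt0 n (@ltr0Sn R 1))) /grid -mulrA mulVf ?mulr1.
  exact: truncnS_gt.
by rewrite expf_neq0.
Qed.

Lemma next_le n t : 0 <= t -> grid n (gnext n t) <= t + mesh n.
Proof.
move=> t0; rewrite /gnext gridS lerD2r.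
have t20 : 0 <= t * 2 ^+ n by rewrite mulr_ge0// exprn_ge0.
have /andP[h _] := truncn_itv t20.
by rewrite /grid ler_pdivrMr// exprn_gt0.
Qed.

Lemma next_le_nat n t k : 0 <= t -> (gnext n t <= k)%N = (t < grid n k).
Proof.
move=> t0; rewrite /gnext truncn_lt_nat ?mulr_ge0 ?exprn_ge0//.
by rewrite /grid /mesh ltr_pdivlMr// exprn_gt0.
Qed.

Lemma cvg_next t : 0 <= t -> grid n (gnext n t) @[n --> \oo] --> t.
Proof.
move=> t0; apply: (@squeeze_cvgr _ _ _ _ (fun=> t) (fun n => t + mesh n)).
- by near=> n; rewrite next_le// ltW// next_gt.
- exact: cvg_cst.
- by rewrite -[X in _ --> X]addr0; apply: cvgD; [exact: cvg_cst|exact: cvg_mesh].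
Unshelve. all: by end_near. Qed.

Lemma cvg_right_next (T : topologicalType) (f : R -> T) t (l : T) : 0 <= t ->
  f s @[s --> t^'+] --> l -> f (grid n (gnext n t)) @[n --> \oo] --> l.
Proof.
move=> t0 fl; apply: cvg_comp fl.
move=> A [e /= e0 tA].
have /cvgrPdist_lt /(_ _ e0) := cvg_next t0; apply: filterS => n ne.
by apply: tA => //; exact: next_gt.
Qed.

End Grid.

(** * Evaluation at random times *)

Section RightContinuousComposition.
Context d1 (T1 : measurableType d1) d2 (T2 : measurableType d2) (R : realType).

Lemma measurable_countable_index (f : nat -> T1 -> R) (k : T1 -> nat) :
  (forall n, measurable_fun setT (f n)) ->
  (forall n, measurable [set x | k x = n]) ->
  measurable_fun setT (fun x => f (k x) x).
Proof.
move=> mf mk _ B mB; rewrite setTI.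
rewrite (_ : _ @^-1` B = \bigcup_n ([set x | k x = n] `&` f n @^-1` B)).
  apply: bigcupT_measurable => n; apply: measurableI => //.
  by have := mf n measurableT B mB; rewrite setTI.
by apply/seteqP; split=> [x fx|x [n _ [/= <-]]]; first by exists (k x).
Qed.

Lemma measurable_next n (tau : T1 -> R) : (forall x, 0 <= tau x) ->
  measurable_fun setT tau -> forall k, measurable [set x | gnext n (tau x) = k].
Proof.
move=> tau0 mtau k.
have mlt j : measurable [set x | tau x < grid R n j].
  have E : [set x | tau x < grid R n j] = tau @^-1` `]-oo, grid R n j[.
    by apply/funext => x /=; rewrite in_itv.
  by rewrite E -[X in measurable X]setTI; exact: mtau.
case: k => [|k]; first by rewrite (_ : [set _ | _] = set0)// -subset0 => x.
rewrite (_ : [set _ | _] = [set x | tau x < grid R n k.+1] `\`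
                           [set x | tau x < grid R n k]).
  exact: measurableD.
apply/seteqP; split=> x /=.
  by move=> E; rewrite -!next_le_nat// E leqnn; split => //; rewrite ltnn.
rewrite -!next_le_nat// => -[h1 h2]; apply/eqP; rewrite eqn_leq h1 /=.
by rewrite ltnNge; apply/negP.
Qed.

(** The random time is approximated from the right by dyadic times, which take countably many
    values. *)
Lemma measurable_right_continuous_comp (Z : R -> T2 -> R) (tau : T1 -> R)
    (om : T1 -> T2) :
  (forall t, 0 <= t -> measurable_fun setT (Z t)) ->
  (forall w t, 0 <= t -> Z s w @[s --> t^'+] --> Z t w) ->
  (forall x, 0 <= tau x) -> measurable_fun setT tau -> measurable_fun setT om ->
  measurable_fun setT (fun x => Z (tau x) (om x)).
Proof.
move=> mZ rZ tau0 mtau mom.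
apply: (@measurable_fun_cvg _ _ _ _
  (fun n x => Z (grid R n (gnext n (tau x))) (om x))).
  move=> n; apply: (@measurable_countable_index
    (fun k x => Z (grid R n k) (om x)) (fun x => gnext n (tau x))).
    by move=> k; apply: measurableT_comp => //; apply: mZ; exact: grid_ge0.
  exact: measurable_next.
move=> x _; exact: (cvg_right_next (tau0 x) (rZ _ _ (tau0 x))).
Qed.

End RightContinuousComposition.

(** * Square-integrable variables *)

Section L2.
Context d (T : measurableType d) (R : realType) (P : probability T R).
Implicit Types U V : T -> R.

Definition L2 U := measurable_fun setT U /\ L1 P (fun w => U w ^+ 2).

Lemma L2_mul U V : L2 U -> L2 V -> L1 P (fun w => U w * V w).
Proof.
move=> [mU iU] [mV iV]; apply: L1_le (L1D iU iV).
  exact: measurable_funM.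
by move=> w; rewrite ler_norml; apply/andP; split;
  have := sqr_ge0 (U w + V w); have := sqr_ge0 (U w - V w);
  have := sqr_ge0 (U w); have := sqr_ge0 (V w); nra.
Qed.

Lemma L2D U V : L2 U -> L2 V -> L2 (fun w => U w + V w).
Proof.
move=> hU hV; have [mU iU] := hU; have [mV iV] := hV.
split; first exact: measurable_funD.
rewrite (_ : (fun w => _) = fun w => U w ^+ 2 + V w ^+ 2 + 2 * (U w * V w));
  last by apply/funext => w; ring.
by apply: L1D; [exact: L1D|apply: L1Z; exact: L2_mul].
Qed.

Lemma L2Z r U : L2 U -> L2 (fun w => r * U w).
Proof.
move=> [mU iU]; split; first exact: measurable_funM.
by under [X in L1 _ X]eq_fun => w do rewrite exprMn; exact: L1Z.
Qed.

Lemma L2B U V : L2 U -> L2 V -> L2 (fun w => U w - V w).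
Proof.
move=> hU hV; have := L2D hU (L2Z (-1) hV).
by under [X in L2 X -> _]eq_fun => w do rewrite mulN1r.
Qed.

Lemma L2_le U V : measurable_fun setT U -> (forall w, `|U w| <= `|V w|) ->
  L2 V -> L2 U.
Proof.
move=> mU UV [mV iV]; split=> //; apply: L1_le iV.
  exact: measurable_funX.
move=> w; rewrite ger0_norm ?sqr_ge0// -(real_normK (num_real (U w))).
by rewrite -(real_normK (num_real (V w))) lerXn2r ?nnegrE.
Qed.

Lemma L2_bounded U M : measurable_fun setT U -> (forall w, `|U w| <= M) -> L2 U.
Proof.
move=> mU UM; split=> //; apply: (@L1_bounded _ _ _ _ _ (M ^+ 2)).
  exact: measurable_funX.
move=> w; rewrite ger0_norm ?sqr_ge0// -(real_normK (num_real (U w))).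
by rewrite lerXn2r ?nnegrE// (le_trans _ (UM w)).
Qed.

Lemma L2Mb U V M : measurable_fun setT V -> (forall w, `|V w| <= M) -> L2 U ->
  L2 (fun w => V w * U w).
Proof.
move=> mV VM hU; apply: L2_le (L2Z M hU).
  by apply: measurable_funM => //; case: hU.
by move=> w; rewrite !normrM ler_wpM2r// (le_trans (VM w))// ler_norm.
Qed.

Lemma L2_L1 U : L2 U -> L1 P U.
Proof.
move=> hU; have h1 : L2 (fun=> 1 : R).
  by apply: (@L2_bounded _ 1) => // w; rewrite normr1.
by have := L2_mul hU h1; under eq_fun do rewrite mulr1.
Qed.

Lemma L2_sum (I : Type) (s : seq I) (Q : pred I) (F : I -> T -> R) :
  (forall i, Q i -> L2 (F i)) -> L2 (fun w => \sum_(i <- s | Q i) F i w).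
Proof.
move=> iF; elim: s => [|i s ih].
  under [X in L2 X]eq_fun do rewrite big_nil.
  by apply: (@L2_bounded _ 0) => // w; rewrite normr0.
under [X in L2 X]eq_fun do rewrite big_cons.
have [Qi|//] := boolP (Q i).
by apply: L2D => //; exact: iF.
Qed.

End L2.

(** * Doob's maximal inequality *)

Section Doob.
Context (R : realType).

Fixpoint runmax (s : nat -> R) (k : nat) : R :=
  if k is k'.+1 then Num.max (runmax s k') `|s k| else `|s 0%N|.

Definition sign (x : R) : R := if 0 <= x then 1 else -1.

Lemma runmax_ge s j k : (j <= k)%N -> `|s j| <= runmax s k.
Proof.
elim: k => [|k ih]; first by rewrite leqn0 => /eqP ->.
rewrite leq_eqVlt => /predU1P[->|]; first by rewrite /= le_max lexx orbT.
by rewrite ltnS => /ih h; rewrite /= le_max h.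
Qed.

Lemma runmax_ge0 s k : 0 <= runmax s k.
Proof. exact: le_trans (normr_ge0 _) (runmax_ge s (leq0n k)). Qed.

Lemma runmax_le_sum s k : runmax s k ^+ 2 <= \sum_(j < k.+1) s j ^+ 2.
Proof.
elim: k => [|k ih].
  by rewrite big_ord_recl big_ord0 addr0 /= real_normK ?num_real.
rewrite big_ord_recr /= maxElt; case: ifP => _.
  by rewrite real_normK ?num_real// lerDr sumr_ge0// => i _; exact: sqr_ge0.
by rewrite (le_trans ih)// lerDl sqr_ge0.
Qed.

(* Summation by parts bounds the discrete integral of the running maximum
   against [|s|]; this pathwise form reduces Doob's maximal inequality to
   taking expectations. *)
Lemma doob_pathwise s N :
  runmax s N ^+ 2 <= 4 * s N ^+ 2 -
    4 * \sum_(k < N) runmax s k * sign (s k) * (s k.+1 - s k).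
Proof.
set A := \sum_(k < N) _.
(* By [H], the claim reduces to the nonnegativity of the square of [runmax s N - 2 * |s N|]. *)
suff H : A <= runmax s N * `|s N| - runmax s N ^+ 2 / 2.
  have := sqr_ge0 (runmax s N - 2 * `|s N|).
  have := real_normK (num_real (s N)); nra.
rewrite /A {A}; elim: N => [|N ih].
  rewrite big_ord0 /=; set x := `|s 0%N|.
  by rewrite -expr2; have := sqr_ge0 x; lra.
rewrite big_ord_recr /=; set m := runmax s N in ih *.
have m0 : 0 <= m by exact: runmax_ge0.
have step : sign (s N) * (s N.+1 - s N) <= `|s N.+1| - `|s N|.
  rewrite /sign; case: (leP 0 (s N)) => h.
    by rewrite mul1r (ger0_norm h) lerD2r ler_norm.
  by rewrite mulN1r opprB (ltr0_norm h) opprK addrC lerD2r -normrN ler_norm.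
have step' : m * sign (s N) * (s N.+1 - s N) <= m * (`|s N.+1| - `|s N|).
  by rewrite -mulrA ler_wpM2l.
apply: (le_trans (lerD ih step')).
have -> : m * `|s N| - m ^+ 2 / 2 + m * (`|s N.+1| - `|s N|) =
  m * `|s N.+1| - m ^+ 2 / 2 by ring.
rewrite maxElt; case: ifP => // _.
have := sqr_ge0 (`|s N.+1| - m); nra.
Qed.

End Doob.

Section DoobExpectation.
Context d (T : measurableType d) (R : realType) (P : probability T R).
Variable S : nat -> T -> R.
Hypothesis S2 : forall k, L2 P (S k).

Lemma measurable_runmax d' (T' : measurableType d') (Z : nat -> T' -> R) k :
  (forall j, (j <= k)%N -> measurable_fun setT (Z j)) ->
  measurable_fun setT (fun w => runmax (Z ^~ w) k).
Proof.
elim: k => [|k ih] mZ /=; first by apply: measurableT_comp => //; exact: mZ.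
apply: measurable_maxr; last by apply: measurableT_comp => //; exact: mZ.
by apply: ih => j jk; apply: mZ; exact: leqW.
Qed.

Lemma L2_runmax k : L2 P (fun w => runmax (S ^~ w) k).
Proof.
have m1 : measurable_fun setT (fun w => runmax (S ^~ w) k).
  by apply: measurable_runmax => j _; case: (S2 j).
split=> //; apply: (@L1_le _ _ _ _ _ (fun w => \sum_(j < k.+1) S j w ^+ 2)).
- exact: measurable_funX.
- by move=> w; rewrite ger0_norm ?sqr_ge0//; exact: runmax_le_sum.
- by apply: L1_sum => j _; case: (S2 j).
Qed.

(** Of the martingale property only the orthogonality that annihilates the pathwise sum is
    assumed. *)
Lemma doob_L2 N :
  (forall k, (k < N)%N -> E P (fun w =>
     runmax (S ^~ w) k * sign (S k w) * (S k.+1 w - S k w)) = 0) ->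
  E P (fun w => runmax (S ^~ w) N ^+ 2) <= 4 * E P (fun w => S N w ^+ 2).
Proof.
move=> orth.
have i1 k : L1 P (fun w => runmax (S ^~ w) k * sign (S k w) * (S k.+1 w - S k w)).
  under [X in L1 _ X]eq_fun => w do rewrite -mulrA.
  apply: L2_mul; first exact: L2_runmax.
  apply: (@L2Mb _ _ _ _ _ _ 1); last exact: L2B.
    by apply: measurable_fun_ifT => //; apply: measurable_fun_ler => //; case: (S2 k).
  by move=> w; rewrite /sign; case: ifP; rewrite ?normrN normr1.
have [_ iN] := S2 N; have [_ iM] := L2_runmax N.
have iS : L1 P (fun w => \sum_(k < N)
    runmax (S ^~ w) k * sign (S k w) * (S k.+1 w - S k w)).
  by apply: L1_sum => k _; exact: i1.
apply: (le_trans (E_le iM _ (fun w => doob_pathwise (S ^~ w) N))).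
  by apply: L1B; exact: L1Z.
rewrite EB ?EZ//; [|exact: L1Z|exact: L1Z].
rewrite E_sum; last by move=> k _; exact: i1.
by rewrite big1 ?mulr0 ?subr0// => k _; rewrite orth.
Qed.

End DoobExpectation.

(** * The isometry for step integrands *)

Section ItoIsometry.
Context d (Omega : measurableType d) (R : realType) (P : probability Omega R).
Variables (W : R -> Omega -> R) (eps : R -> Omega -> 'I_2) (lambda : 'I_2 -> R).
Hypothesis P_complete : measure_is_complete P.
Hypothesis lambda0 : forall i, 0 < lambda i.
Hypothesis W_brownian : brownian_motion P W.
Hypothesis eps_markov : markov_chain P (generator lambda) eps.
Hypothesis W_eps_independent : independent_systems P
  (process_sigma measurable W `[0, +oo[) (process_sigma setT eps `[0, +oo[).

Notation F := (augmented_filtration P W eps).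
Notation Fmeas := (Fmeas P W eps).
Notation Gmeas := (Gmeas P W eps).
Implicit Types (a b c e : R).

Lemma increment_measurable a b : 0 <= a -> 0 <= b ->
  measurable_fun setT (fun w => W b w - W a w).
Proof.
by move=> a0 b0; apply: measurable_funB; apply: (bm_measurable W_brownian).
Qed.

Lemma increment_sqr a b : 0 <= a -> a <= b ->
  L2 P (fun w => W b w - W a w) /\ E P (fun w => (W b w - W a w) ^+ 2) = b - a.
Proof.
move=> a0; rewrite le_eqVlt => /predU1P[<-|ab].
  under [X in L2 _ X]eq_fun do rewrite subrr.
  under [X in E _ X]eq_fun do rewrite subrr expr0n.
  by rewrite E_cst subrr; split => //; apply: (@L2_bounded _ _ _ _ _ 0) => // w; rewrite normr0.
have h0 : 0 < b - a by rewrite subr_gt0.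
have [_ _ i2 e2] := increment_moments W_brownian a0 h0.
have ba : a + (b - a) = b by ring.
rewrite ba in i2 e2; split => //; split => //.
by apply: increment_measurable => //; rewrite (le_trans a0)// ltW.
Qed.

Lemma increment_mean a b U : 0 <= a -> a <= b -> (a < b -> Gmeas a U) -> L1 P U ->
  L1 P (fun w => U w * (W b w - W a w)) /\
  E P (fun w => U w * (W b w - W a w)) = 0.
Proof.
move=> a0; rewrite le_eqVlt => /predU1P[<-|ab] GU iU.
  under [X in L1 _ X]eq_fun do rewrite subrr mulr0.
  under [X in E _ X]eq_fun do rewrite subrr mulr0.
  by rewrite E_cst; split => //; exact: L1_cst.
have h0 : 0 < b - a by rewrite subr_gt0.
have [i1 e1 _ _] := increment_moments W_brownian a0 h0.
have [] := increment_indep_E P_complete W_brownian eps_markov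
  W_eps_independent (g := id) a0 h0 (GU ab) iU (@measurable_id _ _ setT) i1.
have ba : a + (b - a) = b by ring.
rewrite e1 mulr0 ba => ? ?; by split.
Qed.

Lemma increment_indep_sqr a b U : 0 <= a -> a <= b -> (a < b -> Gmeas a U) -> L1 P U ->
  L1 P (fun w => U w * (W b w - W a w) ^+ 2) /\
  E P (fun w => U w * (W b w - W a w) ^+ 2) = E P U * (b - a).
Proof.
move=> a0; rewrite le_eqVlt => /predU1P[<-|ab] GU iU.
  under [X in L1 _ X]eq_fun do rewrite subrr expr0n mulr0.
  under [X in E _ X]eq_fun do rewrite subrr expr0n mulr0.
  by rewrite E_cst subrr mulr0; split => //; exact: L1_cst.
have h0 : 0 < b - a by rewrite subr_gt0.
have [_ _ i1 e1] := increment_moments W_brownian a0 h0.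
have [] := increment_indep_E P_complete W_brownian eps_markov
  W_eps_independent (g := fun x => x ^+ 2) a0 h0 (GU ab) iU (exprn_measurable 2) i1.
have ba : a + (b - a) = b by ring.
rewrite e1 ba => ? ?; by split.
Qed.

(** The length of []a, b]] intersected with []c, d]]. *)
Definition overlap (a b c d : R) : R := Num.max 0 (Num.min b d - Num.max a c).

(** If [b <= c], the later increment is orthogonal to everything before [c]. Otherwise the
    increments are split at [c], [m] and [n]; products over disjoint intervals have mean zero and
    the square over the common part gives its length. *)
Let bilinear_aux a b c e xi eta M N : 0 <= a -> a < b -> a <= c -> c < e ->
  Fmeas a xi -> Fmeas c eta ->
  (forall w, `|xi w| <= M) -> (forall w, `|eta w| <= N) ->
  E P (fun w => (xi w * (W b w - W a w)) * (eta w * (W e w - W c w))) =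
  E P (fun w => xi w * eta w) * overlap a b c e.
Proof.
move=> a0 ab ac ce Fxi Feta bxi beta.
have c0 : 0 <= c by exact: le_trans ac.
have b0 : 0 <= b by exact: le_trans (ltW ab).
have e0 : 0 <= e by exact: le_trans (ltW ce).
have Gc U : Fmeas c U -> Gmeas c U by exact: Fmeas_Gmeas.
have Fxi' := Fmeas_mono ac Fxi.
have mxi := Fmeas_measurable P_complete W_brownian eps_markov Fxi.
have meta := Fmeas_measurable P_complete W_brownian eps_markov Feta.
pose U w := xi w * eta w.
have mU : measurable_fun setT U by exact: measurable_funM.
have FU : Fmeas c U by apply: (@measurable_funM _ (g_sigma_algebraType (genF P W eps c))).
have UB w : `|U w| <= M * N by rewrite normrM ler_pM.
have iU : L1 P U by exact: L1_bounded UB.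
have FWb s t : 0 <= s -> s <= t -> Fmeas t (W s).
  by move=> s0 st; apply: (Fmeas_mono st); exact: Fmeas_W.
have [bc|cb] := leP b c.
  rewrite (_ : overlap _ _ _ _ = 0) ?mulr0; last first.
    by rewrite /overlap; apply/max_idPl; rewrite subr_le0 ge_min le_max bc !orbT.
  rewrite (_ : (fun w => _) = fun w => (U w * (W b w - W a w)) * (W e w - W c w)); last first.
    by apply/funext => w; rewrite /U; ring.
  suff [] : L1 P (fun w => U w * (W b w - W a w) * (W e w - W c w)) /\
    E P (fun w => U w * (W b w - W a w) * (W e w - W c w)) = 0 by [].
  apply: (@increment_mean c e (fun w => U w * (W b w - W a w)) c0 (ltW ce)).
    move=> _; apply: Gc.
    apply: (@measurable_funM _ (g_sigma_algebraType (genF P W eps c))) => //.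
    apply: (@measurable_funB _ (g_sigma_algebraType (genF P W eps c))); apply: FWb => //.
  apply: L2_L1; apply: (L2Mb mU UB).
  by have [] := @increment_sqr a b a0 (ltW ab).
pose m := Num.min b e; pose n := Num.max b e.
have mc : c <= m by rewrite le_min (ltW cb) ltW.
have mn : m <= n by rewrite le_max ge_min lexx.
have m0 : 0 <= m by exact: le_trans mc.
have -> : overlap a b c e = m - c.
  by rewrite /overlap (max_idPr ac); apply/max_idPr; rewrite subr_ge0.
pose U1 w := U w * (W c w - W a w).
pose U2 w := U w * (W m w - W c w).
have G1 : Gmeas c U1.
  apply: Gc; apply: (@measurable_funM _ (g_sigma_algebraType (genF P W eps c))) => //.
  by apply: (@measurable_funB _ (g_sigma_algebraType (genF P W eps c))); apply: FWb.
have G2 : Gmeas m U2.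
  apply: Fmeas_Gmeas; apply: (@measurable_funM _ (g_sigma_algebraType (genF P W eps m))) => //.
    exact: Fmeas_mono FU.
  by apply: (@measurable_funB _ (g_sigma_algebraType (genF P W eps m))); apply: FWb.
have i1 : L1 P U1.
  by apply: L2_L1; apply: (L2Mb mU UB); have [] := @increment_sqr a c a0 ac.
have i2 : L1 P U2.
  by apply: L2_L1; apply: (L2Mb mU UB); have [] := @increment_sqr c m c0 mc.
have [j1 e1] := @increment_mean c e U1 c0 (ltW ce) (fun=> G1) i1.
have [j2 e2] := @increment_mean m n U2 m0 mn (fun=> G2) i2.
have [j3 e3] := @increment_indep_sqr c m U c0 mc (fun=> Gc _ FU) iU.
rewrite (_ : (fun w => _) = fun w => U1 w * (W e w - W c w) +
  U2 w * (W n w - W m w) + U w * (W m w - W c w) ^+ 2).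
  by rewrite !ED ?e1 ?e2 ?e3 ?add0r//; exact: L1D.
apply/funext => w; rewrite /U1 /U2 /U /n /m.
by case: (leP b e) => be; ring.
Qed.

Lemma overlapC a b c e : overlap a b c e = overlap c e a b.
Proof. by rewrite /overlap (minC b) (maxC a). Qed.

Lemma increment_bilinear a b c e xi eta M N : 0 <= a -> a <= b -> 0 <= c -> c <= e ->
  (a < b -> Fmeas a xi) -> (c < e -> Fmeas c eta) ->
  (forall w, `|xi w| <= M) -> (forall w, `|eta w| <= N) ->
  E P (fun w => (xi w * (W b w - W a w)) * (eta w * (W e w - W c w))) =
  E P (fun w => xi w * eta w) * overlap a b c e.
Proof.
move=> a0; rewrite le_eqVlt => /predU1P[<-|ab].
  move=> _ ce _ _ _ _; under [X in E P X = _]eq_fun do rewrite subrr mulr0 mul0r.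
  rewrite E_cst /overlap (_ : Num.max 0 _ = 0) ?mulr0//.
  by apply/max_idPl; rewrite subr_le0 ge_min !le_max lexx.
move=> c0; rewrite le_eqVlt => /predU1P[<-|ce].
  move=> _ _ _ _; under [X in E P X = _]eq_fun do rewrite subrr !mulr0.
  rewrite E_cst /overlap (_ : Num.max 0 _ = 0) ?mulr0//.
  by apply/max_idPl; rewrite subr_le0 ge_min !le_max lexx !orbT.
move=> /(_ ab) Fxi /(_ ce) Feta bxi beta.
have [ac|/ltW ca] := leP a c; first exact: bilinear_aux bxi beta.
rewrite overlapC; under eq_fun do rewrite mulrC.
under [in RHS]eq_fun do rewrite mulrC.
exact: bilinear_aux beta bxi.
Qed.

Lemma integral_overlap (a b c e T : R) : 0 <= a -> a <= b -> 0 <= c -> b <= T ->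
  (\int[lebesgue_measure]_(s in `[0%R, T])
     (((a < s <= b)%R%:R * (c < s <= e)%R%:R)%R : R)%:E)%E = (overlap a b c e)%:E.
Proof.
move=> a0 ab c0 bT.
have -> : (fun s : R => (((a < s <= b)%R%:R * (c < s <= e)%R%:R)%R : R)%:E) =
    EFin \o \1_(`]Num.max a c, Num.min b e]%classic : set R).
  apply/funext => s /=; rewrite indicE mem_setE/= in_itv/= gt_max le_min.
  by case: (a < s); case: (s <= b); case: (c < s); case: (s <= e); rewrite /= ?mulr1 ?mulr0.
rewrite integral_indic//=.
rewrite [X in lebesgue_measure X](_ : _ = `]Num.max a c, Num.min b e]%classic :> set R).
  rewrite lebesgue_measure_itv/= lte_fin /overlap.
  case: ltP => h; first by rewrite -EFinD; congr EFin; apply/esym/max_idPr; rewrite subr_ge0 ltW.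
  by congr EFin; apply/esym/max_idPl; rewrite subr_le0.
apply/seteqP; split => s /=; first by case.
rewrite !in_itv/= gt_max le_min => h; split => //.
by move: h => /andP[/andP[/ltW h1 _] /andP[h2 _]]; rewrite (le_trans a0 h1) (le_trans h2).
Qed.

Section Isometry.
Variables (I : finType) (xi : I -> Omega -> R) (a b M : I -> R).
Hypothesis a0 : forall k, 0 <= a k.
Hypothesis ab : forall k, a k <= b k.
Hypothesis Fxi : forall k, a k < b k -> Fmeas (a k) (xi k).
Hypothesis mxi : forall k, measurable_fun setT (xi k).
Hypothesis bxi : forall k w, `|xi k w| <= M k.

(** The intervals are indexed by an arbitrary finite type, unordered and possibly overlapping, so
    that the difference of two integrands is formed on the disjoint union of index types, with no
    common refinement. *)
Definition step_path (s : R) w := \sum_k xi k w * (a k < s <= b k)%R%:R.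
Definition step_integral w := \sum_k xi k w * (W (b k) w - W (a k) w).

Lemma L2_step_integral : L2 P step_integral.
Proof.
apply: L2_sum => k _; apply: (L2Mb (mxi k) (@bxi k)).
by have [] := increment_sqr (a0 k) (ab k).
Qed.

(** Both sides expand into the double sum of [E (xi_k xi_l)] times the overlap of the intervals [k]
    and [l]. *)
Lemma step_isometry T : (forall k, b k <= T) ->
  (\int[P]_w \int[lebesgue_measure]_(s in `[0%R, T]) (step_path s w ^+ 2)%:E)%E =
  (E P (fun w => step_integral w ^+ 2))%:E.
Proof.
move=> bT.
have L2k k : L2 P (fun w => xi k w * (W (b k) w - W (a k) w)).
  by apply: (L2Mb (mxi k) (@bxi k)); have [] := increment_sqr (a0 k) (ab k).
have -> : E P (fun w => step_integral w ^+ 2) =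
    \sum_k \sum_l E P (fun w => xi k w * xi l w) * overlap (a k) (b k) (a l) (b l).
  under eq_fun => w do rewrite expr2 /step_integral mulr_suml.
  rewrite E_sum => [|k _]; last first.
    under eq_fun => w do rewrite mulr_sumr.
    by apply: L1_sum => l _; exact: L2_mul.
  apply: eq_bigr => k _.
  under eq_fun => w do rewrite mulr_sumr.
  rewrite E_sum => [|l _]; last exact: L2_mul.
  apply: eq_bigr => l _.
  by rewrite (increment_bilinear (a0 k) (ab k) (a0 l) (ab l) (@Fxi k) (@Fxi l)
    (@bxi k) (@bxi l)).
have iU k l : L1 P (fun w => xi k w * xi l w * overlap (a k) (b k) (a l) (b l)).
  under eq_fun => w do rewrite mulrC; apply: L1Z.
  by apply: L2_mul; apply: L2_bounded (@bxi _).
transitivity (\int[P]_w (\sum_k \sum_l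
    xi k w * xi l w * overlap (a k) (b k) (a l) (b l))%:E)%E; last first.
  rewrite E_EFin; last by apply: L1_sum => k _; apply: L1_sum.
  rewrite E_sum => [|k _]; last by apply: L1_sum.
  congr EFin; apply: eq_bigr => k _; rewrite E_sum//; apply: eq_bigr => l _.
  under eq_fun => w do rewrite mulrC; rewrite EZ 1?mulrC//.
  by apply: L2_mul; apply: L2_bounded (@bxi _).
apply: eq_integral => w _.
pose J k s : R := (a k < s <= b k)%R%:R.
pose mu := [the measure _ _ of @lebesgue_measure R].
have mI k : measurable_fun [set: measurableTypeR R] (J k).
  rewrite (_ : J k = \1_(`]a k, b k]%classic : set R)); first exact: measurable_indic.
  by apply/funext => s; rewrite indicE mem_setE /= in_itv.
have II k l : mu.-integrable `[0%R, T] (EFin \o (fun s => xi k w * xi l w * (J k s * J l s))).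
  apply: measurable_bounded_integrable => //=.
  - rewrite [X in (X < _)%E]lebesgue_measure_itv/=; case: ifP => _; exact: ltry.
  - by apply: (@measurable_funTS _ _ (measurableTypeR R) R); apply: measurable_funM => //; apply: measurable_funM.
  - exists (`|xi k w * xi l w|); split; first by rewrite num_real.
    move=> x hx s _ /=; apply: (le_trans _ (ltW hx)).
    rewrite normrM ler_piMr//; rewrite /J.
    by case: (_ < s <= _); case: (_ < s <= _); rewrite ?mulr1 ?mulr0 ?normr0 ?normr1.
transitivity (\int[mu]_(s in `[0%R, T]) (\sum_k (\sum_l (xi k w * xi l w * (J k s * J l s))%R%:E)%E)%E)%E.
  apply: eq_integral => s _.
  rewrite (_ : step_path s w ^+ 2 = \sum_k \sum_l xi k w * xi l w * (J k s * J l s)).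
    by rewrite -sumEFin; apply: eq_bigr => k _; rewrite -sumEFin.
  rewrite /step_path expr2 mulr_suml; apply: eq_bigr => k _.
  by rewrite mulr_sumr; apply: eq_bigr => l _; rewrite /J; ring.
rewrite integral_sum => //=; last first.
  by move=> k; apply: integrable_sum => //= l _; exact: II.
rewrite -sumEFin; apply: eq_bigr => k _.
rewrite integral_sum => //=; last by move=> l; exact: II.
rewrite -sumEFin; apply: eq_bigr => l _.
under eq_integral => s _ do rewrite EFinM.
rewrite integralZl//=; last first.
  apply: measurable_bounded_integrable => //=.
  - rewrite [X in (X < _)%E]lebesgue_measure_itv/=; case: ifP => _; exact: ltry.
  - by apply: (@measurable_funTS _ _ (measurableTypeR R) R); apply: measurable_funM.
  - exists 1; split; first by rewrite num_real.
    move=> x hx s _ /=; apply: (le_trans _ (ltW hx)); rewrite /J.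
    by case: (_ < s <= _); case: (_ < s <= _); rewrite ?mulr1 ?mulr0 ?normr0 ?normr1.
rewrite [RHS]EFinM (integral_overlap _ (a0 k) (ab k) (a0 l) (bT k)).
by [].
Qed.

End Isometry.

End ItoIsometry.

(** * The square norm over probability and time *)

Section SquareNorm.
Context d (Omega : measurableType d) (R : realType) (P : probability Omega R).
Implicit Types p q : R -> Omega -> R.
Notation mu := (@lebesgue_measure R).

Definition joint_measurable q :=
  measurable_fun [set: measurableTypeR R * Omega] (fun z => q z.1 z.2).

Definition sqnorm (T : R) q : \bar R :=
  (\int[P]_w \int[mu]_(s in `[0%R, T]) ((q s w) ^+ 2)%:E)%E.

Lemma joint_measurable_sect1 q w : joint_measurable q ->
  measurable_fun [set: measurableTypeR R] (q ^~ w).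
Proof. by move=> mq; exact: (measurable_fun_pair1 w mq). Qed.

Lemma joint_measurable_sect2 q s : joint_measurable q -> measurable_fun setT (q s).
Proof. by move=> mq; exact: (measurable_fun_pair2 s mq). Qed.

Let patched T q (z : measurableTypeR R * Omega) : \bar R :=
  ((\1_(`[0, T]%classic : set R) z.1 * q z.1 z.2 ^+ 2)%R)%:E.

Let patched_measurable T q : joint_measurable q -> measurable_fun setT (patched T q).
Proof.
move=> mq; apply/measurable_EFinP; apply: measurable_funM.
  have mI : measurable_fun setT (\1_(`[0, T]%classic) : measurableTypeR R -> R).
    exact: measurable_indic.
  exact: (measurableT_comp mI measurable_fst).
exact: measurable_funX.
Qed.

Let inner_patched T q w : (\int[mu]_(s in `[0%R, T]) ((q s w) ^+ 2)%:E)%E =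
  (\int[mu]_s patched T q (s, w))%E.
Proof.
rewrite integral_mkcond; apply: eq_integral => s _.
by rewrite patchE /patched /= indicE mem_setE; case: ifP => _; rewrite ?mul1r ?mul0r.
Qed.

Lemma measurable_inner T q : joint_measurable q -> measurable_fun setT
  (fun w => \int[mu]_(s in `[0%R, T]) ((q s w) ^+ 2)%:E)%E.
Proof.
move=> mq; under eq_fun do rewrite inner_patched.
apply: (@measurable_fun_fubini_tonelli_G _ _ (measurableTypeR R) Omega R
  (@lebesgue_measure R)).
  exact: patched_measurable.
by move=> z; rewrite lee_fin mulr_ge0// ?sqr_ge0// indicE.
Qed.

Lemma inner_ge0 T q w : (0 <= \int[mu]_(s in `[0%R, T]) ((q s w) ^+ 2)%:E)%E.
Proof. by apply: integral_ge0 => s _; rewrite lee_fin sqr_ge0. Qed.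

Lemma sqnorm_tonelli T q : joint_measurable q ->
  sqnorm T q = (\int[mu]_(s in `[0%R, T]) \int[P]_w ((q s w) ^+ 2)%:E)%E.
Proof.
move=> mq; rewrite /sqnorm; under eq_integral do rewrite inner_patched.
have p0 z : (0 <= patched T q z)%E.
  by rewrite lee_fin mulr_ge0// ?sqr_ge0// indicE.
have := @fubini_tonelli2 _ _ (measurableTypeR R) Omega R (@lebesgue_measure R) P
  _ (patched_measurable T mq) p0.
rewrite fubini_tonelli1//; last exact: patched_measurable.
rewrite /fubini_F /fubini_G => <-.
rewrite [RHS]integral_mkcond; apply: eq_integral => s _.
rewrite patchE mem_setE; case: ifPn => h; last first.
  apply: integral0_eq => w _.
  by rewrite /patched/= indicE mem_setE (negbTE h) mul0r.
by apply: eq_integral => w _; rewrite /patched/= indicE mem_setE h mul1r.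
Qed.

Lemma sqnorm_le T q q1 q2 :
  joint_measurable q -> joint_measurable q1 -> joint_measurable q2 ->
  (forall s w, 0 <= s <= T -> q s w ^+ 2 <= 2 * q1 s w ^+ 2 + 2 * q2 s w ^+ 2) ->
  (sqnorm T q <= 2%:E * sqnorm T q1 + 2%:E * sqnorm T q2)%E.
Proof.
move=> mq mq1 mq2 h; rewrite /sqnorm.
have m1 q' : joint_measurable q' -> measurable_fun setT
    (fun w => 2%:E * \int[mu]_(s in `[0%R, T]) ((q' s w) ^+ 2)%:E)%E.
  by move=> mq'; apply: measurable_funeM; exact: measurable_inner.
have i2 q' w : (0 <= 2%:E * \int[mu]_(s in `[0%R, T]) ((q' s w) ^+ 2)%:E)%E.
  by rewrite mule_ge0//; exact: inner_ge0.
rewrite -!ge0_integralZl//; try exact: measurable_inner; try by move=> w _; exact: inner_ge0.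
rewrite -ge0_integralD//; try exact: m1; try by move=> w _; exact: i2.
apply: ge0_le_integral => //.
- by move=> w _; exact: inner_ge0.
- exact: measurable_inner.
- by apply: emeasurable_funD; exact: m1.
move=> w _.
have ms q' c : joint_measurable q' ->
    measurable_fun (`[0%R, T]%classic : set (measurableTypeR R)) (fun s => (c * (q' s w) ^+ 2)%:E).
  move=> mq'; apply/measurable_EFinP; apply: measurable_funTS.
  by apply: measurable_funM => //; apply: measurable_funX; exact: joint_measurable_sect1.
have m2 q' : joint_measurable q' ->
    measurable_fun (`[0%R, T]%classic : set (measurableTypeR R)) (fun s => ((q' s w) ^+ 2)%:E).
  by move=> mq'; have := ms q' 1 mq'; under [X in measurable_fun _ X -> _]eq_fun do rewrite mul1r.
rewrite -!ge0_integralZl//=; try exact: m2; try by move=> s _; rewrite lee_fin sqr_ge0.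
rewrite -ge0_integralD//=; try by move=> s _; rewrite lee_fin mulr_ge0// sqr_ge0.
- apply: ge0_le_integral => //=.
  + by move=> s _; rewrite lee_fin sqr_ge0.
  + exact: m2.
  + by apply: emeasurable_funD; exact: ms.
  + by move=> s; rewrite in_itv/= -EFinD lee_fin; exact: h.
- exact: ms.
- exact: ms.
Qed.

Lemma sqnorm_bound (a b k : R) q : 0 <= a -> a <= b -> 0 <= k -> joint_measurable q ->
  (forall s, a < s -> s <= b -> (\int[P]_w ((q s w) ^+ 2)%:E <= k%:E)%E) ->
  (sqnorm b (fun s w => ((a < s <= b)%R%:R * q s w)%R) <= (k * (b - a))%:E)%E.
Proof.
move=> a0 ab k0 mq qk.
pose J (s : R) : R := (a < s <= b)%R%:R.
have JE : J = \1_(`]a, b]%classic : set R).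
  by apply/funext => s; rewrite indicE mem_setE /= in_itv.
have mJ : measurable_fun [set: measurableTypeR R] J by rewrite JE; exact: measurable_indic.
have mJq : joint_measurable (fun s w => J s * q s w).
  by apply: measurable_funM => //; exact: measurableT_comp.
rewrite sqnorm_tonelli//.
apply: (@le_trans _ _ (\int[mu]_(s in `[0%R, b]) (k * J s)%:E)%E).
  apply: ge0_le_integral => //=.
  - by move=> s _; apply: integral_ge0 => w _; rewrite lee_fin sqr_ge0.
  - apply: measurable_funTS.
    apply: (@measurable_fun_fubini_tonelli_F _ _ (measurableTypeR R) Omega R P
      (fun z => ((J z.1 * q z.1 z.2) ^+ 2)%:E)).
      by apply/measurable_EFinP; apply: measurable_funX.
    by move=> z; rewrite lee_fin sqr_ge0.
  - by apply/measurable_EFinP; apply: measurable_funTS; apply: measurable_funM.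
  - move=> s _; rewrite /J; case: (boolP (a < s <= b)%R) => [/andP[h1 h2]|_] /=.
      under eq_integral do rewrite mul1r.
      by rewrite mulr1; exact: qk.
    under eq_integral do rewrite mul0r expr0n.
    by rewrite integral0 mulr0.
under eq_integral do rewrite EFinM.
rewrite ge0_integralZl//=; last 2 first.
- by apply/measurable_EFinP; apply: measurable_funTS.
- by move=> s _; rewrite lee_fin /J.
rewrite EFinM lee_wpmul2l ?lee_fin//.
under eq_integral do rewrite JE.
rewrite integral_indic//=.
apply: (@le_trans _ _ (mu `]a, b]%classic)).
  by apply: le_measure; rewrite ?inE//=; exact: measurableI.
rewrite [X in (X <= _)%E]lebesgue_measure_itv/= lte_fin; case: ltP => // h.
by rewrite lee_fin subr_ge0.
Qed.

End SquareNorm.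

(** * Stochastic integrals of elementary integrands *)

Section Elementary.
Context d (Omega : measurableType d) (R : realType) (P : probability Omega R).
Variables (W : R -> Omega -> R) (eps : R -> Omega -> 'I_2) (lambda : 'I_2 -> R).
Hypothesis P_complete : measure_is_complete P.
Hypothesis lambda0 : forall i, 0 < lambda i.
Hypothesis W_brownian : brownian_motion P W.
Hypothesis eps_markov : markov_chain P (generator lambda) eps.
Hypothesis W_eps_independent : independent_systems P
  (process_sigma measurable W `[0, +oo[) (process_sigma setT eps `[0, +oo[).

Notation F := (augmented_filtration P W eps).
Notation Fmeas := (Fmeas P W eps).
Implicit Types (a b c e : R) (p q : R -> Omega -> R) (U V xi zeta : Omega -> R).

(** [U] is the stochastic integral of [p], an integrand supported in []a, b]]. Adaptedness is asked
    of nondegenerate intervals only, because clipping simple processes to []a, b]] produces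
    degenerate ones. *)
Definition elementary a b p U := exists (I : finType) (xi : I -> Omega -> R)
    (s t M : I -> R),
  [/\ forall k, a <= s k, forall k, s k <= t k, forall k, t k <= b,
      forall k, s k < t k -> Fmeas (s k) (xi k) & [/\
      forall k, measurable_fun setT (xi k), forall k w, `|xi k w| <= M k,
      p = step_path xi s t & U = step_integral W xi s t]].

Section Basic.
Variables (a b : R) (p : R -> Omega -> R) (U : Omega -> R).
Hypothesis a0 : 0 <= a.
Hypothesis pU : elementary a b p U.

Lemma elementary_L2 : L2 P U.
Proof.
case: pU => I [xi [s [t [M [as_ st tb Fxi [mxi bxi _ ->]]]]]].
by apply: (L2_step_integral W_brownian _ st mxi bxi) => k; exact: le_trans (as_ k).
Qed.

Lemma elementary_isometry : sqnorm P b p = (E P (fun w => U w ^+ 2))%:E.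
Proof.
case: pU => I [xi [s [t [M [as_ st tb Fxi [mxi bxi -> ->]]]]]].
by apply: (step_isometry P_complete W_brownian eps_markov W_eps_independent _ st
  Fxi mxi bxi) => // k; exact: le_trans (as_ k).
Qed.

Lemma elementary_joint : joint_measurable p.
Proof.
case: pU => I [xi [s [t [M [as_ st tb Fxi [mxi bxi -> _]]]]]].
apply: measurable_sum => k; apply: measurable_funM.
  exact: (measurableT_comp (mxi k) measurable_snd).
have mJ : measurable_fun [set: measurableTypeR R] (fun x : R => (s k < x <= t k)%R%:R : R).
  rewrite (_ : (fun _ => _) = \1_(`]s k, t k]%classic : set R)); first exact: measurable_indic.
  by apply/funext => x; rewrite indicE mem_setE /= in_itv.
exact: (measurableT_comp mJ measurable_fst).
Qed.

Lemma elementary_orthogonal xi : Fmeas a xi -> L1 P xi ->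
  E P (fun w => xi w * U w) = 0.
Proof.
case: pU => I [eta [s [t [M [as_ st tb Feta [meta beta _ ->]]]]]] Fxi ixi.
have H k : L1 P (fun w => xi w * eta k w * (W (t k) w - W (s k) w)) /\
    E P (fun w => xi w * eta k w * (W (t k) w - W (s k) w)) = 0.
  apply: (increment_mean P_complete W_brownian eps_markov W_eps_independent) => //.
  - exact: le_trans (as_ k).
  - move=> stk; apply: Fmeas_Gmeas.
    apply: (@measurable_funM _ (g_sigma_algebraType (genF P W eps (s k)))).
      exact: Fmeas_mono (as_ k) Fxi.
    exact: Feta.
  - under eq_fun do rewrite mulrC.
    exact: L1Mb (meta k) (beta k) ixi.
have -> : (fun w => xi w * step_integral W eta s t w) =
    fun w => \sum_k xi w * eta k w * (W (t k) w - W (s k) w).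
  by apply/funext => w; rewrite mulr_sumr; apply: eq_bigr => k _; rewrite mulrA.
rewrite E_sum => [|k _]; last by have [] := H k.
by apply: big1 => k _; have [_] := H k.
Qed.

End Basic.

Lemma elementaryB a b p U q V : elementary a b p U -> elementary a b q V ->
  elementary a b (fun s w => p s w - q s w) (fun w => U w - V w).
Proof.
move=> [I [xi [s [t [M [as_ st tb Fxi [mxi bxi -> ->]]]]]]].
move=> [I' [xi' [s' [t' [M' [as' st' tb' Fxi' [mxi' bxi' -> ->]]]]]]].
pose h T (u : I -> T) (u' : I' -> T) (k : I + I') :=
  match k with inl i => u i | inr j => u' j end.
exists (I + I')%type, (h _ xi (fun j w => - xi' j w)), (h _ s s'), (h _ t t'), (h _ M M').
split=> [[]//|[]//|[]//| |].
- case=> [k|k] /= hk; first exact: Fxi.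
  apply: (@measurable_funN _ (g_sigma_algebraType (genF P W eps (s' k)))).
  exact: Fxi'.
- split=> [[]k //=|[]k w //=| |].
  + exact: measurable_funN.
  + by rewrite normrN.
  + apply/funext => u; apply/funext => w; rewrite /step_path big_sumType/=; congr (_ + _).
    by rewrite -sumrN; apply: eq_bigr => k _; rewrite mulNr.
  + apply/funext => w; rewrite /step_integral big_sumType/=; congr (_ + _).
    by rewrite -sumrN; apply: eq_bigr => k _; rewrite mulNr.
Qed.

Lemma elementary_cst a b zeta M : a <= b -> Fmeas a zeta ->
  (forall w, `|zeta w| <= M) ->
  elementary a b (fun s w => (a < s <= b)%R%:R * zeta w)
    (fun w => zeta w * (W b w - W a w)).
Proof.
move=> ab Fz bz; exists unit, (fun=> zeta), (fun=> a), (fun=> b), (fun=> M).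
split=> //; split=> //.
- by move=> _; exact: (Fmeas_measurable P_complete W_brownian eps_markov Fz).
- by apply/funext => s; apply/funext => w; rewrite /step_path big_const card_unit/= addr0 mulrC.
- by apply/funext => w; rewrite /step_integral big_const card_unit/= addr0.
Qed.

Lemma elementary_simple a b (S : simple_process F) : 0 <= a -> a <= b ->
  elementary a b (fun s w => (a < s <= b)%R%:R * simple_path S s w)
    (fun w => simple_integral W S b w - simple_integral W S a w).
Proof.
move=> a0 ab.
pose clip (t : R) := Num.max a (Num.min t b).
have sp0 k : 0 <= sp_time S k.
  by apply: le_trans (sp_time_ge0 S) _; apply: (sp_time_nd S).
have spS k : sp_time S k <= sp_time S k.+1 by apply: (sp_time_nd S).
have spb k : exists M, forall w, `|sp_value S k w| <= M by exact: sp_value_bnd.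
have Fsp k : Fmeas (sp_time S k) (sp_value S k).
  by apply/FmeasP => B; exact: sp_value_meas.
exists 'I_(sp_size S), (fun k : 'I__ => sp_value S k), (fun k : 'I__ => clip (sp_time S k)),
  (fun k : 'I__ => clip (sp_time S k.+1)), (fun k : 'I__ => projT1 (cid (spb k))).
split.
- by move=> k; rewrite le_max lexx.
- by move=> k; apply: le_max2 => //; apply: le_min2.
- by move=> k; rewrite ge_max ab ge_min lexx orbT.
(* A clipped interval that is nondegenerate starts no earlier than the original one, so its
   coefficient is still known at the start. *)
- move=> k h; apply: Fmeas_mono (Fsp k); move: h (spS k).
  by rewrite /clip !maxEle !minEle; do ![case: ifPn; rewrite -?ltNge]; lra.
- split.
  + by move=> k; exact: (Fmeas_measurable P_complete W_brownian eps_markov (Fsp k)).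
  + by move=> k; exact: (projT2 (cid (spb k))).
  + apply/funext => s; apply/funext => w; rewrite /step_path /simple_path mulr_sumr.
    apply: eq_bigr => k _; rewrite mulrCA; congr (_ * _).
    rewrite /clip gt_max gt_min le_max le_min (leNgt s a) (leNgt s b).
    by case: (a < s); case: (_ < s); case: (b < s); case: (s <= _);
      rewrite /= ?mulr1 ?mulr0 ?mul0r.
  + apply/funext => w; rewrite /step_integral /simple_integral -sumrB.
    apply: eq_bigr => k _; rewrite -mulrBr; congr (_ * _).
    have H t : W (Num.min t b) w - W (Num.min t a) w = W (clip t) w - W a w.
      rewrite /clip; case: (leP t a) => ta.
        by rewrite (min_idPl (le_trans ta ab)) (max_idPl ta) !subrr.
      by rewrite (max_idPr _)// le_min (ltW ta).
    have := H (sp_time S k); have := H (sp_time S k.+1).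
    lra.
Qed.

End Elementary.

(** * Increments of the Ito integral *)

Section ItoProcess.
Context d (Omega : measurableType d) (R : realType) (P : probability Omega R).
Variables (W : R -> Omega -> R) (eps : R -> Omega -> 'I_2) (lambda : 'I_2 -> R).
Hypothesis P_complete : measure_is_complete P.
Hypothesis lambda0 : forall i, 0 < lambda i.
Hypothesis W_brownian : brownian_motion P W.
Hypothesis eps_markov : markov_chain P (generator lambda) eps.
Hypothesis W_eps_independent : independent_systems P
  (process_sigma measurable W `[0, +oo[) (process_sigma setT eps `[0, +oo[).

Notation F := (augmented_filtration P W eps).
Notation Fmeas := (Fmeas P W eps).
Implicit Types (a b e : R) (U V xi zeta : Omega -> R).

Variables (c : 'I_2 -> R) (B : R) (M : R -> Omega -> R).
Hypothesis cB : forall i, `|c i| <= B.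
Hypothesis itoM : ito_integral P F W (fun t w => c (eps t w)) M.

(* The chain is only almost surely cadlag; joint measurability is available
   for a modification. *)
Lemma regime_modification : exists H : R -> Omega -> R,
  [/\ joint_measurable H, forall s w, `|H s w| <= B &
      {ae P, forall w, forall s, 0 <= s -> H s w = c (eps s w)}].
Proof.
have [N [mN N0 sN]] := mc_cadlag eps_markov.
pose Z t w := if w \in N then c reg1 else c (eps t w).
exists (fun s w => Z (Num.max 0 s) w); split.
- apply: (@measurable_right_continuous_comp _ (measurableTypeR R * Omega)%type _ Omega R
    Z (fun z => Num.max 0 z.1) snd) => //.
  + move=> t t0; apply: measurable_fun_ifT => //.
      rewrite (_ : (fun w => w \in N) = fun w => (\1_N w : R) == 1); last first.
        by apply/funext => w; rewrite indicE; case: (w \in N); rewrite ?eqxx// eq_sym oner_eq0.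
      apply: measurable_fun_eqr => //; exact: measurable_indic.
    exact: (Fmeas_measurable P_complete W_brownian eps_markov (@Fmeas_eps _ _ _ P W eps t c t0)).
  + move=> w t t0; rewrite /Z; case: (boolP (w \in N)) => wN; first exact: cvg_cst.
    have cw : cadlag_path (eps ^~ w).
      by apply: contrapT => h; move: wN; rewrite notin_setE; apply; exact: sN.
    apply: cvg_near_cst; have [/(_ t t0) + _] := cw; apply: filterS => s /= ->.
    by [].
  + by move=> z; rewrite le_max lexx.
  + by apply: measurable_maxr => //; exact: measurable_fst.
- by move=> s w; rewrite /Z; case: ifP.
- exists N; split=> // w /= h; apply: contrapT => wN; apply: h => s s0.
  by rewrite /Z memNset// (max_idPr s0).
Qed.

Variable H : R -> Omega -> R.
Hypothesis mH : joint_measurable H.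
Hypothesis HB : forall s w, `|H s w| <= B.
Hypothesis H_eps : {ae P, forall w, forall s, 0 <= s -> H s w = c (eps s w)}.

Lemma simple_path_joint (S : simple_process F) : joint_measurable (simple_path S).
Proof.
apply: measurable_sum => k; apply: measurable_funM.
  have mv : measurable_fun setT (sp_value S k).
    apply: (Fmeas_measurable P_complete W_brownian eps_markov (t := sp_time S k)).
    by apply/FmeasP => C; exact: sp_value_meas.
  exact: (measurableT_comp mv measurable_snd).
have mJ : measurable_fun [set: measurableTypeR R]
    (fun x : R => (sp_time S k < x <= sp_time S k.+1)%R%:R : R).
  rewrite (_ : (fun _ => _) = \1_(`]sp_time S k, sp_time S k.+1]%classic : set R)).
    exact: measurable_indic.
  by apply/funext => x; rewrite indicE mem_setE /= in_itv.
exact: (measurableT_comp mJ measurable_fst).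
Qed.

Lemma joint_measurableB (p q : R -> Omega -> R) : joint_measurable p -> joint_measurable q ->
  joint_measurable (fun s w => p s w - q s w).
Proof. by move=> mp mq; exact: measurable_funB. Qed.

Lemma joint_measurable_itv a b (q : R -> Omega -> R) : joint_measurable q ->
  joint_measurable (fun s w => (a < s <= b)%R%:R * q s w).
Proof.
move=> mq; apply: measurable_funM => //.
have mJ : measurable_fun [set: measurableTypeR R] (fun x : R => (a < x <= b)%R%:R : R).
  rewrite (_ : (fun _ => _) = \1_(`]a, b]%classic : set R)); first exact: measurable_indic.
  by apply/funext => x; rewrite indicE mem_setE /= in_itv.
exact: (measurableT_comp mJ measurable_fst).
Qed.

Let sqnorm_eps T (S : simple_process F) :
  (\int[P]_w \int[lebesgue_measure]_(s in `[0%R, T])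
     ((simple_path S s w - c (eps s w)) ^+ 2)%:E)%E =
  sqnorm P T (fun s w => simple_path S s w - H s w).
Proof.
have mS : joint_measurable (fun s w => simple_path S s w - H s w).
  by apply: joint_measurableB => //; exact: simple_path_joint.
have ae : ae_eq P setT
    (fun w => \int[lebesgue_measure]_(s in `[0%R, T]) ((simple_path S s w - H s w) ^+ 2)%:E)%E
    (fun w => \int[lebesgue_measure]_(s in `[0%R, T]) ((simple_path S s w - c (eps s w)) ^+ 2)%:E)%E.
  apply: filterS H_eps => w h _; apply: eq_integral => s; rewrite inE/= in_itv/= => /andP[s0 _].
  by rewrite h.
have m1 := measurable_inner T mS.
apply/esym/ae_eq_integral => //.
exact: ae_measurable_fun ae m1.
Qed.

Lemma ito_measurable t : 0 <= t -> Fmeas t (M t).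
Proof. by case: itoM => aM _ _ t0; apply/FmeasP; exact: aM. Qed.

Let simple_integral_L2 (S : simple_process F) t : 0 <= t -> L2 P (simple_integral W S t).
Proof.
have h0 s : Num.min (sp_time S s) 0 = 0.
  apply/min_idPr; apply: (le_trans (sp_time_ge0 S)); exact: (sp_time_nd S).
move=> t0; have := elementary_L2 W_brownian (lexx 0) (elementary_simple P_complete W_brownian eps_markov S (lexx 0) t0).
rewrite (_ : (fun w => _) = simple_integral W S t)//.
apply/funext => w; rewrite [X in _ - X]/simple_integral big1 ?subr0// => k _.
by rewrite !h0 subrr mulr0.
Qed.

Lemma ito_approx t e : 0 <= t -> 0 < e -> exists S : simple_process F,
  [/\ (sqnorm P t (fun s w => simple_path S s w - H s w)%R <= e%:E)%E,
      L2 P (fun w => simple_integral W S t w - M t w) &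
      E P (fun w => (simple_integral W S t w - M t w) ^+ 2) <= e].
Proof.
move=> t0 e0; have [_ _ /(_ t t0) [S [c1 c2]]] := itoM.
have mD n : measurable_fun setT (fun w => simple_integral W (S n) t w - M t w).
  apply: measurable_funB; first by case: (simple_integral_L2 (S n) t0).
  exact: (Fmeas_measurable P_complete W_brownian eps_markov (ito_measurable t0)).
have near0 (u : nat -> \bar R) : u @ \oo --> 0%E -> \forall n \near \oo, (u n <= e%:E)%E.
  move=> cu; have : \forall n \near \oo, (u n < e%:E)%E.
    by apply: (cu [set x | (x < e%:E)%E]); apply: open_nbhs_nbhs; split;
      [exact: open_ereal_lt_ereal|rewrite /= lte_fin].
  by apply: filterS => n /ltW.
have [n [h1 h2]] : exists n, (\int[P]_w \int[lebesgue_measure]_(s in `[0%R, t])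
     ((simple_path (S n) s w - c (eps s w)) ^+ 2)%:E <= e%:E)%E /\
    (\int[P]_w ((simple_integral W (S n) t w - M t w) ^+ 2)%:E <= e%:E)%E.
  near \oo => n; exists n; split; near: n; exact: near0.
have i2 : L1 P (fun w => (simple_integral W (S n) t w - M t w) ^+ 2).
  apply: L1_ge0_lty => [|w|]; [exact: measurable_funX|exact: sqr_ge0|].
  exact: le_lt_trans h2 (ltry _).
exists (S n); split; [by rewrite -sqnorm_eps|exact: (conj (mD n) i2)|].
by rewrite -lee_fin -E_EFin.
Unshelve. all: by end_near. Qed.

Lemma L2_ito t : 0 <= t -> L2 P (M t).
Proof.
move=> t0; have [S [_ h _]] := ito_approx t0 (@ltr01 R).
have := L2B (simple_integral_L2 S t0) h.
by under [X in L2 P X -> _]eq_fun => w do rewrite opprB addrCA subrr addr0.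
Qed.

Lemma E_sqrD U V : L2 P U -> L2 P V ->
  E P (fun w => (U w + V w) ^+ 2) <= 2 * E P (fun w => U w ^+ 2) + 2 * E P (fun w => V w ^+ 2).
Proof.
move=> hU hV; have [_ i] := L2D hU hV; have [_ iU] := hU; have [_ iV] := hV.
rewrite -!EZ// -ED; [|exact: L1Z|exact: L1Z]; apply: E_le => //.
  by apply: L1D; exact: L1Z.
by move=> w; have := sqr_ge0 (U w - V w); nra.
Qed.

Lemma E_sqrB U V : L2 P U -> L2 P V ->
  E P (fun w => (U w - V w) ^+ 2) <= 2 * E P (fun w => U w ^+ 2) + 2 * E P (fun w => V w ^+ 2).
Proof.
move=> hU hV; have := E_sqrD hU (L2Z (-1) hV).
rewrite (_ : (fun w => (U w + _) ^+ 2) = (fun w => (U w - V w) ^+ 2)); last first.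
  by apply/funext => w; rewrite mulN1r.
by rewrite (_ : (fun w => (-1 * V w) ^+ 2) = (fun w => V w ^+ 2))//; apply/funext => w; ring.
Qed.

Let simple_dist a e (S S' : simple_process F) : 0 <= a ->
  (sqnorm P a (fun s w => simple_path S s w - H s w)%R <= e%:E)%E ->
  (sqnorm P a (fun s w => simple_path S' s w - H s w)%R <= e%:E)%E ->
  E P (fun w => (simple_integral W S a w - simple_integral W S' a w) ^+ 2) <= 4 * e.
Proof.
move=> a0 h h'.
have h0 (T : simple_process F) s : Num.min (sp_time T s) 0 = 0.
  apply/min_idPr; apply: (le_trans (sp_time_ge0 T)); exact: (sp_time_nd T).
have z0 (T : simple_process F) w : simple_integral W T 0 w = 0.
  by rewrite /simple_integral big1// => k _; rewrite !h0 subrr mulr0.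
have el T := elementary_simple P_complete W_brownian eps_markov T (lexx 0) a0.
have elB := elementaryB (el S) (el S').
have := elementary_isometry P_complete W_brownian eps_markov W_eps_independent (lexx 0) elB.
rewrite (_ : (fun w => (_ - _) ^+ 2) =
  (fun w => (simple_integral W S a w - simple_integral W S' a w) ^+ 2)); last first.
  by apply/funext => w; rewrite !z0 !subr0.
move=> iso; rewrite -lee_fin -iso.
have := @sqnorm_le _ _ _ P a _ _ _ (elementary_joint elB)
  (joint_measurableB (simple_path_joint S) mH) (joint_measurableB (simple_path_joint S') mH).
move=> /(_ _)/le_trans; apply.
  move=> s w _; case: (0 < s <= a)%R; rewrite ?mul1r ?mul0r ?subrr; last first.
    by rewrite expr0n/=; apply: addr_ge0; rewrite mulr_ge0// sqr_ge0.
  have := sqr_ge0 ((simple_path S s w - H s w) + (simple_path S' s w - H s w)); nra.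
rewrite (_ : (4 * e)%:E = 2%:E * e%:E + 2%:E * e%:E)%E; last first.
  by rewrite -!EFinM -EFinD; congr EFin; ring.
have e2 : (0 <= 2%:E :> \bar R)%E by rewrite lee_fin.
exact: (leeD (lee_wpmul2l e2 h) (lee_wpmul2l e2 h')).
Qed.

(** The definition of the integral supplies simple processes for each time separately. Those for [a]
    and for [b] are both close to [H] on [[0, a]], so by the isometry their integrals up to [a] are
    close, and the one for [b] serves the increment. *)
Lemma ito_approx_increment a b e : 0 <= a -> a <= b -> 0 < e ->
  exists S : simple_process F,
  [/\ (sqnorm P b (fun s w => simple_path S s w - H s w)%R <= e%:E)%E,
      L2 P (fun w => (M b w - M a w) - (simple_integral W S b w - simple_integral W S a w)) &
      E P (fun w => ((M b w - M a w) - (simple_integral W S b w - simple_integral W S a w)) ^+ 2) <= e].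
Proof.
move=> a0 ab e0; have b0 := le_trans a0 ab.
(* [22 = 2 * (2 * 4 + 2) + 2]: the three squared errors, of weights 4, 1 and 1, are combined by two
   uses of [(u + v)^2 <= 2 u^2 + 2 v^2]. *)
have e1 : 0 < e / 22 by rewrite divr_gt0.
have [S [n1 l1 d1]] := ito_approx b0 e1.
have [S' [n2 l2 d2]] := ito_approx a0 e1.
exists S.
have n1e : (sqnorm P b (fun s w => simple_path S s w - H s w)%R <= e%:E)%E.
  by apply: (le_trans n1); rewrite lee_fin; lra.
have n3 : (sqnorm P a (fun s w => simple_path S s w - H s w)%R <= (e / 22)%:E)%E.
  apply: le_trans n1; rewrite /sqnorm.
  have mS := joint_measurableB (simple_path_joint S) mH.
  apply: ge0_le_integral => //.
  - by move=> w _; apply: integral_ge0 => s _; rewrite lee_fin sqr_ge0.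
  - exact: measurable_inner.
  - exact: measurable_inner.
  - move=> w _; apply: ge0_subset_integral => //=.
    + apply/measurable_EFinP; apply: measurable_funTS; apply: measurable_funX.
      exact: (joint_measurable_sect1 w mS).
    + by move=> s _; rewrite lee_fin sqr_ge0.
    + by move=> s /=; rewrite !in_itv/= => /andP[->/= /le_trans]; apply.
have d3 := simple_dist a0 n3 n2.
have LS t (t0 : 0 <= t) := simple_integral_L2 S t0.
have LS' := simple_integral_L2 S' a0.
have LM t (t0 : 0 <= t) := L2_ito t0.
have LD : L2 P (fun w => (M b w - M a w) - (simple_integral W S b w - simple_integral W S a w)).
  by apply: L2B; apply: L2B; [exact: LM|exact: LM|exact: LS|exact: LS].
split=> //.
pose X1 w := simple_integral W S b w - M b w.
pose X2 w := simple_integral W S' a w - M a w.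
pose X3 w := simple_integral W S a w - simple_integral W S' a w.
have h1 := E_sqrD (L2B (LS a a0) LS') l2.
have h2 := E_sqrB (L2D (L2B (LS a a0) LS') l2) l1.
rewrite (_ : (fun w => (_ - _ - _) ^+ 2) = fun w => (X3 w + X2 w - X1 w) ^+ 2); last first.
  by apply/funext => w; rewrite /X1 /X2 /X3; ring.
rewrite /X1 /X2 /X3; lra.
Qed.

Section Increment.
Variables (a b : R).
Hypotheses (a0 : 0 <= a) (ab : a <= b).

Lemma L2_ito_increment : L2 P (fun w => M b w - M a w).
Proof. by apply: L2B; apply: L2_ito => //; exact: le_trans ab. Qed.

(** Isometry for the difference between the integrand and a variable [zeta] known at [a]; the factor
    4 is lost in passing through a simple process. Taking [zeta = 0] gives the growth of the price,
    [zeta = sigma (eps a)] its local approximation. *)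
Lemma ito_increment_sqr zeta K k : Fmeas a zeta -> (forall w, `|zeta w| <= K) -> 0 <= k ->
  (forall s, a < s -> s <= b ->
     E P (fun w => (c (eps s w) - zeta w) ^+ 2) <= k) ->
  L2 P (fun w => M b w - M a w - zeta w * (W b w - W a w)) /\
  E P (fun w => (M b w - M a w - zeta w * (W b w - W a w)) ^+ 2) <= 4 * k * (b - a).
Proof.
move=> Fz zK k0 hk; have b0 := le_trans a0 ab.
have elz := elementary_cst P_complete W_brownian eps_markov ab Fz zK.
have mz := Fmeas_measurable P_complete W_brownian eps_markov Fz.
have Lz := elementary_L2 W_brownian a0 elz.
have LN : L2 P (fun w => M b w - M a w - zeta w * (W b w - W a w)).
  by apply: L2B => //; exact: L2_ito_increment.
split=> //.
have mHz : joint_measurable (fun s w => H s w - zeta w).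
  apply: joint_measurableB => //; exact: (measurableT_comp mz measurable_snd).
have nz : (sqnorm P b (fun s w => ((a < s <= b)%R%:R * (H s w - zeta w))%R) <= (k * (b - a))%:E)%E.
  apply: sqnorm_bound => // s as_ sb.
  have s0 : 0 <= s by apply: (le_trans a0); exact: ltW.
  have mHs := joint_measurable_sect2 s mHz.
  have iHs : L1 P (fun w => (H s w - zeta w) ^+ 2).
    have [] // : L2 P (fun w => H s w - zeta w).
    apply: (@L2_bounded _ _ _ _ _ (B + K)) => // w.
    by apply: (le_trans (ler_normB _ _)); exact: lerD.
  rewrite E_EFin// lee_fin; apply: le_trans (hk s as_ sb).
  rewrite le_eqVlt; apply/orP; left; apply/eqP; apply: E_ae.
  - exact: measurable_funX.
  - apply: measurable_funX; apply: measurable_funB => //.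
    exact: (Fmeas_measurable P_complete W_brownian eps_markov (@Fmeas_eps _ _ _ P W eps s c s0)).
  - by apply: filterS H_eps => w h; rewrite h.
apply/ler_addgt0Pr => e e0.
have e1 : 0 < e / 6 by rewrite divr_gt0.
have [S [n1 l1 d1]] := ito_approx_increment a0 ab e1.
have elS := elementary_simple P_complete W_brownian eps_markov S a0 ab.
have elB := elementaryB elS elz.
have iso := elementary_isometry P_complete W_brownian eps_markov W_eps_independent a0 elB.
have mSH := joint_measurableB (simple_path_joint S) mH.
have d2 : E P (fun w => (simple_integral W S b w - simple_integral W S a w -
    zeta w * (W b w - W a w)) ^+ 2) <= 2 * (e / 6) + 2 * (k * (b - a)).
  rewrite -lee_fin -iso.
  have := @sqnorm_le _ _ _ P b _ _ _ (elementary_joint elB) mSH (joint_measurable_itv a b mHz).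
  move=> /(_ _)/le_trans; apply.
    move=> s w _; case: (a < s <= b)%R; rewrite ?mul1r ?mul0r ?subrr; last first.
      by rewrite expr0n/=; apply: addr_ge0; rewrite mulr_ge0// sqr_ge0.
    have := sqr_ge0 ((simple_path S s w - H s w) - (H s w - zeta w)); nra.
  rewrite (_ : (2 * (e / 6) + 2 * (k * (b - a)))%:E =
    2%:E * (e / 6)%:E + 2%:E * (k * (b - a))%:E)%E; last by rewrite -!EFinM -EFinD.
  by apply: leeD; (apply: lee_wpmul2l; [by rewrite lee_fin|assumption]).
have h := E_sqrD l1 (elementary_L2 W_brownian a0 elB).
rewrite (_ : (fun w => (M b w - M a w - zeta w * _) ^+ 2) =
  fun w => ((M b w - M a w) - (simple_integral W S b w - simple_integral W S a w) +
   ((simple_integral W S b w - simple_integral W S a w) - zeta w * (W b w - W a w))) ^+ 2); last first.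
  by apply/funext => w; ring.
move: h d1 d2; set u := E P _; set v := E P _; set t := E P _; lra.
Qed.

Lemma ito_orthogonal xi : Fmeas a xi -> L2 P xi ->
  E P (fun w => xi w * (M b w - M a w)) = 0.
Proof.
move=> Fxi Lxi; have b0 := le_trans a0 ab.
suff H0 e : 0 < e -> `|E P (fun w => xi w * (M b w - M a w))| <= e.
  apply/eqP; rewrite -normr_le0; apply/ler_addgt0Pr => e e0.
  by rewrite add0r; exact: H0.
move=> e0.
have [_ ixi2] := Lxi.
pose q := E P (fun w => xi w ^+ 2); have q0 : 0 <= q by apply: E_ge0 => w; exact: sqr_ge0.
(* By the weighted Young inequality [xi * D] is at most [r / 2 * xi ^+ 2 + D ^+ 2 / (2 * r)]. With
   [E (D ^+ 2) <= r * e], each term contributes at most [e / 2]. *)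
pose r := e / (q + 1); have r0 : 0 < r by rewrite divr_gt0// ltr_wpDl.
have re0 : 0 < r * e by rewrite mulr_gt0.
have [S [n1 l1 d1]] := ito_approx_increment a0 ab re0.
have elS := elementary_simple P_complete W_brownian eps_markov S a0 ab.
have LI := elementary_L2 W_brownian a0 elS.
have e2 := elementary_orthogonal P_complete W_brownian eps_markov W_eps_independent a0 elS Fxi (L2_L1 Lxi).
pose D w := M b w - M a w - (simple_integral W S b w - simple_integral W S a w).
have -> : (fun w => xi w * (M b w - M a w)) = (fun w => xi w * D w +
    xi w * (simple_integral W S b w - simple_integral W S a w)).
  by apply/funext => w; rewrite /D; ring.
have iD : L1 P (fun w => xi w * D w) by exact: L2_mul.
rewrite ED ?e2 ?addr0//; last exact: L2_mul.
have [mD iD2] := l1.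
have iV : L1 P (fun w => r / 2 * xi w ^+ 2 + (2 * r)^-1 * D w ^+ 2).
  by apply: L1D; apply: L1Z.
apply: (@le_trans _ _ (E P (fun w => r / 2 * xi w ^+ 2 + (2 * r)^-1 * D w ^+ 2))).
  apply: E_le_abs => //; first by case: Lxi => mxi _; exact: measurable_funM.
  move=> w; rewrite ler_norml.
  have rV : r * r^-1 = 1 by rewrite divff// gt_eqF.
  have rV0 : 0 < r^-1 by rewrite invr_gt0.
  have E1 : r / 2 * xi w ^+ 2 + (2 * r)^-1 * D w ^+ 2 - xi w * D w =
     (r * xi w - D w) ^+ 2 * r^-1 / 2 by field; rewrite gt_eqF.
  have E2 : r / 2 * xi w ^+ 2 + (2 * r)^-1 * D w ^+ 2 + xi w * D w =
     (r * xi w + D w) ^+ 2 * r^-1 / 2 by field; rewrite gt_eqF.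
  have p1 : 0 <= (r * xi w - D w) ^+ 2 * r^-1 / 2.
    by apply: divr_ge0 => //; apply: mulr_ge0; [exact: sqr_ge0|exact: ltW].
  have p2 : 0 <= (r * xi w + D w) ^+ 2 * r^-1 / 2.
    by apply: divr_ge0 => //; apply: mulr_ge0; [exact: sqr_ge0|exact: ltW].
  by apply/andP; split; lra.
rewrite ED ?EZ//; [|exact: L1Z|exact: L1Z].
have q1 : 0 < q + 1 by rewrite ltr_wpDl.
have h1 : r / 2 * q <= e / 2.
  have : r * (q + 1) = e by rewrite /r divfK// gt_eqF.
  have := ltW r0; nra.
have h2 : (2 * r)^-1 * E P (fun w => D w ^+ 2) <= e / 2.
  have r2 : 0 < 2 * r by rewrite mulr_gt0.
  rewrite ler_pdivrMl//; apply: (le_trans d1).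
  by rewrite le_eqVlt; apply/orP; left; apply/eqP; field.
rewrite -/q; lra.
Qed.

End Increment.
End ItoProcess.

Lemma within_cvg_right (R : realType) (f : R -> R) t :
  {within `[0, +oo[, continuous f} -> 0 <= t -> f s @[s --> t^'+] --> f t.
Proof.
move=> /subspace_continuousP cf t0.
have /cf : (`[0, +oo[%classic : set R) t by rewrite /= in_itv/= t0.
apply: cvg_trans; apply: cvg_app; apply: within_subset.
by move=> s /= ts; rewrite in_itv/= andbT (le_trans t0)// ltW.
Qed.

(** * The price as an abstract diffusion *)

Section Diffusion.
Context d (Omega : measurableType d) (R : realType) (P : probability Omega R).
Variables (W : R -> Omega -> R) (eps : R -> Omega -> 'I_2) (lambda : 'I_2 -> R).
Hypothesis P_complete : measure_is_complete P.
Hypothesis lambda0 : forall i, 0 < lambda i.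
Hypothesis W_brownian : brownian_motion P W.
Hypothesis eps_markov : markov_chain P (generator lambda) eps.
Hypothesis W_eps_independent : independent_systems P
  (process_sigma measurable W `[0, +oo[) (process_sigma setT eps `[0, +oo[).

Notation F := (augmented_filtration P W eps).
Notation Fmeas := (Fmeas P W eps).

Lemma Gmeas_eps2 r (g : 'I_2 -> 'I_2 -> R) s t : 0 <= s -> 0 <= t ->
  Gmeas P W eps r (fun w => g (eps s w) (eps t w)).
Proof.
move=> s0 t0; rewrite (_ : (fun w => _) = fun w =>
    (eps s w == reg1)%:R * g reg1 (eps t w) + (eps s w == reg2)%:R * g reg2 (eps t w)).
  apply: (@measurable_funD _ (g_sigma_algebraType (genG P W eps r)));
  apply: (@measurable_funM _ (g_sigma_algebraType (genG P W eps r)));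
    [exact: (Gmeas_eps (fun k => (k == reg1)%:R))|exact: Gmeas_eps
    |exact: (Gmeas_eps (fun k => (k == reg2)%:R))|exact: Gmeas_eps].
by apply/funext => w; case: (ord2P (eps s w)) => -> /=; rewrite mul0r mul1r ?addr0 ?add0r.
Qed.

(* All that the verification argument uses of the price: [df_local] and
   [df_orth] stand in for Ito's formula. *)
Record diffusion (sigma : 'I_2 -> R) (M : R -> Omega -> R) (C : R) : Prop := {
  df_meas : forall t, 0 <= t -> Fmeas t (M t) ;
  df_L2 : forall t, 0 <= t -> L2 P (M t) ;
  df_growth : forall a b, 0 <= a -> a <= b ->
    E P (fun w => (M b w - M a w) ^+ 2) <= C * (b - a) ;
  df_local : forall a b, 0 <= a -> a <= b ->
    L2 P (fun w => M b w - M a w - sigma (eps a w) * (W b w - W a w)) /\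
    E P (fun w => (M b w - M a w - sigma (eps a w) * (W b w - W a w)) ^+ 2) <=
      C * (b - a) ^+ 2 ;
  df_orth : forall a b xi, 0 <= a -> a <= b -> Fmeas a xi -> L2 P xi ->
    E P (fun w => xi w * (M b w - M a w)) = 0 ;
  df_start : {ae P, forall w, M 0 w = 0} ;
  df_cont : {ae P, forall w, {within `[0, +oo[, continuous (M ^~ w)}} }.

Lemma price_diffusion sigma x X : price_process P F W sigma eps x X ->
  exists2 C, 0 < C & diffusion sigma (fun t w => X t w - x) C.
Proof.
move=> [X0 itoX].
pose B := `|sigma reg1| + `|sigma reg2| + 1.
have sB i : `|sigma i| <= B.
  by rewrite /B; case: (ord2P i) => ->; have := normr_ge0 (sigma reg1);
     have := normr_ge0 (sigma reg2); lra.
have B1 : 1 <= B by rewrite /B lerDr addr_ge0.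
have [H [mH HB H_eps]] := regime_modification P_complete W_brownian eps_markov sB.
pose L := lambda reg1 + lambda reg2.
have L0 : 0 < L by rewrite addr_gt0.
have sqB i : sigma i ^+ 2 <= B ^+ 2.
  by rewrite -(real_normK (num_real (sigma i))) lerXn2r ?nnegrE// (le_trans _ B1).
have msg t : 0 <= t -> measurable_fun setT (fun w => sigma (eps t w)).
  by move=> t0; exact: (Fmeas_measurable P_complete W_brownian eps_markov (Fmeas_eps sigma t0)).
(* The growth constant is [4 * B ^+ 2]. The local one is four times [8 * B ^+ 2 * L], which bounds
   the mean-square change of volatility per unit time. *)
pose C := 32 * B ^+ 2 * L + 4 * B ^+ 2.
have B0 : 0 < B ^+ 2 by rewrite exprn_gt0// (lt_le_trans ltr01).
have C0 : 0 < C by apply: addr_gt0; apply: mulr_gt0 => //; exact: mulr_gt0.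
exists C => //.
have mono (u v h : R) : 0 <= h -> u <= v -> u * h <= v * h by move=> ? ?; rewrite ler_wpM2r.
split=> //.
- by move=> t t0; exact: (ito_measurable itoX t0).
- by move=> t t0; exact: (L2_ito P_complete W_brownian eps_markov itoX mH H_eps t0).
- move=> a b a0 ab.
  have := @ito_increment_sqr _ _ _ P W eps lambda P_complete W_brownian eps_markov
    W_eps_independent sigma B (fun t w => X t w - x) itoX H mH HB H_eps a b a0 ab
    (fun=> 0) 0 (B ^+ 2) _ _ _ _.
  case.
  + exact: measurable_cst.
  + by move=> w; rewrite normr0.
  + exact: sqr_ge0.
  + move=> s as_ _; rewrite -[leRHS](E_cst P); apply: E_le.
    * have [] // : L2 P (fun w => sigma (eps s w) - 0).
      apply: (@L2_bounded _ _ _ _ _ B) => [|w]; last by rewrite subr0.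
      by apply: measurable_funB => //; apply: msg; rewrite (le_trans a0)// ltW.
    * exact: L1_cst.
    * by move=> w; rewrite subr0.
  + move=> _; rewrite (_ : (fun w => _) = (fun w => (X b w - x - (X a w - x)) ^+ 2)); last first.
      by apply/funext => w; rewrite mul0r subr0.
    move/le_trans; apply; apply: mono; first by rewrite subr_ge0.
    by have := ltW (mulr_gt0 B0 L0); rewrite /C; lra.
- move=> a b a0 ab.
  have := @ito_increment_sqr _ _ _ P W eps lambda P_complete W_brownian eps_markov
    W_eps_independent sigma B (fun t w => X t w - x) itoX H mH HB H_eps a b a0 ab
    (fun w => sigma (eps a w)) B (8 * B ^+ 2 * L * (b - a)) _ _ _ _.
  case.
  + exact: Fmeas_eps.
  + by [].
  + by apply: mulr_ge0; [have := mulr_gt0 B0 L0; lra|rewrite subr_ge0].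
  + move=> s as_ sb; have s0 : 0 <= s by rewrite (le_trans a0)// ltW.
    have iI : L1 P (fun w => (eps s w != eps a w)%:R : R).
      apply: (@L1_bounded _ _ _ _ _ 1); last by move=> w; case: eqP; rewrite /= ?normr0 ?normr1.
      apply: (Gmeas_measurable P_complete W_brownian eps_markov (t := 0)).
      have := @Gmeas_eps2 0 (fun i j => (i != j)%:R) s a s0 a0; exact.
    have := regime_change_prob P_complete lambda0 W_brownian eps_markov W_eps_independent a0 (ltW as_).
    rewrite -/L => h.
    apply: (@le_trans _ _ (E P (fun w => 4 * B ^+ 2 * (eps s w != eps a w)%:R))).
      apply: E_le.
      * have [] // : L2 P (fun w => sigma (eps s w) - sigma (eps a w)).
        apply: (@L2_bounded _ _ _ _ _ (B + B)) => [|w].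
          by apply: measurable_funB; apply: msg.
        by apply: (le_trans (ler_normB _ _)); apply: lerD.
      * exact: L1Z.
      * move=> w; case: eqP => [->|_] /=; first by rewrite subrr expr0n mulr0.
        rewrite mulr1; have := sqB (eps s w); have := sqB (eps a w).
        have := sqr_ge0 (sigma (eps s w) + sigma (eps a w)); nra.
    rewrite EZ//.
    apply: (@le_trans _ _ (4 * B ^+ 2 * (2 * L * (s - a)))).
      by rewrite ler_wpM2l//; lra.
    have hs : s - a <= b - a by rewrite lerD2r.
    have k0 : 0 <= 8 * B ^+ 2 * L by have := mulr_gt0 B0 L0; lra.
    have := ler_wpM2l k0 hs; lra.
  + move=> h1 h2; split=> //; apply: (le_trans h2).
    rewrite (_ : 4 * (8 * B ^+ 2 * L * (b - a)) * (b - a) = 32 * B ^+ 2 * L * (b - a) ^+ 2); last by ring.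
    by apply: mono; [exact: sqr_ge0|rewrite /C; lra].
- move=> a b xi a0 ab Fxi Lxi.
  exact: (ito_orthogonal P_complete W_brownian eps_markov W_eps_independent itoX mH H_eps a0 ab Fxi Lxi).
- by apply: filterS X0 => w ->; rewrite subrr.
- by case: itoX.
Qed.

End Diffusion.

(** * Integrable domination of the discounted price *)

Section Domination.
Context d (Omega : measurableType d) (R : realType) (P : probability Omega R).
Variables (W : R -> Omega -> R) (eps : R -> Omega -> 'I_2) (lambda : 'I_2 -> R).
Hypothesis P_complete : measure_is_complete P.
Hypothesis W_brownian : brownian_motion P W.
Hypothesis eps_markov : markov_chain P (generator lambda) eps.
Notation Fmeas := (Fmeas P W eps).
Variables (sigma : 'I_2 -> R) (M : R -> Omega -> R) (C : R).
Hypothesis C0 : 0 < C.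
Hypothesis dfM : diffusion P W eps sigma M C.

(** Maximum of [|M|] over the dyadic times of level [n] up to time [N]. *)
Let A n N w := runmax (fun k => M (grid R n k) w) (N * 2 ^ n).

Lemma diffusion_E_sqr t : 0 <= t -> E P (fun w => M t w ^+ 2) <= C * t.
Proof.
move=> t0; have := df_growth dfM (lexx 0) t0; rewrite subr0; apply: le_trans.
rewrite le_eqVlt; apply/orP; left; apply/eqP.
have [mt _] := df_L2 dfM t0; have [m0 _] := df_L2 dfM (lexx 0).
apply: E_ae.
- exact: measurable_funX.
- by apply: measurable_funX; exact: measurable_funB.
- by apply: filterS (df_start dfM) => w ->; rewrite subr0.
Qed.

Let A_L2 n N : L2 P (A n N).
Proof. by apply: L2_runmax => k; apply: (df_L2 dfM); exact: grid_ge0. Qed.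

Let A_E n N : E P (fun w => A n N w ^+ 2) <= 4 * C * N%:R.
Proof.
apply: le_trans (_ : 4 * E P (fun w => M (grid R n (N * 2 ^ n)) w ^+ 2) <= _); last first.
  rewrite grid_nat -mulrA ler_pM2l//; exact: diffusion_E_sqr.
apply: (doob_L2 (S := fun k => M (grid R n k))).
  by move=> k; apply: (df_L2 dfM); exact: grid_ge0.
move=> k _; apply: (df_orth dfM); [exact: grid_ge0|exact: grid_le| |].
  have mF j : (j <= k)%N -> Fmeas (grid R n k) (M (grid R n j)).
    move=> jk; apply: (Fmeas_mono (grid_le R n jk)); apply: (df_meas dfM); exact: grid_ge0.
  apply: (@measurable_funM _ (g_sigma_algebraType (genF P W eps (grid R n k)))).
    by apply: (@measurable_runmax R _ (g_sigma_algebraType (genF P W eps (grid R n k)))).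
  apply: (@measurable_fun_ifT _ _ (g_sigma_algebraType (genF P W eps (grid R n k)))) => //.
  apply: (@measurable_fun_ler _ (g_sigma_algebraType (genF P W eps (grid R n k)))) => //.
  exact: mF.
under eq_fun do rewrite mulrC.
apply: (@L2Mb _ _ _ _ _ _ 1).
- apply: measurable_fun_ifT => //; apply: measurable_fun_ler => //.
  by have [] := df_L2 dfM (grid_ge0 R n k).
- by move=> w; rewrite /sign; case: ifP; rewrite ?normrN normr1.
- by apply: L2_runmax => j; apply: (df_L2 dfM); exact: grid_ge0.
Qed.

Variable r : R.
Hypothesis r0 : 0 < r.

Let q := expR (- r).
Let T n w := \sum_(N < n) (q ^+ N) ^+ 2 * A n N.+1 w ^+ 2.

Let q0 : 0 < q. Proof. exact: expR_gt0. Qed.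
Let q1 : q < 1. Proof. by rewrite expR_lt1 oppr_lt0. Qed.

Let T_L1 n : L1 P (T n).
Proof. by apply: L1_sum => N _; apply: L1Z; have [] := A_L2 n N.+1. Qed.

(** One factor [q ^+ N] absorbs the linear growth of the second moments, since
    [q ^+ N * (1 + N * r) <= 1]; the other leaves a geometric series. *)
Let T_E n : E P (T n) <= 4 * C * (1 + r^-1) / (1 - q).
Proof.
rewrite E_sum; last by move=> N _; apply: L1Z; have [] := A_L2 n N.+1.
have q10 : 0 < 1 - q by rewrite subr_gt0.
rewrite ler_pdivlMr//.
apply: (@le_trans _ _ (\sum_(N < n) (4 * C * (1 + r^-1)) * (q ^+ N * (1 - q)))); last first.
  rewrite -mulr_sumr -mulr_suml -[leRHS]mulr1 ler_pM2l; last first.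
    by rewrite !mulr_gt0// addr_gt0// invr_gt0.
  have : \sum_(N < n) q ^+ N * (1 - q) = 1 - q ^+ n.
    elim: n => [|n ih]; first by rewrite big_ord0 expr0 subrr.
    by rewrite big_ord_recr/= ih exprS; ring.
  rewrite mulr_suml => ->; by rewrite gerBl exprn_ge0// ltW.
rewrite mulr_suml; apply: ler_sum => N _.
rewrite EZ; last by have [] := A_L2 n N.+1.
rewrite mulrA ler_wpM2r//; first exact: ltW.
have qN0 : 0 < q ^+ N by rewrite exprn_gt0.
apply: (@le_trans _ _ ((q ^+ N) ^+ 2 * (4 * C * N.+1%:R))).
  by rewrite ler_wpM2l ?sqr_ge0//; exact: A_E.
rewrite expr2 (_ : q ^+ N * q ^+ N * _ = q ^+ N * (4 * C) * (q ^+ N * N.+1%:R)); last by ring.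
rewrite [leRHS](_ : _ = q ^+ N * (4 * C) * (1 + r^-1)); last by ring.
rewrite ler_pM2l ?mulr_gt0//.
have h : 1 + N%:R * r <= (q ^+ N)^-1.
  rewrite -exprVn /q -expRN opprK -expRM_natl; exact: expR_ge1Dx.
have h' : q ^+ N * (1 + N%:R * r) <= 1 by rewrite -ler_pdivlMl// mulr1.
have rr : r * r^-1 = 1 by rewrite divff// gt_eqF.
have rV : 0 < r^-1 by rewrite invr_gt0.
have n0 : 0 <= N%:R :> R by [].
rewrite -natr1.
have : q ^+ N * (1 + N%:R * r) * (1 + r^-1) <= 1 * (1 + r^-1) by rewrite ler_wpM2r// addr_ge0// ltW.
have : 0 <= q ^+ N * (N%:R * r) by rewrite !mulr_ge0// ltW.
have : 0 <= q ^+ N * r^-1 by rewrite mulr_ge0// ltW.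
rewrite (_ : q ^+ N * (1 + N%:R * r) * (1 + r^-1) = q ^+ N + q ^+ N * r^-1 +
  q ^+ N * (N%:R * r) + q ^+ N * N%:R * (r * r^-1)); last by ring.
rewrite rr; lra.
Qed.

Let A_mono n m N w : (n <= m)%N -> A n N w <= A m N w.
Proof.
move=> nm.
suff H k : (k <= N * 2 ^ n)%N -> runmax (fun k => M (grid R n k) w) k <= A m N w by exact: H.
have Hk j : (j <= N * 2 ^ n)%N -> `|M (grid R n j) w| <= A m N w.
  move=> jN; have -> : grid R n j = grid R m (j * 2 ^ (m - n)).
    rewrite -(subnK nm) addnK; elim: (m - n)%N => [|p ih]; first by rewrite expn0 muln1.
    by rewrite addSn expnSr mulnA grid_refine.
  apply: (runmax_ge (fun k => M (grid R m k) w)).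
  by rewrite -{2}(subnK nm) addnC expnD mulnA leq_mul2r jN orbT.
elim: k => [|k ih] kN /=; first exact: Hk.
by rewrite ge_max Hk// ih// ltnW.
Qed.

Let A_ge0 n N w : 0 <= A n N w. Proof. exact: runmax_ge0. Qed.

Let T_mono n m w : (n <= m)%N -> T n w <= T m w.
Proof.
move=> nm; rewrite /T.
rewrite -(big_mkord xpredT (fun N => (q ^+ N) ^+ 2 * A n N.+1 w ^+ 2)).
rewrite -(big_mkord xpredT (fun N => (q ^+ N) ^+ 2 * A m N.+1 w ^+ 2)).
rewrite [leRHS](@big_cat_nat _ _ _ n)//= -[leLHS]addr0; apply: lerD.
  apply: ler_sum => N _; rewrite ler_wpM2l ?sqr_ge0// lerXn2r ?nnegrE//; exact: A_mono.
by apply: sumr_ge0 => N _; rewrite mulr_ge0// sqr_ge0.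
Qed.

(** [S] is the monotone limit of the sums [T n] as the grid is refined and the horizon grows; its
    integral is finite by [T_E]. Right continuity passes from dyadic times to all times. *)
Lemma diffusion_domination : exists G, [/\ forall w, 0 <= G w, L1 P G &
  {ae P, forall w t, 0 <= t -> expR (- r * t) * `|M t w| <= G w}].
Proof.
pose S w := limn (fun n => (T n w)%:E).
have cS w : (fun n => (T n w)%:E) @ \oo --> S w.
  by apply: ereal_nondecreasing_is_cvgn => n m nm; rewrite lee_fin; exact: T_mono.
have T0 n w : 0 <= T n w.
  by apply: sumr_ge0 => N _; rewrite mulr_ge0// sqr_ge0.
have leS n w : ((T n w)%:E <= S w)%E.
  apply: lime_ge; first exact: cvgP (cS w).
  by near=> m; rewrite lee_fin; apply: T_mono; near: m; exists n.
have mT n : measurable_fun setT (fun w => (T n w)%:E).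
  by apply/measurable_EFinP; exact: L1_measurable (T_L1 n).
have mS : measurable_fun setT S by apply: (emeasurable_fun_cvg (fun n w => (T n w)%:E)).
have S0 w : (0 <= S w)%E by apply: le_trans (leS 0%N w); rewrite lee_fin.
have IS : (\int[P]_w S w <= (4 * C * (1 + r^-1) / (1 - q))%:E)%E.
  rewrite monotone_convergence//; last 2 first.
  - by move=> n w _; rewrite lee_fin.
  - by move=> w _ n m nm; rewrite lee_fin; exact: T_mono.
  apply: lime_le.
    apply: ereal_nondecreasing_is_cvgn => n m nm; apply: ge0_le_integral => //.
    + by move=> w _; rewrite lee_fin.
    + by move=> w _; rewrite lee_fin; exact: T_mono.
  by apply: nearW => n; rewrite E_EFin// lee_fin.
have iS : P.-integrable setT S.
  apply/integrableP; split=> //; under eq_integral do rewrite gee0_abs//.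
  exact: le_lt_trans IS (ltry _).
have fS : {ae P, forall w, S w \is a fin_num}.
  by apply: filterS (integrable_ae measurableT iS) => w; exact.
pose G w := 1 + fine (S w).
have mG : measurable_fun setT (fun w => fine (S w)).
  by exact: (@measurableT_comp _ _ _ _ _ _ fine setT S (@fine_measurable R setT measurableT) mS).
have G0 w : 0 <= fine (S w) by exact: fine_ge0.
exists G; split.
- by move=> w; rewrite addr_ge0.
- apply: L1D; first exact: L1_cst.
  apply: L1_ge0_lty => //.
  rewrite (ae_eq_integral S)//.
  + exact: le_lt_trans IS (ltry _).
  + exact/measurable_EFinP.
  + by apply: filterS fS => w fw _; rewrite fineK.
- apply: filterS2 fS (df_cont dfM) => w fw cw t t0.
  (* With [s] in [[N, N + 1[], the square of [q ^+ N * |M s|] is at most a term of the sum, and a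
     number is at most one plus its square. *)
  have key n k : (1 <= k)%N -> expR (- r * grid R n k) * `|M (grid R n k) w| <= G w.
    move=> k1; set s := grid R n k.
    pose N := Num.truncn s.
    have s0 : 0 <= s by exact: grid_ge0.
    have /andP[Ns sN] := truncn_itv s0.
    pose m := maxn n N.+1.
    have h1 : (q ^+ N * `|M s w|) ^+ 2 <= fine (S w).
      rewrite -lee_fin fineK//; apply: le_trans (leS m w); rewrite lee_fin.
      have Nm : (N < m)%N by rewrite leq_max ltnSn orbT.
      rewrite /T (bigD1 (Ordinal Nm))//= -[leLHS]addr0; apply: lerD; last first.
        by apply: sumr_ge0 => j _; rewrite mulr_ge0// sqr_ge0.
      rewrite exprMn ler_wpM2l ?sqr_ge0// lerXn2r ?nnegrE//.
      apply: le_trans (A_mono _ _ (leq_maxl n N.+1)).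
      apply: (runmax_ge (fun k => M (grid R n k) w)).
      move: sN; rewrite -(grid_nat R n) => /ltW.
      by rewrite /s /grid ler_pM2r ?mesh_gt0// ler_nat.
    have h2 : expR (- r * s) <= q ^+ N.
      by rewrite /q -expRM_natl ler_expR mulrC !mulrN lerN2 ler_wpM2r// ltW.
    apply: (@le_trans _ _ (q ^+ N * `|M s w|)); first by rewrite ler_wpM2r.
    have := sqr_ge0 (q ^+ N * `|M s w| - 1); rewrite /G.
    have := G0 w; nra.
  have c1 : expR (- r * s) * `|M s w| @[s --> t^'+] --> expR (- r * t) * `|M t w|.
    apply: cvgM.
      apply: cvg_at_right_filter; apply: continuous_comp; last exact: continuous_expR.
      exact: mulrl_continuous.
    apply: cvg_norm.
    exact: within_cvg_right.
  have c2 := cvg_right_next t0 c1.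
  rewrite -(cvg_lim _ c2)//; apply: limr_le; first by apply: cvgP c2.
  by apply: nearW => n; exact: key.
Unshelve. all: by end_near. Qed.

End Domination.

(** * Dynkin's formula *)

Section TaylorStep.
Variables (R : realType) (rho K : R) (v dv ddv : 'I_2 -> R -> R).

Record smooth_family : Prop := {
  sf_K : 1 <= K ;
  sf_v : forall i (x : R), is_derive x 1 (v i) (dv i x) ;
  sf_dv : forall i (x : R), is_derive x 1 (dv i) (ddv i x) ;
  sf_dv_bnd : forall i x, `|dv i x| <= K ;
  sf_ddv_bnd : forall i x, `|ddv i x| <= K ;
  sf_ddv_lip : forall i x y, `|ddv i x - ddv i y| <= K * `|x - y| ;
  sf_diff : forall i j x, `|v i x - v j x| <= K ;
  sf_0 : forall i, `|v i 0| <= K }.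

Hypothesis rho0 : 0 < rho.
Hypothesis sf : smooth_family.

Lemma sf_lip i x y : `|v i x - v i y| <= K * `|x - y|.
Proof.
have [t _ E] := MVT_between y x (sf_v sf i).
by rewrite E normrM ler_wpM2r// (sf_dv_bnd sf).
Qed.

Lemma sf_dv_lip i x y : `|dv i x - dv i y| <= K * `|x - y|.
Proof.
have [t _ E] := MVT_between y x (sf_dv sf i).
by rewrite E normrM ler_wpM2r// (sf_ddv_bnd sf).
Qed.

Lemma sf_growth i x : `|v i x| <= K * (1 + `|x|).
Proof.
have := sf_lip i x 0; rewrite subr0 => h.
rewrite (_ : v i x = (v i x - v i 0) + v i 0); last by ring.
apply: (le_trans (ler_normD _ _)); have := sf_0 sf i; lra.
Qed.

Lemma expR_second_order (u : R) : 0 <= u -> `|expR (- u) - 1 + u| <= u ^+ 2.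
Proof.
move=> u0; have h1 := expR_ge1Dx (- u); have h2 := expR_ge1Dx u.
have e0 := expR_gt0 (- u).
have eN : expR (- u) * expR u = 1 by rewrite -expRD addNr expR0.
rewrite ger0_norm; last by lra.
nra.
Qed.

(** The generator of the pair of regime and price, minus [rho]. *)
Definition generator_op (sigma lambda : 'I_2 -> R) i x :=
  sigma i ^+ 2 / 2 * ddv i x - rho * v i x + lambda i * (v (rev_ord i) x - v i x).

(* Second-order expansion along x -> x + D + De, i -> j, where D is the Brownian
   increment and De a term of lower order. *)
Lemma taylor_step i j x D De h : 0 <= h ->
  `|expR (- rho * h) * v j (x + D + De) - v i x -
    (dv i x * (D + De) + ddv i x / 2 * D ^+ 2 +
     (j != i)%:R * (v (rev_ord i) x - v i x) - rho * h * v i x)| <=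
  K * (De ^+ 2 + `|D| * `|De|) + K * `|D| ^+ 3 +
  2 * K * (j != i)%:R * (`|D| + `|De|) +
  (rho * h) ^+ 2 * (K * (1 + `|x + D + De|)) +
  rho * h * (K * (j != i)%:R + K * (`|D| + `|De|)).
Proof.
move=> h0; set y := x + D + De; set ne : R := (j != i)%:R.
have K0 : 0 <= K by apply: le_trans (sf_K sf).
have ne0 : 0 <= ne by rewrite /ne.
have yx : `|y - x| <= `|D| + `|De|.
  by rewrite (_ : y - x = D + De); [exact: ler_normD|rewrite /y; ring].
(* With two regimes, a change of regime is an exact identity and not an expansion. *)
have vj z : v j z = v i z + ne * (v (rev_ord i) z - v i z).
  rewrite /ne; case: (ord2P i) => ->; case: (ord2P j) => -> /=;
  by rewrite ?rev_reg1 ?rev_reg2 /= ?mul0r ?addr0 ?mul1r// addrC subrK.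
(* [A1] to [A5] bound in turn the lower-order increment, the Taylor remainder, the regime change
   combined with a move, the second order of the discount, and the discount combined with a change
   of state. *)
have A1 : `|v i y - v i (x + D) - dv i x * De| <= K * (De ^+ 2 + `|D| * `|De|).
  have [t [tD _] E] := MVT_between (x + D) y (sf_v sf i).
  rewrite (_ : y - (x + D) = De) in tD E; last by rewrite /y; ring.
  rewrite E -mulrBl normrM.
  have h1 : `|t - x| <= `|D| + `|De|.
    rewrite (_ : t - x = D + (t - (x + D))); last by ring.
    by apply: (le_trans (ler_normD _ _)); rewrite lerD2l.
  have h2 : `|dv i t - dv i x| <= K * (`|D| + `|De|).
    by apply: (le_trans (sf_dv_lip i t x)); rewrite ler_wpM2l.
  have := ler_wpM2r (normr_ge0 De) h2.
  have := real_normK (num_real De) => <-; rewrite expr2; lra.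
have A2 := taylor2_lipschitz (sf_v sf i) (sf_dv sf i) (sf_ddv_lip sf i) x D.
have A3 : `|ne * ((v (rev_ord i) y - v i y) - (v (rev_ord i) x - v i x))| <=
    2 * K * ne * (`|D| + `|De|).
  rewrite normrM (ger0_norm ne0) (_ : 2 * K * ne * _ = ne * (2 * K * (`|D| + `|De|))); last by ring.
  apply: ler_wpM2l => //.
  have h1 := sf_lip (rev_ord i) y x; have h2 := sf_lip i y x.
  have h3 := ler_wpM2l K0 yx.
  rewrite (_ : _ - _ = (v (rev_ord i) y - v (rev_ord i) x) - (v i y - v i x)); last by ring.
  apply: (le_trans (ler_normB _ _)); lra.
have A4 : `|(expR (- rho * h) - 1 + rho * h) * v j y| <= (rho * h) ^+ 2 * (K * (1 + `|y|)).
  rewrite normrM; apply: ler_pM => //; last exact: sf_growth.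
  by rewrite mulNr; apply: expR_second_order; rewrite mulr_ge0// ltW.
have A5 : `|rho * h * (v j y - v i x)| <= rho * h * (K * ne + K * (`|D| + `|De|)).
  rewrite normrM ger0_norm ?mulr_ge0// ?(ltW rho0)//.
  rewrite ler_wpM2l// ?mulr_ge0// ?(ltW rho0)//.
  rewrite (_ : v j y - v i x = (v j y - v i y) + (v i y - v i x)); last by ring.
  apply: (le_trans (ler_normD _ _)); apply: lerD; last first.
    by apply: (le_trans (sf_lip i y x)); rewrite ler_wpM2l.
  rewrite vj addrAC subrr add0r normrM (ger0_norm ne0) mulrC ler_wpM2r//.
  exact: (sf_diff sf).
rewrite (_ : _ - _ - _ =
  (v i y - v i (x + D) - dv i x * De) +
  (v i (x + D) - v i x - dv i x * D - ddv i x / 2 * D ^+ 2) +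
  (ne * ((v (rev_ord i) y - v i y) - (v (rev_ord i) x - v i x))) +
  ((expR (- rho * h) - 1 + rho * h) * v j y) - (rho * h * (v j y - v i x))); last first.
  rewrite [in RHS]vj !(vj y); ring.
apply: (le_trans (ler_normB _ _)); apply: lerD => //.
apply: (le_trans (ler_normD _ _)); apply: lerD => //.
apply: (le_trans (ler_normD _ _)); apply: lerD => //.
apply: (le_trans (ler_normD _ _)); apply: lerD => //.
Qed.

(* The same remainder, with AM-GM at scale [s = sqrt h] applied to the products. *)
Lemma taylor_step_amgm i j x D De s : 0 < s -> s <= 1 ->
  `|expR (- rho * s ^+ 2) * v j (x + D + De) - v i x -
    (dv i x * (D + De) + ddv i x / 2 * D ^+ 2 +
     (j != i)%:R * (v (rev_ord i) x - v i x) - rho * s ^+ 2 * v i x)| <=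
  K * (8 + 4 * rho + rho ^+ 2) *
    (s^-1 * De ^+ 2 + s * D ^+ 2 + s^-1 * D ^+ 4 + s^-1 * ((j != i)%:R * D ^+ 2) +
     s * (j != i)%:R + s ^+ 3 + s ^+ 4 * (1 + `|x + D + De|)).
Proof.
move=> s0 s1; apply: (le_trans (taylor_step i j x D De (sqr_ge0 s))).
set ne : R := (j != i)%:R; set y := `|x + D + De|.
have y0 : 0 <= y by exact: normr_ge0.
have K0 : 0 < K by apply: lt_le_trans (sf_K sf).
have ne01 : ne = 0 \/ ne = 1 by rewrite /ne; case: (j != i); [right|left].
have -> : De ^+ 2 = `|De| ^+ 2 by rewrite real_normK ?num_real.
have D2 : D ^+ 2 = `|D| ^+ 2 by rewrite real_normK ?num_real.
have D4 : D ^+ 4 = `|D| ^+ 4 by rewrite (_ : 4 = 2 * 2)%N// !exprM D2.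
rewrite {}D2 {}D4.
set p := `|D|; set q := `|De|.
have p0 : 0 <= p by exact: normr_ge0.
have q0 : 0 <= q by exact: normr_ge0.
set S := s^-1; have S0 : 0 < S by rewrite invr_gt0.
have sS : s * S = 1 by rewrite divff// gt_eqF.
have S1 : 1 <= S by rewrite invf_ge1.
have ag a b : 0 <= a -> 0 <= b -> a * b <= s * a ^+ 2 + S * b ^+ 2.
  move=> a0 b0; have h : 0 <= S * (s * a - b) ^+ 2 by rewrite mulr_ge0 ?sqr_ge0// ltW.
  have E : S * (s * a - b) ^+ 2 = (s * S) * s * a ^+ 2 - 2 * (s * S) * (a * b) + S * b ^+ 2 by ring.
  rewrite E sS in h; have ab0 : 0 <= a * b by exact: mulr_ge0.
  lra.
set t1 := S * q ^+ 2; set t2 := s * p ^+ 2; set t3 := S * p ^+ 4.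
set t4 := S * (ne * p ^+ 2); set t5 := s * ne; set t6 := s ^+ 3.
set t7 := s ^+ 4 * (1 + y).
have t10 : 0 <= t1 by rewrite mulr_ge0 ?sqr_ge0// ltW.
have t20 : 0 <= t2 by rewrite mulr_ge0 ?sqr_ge0// ltW.
have t30 : 0 <= t3 by rewrite mulr_ge0 ?exprn_ge0// ltW.
have ne0 : 0 <= ne by rewrite /ne.
have t40 : 0 <= t4 by rewrite mulr_ge0 ?mulr_ge0 ?sqr_ge0// ltW.
have t50 : 0 <= t5 by rewrite mulr_ge0// ltW.
have t60 : 0 <= t6 by rewrite exprn_ge0// ltW.
have t70 : 0 <= t7 by rewrite mulr_ge0 ?exprn_ge0 ?addr_ge0// ltW.
have b1 : q ^+ 2 <= t1 by rewrite /t1 ler_peMl ?sqr_ge0.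
have b2 : p * q <= t2 + t1 by exact: ag.
have b3 : p ^+ 3 <= t2 + t3.
  have := ag p (p ^+ 2) p0 (sqr_ge0 _); rewrite -exprM -exprS /t2 /t3; lra.
have b4 : ne * p <= t5 + t4.
  have := ag ne (ne * p) ne0 (mulr_ge0 ne0 p0).
  by rewrite /t5 /t4; case: ne01 => ->; rewrite ?mul0r ?mul1r ?expr1n ?expr0n ?mulr0 ?mulr1 ?addr0 ?mul1r.
have b5 : ne * q <= t5 + t1.
  have := ag ne q ne0 q0.
  by rewrite /t5 /t1; case: ne01 => ->; rewrite ?expr1n// ?mul0r ?mulr0 ?add0r.
have s21 : s ^+ 2 <= 1 by rewrite exprn_ile1// ltW.
have s20 : 0 <= s ^+ 2 by exact: sqr_ge0.
have b6 : s ^+ 2 * p <= t6 + t2.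
  have := ag (s * s) (s * p) (mulr_ge0 (ltW s0) (ltW s0)) (mulr_ge0 (ltW s0) p0).
  rewrite (_ : s * s * (s * p) = s * (s ^+ 2 * p)); last by ring.
  rewrite (_ : S * (s * p) ^+ 2 = (s * S) * s * p ^+ 2); last by ring.
  rewrite sS mul1r (_ : s * (s * s) ^+ 2 = s ^+ 2 * s ^+ 3); last by ring.
  move=> _; have := sqr_ge0 (p - s); rewrite /t6 /t2.
  move=> hh; have h2 := mulr_ge0 (ltW s0) hh.
  have h3 : 0 <= s ^+ 2 * p by exact: mulr_ge0.
  have E : s * (p - s) ^+ 2 = s * p ^+ 2 - 2 * (s ^+ 2 * p) + s ^+ 3 by ring.
  lra.
have b7 : s ^+ 2 * q <= t6 + t1.
  have := ag (s ^+ 2) q s20 q0; rewrite -exprM => h.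
  have : s * s ^+ (2 * 2) <= s ^+ 3.
    rewrite -exprS (_ : 5 = 3 + 2)%N// exprD ler_piMr// exprn_ge0// ltW.
  rewrite -/t6 -/t1 in h *; lra.
have b8 : s ^+ 2 * ne <= t5.
  by rewrite /t5 ler_wpM2r// expr2 ler_piMr// ltW.
have E7 : (rho * s ^+ 2) ^+ 2 * (K * (1 + y)) = K * rho ^+ 2 * t7 by rewrite /t7; ring.
rewrite E7.
have E8 : rho * s ^+ 2 * (K * ne + K * (p + q)) = K * rho * (s ^+ 2 * ne + s ^+ 2 * p + s ^+ 2 * q) by ring.
rewrite E8.
have E9 : 2 * K * ne * (p + q) = K * (2 * (ne * p + ne * q)) by ring.
rewrite E9 -!mulrA -!mulrDr ler_pM2l//.
set A := t1 + t2 + t3 + t4 + t5 + t6 + t7.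
have A0 : 0 <= A by rewrite !addr_ge0.
have c1 : s ^+ 2 * ne + s ^+ 2 * p + s ^+ 2 * q <= 4 * A by rewrite /A; lra.
have c2 : q ^+ 2 + p * q + p ^+ 3 + 2 * (ne * p + ne * q) <= 8 * A by rewrite /A; lra.
have c3 : t7 <= A by rewrite /A; lra.
have := ler_wpM2l (ltW rho0) c1; have := ler_wpM2l (sqr_ge0 rho) c3.
rewrite !mulrDr in c2 *; move: c2; lra.
Qed.

End TaylorStep.

(** * Expansion of the expectation over one step *)

Section OneStep.
Context d (Omega : measurableType d) (R : realType) (P : probability Omega R).
Variables (W : R -> Omega -> R) (eps : R -> Omega -> 'I_2) (lambda : 'I_2 -> R).
Hypothesis P_complete : measure_is_complete P.
Hypothesis lambda0 : forall i, 0 < lambda i.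
Hypothesis W_brownian : brownian_motion P W.
Hypothesis eps_markov : markov_chain P (generator lambda) eps.
Hypothesis W_eps_independent : independent_systems P
  (process_sigma measurable W `[0, +oo[) (process_sigma setT eps `[0, +oo[).
Notation Fmeas := (Fmeas P W eps).
Notation Gmeas := (Gmeas P W eps).
Notation FT t := (g_sigma_algebraType (genF P W eps t)).
Variables (sigma : 'I_2 -> R) (M : R -> Omega -> R) (C : R).
Hypothesis C0 : 0 < C.
Hypothesis dfM : diffusion P W eps sigma M C.
Variables (rho K : R) (v dv ddv : 'I_2 -> R -> R).
Hypothesis rho0 : 0 < rho.
Hypothesis sf : smooth_family K v dv ddv.
Variable (x0 : R).

Let Y t w := x0 + M t w.

Lemma Fmeas_state (u : 'I_2 -> R -> R) t : 0 <= t ->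
  (forall i, measurable_fun setT (u i)) -> Fmeas t (fun w => u (eps t w) (Y t w)).
Proof.
move=> t0 mu; rewrite (_ : (fun w => _) = fun w =>
    (eps t w == reg1)%:R * u reg1 (Y t w) + (eps t w == reg2)%:R * u reg2 (Y t w)).
  have mY : Fmeas t (Y t).
    apply: (@measurable_funD _ (FT t)); [exact: measurable_cst|exact: df_meas dfM _ t0].
  apply: (@measurable_funD _ (FT t)); apply: (@measurable_funM _ (FT t)).
  - exact: (Fmeas_eps (fun k => (k == reg1)%:R)).
  - exact: (@measurableT_comp _ _ _ (FT t) _ _ (u reg1) setT (Y t) (mu reg1) mY).
  - exact: (Fmeas_eps (fun k => (k == reg2)%:R)).
  - exact: (@measurableT_comp _ _ _ (FT t) _ _ (u reg2) setT (Y t) (mu reg2) mY).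
by apply/funext => w; case: (ord2P (eps t w)) => -> /=; rewrite mul0r mul1r ?addr0 ?add0r.
Qed.

Let derive_measurable (f df : R -> R) : (forall x : R, is_derive x 1 f (df x)) ->
  measurable_fun setT f.
Proof. by move=> fd; apply: continuous_measurable_fun; exact: is_derive_continuous fd. Qed.

Let mv i : measurable_fun setT (v i). Proof. exact: derive_measurable (sf_v sf i). Qed.
Let mdv i : measurable_fun setT (dv i). Proof. exact: derive_measurable (sf_dv sf i). Qed.
Let mddv i : measurable_fun setT (ddv i).
Proof.
apply: continuous_measurable_fun => x; apply/cvgrPdist_le => e e0.
have K0 : 0 < K by apply: lt_le_trans (sf_K sf).
near=> y; apply: (le_trans (sf_ddv_lip sf i x y)).
rewrite -ler_pdivlMl//; near: y.
by apply: (@cvgr_dist_le _ _ _ _ _ id); [exact: cvg_id|rewrite mulr_gt0// invr_gt0].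
Unshelve. all: by end_near. Qed.

Let L2Y t : 0 <= t -> L2 P (Y t).
Proof.
move=> t0; apply: L2D; last exact: df_L2 dfM _ t0.
by apply: (@L2_bounded _ _ _ _ _ `|x0|).
Qed.

Lemma state_L1 (u : 'I_2 -> R -> R) D t : 0 <= t -> (forall i, measurable_fun setT (u i)) ->
  (forall i x, `|u i x| <= D * (1 + `|x|)) -> L1 P (fun w => u (eps t w) (Y t w)).
Proof.
move=> t0 mu uD; apply: (@L1_le _ _ _ _ _ (fun w => D * (1 + `|Y t w|))).
- exact: (Fmeas_measurable P_complete W_brownian eps_markov (Fmeas_state t0 mu)).
- by move=> w; exact: uD.
- apply: L1Z; apply: L1D; first exact: L1_cst.
  by apply: L1_abs; apply: L2_L1; exact: L2Y.
Qed.

Lemma state_E_abs t : 0 <= t -> E P (fun w => `|Y t w|) <= `|x0| + (C * t + 1).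
Proof.
move=> t0; have LM := df_L2 dfM t0; have iM := L1_abs (L2_L1 LM).
have [_ iM2] := LM.
apply: (@le_trans _ _ (E P (fun w => `|x0| + (M t w ^+ 2 + 1)))).
  apply: E_le; [exact: L1_abs (L2_L1 (L2Y t0))| |].
    by apply: L1D; [exact: L1_cst|apply: L1D => //; exact: L1_cst].
  move=> w; apply: (le_trans (ler_normD _ _)); rewrite lerD2l.
  have := real_normK (num_real (M t w)) => <-.
  have := sqr_ge0 (`|M t w| - 1); have := normr_ge0 (M t w); nra.
rewrite !ED ?E_cst//; try exact: L1_cst; last first.
  by apply: L1D => //; exact: L1_cst.
by rewrite lerD2l lerD2r; exact: (diffusion_E_sqr dfM t0).
Qed.

Variable B : R.
Hypothesis sB : forall i, `|sigma i| <= B.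
Let Lam := lambda reg1 + lambda reg2.
Let K2 := K * (8 + 4 * rho + rho ^+ 2).

Section Step.
Variables (a s T : R) (xi : Omega -> R).
Hypotheses (a0 : 0 <= a) (s0 : 0 < s) (s1 : s <= 1) (bT : a + s ^+ 2 <= T).
Hypotheses (Fxi : Fmeas a xi) (xi1 : forall w, `|xi w| <= 1).
(** The step has length [s ^+ 2]: then [s] is the size of a Brownian increment and the error is of
    order [s ^+ 3]. *)
Let b := a + s ^+ 2.
Let ab : a <= b. Proof. by rewrite lerDl sqr_ge0. Qed.
Let b0 : 0 <= b. Proof. exact: le_trans ab. Qed.
Let ba : b - a = s ^+ 2. Proof. by rewrite /b; ring. Qed.
Let dWt w := W b w - W a w.
Let D w := sigma (eps a w) * dWt w.
Let De w := M b w - M a w - sigma (eps a w) * (W b w - W a w).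
Let ne w : R := (eps b w != eps a w)%:R.
(** The part whose expectation is computed; [rem] is only estimated. *)
Let main w := dv (eps a w) (Y a w) * (M b w - M a w) +
  ddv (eps a w) (Y a w) / 2 * D w ^+ 2 +
  ne w * (v (rev_ord (eps a w)) (Y a w) - v (eps a w) (Y a w)) -
  rho * s ^+ 2 * v (eps a w) (Y a w).
Let rem w := expR (- rho * s ^+ 2) * v (eps b w) (Y b w) - v (eps a w) (Y a w) - main w.

Let K0 : 0 < K. Proof. exact: lt_le_trans (sf_K sf). Qed.
Let K20 : 0 < K2.
Proof. by apply: mulr_gt0 => //; have := sqr_ge0 rho; have := rho0; lra. Qed.
Let B0 : 0 <= B. Proof. exact: le_trans (sB reg1). Qed.
Let Lam0 : 0 < Lam. Proof. exact: addr_gt0. Qed.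

Let mxi : measurable_fun setT xi.
Proof. exact: (Fmeas_measurable P_complete W_brownian eps_markov Fxi). Qed.

Let Gne : Gmeas a ne.
Proof.
have := @Gmeas_eps2 _ _ _ P W eps a (fun i j => (i != j)%:R) b a b0 a0; exact.
Qed.
Let ne1 w : `|ne w| <= 1.
Proof. by rewrite /ne; case: (_ != _); rewrite ?normr0 ?normr1. Qed.
Let ne0 w : 0 <= ne w. Proof. by rewrite /ne. Qed.
Let L1ne : L1 P ne.
Proof.
apply: (@L1_bounded _ _ _ _ _ 1) => //.
exact: (Gmeas_measurable P_complete W_brownian eps_markov Gne).
Qed.
Let E_ne : E P ne <= 2 * Lam * s ^+ 2.
Proof.
by rewrite -ba; exact: (regime_change_prob P_complete lambda0 W_brownian eps_markov W_eps_independent a0 ab).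
Qed.

Let bound w := s^-1 * De w ^+ 2 + s * (B ^+ 2 * dWt w ^+ 2) +
  s^-1 * (B ^+ 4 * dWt w ^+ 4) + s^-1 * (B ^+ 2 * (ne w * dWt w ^+ 2)) +
  s * ne w + s ^+ 3 + s ^+ 4 * (1 + `|Y b w|).

Let rem_bound w : `|rem w| <= K2 * bound w.
Proof.
have sgB := sB (eps a w).
have sq2 : sigma (eps a w) ^+ 2 <= B ^+ 2.
  by rewrite -(real_normK (num_real (sigma _))) lerXn2r ?nnegrE.
have D2 : D w ^+ 2 <= B ^+ 2 * dWt w ^+ 2 by rewrite exprMn ler_wpM2r ?sqr_ge0.
have D4 : D w ^+ 4 <= B ^+ 4 * dWt w ^+ 4.
  rewrite exprMn ler_wpM2r//; first by rewrite exprn_even_ge0.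
  by rewrite (_ : 4 = 2 * 2)%N// !exprM lerXn2r ?nnegrE ?sqr_ge0.
have := taylor_step_amgm rho0 sf (eps a w) (eps b w) (Y a w) (D w) (De w) s0 s1.
have -> : Y a w + D w + De w = Y b w by rewrite /Y /D /De /dWt; ring.
rewrite (_ : D w + De w = M b w - M a w); last by rewrite /D /De /dWt; ring.
move/le_trans; apply; rewrite -/K2 ler_pM2l//.
have S0 : 0 <= s^-1 by rewrite invr_ge0 ltW.
rewrite /bound -!addrA lerD2l; apply: lerD; first by rewrite ler_wpM2l// ltW.
apply: lerD; first by rewrite ler_wpM2l.
apply: lerD => //.
by rewrite -/(ne w) ler_wpM2l// (mulrCA (B ^+ 2)); exact: ler_wpM2l.
Qed.

(** Each term is of order [s ^+ 3]: the local error and the fourth moment are of order [s ^+ 4]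
    before division by [s], and so is the product of [ne] with the squared increment, which are
    independent because [ne] depends on the chain alone. *)
Let L1bound : L1 P bound /\
  E P bound <= (C + B ^+ 2 + 64 * B ^+ 4 + 2 * Lam * B ^+ 2 + 2 * Lam + 1 +
                (2 + `|x0| + C * T)) * s ^+ 3.
Proof.
have [LDe EDe] := df_local dfM a0 ab; have [_ iDe] := LDe.
have [[mW iW2] EW2] := increment_sqr W_brownian a0 ab.
have s20 : 0 < s ^+ 2 by rewrite exprn_gt0.
have [iW4 EW4] := increment_moment4 W_brownian a0 s20.
rewrite -/b in iW4 EW4.
have [iN EN] := increment_indep_sqr P_complete W_brownian eps_markov W_eps_independent a0 ab (fun=> Gne) L1ne.
have iY : L1 P (fun w => `|Y b w|) by apply: L1_abs; apply: L2_L1; exact: L2Y.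
have i7 : L1 P (fun w => s ^+ 4 * (1 + `|Y b w|)).
  by apply: L1Z; apply: L1D => //; exact: L1_cst.
have j1 := L1Z s^-1 iDe.
have j2 := L1Z s (L1Z (B ^+ 2) iW2).
have j3 := L1Z s^-1 (L1Z (B ^+ 4) iW4).
have j4 := L1Z s^-1 (L1Z (B ^+ 2) iN).
have j5 := L1Z s L1ne.
have j6 := L1_cst P (s ^+ 3).
have k2 := L1D j1 j2; have k3 := L1D k2 j3; have k4 := L1D k3 j4.
have k5 := L1D k4 j5; have k6 := L1D k5 j6; have k7 := L1D k6 i7.
split; first exact: k7.
rewrite /bound (ED k6 i7) (ED k5 j6) (ED k4 j5) (ED k3 j4) (ED k2 j3) (ED j1 j2).
have iY1 : L1 P (fun w => 1 + `|Y b w|) by apply: L1D => //; exact: L1_cst.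
rewrite E_cst (EZ s^-1 iDe) (EZ s (L1Z (B ^+ 2) iW2)) (EZ _ iW2).
rewrite (EZ s^-1 (L1Z (B ^+ 4) iW4)) (EZ _ iW4) (EZ s^-1 (L1Z (B ^+ 2) iN)) (EZ _ iN).
rewrite (EZ s L1ne) (EZ _ iY1) (ED (L1_cst P 1) iY) E_cst.
rewrite EW2 EN ba.
have S0 : 0 < s^-1 by rewrite invr_gt0.
have sS : s^-1 * s = 1 by rewrite mulVf// gt_eqF.
have e1 : s^-1 * E P (fun w => De w ^+ 2) <= C * s ^+ 3.
  apply: (@le_trans _ _ (s^-1 * (C * (b - a) ^+ 2))); first by rewrite ler_pM2l.
  rewrite ba (_ : s^-1 * _ = (s^-1 * s) * (C * s ^+ 3)); last by ring.
  by rewrite sS mul1r.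
have e2 : s * (B ^+ 2 * s ^+ 2) = B ^+ 2 * s ^+ 3 by ring.
have e3 : s^-1 * (B ^+ 4 * E P (fun w => dWt w ^+ 4)) <= 64 * B ^+ 4 * s ^+ 3.
  apply: (@le_trans _ _ (s^-1 * (B ^+ 4 * (64 * (s ^+ 2) ^+ 2)))).
    by rewrite ler_pM2l// ler_wpM2l ?exprn_ge0.
  rewrite (_ : s^-1 * _ = (s^-1 * s) * (64 * B ^+ 4 * s ^+ 3)); last by ring.
  by rewrite sS mul1r.
have e4 : s^-1 * (B ^+ 2 * (E P ne * s ^+ 2)) <= 2 * Lam * B ^+ 2 * s ^+ 3.
  apply: (@le_trans _ _ (s^-1 * (B ^+ 2 * (2 * Lam * s ^+ 2 * s ^+ 2)))).
    rewrite ler_pM2l// ler_wpM2l ?exprn_ge0//.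
    by apply: ler_wpM2r => //; exact: ltW.
  rewrite (_ : s^-1 * _ = (s^-1 * s) * (2 * Lam * B ^+ 2 * s ^+ 3)); last by ring.
  by rewrite sS mul1r.
have e5 : s * E P ne <= 2 * Lam * s ^+ 3.
  rewrite (_ : 2 * Lam * _ = s * (2 * Lam * s ^+ 2)); last by ring.
  by rewrite ler_pM2l.
have e7 : s ^+ 4 * (1 + E P (fun w => `|Y b w|)) <= (2 + `|x0| + C * T) * s ^+ 3.
  have hY := state_E_abs b0.
  have h1 : 1 + E P (fun w => `|Y b w|) <= 2 + `|x0| + C * T.
    have : C * b <= C * T by rewrite ler_pM2l.
    lra.
  have h2 : 0 <= 1 + E P (fun w => `|Y b w|) by rewrite addr_ge0//; apply: E_ge0.
  rewrite mulrC; apply: ler_pM => //; first by rewrite exprn_ge0// ltW.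
  by rewrite exprS ler_piMl// exprn_ge0// ltW.
rewrite !mulrDl; lra.
Qed.

Let FT_mul U V : Fmeas a U -> Fmeas a V -> Fmeas a (fun w => U w * V w).
Proof. exact: (@measurable_funM _ (FT a)). Qed.

Let vdiff i x := v (rev_ord i) x - v i x.
Let mvdiff i : measurable_fun setT (vdiff i). Proof. exact: measurable_funB. Qed.

Let grow : forall i x, `|v i x| <= K * (1 + `|x|).
Proof. by move=> i x; exact: (sf_growth sf). Qed.

Let iv : L1 P (fun w => v (eps a w) (Y a w)). Proof. exact: state_L1 grow. Qed.

Let ixi U : L1 P U -> L1 P (fun w => xi w * U w).
Proof. exact: L1Mb. Qed.

(** The linear term vanishes by orthogonality, the quadratic one has conditional mean [s ^+ 2] by
    independence, and the Markov property gives the regime term exactly, with [ah] in place of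
    [s ^+ 2]. The discrepancy [ah - s ^+ 2] is of order [s ^+ 4]. *)
Let main_E : L1 P main /\
  `|E P (fun w => xi w * main w) -
    s ^+ 2 * E P (fun w => xi w * generator_op rho v ddv sigma lambda (eps a w) (Y a w))| <=
  Lam ^+ 2 * K * s ^+ 3.
Proof.
have [[mW iW2] EW2] := increment_sqr W_brownian a0 ab.
have LdM : L2 P (fun w => M b w - M a w).
  by apply: L2B; apply: (df_L2 dfM).
have Fdv := Fmeas_state a0 mdv.
have bdv w : `|dv (eps a w) (Y a w)| <= K by exact: (sf_dv_bnd sf).
have mF U : Fmeas a U -> measurable_fun setT U.
  exact: (Fmeas_measurable P_complete W_brownian eps_markov).
have i1 : L1 P (fun w => dv (eps a w) (Y a w) * (M b w - M a w)).
  by apply: (L1Mb (mF _ Fdv) bdv); exact: L2_L1.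
have E1 : E P (fun w => xi w * (dv (eps a w) (Y a w) * (M b w - M a w))) = 0.
  under eq_fun do rewrite mulrA.
  apply: (df_orth dfM a0 ab); first exact: FT_mul.
  apply: (@L2_bounded _ _ _ _ _ (1 * K)); first by apply: mF; exact: FT_mul.
  by move=> w; rewrite normrM ler_pM.
pose q w := sigma (eps a w) ^+ 2 / 2 * ddv (eps a w) (Y a w).
have Fq : Fmeas a q.
  by apply: FT_mul; [exact: (Fmeas_eps (fun k => sigma k ^+ 2 / 2))|exact: Fmeas_state].
have bq w : `|q w| <= B ^+ 2 / 2 * K.
  rewrite normrM; apply: ler_pM => //; last exact: (sf_ddv_bnd sf).
  rewrite ger0_norm ?divr_ge0 ?sqr_ge0// ler_pM2r//.
  by rewrite -(real_normK (num_real (sigma _))) lerXn2r ?nnegrE.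
have iq : L1 P q by by apply: (@L1_bounded _ _ _ _ _ (B ^+ 2 / 2 * K)) => //; exact: mF.
have xiq := ixi iq.
have [i2 E2] := increment_indep_sqr P_complete W_brownian eps_markov W_eps_independent a0 ab
  (fun=> Fmeas_Gmeas (FT_mul Fxi Fq)) xiq.
have [i2' _] := increment_indep_sqr P_complete W_brownian eps_markov W_eps_independent a0 ab
  (fun=> Fmeas_Gmeas Fq) iq.
have q2 w : ddv (eps a w) (Y a w) / 2 * D w ^+ 2 = q w * (W b w - W a w) ^+ 2.
  by rewrite /q /D /dWt; field.
have bvd i x : `|vdiff i x| <= K by exact: (sf_diff sf).
have Fvd i : Fmeas a (fun w => vdiff i (Y a w)).
  by apply: (@Fmeas_state (fun=> vdiff i)).
have Fvde := Fmeas_state a0 mvdiff.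
have ivd : L1 P (fun w => vdiff (eps a w) (Y a w)).
  by apply: (@L1_bounded _ _ _ _ _ K) => [|w]; [exact: mF|exact: bvd].
have i3 : L1 P (fun w => ne w * vdiff (eps a w) (Y a w)).
  by apply: (L1Mb _ ne1) => //; exact: (Gmeas_measurable P_complete W_brownian eps_markov Gne).
pose ah := (1 - expR (- (Lam * s ^+ 2))) / Lam.
have [ah1 /andP[ah0 ah2]] := transition_bounds lambda0 (sqr_ge0 s).
rewrite -/Lam -/ah in ah0 ah1 ah2.
have ixv i : L1 P (fun w => xi w * vdiff i (Y a w)).
  apply: (@L1_bounded _ _ _ _ _ (1 * K)) => [|w]; last by rewrite normrM ler_pM.
  by apply: mF; apply: FT_mul.
have mi (i : 'I_2) : measurable_fun setT (fun w => (eps a w == i)%:R : R).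
  by apply: mF; exact: (Fmeas_eps (fun k => (k == i)%:R)).
have bi (i : 'I_2) w : `|(eps a w == i)%:R : R| <= 1.
  by case: (_ == _); rewrite ?normr0 ?normr1.
pose J i w := (eps a w == i)%:R * (xi w * vdiff i (Y a w)).
have iJ i : L1 P (J i) by apply: (L1Mb (mi i) (bi i)).
have mkv i : E P (fun w => (eps a w == i)%:R * (eps b w == rev_ord i)%:R *
    (xi w * vdiff i (Y a w))) = lambda i * ah * E P (J i).
  rewrite (markov_E P_complete lambda0 W_brownian eps_markov W_eps_independent) ?sqr_ge0//; last first.
    exact: FT_mul.
  have ir : i != rev_ord i by case: (ord2P i) => ->; rewrite ?rev_reg1 ?rev_reg2.
  by have [_ ->] := transitionE lambda (s ^+ 2) ir.
have iK i : L1 P (fun w => (eps a w == i)%:R * (eps b w == rev_ord i)%:R *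
    (xi w * vdiff i (Y a w))).
  apply: (@L1Mb _ _ _ _ _ _ 1) => //.
    apply: measurable_funM => //.
    exact: (Fmeas_measurable P_complete W_brownian eps_markov (Fmeas_eps (fun k => (k == rev_ord i)%:R) b0)).
  by move=> w; case: (_ == _); case: (_ == _); rewrite ?mulr0 ?mulr1 ?normr0 ?normr1.
have E3 : E P (fun w => xi w * (ne w * vdiff (eps a w) (Y a w))) =
    ah * E P (fun w => xi w * (lambda (eps a w) * vdiff (eps a w) (Y a w))).
  have -> : (fun w => xi w * (ne w * vdiff (eps a w) (Y a w))) =
    (fun w => (eps a w == reg1)%:R * (eps b w == rev_ord reg1)%:R * (xi w * vdiff reg1 (Y a w)) +
     (eps a w == reg2)%:R * (eps b w == rev_ord reg2)%:R * (xi w * vdiff reg2 (Y a w))).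
    apply/funext => w; rewrite /ne rev_reg1 rev_reg2.
    case: (ord2P (eps a w)) => ->; case: (ord2P (eps b w)) => -> /=;
      by rewrite ?eqxx /= ?mul0r ?mulr0 ?mulr1 ?mul0r ?mul1r ?addr0 ?add0r ?mulr0.
  rewrite ED// !mkv.
  have -> : (fun w => xi w * (lambda (eps a w) * vdiff (eps a w) (Y a w))) =
      (fun w => lambda reg1 * J reg1 w + lambda reg2 * J reg2 w).
    apply/funext => w; rewrite /J.
    by case: (ord2P (eps a w)) => -> /=; rewrite ?mul0r ?mul1r ?mulr0 ?addr0 ?add0r mulrCA.
  rewrite ED ?EZ//; [ring|exact: L1Z|exact: L1Z].
pose lv w := lambda (eps a w) * vdiff (eps a w) (Y a w).
have lam_le i : 0 <= lambda i <= Lam.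
  rewrite /Lam; have := lambda0 reg1; have := lambda0 reg2.
  by case: (ord2P i) => -> ? ?; apply/andP; split; lra.
have blv w : `|lv w| <= Lam * K.
  rewrite normrM; apply: ler_pM => //.
  by have /andP[h1 h2] := lam_le (eps a w); rewrite ger0_norm.
have Flv : Fmeas a lv by apply: FT_mul => //; exact: Fmeas_eps.
have ilv : L1 P lv by by apply: (@L1_bounded _ _ _ _ _ (Lam * K)) => //; exact: mF.
have i4 := L1Z (rho * s ^+ 2) iv.
have mainE w : main w = dv (eps a w) (Y a w) * (M b w - M a w) +
    q w * (W b w - W a w) ^+ 2 + ne w * vdiff (eps a w) (Y a w) -
    rho * s ^+ 2 * v (eps a w) (Y a w) by rewrite /main q2.
have k2 := L1D i1 i2'; have k3 := L1D k2 i3; have k4 := L1B k3 i4.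
have imain : L1 P main by move: k4; under eq_fun do rewrite -mainE.
split=> //.
have -> : (fun w => xi w * main w) = fun w =>
    xi w * (dv (eps a w) (Y a w) * (M b w - M a w)) +
    xi w * q w * (W b w - W a w) ^+ 2 +
    xi w * (ne w * vdiff (eps a w) (Y a w)) - rho * s ^+ 2 * (xi w * v (eps a w) (Y a w)).
  by apply/funext => w; rewrite mainE; ring.
have l1 := ixi i1; have l3 := ixi i3; have l4 := L1Z (rho * s ^+ 2) (ixi iv).
rewrite EB//; last by apply: L1D => //; exact: L1D.
rewrite ED//; last exact: L1D.
rewrite ED// E1 E2 E3 EZ ?ba; last exact: ixi.
have -> : (fun w => xi w * generator_op rho v ddv sigma lambda (eps a w) (Y a w)) =
    fun w => xi w * q w - rho * (xi w * v (eps a w) (Y a w)) + xi w * lv w.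
  by apply/funext => w; rewrite /generator_op /q /lv /vdiff; ring.
have l5 := L1Z rho (ixi iv).
rewrite ED//; [|exact: L1B|exact: ixi].
rewrite EB// EZ; last exact: ixi.
rewrite (_ : _ - _ = (ah - s ^+ 2) * E P (fun w => xi w * lv w)); last by rewrite /lv; ring.
rewrite normrM (_ : _ * s ^+ 3 = Lam * s ^+ 3 * (Lam * K)); last by ring.
apply: ler_pM => //.
  rewrite distrC ger0_norm ?subr_ge0//.
  apply: (@le_trans _ _ (Lam * (s ^+ 2) ^+ 2)); first by lra.
  by rewrite ler_pM2l// -exprM (_ : 2 * 2 = 1 + 3)%N// exprD ler_piMl// exprn_ge0// ltW.
rewrite -[leRHS](E_cst P); apply: E_le_abs.
- by apply: measurable_funM => //; apply: mF.
- exact: L1_cst.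
- by move=> w; rewrite normrM -[leRHS]mul1r; apply: ler_pM.
Qed.

Lemma one_step :
  `|E P (fun w => xi w * (expR (- rho * s ^+ 2) * v (eps b w) (Y b w) - v (eps a w) (Y a w))) -
    s ^+ 2 * E P (fun w => xi w * generator_op rho v ddv sigma lambda (eps a w) (Y a w))| <=
  (Lam ^+ 2 * K + K2 * (C + B ^+ 2 + 64 * B ^+ 4 + 2 * Lam * B ^+ 2 + 2 * Lam + 1 +
                (2 + `|x0| + C * T))) * s ^+ 3.
Proof.
have [imain Emain] := main_E; have [ib Eb] := L1bound.
have iend : L1 P (fun w => expR (- rho * s ^+ 2) * v (eps b w) (Y b w) - v (eps a w) (Y a w)).
  by apply: L1B => //; apply: L1Z; exact: state_L1 grow.
have irem : L1 P rem by exact: L1B.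
have -> : (fun w => xi w * (expR (- rho * s ^+ 2) * v (eps b w) (Y b w) - v (eps a w) (Y a w))) =
    fun w => xi w * rem w + xi w * main w.
  by apply/funext => w; rewrite /rem; ring.
rewrite ED; [|exact: ixi|exact: ixi].
rewrite -addrA; apply: (le_trans (ler_normD _ _)); rewrite mulrDl [leRHS]addrC; apply: lerD => //.
rewrite -mulrA; apply: (@le_trans _ _ (K2 * E P bound)); last by rewrite ler_pM2l.
rewrite -EZ//; apply: E_le_abs; [by apply: L1_measurable; exact: ixi|exact: L1Z|].
move=> w; rewrite normrM; apply: le_trans (rem_bound w).
by rewrite ler_piMl.
Qed.

End Step.
End OneStep.

(** * Comparison and convergence almost surely *)

Section AlmostEverywhere.
Context d (T : measurableType d) (R : realType) (P : probability T R).
Implicit Types U V : T -> R.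

Lemma E_le_ae U V : L1 P U -> L1 P V -> {ae P, forall w, U w <= V w} ->
  E P U <= E P V.
Proof.
move=> iU iV UV; have mU := L1_measurable iU; have mV := L1_measurable iV.
have mm : measurable_fun setT (fun w => Num.min (U w) (V w)) by exact: measurable_minr.
have im : L1 P (fun w => Num.min (U w) (V w)).
  apply: (L1_le mm _ (L1D (L1_abs iU) (L1_abs iV))) => w.
  have := normr_ge0 (U w); have := normr_ge0 (V w).
  by rewrite minEle; case: ifP => _; lra.
rewrite (E_ae (V := fun w => Num.min (U w) (V w))) => //.
  by apply: E_le => // w; rewrite ge_min lexx orbT.
by apply: filterS UV => w /min_idPl ->.
Qed.

Lemma L1_le_ae U V : measurable_fun setT U -> {ae P, forall w, `|U w| <= V w} ->
  L1 P V -> L1 P U.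
Proof.
move=> mU UV /integrableP[mV fV]; apply/integrableP; split; first exact/measurable_EFinP.
apply: le_lt_trans fV; apply: ae_ge0_le_integral => //.
- by apply: measurableT_comp => //; exact/measurable_EFinP.
- exact: measurableT_comp.
- by apply: filterS UV => w h _; rewrite /= lee_fin (le_trans h)// ler_norm.
Qed.

Lemma cvg_E_ae (U_ : nat -> T -> R) U V : (forall n, measurable_fun setT (U_ n)) ->
  measurable_fun setT U -> L1 P V ->
  {ae P, forall w, forall n, `|U_ n w| <= V w} ->
  {ae P, forall w, U_ ^~ w @ \oo --> U w} ->
  [/\ forall n, L1 P (U_ n), L1 P U & E P (U_ n) @[n --> \oo] --> E P U].
Proof.
move=> mU_ mU iV UV cU.
have mE n : measurable_fun setT (EFin \o U_ n) by exact/measurable_EFinP.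
have mEU : measurable_fun setT (EFin \o U) by exact/measurable_EFinP.
have iU_ n : L1 P (U_ n).
  by apply: L1_le_ae (mU_ n) _ iV; apply: filterS UV => w; apply.
have := @dominated_convergence _ T R P setT measurableT
  (fun n => EFin \o U_ n) (EFin \o U) (EFin \o V) mE mEU.
case.
- apply: filterS cU => w /= cUw _.
  by apply/fine_cvgP; split; [exact: nearW|exact: cUw].
- exact: iV.
- by apply: filterS UV => w h n _ /=; rewrite lee_fin.
- move=> iU _ /=; rewrite E_EFin//.
  under eq_fun => n do rewrite (E_EFin (iU_ n)).
  by move/fine_cvgP => -[_ h]; split.
Qed.

Lemma measurable_ae_cvg (U_ : nat -> T -> R) U : measure_is_complete P ->
  (forall n, measurable_fun setT (U_ n)) ->
  {ae P, forall w, U_ ^~ w @ \oo --> U w} -> measurable_fun setT U.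
Proof.
move=> cP mU_ [N [mN N0 sN]].
have mI : measurable_fun setT (\1_(~` N) : T -> R).
  by apply: measurable_indic; exact: measurableC.
have mV : measurable_fun setT (fun w => \1_(~` N) w * U w).
  apply: (@measurable_fun_cvg _ _ _ _ (fun n w => \1_(~` N) w * U_ n w)).
    by move=> n; exact: measurable_funM.
  move=> w _; rewrite indicE; case: (boolP (w \in ~` N)) => wN.
    under eq_fun do rewrite mul1r; rewrite mul1r.
    apply: contrapT => h; move: wN; rewrite in_setC => /negP; apply.
    by rewrite inE; apply: sN.
  under eq_fun do rewrite mul0r; rewrite mul0r; exact: cvg_cst.
apply/measurable_EFinP.
apply: (ae_measurable_fun cP (f := EFin \o (fun w => \1_(~` N) w * U w))).
  exists N; split=> // w /= h; apply: contrapT => wN; apply: h => _.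
  by rewrite /= indicE mem_set// mul1r.
exact/measurable_EFinP.
Qed.

End AlmostEverywhere.

Lemma regime_right_cont (R : realType) (e : R -> 'I_2) (y : R -> R) (u : 'I_2 -> R -> R) t :
  cadlag_path e -> {within `[0, +oo[, continuous y} -> 0 <= t ->
  (forall i, continuous (u i)) -> u (e s) (y s) @[s --> t^'+] --> u (e t) (y t).
Proof.
move=> [ce _] cy t0 cu.
have h : u (e t) (y s) @[s --> t^'+] --> u (e t) (y t).
  by apply: continuous_cvg; [exact: cu|exact: within_cvg_right].
apply: cvg_trans h; apply: near_eq_cvg; have := ce t t0; apply: filterS => s /= ->.
by [].
Qed.

(** * Evaluation at optional times *)

Section OptionalTimes.
Context d (Omega : measurableType d) (R : realType) (P : probability Omega R).
Variables (W : R -> Omega -> R) (eps : R -> Omega -> 'I_2) (lambda : 'I_2 -> R).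
Hypothesis P_complete : measure_is_complete P.
Hypothesis W_brownian : brownian_motion P W.
Hypothesis eps_markov : markov_chain P (generator lambda) eps.
Notation F := (augmented_filtration P W eps).

Lemma optional_measurable (tau : Omega -> R) : (forall w, 0 <= tau w) ->
  (forall t, 0 <= t -> F t [set w | tau w < t]) -> measurable_fun setT tau.
Proof.
move=> tau0 Ftau.
apply: (measurability _ (RGenInftyO.measurableE R)).
move=> _ [_ [a ->] <-]; rewrite setTI.
rewrite (_ : _ @^-1` _ = [set w | tau w < a]); last first.
  by apply/seteqP; split=> w /=; rewrite in_itv.
have [a0|a0] := ltP a 0.
  rewrite (_ : [set _ | _] = set0)// -subset0 => w /= h.
  by have := lt_trans h a0; rewrite ltNge tau0.
exact: (F_measurable P_complete W_brownian eps_markov (Ftau a a0)).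
Qed.

Variables (sigma : 'I_2 -> R) (M : R -> Omega -> R) (C : R).
Hypothesis dfM : diffusion P W eps sigma M C.

Lemma state_at_measurable (u : 'I_2 -> R -> R) x0 (tau : Omega -> R) :
  (forall i, continuous (u i)) -> (forall w, 0 <= tau w) -> measurable_fun setT tau ->
  measurable_fun setT (fun w => u (eps (tau w) w) (x0 + M (tau w) w)).
Proof.
move=> cu tau0 mtau.
apply: (measurable_ae_cvg P_complete (U_ := fun n w =>
  u (eps (grid R n (gnext n (tau w))) w) (x0 + M (grid R n (gnext n (tau w))) w))).
  move=> n; apply: (@measurable_countable_index _ _ _
    (fun k w => u (eps (grid R n k) w) (x0 + M (grid R n k) w)) (fun w => gnext n (tau w))).
    move=> k; apply: (Fmeas_measurable P_complete W_brownian eps_markov).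
    apply: (Fmeas_state dfM x0 (grid_ge0 R n k)) => i; exact: continuous_measurable_fun.
  exact: measurable_next.
apply: filterS2 (mc_cadlag eps_markov) (df_cont dfM) => w ce cM.
apply: (cvg_right_next (f := fun t => u (eps t w) (x0 + M t w)) (tau0 w)).
apply: regime_right_cont => // t; apply: cvgD; [exact: cvg_cst|exact: cM].
Qed.

End OptionalTimes.

(** * Dynkin's formula at bounded optional times *)

Section Dynkin.
Context d (Omega : measurableType d) (R : realType) (P : probability Omega R).
Variables (W : R -> Omega -> R) (eps : R -> Omega -> 'I_2) (lambda : 'I_2 -> R).
Hypothesis P_complete : measure_is_complete P.
Hypothesis lambda0 : forall i, 0 < lambda i.
Hypothesis W_brownian : brownian_motion P W.
Hypothesis eps_markov : markov_chain P (generator lambda) eps.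
Hypothesis W_eps_independent : independent_systems P
  (process_sigma measurable W `[0, +oo[) (process_sigma setT eps `[0, +oo[).
Notation F := (augmented_filtration P W eps).
Notation Fmeas := (Fmeas P W eps).
Notation FT t := (g_sigma_algebraType (genF P W eps t)).
Variables (sigma : 'I_2 -> R) (M : R -> Omega -> R) (C : R).
Hypothesis C0 : 0 < C.
Hypothesis dfM : diffusion P W eps sigma M C.
Variables (rho K : R) (v dv ddv : 'I_2 -> R -> R).
Hypothesis rho0 : 0 < rho.
Hypothesis sf : smooth_family K v dv ddv.
Variable (x0 : R).

Let Y t w := x0 + M t w.

Variables (G : Omega -> R).
Hypothesis G0 : forall w, 0 <= G w.
Hypothesis iG : L1 P G.
Hypothesis GM : {ae P, forall w t, 0 <= t -> expR (- rho * t) * `|M t w| <= G w}.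

Lemma discount_state_bound (u : 'I_2 -> R -> R) D : 0 <= D ->
  (forall i x, `|u i x| <= D * (1 + `|x|)) ->
  {ae P, forall w t, 0 <= t ->
    `|expR (- rho * t) * u (eps t w) (Y t w)| <= D * (1 + `|x0| + G w)}.
Proof.
move=> D0 uD; apply: filterS GM => w h t t0.
rewrite normrM ger0_norm ?expR_ge0//.
have e1 : expR (- rho * t) <= 1 by rewrite -expR0 ler_expR mulNr oppr_le0 mulr_ge0// ltW.
have e0 : 0 <= expR (- rho * t) by exact: expR_ge0.
apply: (@le_trans _ _ (expR (- rho * t) * (D * (1 + (`|x0| + `|M t w|))))).
  rewrite ler_wpM2l//; apply: (le_trans (uD _ _)); rewrite ler_wpM2l// lerD2l.
  exact: ler_normD.
rewrite mulrCA ler_wpM2l// !mulrDr mulr1 addrA; apply: lerD; last exact: h.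
by apply: lerD => //; rewrite ler_piMl.
Qed.

Variables (T : nat) (tau : Omega -> R) (D : set Omega).
Hypothesis tau0 : forall w, 0 <= tau w.
Hypothesis tauT : forall w, tau w <= T%:R.
Hypothesis Ftau : forall t, 0 <= t -> F t [set w | tau w < t].
Hypothesis FD : F 0 D.

Let N n := (T * 2 ^ n)%N.
Let kappa n w := minn (gnext n (tau w)) (N n).
Let U t w := expR (- rho * t) * v (eps t w) (Y t w).
Let t_ n k := grid R n k.
(** The step starting at [t_ n k] is taken as long as [tau] is not before that time. Strictness
    keeps the event in the sigma-algebra of time [t_ n k] even if [tau] is only optional. *)
Let A n k := D `&` ~` [set w | tau w < t_ n k].
Let g := generator_op rho v ddv sigma lambda.

Let FA n k : F (t_ n k) (A n k).
Proof.
apply: (@measurableI _ (FT (t_ n k))).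
  exact: F_mono (grid_ge0 R n k) _ FD.
by apply: (@measurableC _ (FT (t_ n k))); apply: Ftau; exact: grid_ge0.
Qed.

Let mA n k : measurable (A n k).
Proof. exact: (F_measurable P_complete W_brownian eps_markov (@FA n k)). Qed.

Let mD : measurable D.
Proof. exact: (F_measurable P_complete W_brownian eps_markov FD). Qed.

Let AE n k w : (k < N n)%N -> \1_(A n k) w = \1_D w * (k < kappa n w)%N%:R :> R.
Proof.
move=> kN; rewrite /A indicI /=; congr (_ * _); rewrite indicE; congr ((nat_of_bool _)%:R).
rewrite leq_min kN andbT ltnNge next_le_nat//.
by apply/idP/idP; rewrite ?inE /= => /negP.
Qed.

Let telescope n w : \1_D w * U (t_ n (kappa n w)) w - \1_D w * U 0 w =
  \sum_(k < N n) \1_(A n k) w * (U (t_ n k.+1) w - U (t_ n k) w).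
Proof.
rewrite (eq_bigr (fun k : 'I_(N n) => \1_D w * ((k < kappa n w)%N%:R *
    (U (t_ n k.+1) w - U (t_ n k) w)))); last first.
  by move=> k _; rewrite AE// mulrA.
rewrite -mulr_sumr -mulrBr; congr (_ * _).
have : (kappa n w <= N n)%N by rewrite geq_minr.
have -> : U 0 w = U (t_ n 0) w by rewrite /t_ grid0.
move: (kappa n w) (N n) => m; elim=> [|j ih] mj.
  by move: mj; rewrite leqn0 => /eqP ->; rewrite big_ord0 subrr.
rewrite big_ord_recr/=; move: mj; rewrite leq_eqVlt => /predU1P[->|].
  rewrite ltnSn mul1r (eq_bigr (fun k : 'I_j => U (t_ n k.+1) w - U (t_ n k) w)); last first.
    by move=> k _; rewrite (leq_trans (ltn_ord k) (leqnSn _)) mul1r.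
  rewrite -(big_mkord xpredT (fun k => U (t_ n k.+1) w - U (t_ n k) w)).
  by rewrite telescope_sumr// addrC addrA subrK.
by rewrite ltnS => mj; rewrite ltnNge mj mul0r addr0; exact: ih.
Qed.

Let cv i : continuous (v i).
Proof. exact: is_derive_continuous (sf_v sf i). Qed.
Let mv i : measurable_fun setT (v i).
Proof. exact: continuous_measurable_fun. Qed.
Let cddv i : continuous (ddv i).
Proof.
move=> x; apply/cvgrPdist_le => e e0.
have K0 : 0 < K by apply: lt_le_trans (sf_K sf).
near=> y; apply: (le_trans (sf_ddv_lip sf i x y)).
rewrite -ler_pdivlMl//; near: y.
by apply: (@cvgr_dist_le _ _ _ _ _ id); [exact: cvg_id|rewrite mulr_gt0// invr_gt0].
Unshelve. all: by end_near. Qed.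
Let mg i : measurable_fun setT (g i).
Proof.
apply: measurable_funD; last first.
  by apply: measurable_funM => //; exact: measurable_funB.
apply: measurable_funB; apply: measurable_funM => //.
exact: continuous_measurable_fun.
Qed.

Let K0 : 0 < K. Proof. exact: lt_le_trans (sf_K sf). Qed.

Let mU t : 0 <= t -> measurable_fun setT (U t).
Proof.
move=> t0; apply: measurable_funM => //.
exact: (Fmeas_measurable P_complete W_brownian eps_markov (Fmeas_state dfM x0 t0 mv)).
Qed.

Let iU t : 0 <= t -> L1 P (U t).
Proof.
move=> t0; apply: L1Z.
exact: (state_L1 P_complete W_brownian eps_markov dfM x0 t0 mv (fun i x => sf_growth sf i x)).
Qed.

Let cadlag_ae : {ae P, forall w, cadlag_path (eps ^~ w)} := mc_cadlag eps_markov.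

Let state_cvg (u : 'I_2 -> R -> R) : (forall i, continuous (u i)) ->
  {ae P, forall w, expR (- rho * t_ n (kappa n w)) *
      u (eps (t_ n (kappa n w)) w) (Y (t_ n (kappa n w)) w) @[n --> \oo] -->
    expR (- rho * tau w) * u (eps (tau w) w) (Y (tau w) w)}.
Proof.
move=> cu; apply: filterS2 cadlag_ae (df_cont dfM) => w ce cM.
have cY : {within `[0, +oo[, continuous (Y ^~ w)}.
  by move=> t; apply: cvgD; [exact: cvg_cst|exact: cM].
(* On [tau = T] the cap in [kappa] is reached at every level and the sequence is constant. *)
have [tT|Tt] := ltP (tau w) T%:R; last first.
  have tE : tau w = T%:R by apply/le_anti; rewrite tauT Tt.
  rewrite (_ : (fun n => _) = fun=> expR (- rho * tau w) * u (eps (tau w) w) (Y (tau w) w)).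
    exact: cvg_cst.
  apply/funext => n; rewrite /kappa (minn_idPr _).
    by rewrite /t_ grid_nat tE.
  by rewrite ltnW// ltnNge next_le_nat// grid_nat tE ltxx.
have kE n : kappa n w = gnext n (tau w).
  by apply/minn_idPl; rewrite next_le_nat// grid_nat.
under eq_fun do rewrite kE.
apply: (cvg_right_next (f := fun t => expR (- rho * t) * u (eps t w) (Y t w)) (tau0 w)).
apply: cvgM; last exact: regime_right_cont.
apply: cvg_at_right_filter; apply: continuous_comp; last exact: continuous_expR.
exact: mulrl_continuous.
Qed.

Let mtau : measurable_fun setT tau.
Proof. exact (optional_measurable P_complete W_brownian eps_markov tau0 Ftau). Qed.

Let mkappa n k : measurable [set w | kappa n w = k].
Proof.
have mn := measurable_next n tau0 mtau.
rewrite (_ : [set _ | _] = \bigcup_(j in [set j | minn j (N n) = k]) [set w | gnext n (tau w) = j]).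
  by apply: bigcup_measurable => j _.
apply/seteqP; split=> w /=; first by move=> h; exists (gnext n (tau w)).
by move=> [j /= jk h]; rewrite /kappa h.
Qed.

Let mUk n : measurable_fun setT (fun w => U (t_ n (kappa n w)) w).
Proof.
apply: (@measurable_countable_index _ _ _ (fun k w => U (t_ n k) w) (kappa n)) => // k.
by apply: mU; exact: grid_ge0.
Qed.

Let mIU n : measurable_fun setT (fun w => \1_D w * U (t_ n (kappa n w)) w).
Proof. by apply: measurable_funM => //; exact: measurable_indic. Qed.

Let mUtau : measurable_fun setT (fun w => \1_D w * U (tau w) w).
Proof.
apply: measurable_funM; first exact: measurable_indic.
apply: (measurable_ae_cvg P_complete mUk); exact: state_cvg.
Qed.

Let dom := fun w => K * (1 + `|x0| + G w).
Let idom : L1 P dom.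
Proof. by apply: L1Z; apply: L1D => //; exact: L1_cst. Qed.

Let Ubound : {ae P, forall w t, 0 <= t -> `|U t w| <= dom w}.
Proof. by apply: discount_state_bound; [exact: ltW|move=> i x; exact: (sf_growth sf)]. Qed.

Let E_cvg : [/\ forall n, L1 P (fun w => \1_D w * U (t_ n (kappa n w)) w),
  L1 P (fun w => \1_D w * U (tau w) w) &
  E P (fun w => \1_D w * U (t_ n (kappa n w)) w) @[n --> \oo] -->
  E P (fun w => \1_D w * U (tau w) w)].
Proof.
have ind w : 0 <= (\1_D w : R) <= 1 by rewrite indicE; case: (w \in D) => /=; lra.
apply: (cvg_E_ae mIU mUtau idom).
  apply: filterS Ubound => w h n; apply: le_trans (h _ (grid_ge0 R n (kappa n w))).
  have /andP[i0 i1] := ind w.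
  by rewrite normrM ger0_norm// ler_piMl.
by apply: filterS (state_cvg cv) => w h; apply: cvgM => //; exact: cvg_cst.
Qed.

Variable B : R.
Hypothesis sB : forall i, `|sigma i| <= B.

Let Kg := K * (B ^+ 2 / 2 + rho + lambda reg1 + lambda reg2).
Let g_growth i x : `|g i x| <= Kg * (1 + `|x|).
Proof.
have l1 := lambda0 reg1; have l2 := lambda0 reg2.
have ll : 0 < lambda i <= lambda reg1 + lambda reg2.
  by case: (ord2P i) => ->; apply/andP; split=> //; lra.
have sg : sigma i ^+ 2 <= B ^+ 2.
  by rewrite -(real_normK (num_real (sigma i))) lerXn2r ?nnegrE// (le_trans _ (sB i)).
have h1 : `|sigma i ^+ 2 / 2 * ddv i x| <= B ^+ 2 / 2 * K.
  rewrite normrM ger0_norm ?divr_ge0 ?sqr_ge0//.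
  by apply: ler_pM; rewrite ?divr_ge0 ?sqr_ge0// ?ler_pM2r//; exact: (sf_ddv_bnd sf).
have h2 : `|rho * v i x| <= rho * (K * (1 + `|x|)).
  by rewrite normrM (gtr0_norm rho0) ler_pM2l//; exact: (sf_growth sf).
have h3 : `|lambda i * (v (rev_ord i) x - v i x)| <= (lambda reg1 + lambda reg2) * K.
  have /andP[p q] := ll; rewrite normrM (gtr0_norm p).
  by apply: ler_pM => //; [exact: ltW|exact: (sf_diff sf)].
apply: (le_trans (ler_normD _ _)); apply: (le_trans (lerD (ler_normB _ _) (lexx _))).
have x0' : 0 <= `|x| by [].
have p1 : 0 <= B ^+ 2 / 2 * K * `|x|.
  by apply: mulr_ge0 => //; apply: mulr_ge0; [rewrite divr_ge0 ?sqr_ge0|exact: ltW].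
have p2 : 0 <= (lambda reg1 + lambda reg2) * K * `|x|.
  by apply: mulr_ge0 => //; apply: mulr_ge0; [lra|exact: ltW].
rewrite (_ : Kg * (1 + `|x|) = B ^+ 2 / 2 * K + B ^+ 2 / 2 * K * `|x| + rho * (K * (1 + `|x|)) +
  ((lambda reg1 + lambda reg2) * K + (lambda reg1 + lambda reg2) * K * `|x|)); last by rewrite /Kg; ring.
lra.
Qed.

Let drift n := \sum_(k < N n) expR (- rho * t_ n k) * (mesh R n *
  E P (fun w => \1_(A n k) w * g (eps (t_ n k) w) (Y (t_ n k) w))).

Let discrete_dynkin : exists K1 : R, forall n,
  `|E P (fun w => \1_D w * U (t_ n (kappa n w)) w) - E P (fun w => \1_D w * U 0 w) - drift n| <=
  K1 * T%:R * Num.sqrt (mesh R n).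
Proof.
pose K1 := (lambda reg1 + lambda reg2) ^+ 2 * K + K * (8 + 4 * rho + rho ^+ 2) *
  (C + B ^+ 2 + 64 * B ^+ 4 + 2 * (lambda reg1 + lambda reg2) * B ^+ 2 +
   2 * (lambda reg1 + lambda reg2) + 1 + (2 + `|x0| + C * T%:R)).
exists K1 => n.
have [iUk _ _] := E_cvg.
have iU0 : L1 P (fun w => \1_D w * U 0 w) by apply: L1_indic => //; exact: iU.
rewrite -EB// (_ : (fun w => _) = fun w => \sum_(k < N n)
  \1_(A n k) w * (U (t_ n k.+1) w - U (t_ n k) w)); last by apply/funext => w; exact: telescope.
have idU k : L1 P (fun w => U (t_ n k.+1) w - U (t_ n k) w).
  by apply: L1B; apply: iU; exact: grid_ge0.
rewrite E_sum; last by move=> k _; apply: L1_indic.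
rewrite /drift -sumrB.
set s := Num.sqrt (mesh R n).
have s0 : 0 < s by rewrite sqrtr_gt0 mesh_gt0.
have s2 : s ^+ 2 = mesh R n by rewrite sqr_sqrtr// ltW// mesh_gt0.
have s1 : s <= 1 by rewrite -[leRHS]sqrtr1 ler_wsqrtr// mesh_le1.
apply: (le_trans (ler_norm_sum _ _ _)).
(* There are [T * 2 ^+ n] steps of length [s ^+ 2], so errors of order [s ^+ 3] add up to order
   [s]. *)
apply: (@le_trans _ _ (\sum_(k < N n) K1 * s ^+ 3)); last first.
  rewrite sumr_const card_ord -[leLHS]mulr_natr exprS s2.
  have -> : (N n)%:R = T%:R * 2 ^+ n :> R by rewrite /N natrM natrX.
  have -> : K1 * (s * mesh R n) * (T%:R * 2 ^+ n) = K1 * T%:R * (2 ^+ n * mesh R n) * s by ring.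
  by rewrite pow2_mesh mulr1.
apply: ler_sum => k _.
have tS : t_ n k.+1 = t_ n k + s ^+ 2 by rewrite /t_ gridS s2.
have := @one_step _ _ _ P W eps lambda P_complete lambda0 W_brownian eps_markov
  W_eps_independent sigma M C C0 dfM rho K v dv ddv rho0 sf x0 B sB (t_ n k) s T%:R (\1_(A n k))
  (grid_ge0 R n k) s0 s1 _ (Fmeas_indic (@FA n k)) _.
rewrite -tS s2 -/g => /(_ _ _) h.
have hh : t_ n k.+1 <= T%:R by rewrite -(grid_nat R n); exact: grid_le.
have {}h := h hh (fun w => _).
have e1 : expR (- rho * t_ n k) <= 1.
  by rewrite -expR0 ler_expR mulNr oppr_le0 mulr_ge0 ?grid_ge0// ltW.
rewrite (_ : (fun w => _) = fun w => expR (- rho * t_ n k) * (\1_(A n k) w *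
  (expR (- rho * mesh R n) * v (eps (t_ n k.+1) w) (Y (t_ n k.+1) w) -
   v (eps (t_ n k) w) (Y (t_ n k) w)))); last first.
  have eS : expR (- rho * t_ n k.+1) = expR (- rho * t_ n k) * expR (- rho * mesh R n).
    by rewrite -expRD -mulrDr /t_ gridS.
  by apply/funext => w; rewrite /U eS; ring.
rewrite EZ; last first.
  apply: L1_indic => //; apply: L1B.
    apply: L1Z; apply: (state_L1 P_complete W_brownian eps_markov dfM x0 (grid_ge0 R n k.+1) mv (fun i x => sf_growth sf i x)).
  exact: (state_L1 P_complete W_brownian eps_markov dfM x0 (grid_ge0 R n k) mv (fun i x => sf_growth sf i x)).
rewrite -mulrBr normrM (ger0_norm (expR_ge0 _)) -[leRHS]mul1r.
apply: ler_pM => //.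
apply: h; first by move=> w; rewrite indicE; case: (_ \in _); rewrite ?normr0 ?normr1.
Qed.

Let E_bound_cvg (q : nat -> R) : q @ \oo --> 0 ->
  forall K1 : R, E P (fun w => \1_D w * U 0 w) + q n + K1 * T%:R * Num.sqrt (mesh R n) @[n --> \oo]
    --> E P (fun w => \1_D w * U 0 w).
Proof.
move=> cq K1.
have cs : K1 * T%:R * Num.sqrt (mesh R n) @[n --> \oo] --> (0 : R).
  rewrite -(mulr0 (K1 * T%:R)); apply: cvgM; first exact: cvg_cst.
  rewrite -[X in _ --> X]sqrtr0.
  by apply: continuous_cvg; [exact: sqrt_continuous|exact: cvg_mesh].
rewrite -[X in _ --> X]addr0 -[X in _ --> X + _]addr0.
by apply: cvgD => //; apply: cvgD => //; exact: cvg_cst.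
Qed.

Let E_A n k : L1 P (fun w => \1_(A n k) w * g (eps (t_ n k) w) (Y (t_ n k) w)).
Proof.
apply: L1_indic => //.
apply: (state_L1 P_complete W_brownian eps_markov dfM x0 (grid_ge0 R n k) mg g_growth).
Qed.

Lemma dynkin_le : (forall i x, g i x <= 0) ->
  E P (fun w => \1_D w * U (tau w) w) <= E P (fun w => \1_D w * U 0 w).
Proof.
move=> gle; have [K1 h] := discrete_dynkin; have [_ _ c] := E_cvg.
apply: ler_cvg_to c (E_bound_cvg (cvg_cst 0) K1) _.
apply: nearW => n; rewrite addr0 -lerBlDl.
apply: le_trans (h n); apply: le_trans (ler_norm _); rewrite lerBrDr gerDl.
apply: sumr_le0 => k _; rewrite mulr_ge0_le0 ?expR_ge0//.
rewrite mulr_ge0_le0 ?(ltW (mesh_gt0 R n))//.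
rewrite -oppr_ge0 -mulN1r -EZ//; apply: E_ge0 => w.
by rewrite mulN1r oppr_ge0 mulr_ge0_le0.
Qed.

(** The generator vanishes strictly before [tau], whereas the discrete sum also contains a step
    starting at [tau] when [tau] is a grid time. At most one grid time equals [tau], so this extra
    drift is of the order of the mesh. *)
Lemma dynkin_eq : {ae P, forall w t, 0 <= t -> t < tau w -> g (eps t w) (Y t w) = 0} ->
  E P (fun w => \1_D w * U (tau w) w) = E P (fun w => \1_D w * U 0 w).
Proof.
move=> gz; have [K1 h] := discrete_dynkin; have [_ _ c] := E_cvg.
have Kg0 : 0 <= Kg.
  have := lambda0 reg1; have := lambda0 reg2; have := sqr_ge0 B; have := rho0 => ? ? ? ?.
  by rewrite mulr_ge0//; [exact: ltW|lra].
pose gdom w := Kg * (1 + `|x0| + G w).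
have igdom : L1 P gdom by apply: L1Z; apply: L1D => //; exact: L1_cst.
have gb := discount_state_bound Kg0 g_growth.
have drift0 n : `|drift n| <= mesh R n * E P gdom.
  pose q k w := (tau w == t_ n k)%:R * `|expR (- rho * t_ n k) * g (eps (t_ n k) w) (Y (t_ n k) w)|.
  have mq k : measurable_fun setT (fun w => (tau w == t_ n k)%:R : R).
    rewrite (_ : (fun _ => _) = \1_(tau @^-1` [set t_ n k])).
      apply: measurable_indic; rewrite -[X in measurable X]setTI; exact: mtau.
    apply/funext => w; rewrite indicE; congr ((nat_of_bool _)%:R).
    by apply/eqP/idP; rewrite inE.
  have ig k : L1 P (fun w => expR (- rho * t_ n k) * g (eps (t_ n k) w) (Y (t_ n k) w)).
    apply: L1Z; exact: (state_L1 P_complete W_brownian eps_markov dfM x0 (grid_ge0 R n k) mg g_growth).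
  have iq k : L1 P (q k).
    apply: (@L1Mb _ _ _ _ _ _ 1) => //; last exact: L1_abs.
    by move=> w; case: (_ == _); rewrite ?normr0 ?normr1.
  apply: (@le_trans _ _ (\sum_(k < N n) mesh R n * E P (q k))).
    apply: (le_trans (ler_norm_sum _ _ _)); apply: ler_sum => k _.
    rewrite mulrCA normrM (ger0_norm (ltW (mesh_gt0 R n))) ler_pM2l ?mesh_gt0//.
    rewrite -EZ//; apply: (le_trans (E_abs (L1Z _ (E_A n k)))).
    apply: E_le_ae => //; first by apply: L1_abs; apply: L1Z.
    apply: filterS gz => w hw; rewrite /q /A indicI mulrCA -mulrA normrM.
    have ind B' : (\1_B' w : R) = 0 \/ (\1_B' w : R) = 1.
      by rewrite indicE; case: (w \in B'); [right|left].
    case: (ind D) => ->; first by rewrite normr0 mul0r mulr_ge0.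
    rewrite normr1 mul1r; case: (ltgtP (tau w) (t_ n k)) => htau /=.
    - rewrite indicE memNset/= ?mul0r ?normr0//; exact.
    - by rewrite hw ?grid_ge0// !mulr0 normr0.
    - rewrite mul1r indicE mem_set/= ?mul1r//; apply/negP; rewrite -leNgt htau; exact: lexx.
  rewrite -mulr_sumr ler_pM2l ?mesh_gt0// -E_sum; last by move=> k _; exact: iq.
  apply: E_le_ae => //; first by apply: L1_sum => k _; exact: iq.
  apply: filterS gb => w hw.
  have dom0 : 0 <= gdom w by apply: le_trans (hw 0 (lexx 0)).
  have [[k htau]|nk] := pselect (exists k : 'I_(N n), tau w = t_ n k).
    rewrite (bigD1 k)//= big1 ?addr0.
      rewrite /q htau eqxx mul1r; apply: hw; exact: grid_ge0.
    move=> j jk; rewrite /q (_ : (tau w == t_ n j) = false) ?mul0r//.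
    apply/negbTE; apply: contra jk; rewrite htau => /eqP.
    move=> /(mulIf (lt0r_neq0 (mesh_gt0 R n))) /eqP; rewrite eqr_nat => /eqP kj.
    by apply/eqP/val_inj.
  rewrite big1// => k _; rewrite /q (_ : (tau w == t_ n k) = false) ?mul0r//.
  by apply/negbTE/eqP => htau; apply: nk; exists k.
have cm : mesh R n * E P gdom @[n --> \oo] --> (0 : R).
  rewrite -(mul0r (E P gdom)); apply: cvgM; [exact: cvg_mesh|exact: cvg_cst].
apply/le_anti/andP; split.
  apply: ler_cvg_to c (E_bound_cvg cm K1) _; apply: nearW => n.
  have := h n; have := drift0 n; rewrite !ler_norml; lra.
have cm' : - (mesh R n * E P gdom) @[n --> \oo] --> (0 : R).
  by rewrite -oppr0; exact: cvgN.
apply: ler_cvg_to (E_bound_cvg cm' (- K1)) c _; apply: nearW => n.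
have := h n; have := drift0 n; rewrite !ler_norml !mulNr; lra.
Qed.

End Dynkin.

(** * Verification for the stopping problem *)

Section Verification.
Context d (Omega : measurableType d) (R : realType) (P : probability Omega R).
Variables (W : R -> Omega -> R) (eps : R -> Omega -> 'I_2) (lambda : 'I_2 -> R).
Hypothesis P_complete : measure_is_complete P.
Hypothesis lambda0 : forall i, 0 < lambda i.
Hypothesis W_brownian : brownian_motion P W.
Hypothesis eps_markov : markov_chain P (generator lambda) eps.
Hypothesis W_eps_independent : independent_systems P
  (process_sigma measurable W `[0, +oo[) (process_sigma setT eps `[0, +oo[).
Notation F := (augmented_filtration P W eps).
Variables (sigma : 'I_2 -> R) (M : R -> Omega -> R) (C : R).
Hypothesis C0 : 0 < C.
Hypothesis dfM : diffusion P W eps sigma M C.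
Variables (rho : R).
Hypothesis rho0 : 0 < rho.
Variables (G : Omega -> R).
Hypothesis G0 : forall w, 0 <= G w.
Hypothesis iG : L1 P G.
Hypothesis GM : {ae P, forall w t, 0 <= t -> expR (- (rho / 2) * t) * `|M t w| <= G w}.

Variables (z : 'I_2 -> R) (v dv Iv : 'I_2 -> R -> R) (L : R).
Hypothesis ss : stopping_solution rho sigma lambda z v dv Iv L.
Variable (x0 : R).
Let Y t w := x0 + M t w.

Let L0 : 0 <= L. Proof. exact: le_trans (normr_ge0 _) (ss_dw_bnd ss reg1 0). Qed.

Let GM' : {ae P, forall w t, 0 <= t -> expR (- rho * t) * `|M t w| <= G w}.
Proof.
apply: filterS GM => w h t t0; apply: le_trans (h t t0).
rewrite ler_wpM2r// ler_expR !mulNr lerN2 ler_wpM2r//; have := rho0; lra.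
Qed.

(* [v] is only C^1; these difference quotients of its antiderivative are C^2
   with Lipschitz second derivatives, and [ss_K] turns into the pointwise
   variational inequality for them. *)
Let sm (e : R) (i : 'I_2) x := (Iv i x - Iv i (x - e)) / e.

Section Smoothing.
Variable (e : R).
Hypothesis e0 : 0 < e.
Let sv := sm e.
Let sdv i x := (v i x - v i (x - e)) / e.
Let sddv i x := (dv i x - dv i (x - e)) / e.

Let en0 : e != 0. Proof. by rewrite gt_eqF. Qed.
Let xe x : `|x - (x - e)| = e.
Proof. by rewrite (_ : x - (x - e) = e); [rewrite gtr0_norm|ring]. Qed.

Let derive_smooth (f df : R -> R) : (forall x : R, is_derive x 1 f (df x)) ->
  forall x : R, is_derive x 1 (fun y => (f y - f (y - e)) / e) ((df x - df (x - e)) / e).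
Proof.
move=> fd x.
have h1 := fd x.
have h2 : is_derive x 1 (fun y => f (y - e)) (df (x - e)).
  have hs : is_derive x 1 (fun y : R => y - e) (1 : R).
    by apply: is_derive_eq; rewrite subr0.
  have := @is_derive1_comp _ f (fun y => y - e) x (df (x - e)) 1 (fd (x - e)) hs.
  by rewrite mulr1.
have h3 : is_derive x 1 (fun y => f y - f (y - e)) (df x - df (x - e)).
  exact: is_deriveB.
have := @is_deriveZ _ _ _ (fun y => f y - f (y - e)) e^-1 x 1 _ h3.
rewrite /GRing.scale/= mulrC.
by rewrite (_ : _ \*: _ = (fun y => (f y - f (y - e)) / e))//; apply/funext => y; rewrite /GRing.scale/= mulrC.
Qed.

Lemma smoothing_family : exists K, smooth_family K sv sdv sddv.
Proof.
exists (1 + L + 2 * L / e + `|sv reg1 0| + `|sv reg2 0|).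
have Le0 : 0 <= 2 * L / e by rewrite divr_ge0 ?mulr_ge0// ltW.
have n1 : 0 <= `|sv reg1 0| by []. have n2 : 0 <= `|sv reg2 0| by [].
have l0 := L0.
have leK x : x <= L -> x <= 1 + L + 2 * L / e + `|sv reg1 0| + `|sv reg2 0| by move=> ?; lra.
have div_le x : `|x| <= L * e -> `|x / e| <= L.
  by move=> h; rewrite normrM normfV (gtr0_norm e0) ler_pdivrMr.
split.
- by have := L0; lra.
- by move=> i x; exact: (derive_smooth (ss_Iw ss i)).
- by move=> i x; exact: (derive_smooth (ss_w ss i)).
- move=> i x; apply/leK/div_le; have [t _ ->] := MVT_between (x - e) x (ss_w ss i).
  by rewrite normrM xe ler_wpM2r// ?(ltW e0)//; exact: ss_dw_bnd ss _ _.
- by move=> i x; apply/leK/div_le; rewrite -{2}(xe x); exact: ss_dw_lip ss _ _ _.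
- move=> i x y; apply: (@le_trans _ _ (2 * L / e * `|x - y|)); last first.
    by rewrite ler_wpM2r//; lra.
  rewrite /sddv -mulrBl normrM normfV (gtr0_norm e0) mulrAC ler_pM2r ?invr_gt0//.
  rewrite (_ : _ - _ - _ = (dv i x - dv i y) - (dv i (x - e) - dv i (y - e))); last by ring.
  apply: (le_trans (ler_normB _ _)).
  have := ss_dw_lip ss i x y; have := ss_dw_lip ss i (x - e) (y - e).
  rewrite (_ : x - e - (y - e) = x - y); last by ring.
  lra.
- move=> i j x; apply: leK; rewrite /sv /sm -mulrBl; apply: div_le.
  have hd (y : R) : is_derive y 1 (fun y => Iv i y - Iv j y) (v i y - v j y).
    by have h1 := ss_Iw ss i y; have h2 := ss_Iw ss j y; exact: is_deriveB.
  have [t _] := MVT_between (x - e) x hd.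
  rewrite (_ : _ - _ - (_ - _) = Iv i x - Iv i (x - e) - (Iv j x - Iv j (x - e))); last by ring.
  by move=> ->; rewrite normrM xe ler_wpM2r// ?(ltW e0)//; exact: ss_diff ss _ _ _.
- by move=> i; case: (ord2P i) => ->; lra.
Qed.

(** The quotient is a value of [v i] at a point within [e] of [x], and [v i] is Lipschitz. *)
Lemma smoothing_dist i x : `|sv i x - v i x| <= L * e.
Proof.
have [t [tx _] E] := MVT_between x (x - e) (ss_Iw ss i).
have -> : sv i x = v i t.
  rewrite /sv /sm -[RHS](mulfK en0); congr (_ / _).
  have -> : v i t * e = - (v i t * (x - e - x)) by ring.
  by rewrite -E; ring.
have [s _ ->] := MVT_between x t (ss_w ss i).
rewrite normrM; apply: ler_pM => //; first exact: ss_dw_bnd ss _ _.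
by apply: (le_trans tx); rewrite distrC xe.
Qed.

Let Kf i x := sigma i ^+ 2 / 2 * dv i x - rho * Iv i x + lambda i * (Iv (rev_ord i) x - Iv i x).
Let gE i x : generator_op rho sv sddv sigma lambda i x = (Kf i x - Kf i (x - e)) / e.
Proof. by rewrite /generator_op /Kf /sv /sm /sddv; field. Qed.

Lemma smoothing_generator_le0 i x : generator_op rho sv sddv sigma lambda i x <= 0.
Proof.
rewrite gE ler_pdivrMr// mul0r subr_le0; apply: (ss_K ss).
by rewrite gerBl ltW.
Qed.

(** The quotient is taken backwards so that [x] and [x - e] both lie below the threshold. *)
Lemma smoothing_generator_eq0 i x : x <= z i ->
  generator_op rho sv sddv sigma lambda i x = 0.
Proof.
move=> xz; rewrite gE (_ : Kf i x = Kf i (x - e)) ?subrr ?mul0r//.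
by apply: (ss_K_eq ss) => //; rewrite gerBl ltW.
Qed.

End Smoothing.

Let cv i : continuous (v i).
Proof. exact: is_derive_continuous (ss_w ss i). Qed.

Let Kv := L + `|v reg1 0| + `|v reg2 0|.
Let Kv0 : 0 <= Kv. Proof. by rewrite !addr_ge0. Qed.
Let v_growth i x : `|v i x| <= Kv * (1 + `|x|).
Proof.
have [t _ E] := MVT_between 0 x (ss_w ss i).
rewrite (_ : v i x = v i 0 + (v i x - v i 0)); last by ring.
rewrite E subr0; apply: (le_trans (ler_normD _ _)); rewrite normrM.
have h1 := ler_wpM2r (normr_ge0 x) (ss_dw_bnd ss i t).
have h2 : `|v i 0| <= `|v reg1 0| + `|v reg2 0|.
  by case: (ord2P i) => ->; rewrite ?lerDl ?lerDr.
have p1 : 0 <= `|v reg1 0| * `|x| by rewrite mulr_ge0.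
have p2 : 0 <= `|v reg2 0| * `|x| by rewrite mulr_ge0.
rewrite /Kv mulrDr mulr1 !mulrDl; have := L0; lra.
Qed.

Section BoundedTime.
Variables (T : nat) (tau : Omega -> R) (D : set Omega).
Hypothesis tau0 : forall w, 0 <= tau w.
Hypothesis tauT : forall w, tau w <= T%:R.
Hypothesis Ftau : forall t, 0 <= t -> F t [set w | tau w < t].
Hypothesis FD : F 0 D.

Let mD : measurable D.
Proof. exact: (F_measurable P_complete W_brownian eps_markov FD). Qed.
Let mtau : measurable_fun setT tau.
Proof. exact (optional_measurable P_complete W_brownian eps_markov tau0 Ftau). Qed.

Let stopped (u : 'I_2 -> R -> R) (s : Omega -> R) w :=
  \1_D w * (expR (- rho * s w) * u (eps (s w) w) (Y (s w) w)).

Lemma stopped_L1 (u : 'I_2 -> R -> R) K (s : Omega -> R) : (forall i, continuous (u i)) ->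
  0 <= K -> (forall i x, `|u i x| <= K * (1 + `|x|)) ->
  (forall w, 0 <= s w) -> measurable_fun setT s -> L1 P (stopped u s).
Proof.
move=> cu K0 uK s0 ms; apply: L1_indic => //.
apply: (L1_le_ae (V := fun w => K * (1 + `|x0| + G w))).
- apply: measurable_funM.
    by apply: measurableT_comp => //; exact: measurable_funM.
  exact: (state_at_measurable P_complete W_brownian eps_markov dfM).
- have := discount_state_bound eps rho0 x0 GM' K0 uK.
  by apply: filterS => w h; exact: h.
- by apply: L1Z; apply: L1D => //; exact: L1_cst.
Qed.

Let B := `|sigma reg1| + `|sigma reg2|.
Let sB i : `|sigma i| <= B.
Proof. by rewrite /B; case: (ord2P i) => ->; rewrite ?lerDl ?lerDr. Qed.

Let E_close (s : Omega -> R) (u : 'I_2 -> R -> R) e : (forall w, 0 <= s w) ->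
  L1 P (stopped u s) -> L1 P (stopped v s) ->
  (forall i x, `|u i x - v i x| <= e) ->
  `|E P (stopped u s) - E P (stopped v s)| <= e.
Proof.
move=> s0 iu iv uv; rewrite -EB// -[leRHS](E_cst P).
have iuv := L1B iu iv.
apply: E_le_abs; [exact: L1_measurable iuv|exact: L1_cst|].
move=> w; rewrite /stopped -!mulrBr !normrM.
have h1 : `|\1_D w : R| <= 1 by rewrite indicE; case: (_ \in _); rewrite ?normr0 ?normr1.
have h2 : `|expR (- rho * s w)| <= 1.
  by rewrite ger0_norm ?expR_ge0// -expR0 ler_expR mulNr oppr_le0 mulr_ge0// ltW.
rewrite -[leRHS]mul1r; apply: ler_pM => //; rewrite -[leRHS]mul1r; exact: ler_pM.
Qed.

Let approx e : 0 < e ->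
  `|E P (stopped (sm e) tau) - E P (stopped v tau)| <= L * e /\
  `|E P (stopped (sm e) (fun=> 0)) - E P (stopped v (fun=> 0))| <= L * e.
Proof.
move=> e0; have [K sf] := smoothing_family e0.
have csv i : continuous (sm e i) by exact: is_derive_continuous (sf_v sf i).
have K0 : 0 <= K by apply: le_trans (sf_K sf).
have z0 : Omega -> 0 <= (0 : R) by [].
have mz : measurable_fun [set: Omega] (fun=> 0 : R) by exact: measurable_cst.
split.
- apply: E_close => //; [exact: (stopped_L1 csv K0 (sf_growth sf))|exact: (stopped_L1 cv Kv0)|].
  by move=> i x; exact: smoothing_dist.
- apply: E_close => //; [exact: (stopped_L1 csv K0 (sf_growth sf))|exact: (stopped_L1 cv Kv0)|].
  by move=> i x; exact: smoothing_dist.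
Qed.

Lemma bounded_verification_le : E P (stopped v tau) <= E P (stopped v (fun=> 0)).
Proof.
apply/ler_addgt0Pr => r r0.
(* The smoothing error [L * e] occurs twice, once at [tau] and once at time zero. *)
pose e := r / (2 * L + 1).
have l1 : 0 < 2 * L + 1 by have := L0; lra.
have e0 : 0 < e by rewrite divr_gt0.
have [h1 h2] := approx e0; have [K sf] := smoothing_family e0.
have h3 : E P (stopped (sm e) tau) <= E P (stopped (sm e) (fun=> 0)) :=
  dynkin_le P_complete lambda0 W_brownian eps_markov W_eps_independent C0 dfM rho0 sf
  x0 iG GM' tau0 tauT Ftau FD sB (smoothing_generator_le0 e0).
have eL : (2 * L + 1) * e = r by rewrite mulrC divfK// gt_eqF.
move: h1 h2; rewrite !ler_norml => /andP[a1 a2] /andP[b1 b2].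
lra.
Qed.

Lemma bounded_verification_eq :
  {ae P, forall w t, 0 <= t -> t < tau w -> Y t w <= z (eps t w)} ->
  E P (stopped v tau) = E P (stopped v (fun=> 0)).
Proof.
move=> Yz; apply/le_anti; rewrite bounded_verification_le/=; apply/ler_addgt0Pr => r r0.
pose e := r / (2 * L + 1).
have l1 : 0 < 2 * L + 1 by have := L0; lra.
have e0 : 0 < e by rewrite divr_gt0.
have [h1 h2] := approx e0; have [K sf] := smoothing_family e0.
have h3 : E P (stopped (sm e) tau) = E P (stopped (sm e) (fun=> 0)).
  apply: (dynkin_eq P_complete lambda0 W_brownian eps_markov W_eps_independent C0 dfM rho0 sf
    iG GM' tau0 tauT Ftau FD sB).
  apply: filterS Yz => w h t t0 tt; apply: smoothing_generator_eq0 => //; exact: h.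
have eL : (2 * L + 1) * e = r by rewrite mulrC divfK// gt_eqF.
move: h1 h2; rewrite !ler_norml => /andP[a1 a2] /andP[b1 b2].
lra.
Qed.

End BoundedTime.

(** * Unbounded optional times *)

Section UnboundedTime.
Variables (tau : Omega -> \bar R) (D : set Omega).
Hypothesis tau0 : forall w, (0 <= tau w)%E.
Hypothesis Ftau : forall t, 0 <= t -> F t [set w | (tau w < t%:E)%E].
Hypothesis FD : F 0 D.

Let mD : measurable D.
Proof. exact: (F_measurable P_complete W_brownian eps_markov FD). Qed.

Let tauT (T : nat) w := fine (Order.min (tau w) T%:R%:E).
Let tauTE T w : (tauT T w)%:E = Order.min (tau w) T%:R%:E.
Proof.
rewrite /tauT fineK//; have := tau0 w; case: (tau w) => [r||]//= _.
by rewrite -EFin_min.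
Qed.

Lemma truncated_ge0 T w : 0 <= tauT T w.
Proof. by rewrite -lee_fin tauTE le_min tau0 /= lee_fin ler0n. Qed.
Let tauTT T w : tauT T w <= T%:R.
Proof. by rewrite -lee_fin tauTE ge_min lexx orbT. Qed.
Lemma truncated_optional T t : 0 <= t -> F t [set w | tauT T w < t].
Proof.
move=> t0; have [tT|Tt] := leP t T%:R.
  rewrite (_ : [set _ | _] = [set w | (tau w < t%:E)%E]); first exact: Ftau.
  apply/seteqP; split=> w /=; rewrite -lte_fin tauTE gt_min lte_fin (ltNge T%:R) tT orbF.
    by [].
  by [].
rewrite (_ : [set _ | _] = setT).
  by apply: (@measurableT _ (g_sigma_algebraType (genF P W eps t))).
by apply/seteqP; split=> w //= _; exact: le_lt_trans (tauTT T w) Tt.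
Qed.

(** An infinite time pays nothing, which is the limit of the rewards at truncated times. *)
Definition reward (u : 'I_2 -> R -> R) w := \1_D w *
  (if tau w is r%:E then expR (- rho * r) * u (eps r w) (Y r w) else 0).

Let mtauT T : measurable_fun setT (tauT T).
Proof. exact (optional_measurable P_complete W_brownian eps_markov (truncated_ge0 T) (truncated_optional T)). Qed.

Let stopped (u : 'I_2 -> R -> R) T w :=
  \1_D w * (expR (- rho * tauT T w) * u (eps (tauT T w) w) (Y (tauT T w) w)).

Lemma reward_cvg (u : 'I_2 -> R -> R) K : (forall i, continuous (u i)) -> 0 <= K ->
  (forall i x, `|u i x| <= K * (1 + `|x|)) ->
  L1 P (reward u) /\ E P (stopped u T) @[T --> \oo] --> E P (reward u).
Proof.
move=> cu K0 uK.
have iS T : L1 P (stopped u T) by exact: (stopped_L1 FD cu K0 uK (truncated_ge0 T)).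
have cS : {ae P, forall w, stopped u T w @[T --> \oo] --> reward u w}.
  apply: filterS GM => w hG; rewrite /reward /stopped; apply: cvgM; first exact: cvg_cst.
  move: (tau0 w); case E : (tau w) => [r||]// r0.
    apply: cvg_near_cst; near=> T.
    have -> // : tauT T w = r.
    rewrite /tauT E -EFin_min/=; apply/min_idPl; near: T; exact: nbhs_infty_ger.
  have tE T : tauT T w = T%:R by rewrite /tauT E (min_idPr (leey _)).
  apply: norm_cvg0; apply: (@squeeze_cvgr _ _ _ _ (fun=> 0)
    (fun T => expR (- (rho / 2)) ^+ T * (K * (1 + `|x0| + G w)))).
  - apply: nearW => T; rewrite normr_ge0/= tE normrM ger0_norm ?expR_ge0//.
    have -> : expR (- rho * T%:R) = expR (- (rho / 2)) ^+ T * expR (- (rho / 2) * T%:R).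
      by rewrite -expRM_natl -expRD; congr expR; field.
    rewrite -mulrA ler_wpM2l ?exprn_ge0 ?expR_ge0//.
    have e1 : expR (- (rho / 2) * T%:R) <= 1.
      by rewrite -expR0 ler_expR mulNr oppr_le0 mulr_ge0// divr_ge0// ltW.
    have ee0 := expR_ge0 (- (rho / 2) * T%:R).
    apply: (@le_trans _ _ (expR (- (rho / 2) * T%:R) * (K * (1 + (`|x0| + `|M T%:R w|))))).
      rewrite ler_wpM2l//; apply: (le_trans (uK _ _)); rewrite ler_wpM2l// lerD2l.
      exact: ler_normD.
    rewrite mulrCA ler_wpM2l// !mulrDr mulr1 addrA; apply: lerD; last exact: hG.
    by apply: lerD => //; rewrite ler_piMl.
  - exact: cvg_cst.
  - rewrite -(mul0r (K * (1 + `|x0| + G w))); apply: cvgM; last exact: cvg_cst.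
    by apply: cvg_expr; rewrite ger0_norm ?expR_ge0// expR_lt1 oppr_lt0 divr_gt0.
have mR : measurable_fun setT (reward u).
  by apply: (measurable_ae_cvg P_complete (U_ := stopped u)) => // T; exact: L1_measurable.
have bS : {ae P, forall w, forall T, `|stopped u T w| <= K * (1 + `|x0| + G w)}.
  apply: filterS (discount_state_bound eps rho0 x0 GM' K0 uK) => w h T.
  rewrite normrM; apply: le_trans (h _ (truncated_ge0 T w)).
  by rewrite ler_piMl// indicE; case: (_ \in _); rewrite ?normr0 ?normr1.
have [] // := cvg_E_ae (fun T => L1_measurable (iS T)) mR _ bS cS.
by apply: L1Z; apply: L1D => //; exact: L1_cst.
Unshelve. all: by end_near. Qed.

Let E0 i : D = initial_regime eps i ->
  E P (fun w => \1_D w * (expR (- rho * 0) * v (eps 0 w) (Y 0 w))) = v i x0 * fine (P D).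
Proof.
move=> Di.
have mI : measurable_fun setT (\1_D : Omega -> R) by exact: measurable_indic.
have -> : E P (fun w => \1_D w * (expR (- rho * 0) * v (eps 0 w) (Y 0 w))) =
    E P (fun w => v i x0 * \1_D w).
  apply: E_ae.
  - by apply: L1_measurable; exact: (stopped_L1 FD cv Kv0 v_growth (s := fun=> 0)).
  - exact: measurable_funM.
  - apply: filterS (df_start dfM) => w M0; rewrite indicE.
    case: (boolP (w \in D)) => wD; last by rewrite mul0r mulr0.
    move: wD; rewrite Di inE /initial_regime /= => ->.
    by rewrite /Y M0 addr0 mulr0 expR0 !mul1r mulr1.
have iI : L1 P (\1_D : Omega -> R).
  by apply: (@L1_bounded _ _ _ _ _ 1) => // w; rewrite indicE; case: (_ \in _); rewrite ?normr0 ?normr1.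
by rewrite EZ// /E /Rintegral integral_indic// setIT.
Qed.

Let idf (i : 'I_2) (x : R) := x.
Let idf_growth (i : 'I_2) x : `|idf i x| <= 1 * (1 + `|x|).
Proof. by rewrite mul1r lerDr. Qed.
Let cid i : continuous (idf i). Proof. by move=> x; exact: cvg_id. Qed.

Lemma reward_L1 : L1 P (reward (fun _ x => x)).
Proof. by have [] := reward_cvg cid ler01 idf_growth. Qed.

Lemma reward_le i : D = initial_regime eps i ->
  E P (reward (fun _ x => x)) <= v i x0 * fine (P D).
Proof.
move=> Di; have [iv cvv] := reward_cvg cv Kv0 v_growth.
apply: (@le_trans _ _ (E P (reward v))).
  apply: E_le => //; first exact: reward_L1.
  move=> w; apply: ler_wpM2l; first by rewrite indicE.
  case: (tau w) => // r; rewrite ler_wpM2l ?expR_ge0//; exact: ss_ge ss _ _.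
rewrite -(E0 Di); apply: (cvgr_to_le cvv); apply: nearW => T.
exact: (bounded_verification_le (truncated_ge0 T) (tauTT T) (truncated_optional T) FD).
Qed.

(** At a finite [tau] the state lies in the stopping region, where [v] is the identity; an infinite
    [tau] pays zero under both rewards. *)
Lemma reward_eq i : D = initial_regime eps i ->
  {ae P, forall w t, 0 <= t -> (t%:E < tau w)%E -> Y t w <= z (eps t w)} ->
  {ae P, forall w r, tau w = r%:E -> z (eps r w) <= Y r w} ->
  E P (reward (fun _ x => x)) = v i x0 * fine (P D).
Proof.
move=> Di Yz Yz'; have [iv cvv] := reward_cvg cv Kv0 v_growth.
have -> : E P (reward (fun _ x => x)) = E P (reward v).
  apply: E_ae; [exact: L1_measurable reward_L1|exact: L1_measurable iv|].
  apply: filterS Yz' => w h; rewrite /reward; congr (_ * _).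
  by case E : (tau w) => [r||]//; rewrite (ss_stop ss)//; exact: h.
rewrite -(E0 Di); apply: (cvg_unique _ cvv) => //.
apply: cvg_near_cst; apply: nearW => T.
apply: (bounded_verification_eq (truncated_ge0 T) (tauTT T) (truncated_optional T) FD).
apply: filterS Yz => w h t t0 tT; apply: h => //.
by move: tT; rewrite -lte_fin tauTE lt_min => /andP[].
Qed.

End UnboundedTime.
End Verification.

(** * From control to stopping *)

Section Passage.
Context (R : realType).
Implicit Types (g : R -> R) (l t : R).

(* First passage of [g] above [l], through rational times so that measurability
   and adaptedness are countable statements. *)
Definition passage g l : \bar R := ereal_inf
  [set (ratr q)%:E | q in [set q : rat | 0 <= (ratr q : R) /\ l < g (ratr q)]].

Lemma passage_ge0 g l : (0 <= passage g l)%E.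
Proof. by apply/ereal_infP => _ [q [q0 _] <-]; rewrite lee_fin. Qed.

Lemma passage_ltP g l x : (passage g l < x)%E <->
  exists q : rat, [/\ 0 <= (ratr q : R), l < g (ratr q) & ((ratr q : R)%:E < x)%E].
Proof.
split=> [/ereal_inf_lt [_ [q [q0 lq] <-] qx]|[q [q0 lq qx]]]; first by exists q.
by apply: le_lt_trans qx; apply: ereal_inf_lbound; exists q.
Qed.

Lemma measurable_passage d (T : measurableType d) (G : T -> R -> R) (l : T -> R) :
  (forall q : rat, 0 <= (ratr q : R) -> measurable_fun setT (fun x => G x (ratr q))) ->
  measurable_fun setT l -> measurable_fun setT (fun x => passage (G x) (l x)).
Proof.
move=> mG ml; apply: (measurability _ (ErealGenInftyO.measurableE R)).
move=> _ [_ [a ->] <-]; rewrite setTI.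
rewrite (_ : _ @^-1` _ = \bigcup_(q : rat) [set x | [/\ 0 <= (ratr q : R),
    l x < G x (ratr q) & ((ratr q : R)%:E < a%:E)%E]]); last first.
  apply/seteqP; split=> x /=; rewrite in_itv/=.
    by move/passage_ltP => [q hq]; exists q.
  by move=> [q _ hq]; apply/passage_ltP; exists q.
apply: bigcupT_measurable_rat => q.
have [q0|q0] := boolP (0 <= (ratr q : R)); last first.
  by rewrite (_ : [set _ | _] = set0)// -subset0 => x [].
have [qa|qa] := boolP ((ratr q : R)%:E < a%:E)%E; last first.
  by rewrite (_ : [set _ | _] = set0)// -subset0 => x [].
have h := measurable_fun_ltr ml (mG q q0).
rewrite (_ : [set _ | _] = setT `&` (fun x => l x < G x (ratr q)) @^-1` [set true]).
  exact: h.
by rewrite setTI; apply/seteqP; split=> x /= => [[]|].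
Qed.

Section Monotone.
Variable g : R -> R.
Hypothesis hg : increasing_path g.

Let g0 : g 0 = 0. Proof. by case: hg. Qed.
Let gnd s t : 0 <= s -> s <= t -> g s <= g t. Proof. by case: hg => _ + _; exact. Qed.

(** Left continuity moves the inequality [l < g t] to a rational time before [t]. *)
Lemma passage_lt l t : 0 <= l -> 0 <= t -> (passage g l < t%:E)%E = (l < g t).
Proof.
move=> l0 t0; apply/idP/idP.
  move=> /passage_ltP[q [q0 lq]]; rewrite lte_fin => qt.
  by apply: (lt_le_trans lq); exact: gnd (ltW qt).
move=> lt; have tp : 0 < t.
  by rewrite lt_neqAle t0 andbT; apply/eqP => t0'; move: lt; rewrite -t0' g0 ltNge l0.
have [_ _ /(_ t tp)] := hg => /cvgr_gt /(_ _ lt) lg.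
have [e /= e0 he] := lg.
have hm : Num.max 0 (t - e) < t by rewrite gt_max tp ltrBlDr ltrDl.
have [q] := rat_in_itvoo hm; rewrite in_itv/= gt_max => /andP[/andP[q0 qe] qt].
apply/passage_ltP; exists q; split; [exact: ltW| |by rewrite lte_fin].
apply: he => //=; rewrite ger0_norm; first by rewrite ltrBlDr -ltrBlDl.
by rewrite subr_ge0 ltW.
Qed.

Lemma right_limits_ge0 t : 0 <= right_limits hg t.
Proof.
rewrite /right_limits; case: ltP => // t0; apply: lb_le_inf.
  by exists (g (t + 1)), (t + 1) => //=; rewrite in_itv/= andbT ltrDl.
move=> _ [s /= + <-]; rewrite in_itv/= andbT => ts.
by rewrite -g0; apply: gnd => //; rewrite (le_trans t0)// ltW.
Qed.

Lemma right_limits_le t s : 0 <= t -> t < s -> right_limits hg t <= g s.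
Proof.
move=> t0 ts; rewrite /right_limits ltNge t0/=; apply: ge_inf.
  exists 0 => _ [r /= + <-]; rewrite in_itv/= andbT => tr.
  by rewrite -g0; apply: gnd => //; rewrite (le_trans t0)// ltW.
by exists s => //=; rewrite in_itv/= andbT.
Qed.

Lemma passage_le_of_lt l t : 0 <= l -> l < right_limits hg t -> (passage g l <= t%:E)%E.
Proof.
move=> l0; have [t0|t0] := ltP t 0.
  by rewrite /right_limits t0 ltNge l0.
move=> lt; apply/lee_addgt0Pr => e e0; apply: ltW.
rewrite -EFinD passage_lt ?addr_ge0// ?(ltW e0)//.
by apply: (lt_le_trans lt); apply: right_limits_le => //; rewrite ltrDl.
Qed.

Lemma passage_le_le l t : 0 <= l -> (passage g l <= t%:E)%E -> l <= right_limits hg t.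
Proof.
move=> l0 lt.
have t0 : 0 <= t by rewrite -lee_fin; exact: le_trans (passage_ge0 g l) lt.
rewrite /right_limits ltNge t0/=; apply: lb_le_inf.
  by exists (g (t + 1)), (t + 1) => //=; rewrite in_itv/= andbT ltrDl.
move=> _ [s /= + <-]; rewrite in_itv/= andbT => ts; apply: ltW.
rewrite -passage_lt//; last by rewrite (le_trans t0)// ltW.
by apply: le_lt_trans lt _; rewrite lte_fin.
Qed.

Variable y : R.
Hypothesis y0 : 0 <= y.
Hypothesis gy : forall t, 0 <= t -> g t <= y.

Let Rl := right_limits hg.
Let Rl_le t : Rl t <= y.
Proof.
have [t0|t0] := ltP t 0; first by rewrite /Rl /right_limits t0.
by apply: (le_trans (right_limits_le t0 (_ : t < t + 1))); rewrite ?ltrDl// gy// addr_ge0.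
Qed.

Notation mu := (@lebesgue_measure R).
Let tau z := passage g (y - z).

Let mtau : measurable_fun [set: measurableTypeR R] tau.
Proof. by apply: measurable_passage => //; exact: measurable_funB. Qed.

(** The time at which the level [z] is left. Levels outside []0, y[] and levels never left are sent
    to [- 1], away from the nonnegative times. *)
Let phi (z : measurableTypeR R) : measurableTypeR R :=
  if (0 < z < y) && (tau z < +oo)%E then fine (tau z) else - 1.

Let mphi : measurable_fun setT phi.
Proof.
apply: measurable_fun_ifT => //.
- apply: measurable_and; last exact: measurable_fun_lte.
  by apply: measurable_and; apply: measurable_fun_ltr.
- exact: (@measurableT_comp _ _ _ _ _ _ fine setT tau (@fine_measurable R setT measurableT) mtau).
Qed.

Let S b := [set z : R | 0 < z < y /\ (tau z <= b%:E)%E].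

Let mS b : measurable (S b : set (measurableTypeR R)).
Proof.
rewrite (_ : S b = `]0, y[%classic `&` (tau @^-1` `]-oo, b%:E])).
  apply: measurableI => //; rewrite -[X in measurable X]setTI.
  by apply: mtau => //; exact: emeasurable_itv.
by apply/seteqP; split=> z /=; rewrite !in_itv/=.
Qed.

(** [S b] contains []y - Rl b, y[] and is contained in [[y - Rl b, y[]: the two comparisons of
    passage times with right limits leave only an endpoint undecided. *)
Let muS b : mu (S b) = (Rl b)%:E.
Proof.
have R0 := right_limits_ge0 b; have Ry := Rl_le b.
apply/le_anti/andP; split.
  apply: (@le_trans _ _ (mu `[y - Rl b, y[%classic)).
    apply: le_measure; [by rewrite inE; exact: mS|by rewrite inE|].
    move=> z /= [/andP[z0 zy] tz]; rewrite in_itv/= zy andbT lerBlDr addrC -lerBlDr.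
    by apply: passage_le_le => //; rewrite subr_ge0 ltW.
  rewrite [leLHS]lebesgue_measure_itv/= lte_fin; case: ifP => _; rewrite ?lee_fin//.
  by lra.
apply: (@le_trans _ _ (mu `]y - Rl b, y[%classic)).
  rewrite [leRHS]lebesgue_measure_itv/= lte_fin; case: ifPn => [_|].
    by rewrite -EFinD lee_fin; lra.
  by rewrite -leNgt => h; rewrite lee_fin; lra.
apply: le_measure; [by rewrite inE|by rewrite inE; exact: mS|].
move=> z /=; rewrite in_itv/= => /andP[h1 h2].
have z0 : 0 < z by apply: le_lt_trans h1; rewrite subr_ge0.
split; first by rewrite z0.
by apply: passage_le_of_lt; [rewrite subr_ge0 ltW|rewrite ltrBlDr addrC -ltrBlDr].
Qed.

Let D : set (measurableTypeR R) := `[0%R, +oo[%classic.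
Let mD : measurable D. Proof. exact: measurable_itv. Qed.

Let phi_itv a b : phi @^-1` (`]a, b] `&` D) = S b `\` S a.
Proof.
have t0 z : (0 <= tau z)%E by exact: passage_ge0.
apply/seteqP; split=> z /=; rewrite /phi /D /S /= !in_itv/= andbT.
  case: ifPn => [/andP[zy tf]|_] [/andP[h1 h2] h3]; last by move: h3; rewrite oppr_ge0 ler10.
  have fz : (fine (tau z))%:E = tau z by rewrite fineK// ge0_fin_numE.
  split; first by split=> //; rewrite -fz lee_fin.
  by move=> [_]; rewrite -fz lee_fin leNgt h1.
move=> [[zy tb] na]; have tf : (tau z < +oo)%E by apply: le_lt_trans tb (ltry _).
have fz : (fine (tau z))%:E = tau z by rewrite fineK// ge0_fin_numE.
rewrite zy tf/=; split; last by rewrite -lee_fin fz.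
apply/andP; split; last by rewrite -lee_fin fz.
by rewrite ltNge; apply/negP => h; apply: na; split => //; rewrite -fz lee_fin.
Qed.

Let lsm := lebesgue_stieltjes_measure (right_limits hg).

Let lsmE A : measurable A -> A `<=` D -> lsm A = pushforward mu phi A.
Proof.
move=> mA AD.
(* The image measure is cut down to [D] before the comparison on intervals []a, b]], since it
   charges the marker [- 1] while the Stieltjes measure vanishes on negative times. *)
pose m2 := mrestr (pushforward mu phi) mD.
have -> : pushforward mu phi A = m2 A by rewrite /m2 /mrestr (setIidl AD).
apply: (lebesgue_stieltjes_measure_unique (mu := m2)) => // _ [[a b] /= ab <-].
have [{}ab|ba] := leP a b; last first.
  by rewrite set_itv_ge ?measure0// bnd_simp -leNgt ltW.
rewrite /m2 /mrestr /pushforward phi_itv.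
have Sab : S a `<=` S b.
  move=> z [zy za]; split=> //; apply: (le_trans za).
  by rewrite lee_fin; exact: ab.
have -> : lebesgue_stieltjes_measure (right_limits hg) `]a, b]%classic = (Rl b - Rl a)%:E.
  rewrite /lebesgue_stieltjes_measure/= /measure_extension/=.
  rewrite measurable_mu_extE//=; last by exists (a, b).
  exact: wlength_itv_bnd.
have fS : (mu (S b) < +oo)%E by rewrite muS ltry.
have -> : mu (S b `\` S a) = (mu (S b) - mu (S b `&` S a))%E.
  by apply: measureD; [exact: mS|exact: mS|exact: fS].
by rewrite (setIidr Sab) !muS EFinB.
Qed.

Lemma stieltjes_time_change (h : R -> R) (K : R) : measurable_fun setT (fun t => h (Num.max 0 t)) ->
  (forall t, 0 <= t -> `|h t| <= K) ->
  stieltjes_integral h g =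
  (\int[mu]_(z in `]0%R, y[) (if passage g (y - z) is r%:E then h r else 0)%:E)%E.
Proof.
move=> mh hK; rewrite /stieltjes_integral; case: pselect => [hg'|/(_ hg)[]].
rewrite (Prop_irrelevance hg' hg).
pose h' t := h (Num.max 0 t).
transitivity (\int[lsm]_(t in D) (h' t)%:E)%E.
  apply: eq_integral => t; rewrite inE/= in_itv/= andbT => t0.
  by rewrite /h' (max_idPr t0).
rewrite (eq_measure_integral (pushforward mu phi)); last exact: lsmE.
have mh' : measurable_fun [set: measurableTypeR R] (EFin \o h').
  by apply/measurable_EFinP.
have mP : measurable (phi @^-1` D) by rewrite -[X in measurable X]setTI; exact: mphi.
have PD z : (phi @^-1` D) z <-> 0 < z < y /\ (tau z < +oo)%E.
  rewrite /D /phi /= in_itv/= andbT; case: ifPn => [/andP[zy tf]|zy]; split.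
  - by [].
  - by move=> _; rewrite fine_ge0// passage_ge0.
  - by rewrite oppr_ge0 ler10.
  - by move=> [h1 h2]; move: zy; rewrite h1 h2.
have Py : phi @^-1` D `<=` `]0, y[%classic.
  by move=> z /PD[zy _]; rewrite /= in_itv.
rewrite integral_pushforward//; last first.
  apply: measurable_bounded_integrable => //.
  - apply: (@le_lt_trans _ _ (mu `]0, y[%classic)).
      by apply: le_measure; rewrite ?inE.
    by rewrite [X in (X < _)%E]lebesgue_measure_itv/=; case: ifP => _; exact: ltry.
  - apply: measurable_funTS; apply: (measurableT_comp (f := h')) => //; exact/measurable_EFinP.
  - exists K; split; first by rewrite num_real.
    move=> x Kx z _ /=; apply: (le_trans _ (ltW Kx)); apply: hK.
    by rewrite le_max lexx.
rewrite integral_mkcond [RHS]integral_mkcond; apply: eq_integral => z _.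
rewrite !patchE (_ : (z \in `]0%R, y[%classic) = (0 < z < y)%R); last first.
  by rewrite mem_setE in_itv.
case: ifPn.
  rewrite inE => /PD[zy tf]; rewrite zy /= /phi zy tf/= /h' (max_idPr _) ?fine_ge0 ?passage_ge0//.
  have := tf; have := passage_ge0 g (y - z).
  by rewrite -/(tau z); case: (tau z).
rewrite notin_setE => nP; case: ifP => // zy.
have : ~ (tau z < +oo)%E by move=> h2; apply: nP; apply/PD.
have := passage_ge0 g (y - z).
by rewrite -/(tau z); case: (tau z) => [r||]// _; rewrite ltry.
Qed.

End Monotone.
End Passage.

(** * The derivative of the running cost *)

Section CostDerivative.
Context (R : realType).
Variable f : R -> R.
Hypothesis f_cost : convex_running_cost f.

Let clip (z : R) : R := Num.max 0 (Num.min 1 z).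
Let clip_itv z : 0 <= clip z <= 1.
Proof. by rewrite /clip le_max lexx/= ge_max ler01/= ge_min lexx. Qed.
Let clipE z : 0 <= z <= 1 -> clip z = z.
Proof. by move=> /andP[z0 z1]; rewrite /clip (min_idPr z1) (max_idPr z0). Qed.

(** Clipping the argument extends the derivative on [[0, 1]] to a continuous and bounded function on
    the line. *)
Definition cost_derive (z : R) : R := unit_derive f (clip z).

Lemma cost_deriveE z : 0 <= z <= 1 -> cost_derive z = unit_derive f z.
Proof. by move=> z01; rewrite /cost_derive clipE. Qed.

Let f_C1 : C1_on_unit f. Proof. by case: f_cost. Qed.
Let f_cvx : strictly_convex_on_unit f. Proof. by case: f_cost. Qed.
Let f_nd : {homo f : a b / a <= b}. Proof. by case: f_cost. Qed.

Let clip_cvg (z : R) : clip u @[u --> z] --> clip z.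
Proof.
apply: (@continuous_comp _ _ _ (fun u : R => Num.min 1 u) (fun u : R => Num.max 0 u)).
  by apply: continuous_min; [exact: cvg_cst|exact: cvg_id].
by apply: continuous_max; [exact: cvg_cst|exact: cvg_id].
Qed.

Lemma cost_derive_continuous : continuous cost_derive.
Proof.
move=> z; have [_ /subspace_continuousP cf] := f_C1.
have c1 := cf (clip z) (_ : (`[0, 1]%classic : set R) (clip z)).
have {}c1 := c1 ltac:(by rewrite /= in_itv/=; exact: clip_itv).
apply: cvg_comp c1 => A wA; rewrite /nbhs/= /within/= in wA.
have := clip_cvg wA; rewrite /= !nbhs_simpl/=; apply: filterS => u /=; apply.
by rewrite in_itv/=; exact: clip_itv.
Qed.

Lemma unit_quotient_cvg y : 0 <= y <= 1 ->
  unit_quotient f y z @[z --> within `[0, 1] y^'] --> unit_derive f y.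
Proof. by move=> y01; have [h _] := f_C1; exact: h. Qed.

Let right_sub y : 0 <= y -> y < 1 -> (y : R)^'+ `=>` within `[0, 1] y^'.
Proof.
move=> y0 y1 A; rewrite /within/= => wA.
have wA' : \forall z \near nbhs y, z != y -> (`[0, 1]%classic : set R) z -> A z := wA.
have h : \forall z \near y^'+, z != y -> (`[0, 1]%classic : set R) z -> A z.
  by rewrite near_withinE; apply: filterS wA' => z hz _.
near=> z; apply: (near h z) => //.
rewrite /= in_itv/=; apply/andP; split; last by near: z; exact: nbhs_right_le.
  by rewrite (le_trans y0)// ltW//; near: z; exact: nbhs_right_gt.
Unshelve. all: by end_near. Qed.

Let left_sub y : 0 < y -> y <= 1 -> (y : R)^'- `=>` within `[0, 1] y^'.
Proof.
move=> y0 y1 A; rewrite /within/= => wA.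
have wA' : \forall z \near nbhs y, z != y -> (`[0, 1]%classic : set R) z -> A z := wA.
have h : \forall z \near y^'-, z != y -> (`[0, 1]%classic : set R) z -> A z.
  by rewrite near_withinE; apply: filterS wA' => z hz _.
near=> z; apply: (near h z) => //.
rewrite /= in_itv/=; apply/andP; split; first by near: z; exact: nbhs_left_ge.
  by rewrite (le_trans _ y1)// ltW//; near: z; exact: nbhs_left_lt.
Unshelve. all: by end_near. Qed.

Let quotient_right y : 0 <= y -> y < 1 ->
  unit_quotient f y z @[z --> y^'+] --> unit_derive f y.
Proof.
move=> y0 y1; apply: cvg_trans (unit_quotient_cvg _); last by rewrite y0 ltW.
exact: cvg_app (right_sub y0 y1).
Qed.

Let quotient_left y : 0 < y -> y <= 1 ->
  unit_quotient f y z @[z --> y^'-] --> unit_derive f y.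
Proof.
move=> y0 y1; apply: cvg_trans (unit_quotient_cvg _); last by rewrite y1 ltW.
exact: cvg_app (left_sub y0 y1).
Qed.

Let slopes a m b : 0 <= a -> a < m -> m < b -> b <= 1 ->
  unit_quotient f a m < unit_quotient f m b.
Proof.
move=> a0 am mb b1; pose t := (b - m) / (b - a).
have ab : 0 < b - a by rewrite subr_gt0 (lt_trans am).
have t01 : 0 < t < 1.
  have bm : 0 < b - m by rewrite subr_gt0.
  apply/andP; split; first exact: divr_gt0.
  by rewrite /t ltr_pdivrMr// mul1r ltrD2l ltrN2.
have a01 : 0 <= a <= 1 by rewrite a0/= (le_trans (ltW am))// (le_trans (ltW mb)).
have b01 : 0 <= b <= 1 by rewrite b1 andbT (le_trans a0)// ltW// (lt_trans am).
have ne : a != b by rewrite lt_eqF// (lt_trans am).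
have := f_cvx a01 b01 ne t01.
have -> : t * a + (1 - t) * b = m by rewrite /t; field; rewrite gt_eqF.
have am' : 0 < m - a by rewrite subr_gt0.
have mb' : 0 < b - m by rewrite subr_gt0.
rewrite /unit_quotient ltr_pdivrMr// (mulrAC _ _ (m - a)) ltr_pdivlMr//.
rewrite -(ltr_pM2r ab) mulrDl.
have -> : t * f a * (b - a) = (b - m) * f a by rewrite /t; field; rewrite gt_eqF.
have -> : (1 - t) * f b * (b - a) = (m - a) * f b by rewrite /t; field; rewrite gt_eqF.
move=> h; lra.
Qed.

Let derive_le_slope a m : 0 <= a -> a < m -> m <= 1 ->
  unit_derive f a <= unit_quotient f a m.
Proof.
move=> a0 am m1; apply: cvgr_to_le (quotient_right a0 (lt_le_trans am m1)) _.
near=> z.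
have az : a < z by near: z; exact: nbhs_right_gt.
have zm : z < m by near: z; exact: nbhs_right_lt.
have := slopes a0 az zm m1; rewrite /unit_quotient.
have az' : 0 < z - a by rewrite subr_gt0.
have zm' : 0 < m - z by rewrite subr_gt0.
have am' : 0 < m - a by rewrite subr_gt0.
rewrite ltr_pdivrMr// mulrAC ltr_pdivlMr// => h.
rewrite ler_pdivrMr// mulrAC ler_pdivlMr//; nra.
Unshelve. all: by end_near. Qed.

Let slope_le_derive m b : 0 <= m -> m < b -> b <= 1 ->
  unit_quotient f m b <= unit_derive f b.
Proof.
move=> m0 mb b1; apply: cvgr_to_ge (quotient_left (le_lt_trans m0 mb) b1) _.
near=> z.
have mz : m < z by near: z; exact: nbhs_left_gt.
have zb : z < b by near: z; exact: nbhs_left_lt.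
have := slopes m0 mz zb b1; rewrite /unit_quotient.
have -> : (f z - f b) / (z - b) = (f b - f z) / (b - z).
  by rewrite -(opprB (f b)) -(opprB b) invrN mulrNN.
have mz' : 0 < z - m by rewrite subr_gt0.
have zb' : 0 < b - z by rewrite subr_gt0.
have mb' : 0 < b - m by rewrite subr_gt0.
rewrite ltr_pdivrMr// mulrAC ltr_pdivlMr// => h.
rewrite ler_pdivrMr// mulrAC ler_pdivlMr//; nra.
Unshelve. all: by end_near. Qed.

(** Strictness comes through the midpoint: the slopes of [f] on the two halves differ strictly and
    lie between the derivatives at the ends. *)
Lemma cost_derive_incr a b : 0 <= a -> a < b -> b <= 1 -> cost_derive a < cost_derive b.
Proof.
move=> a0 ab b1; rewrite !cost_deriveE; last 2 first.
- by rewrite b1 andbT (le_trans a0)// ltW.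
- by rewrite a0/= (le_trans (ltW ab)).
have am : a < (a + b) / 2 by lra.
have mb : (a + b) / 2 < b by lra.
apply: (le_lt_trans (derive_le_slope a0 am _)); first by rewrite (le_trans (ltW mb)).
apply: (lt_le_trans (slopes a0 am mb b1)).
by apply: slope_le_derive => //; rewrite (le_trans a0)// ltW.
Qed.

Lemma cost_derive_ge0 z : 0 <= cost_derive z.
Proof.
suff h y : 0 <= y -> y < 1 -> 0 <= unit_derive f y.
  have /andP[c0] := clip_itv z; rewrite /cost_derive le_eqVlt => /predU1P[c1|]; last exact: h.
  have := @cost_derive_incr 0 1 (lexx _) ltr01 (lexx _).
  move=> h1; rewrite c1 -(@cost_deriveE 1) ?ler01 ?lexx//; apply: ltW; apply: le_lt_trans h1.
  by rewrite cost_deriveE ?lexx ?ler01//; exact: h.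
move=> y0 y1; apply: cvgr_to_ge (quotient_right y0 y1) _.
near=> u; have yu : y < u by near: u; exact: nbhs_right_gt.
by rewrite divr_ge0 ?subr_ge0 ?(ltW yu)//; apply: f_nd; exact: ltW.
Unshelve. all: by end_near. Qed.

Let f_right y : 0 <= y -> y < 1 -> f z @[z --> y^'+] --> f y.
Proof.
move=> y0 y1.
have h : unit_quotient f y z * (z - y) + f y @[z --> y^'+] --> unit_derive f y * (y - y) + f y.
  apply: cvgD; last exact: cvg_cst.
  apply: cvgM; first exact: quotient_right.
  apply: cvgB; last exact: cvg_cst.
  exact: cvg_at_right_filter cvg_id.
rewrite subrr mulr0 add0r in h; apply: cvg_trans h; apply: near_eq_cvg; near=> z.
rewrite /unit_quotient divfK ?subrK// subr_eq0 gt_eqF//; near: z; exact: nbhs_right_gt.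
Unshelve. all: by end_near. Qed.

Let f_left y : 0 < y -> y <= 1 -> f z @[z --> y^'-] --> f y.
Proof.
move=> y0 y1.
have h : unit_quotient f y z * (z - y) + f y @[z --> y^'-] --> unit_derive f y * (y - y) + f y.
  apply: cvgD; last exact: cvg_cst.
  apply: cvgM; first exact: quotient_left.
  apply: cvgB; last exact: cvg_cst.
  exact: cvg_at_left_filter cvg_id.
rewrite subrr mulr0 add0r in h; apply: cvg_trans h; apply: near_eq_cvg; near=> z.
rewrite /unit_quotient divfK ?subrK// subr_eq0 lt_eqF//; near: z; exact: nbhs_left_lt.
Unshelve. all: by end_near. Qed.

Let f_derive (y : R) : 0 < y < 1 -> is_derive y 1 f (cost_derive y).
Proof.
move=> /andP[y0 y1].
have c : h^-1 *: ((f \o shift y) (h *: 1) - f y) @[h --> 0^'] --> cost_derive y.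
  rewrite cost_deriveE ?(ltW y0) ?(ltW y1)//.
  have y01 : 0 <= y <= 1 by rewrite !ltW.
  have hs : (fun h => h + y) @ (0 : R)^' --> within `[0, 1] y^'.
    move=> A; rewrite /within/= => wA.
    have : \forall e \near (0 : R), y + e != y -> (`[0, 1]%classic : set R) (y + e) -> A (y + e).
      by apply/(nbhs0P (fun z => z != y -> (`[0, 1]%classic : set R) z -> A z)).
    move=> h1; have h2 : \forall e \near (0 : R), (`[0, 1]%classic : set R) (y + e).
      apply/(nbhs0P (fun z => (`[0, 1]%classic : set R) z)).
      near=> z; rewrite /= in_itv/=; apply/andP; split; near: z.
        by apply: (@cvgr_ge R _ _ _ id y); [exact: cvg_id|exact: y0].
      by apply: (@cvgr_le R _ _ _ id y); [exact: cvg_id|exact: y1].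
    suff : \forall e \near (0 : R)^', A (e + y) by [].
    rewrite near_withinE; near=> e => e0.
    rewrite addrC; apply: (near h1 e) => //; last exact: (near h2 e).
    by rewrite -subr_eq0 addrAC subrr add0r.
  apply: cvg_trans (cvg_comp _ _ hs (unit_quotient_cvg y01)).
  apply: near_eq_cvg; near=> e; rewrite /unit_quotient /= addrK /GRing.scale/= mulr1 mulrC.
  by rewrite addrC.
apply: DeriveDef; first by apply/cvg_ex; exists (cost_derive y).
exact: cvg_lim c.
Unshelve. all: by end_near. Qed.

Lemma cost_derive_le z : cost_derive z <= cost_derive 1.
Proof.
have /andP[c0] := clip_itv z.
have -> : cost_derive z = cost_derive (clip z) by rewrite [RHS]/cost_derive clipE ?clip_itv.
rewrite le_eqVlt => /predU1P[->//|c1]; exact/ltW/cost_derive_incr.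
Qed.

Lemma cost_FTC a b : 0 <= a -> a <= b -> b <= 1 ->
  (\int[lebesgue_measure]_(z in `]a, b[) (cost_derive z)%:E = (f b - f a)%:E)%E.
Proof.
move=> a0; rewrite le_eqVlt => /predU1P[-> b1|ab b1].
  by rewrite set_itv_ge ?bnd_simp ?ltxx// integral_set0 subrr.
rewrite -(@integral_itv_bndoo _ a b _ true false); last first.
  by apply/measurable_EFinP; apply: measurable_funTS; apply: continuous_measurable_fun;
    exact: cost_derive_continuous.
rewrite (continuous_FTC2 (F := f) ab).
- by rewrite EFinB.
- by apply: continuous_subspaceT; exact: cost_derive_continuous.
- split.
  + move=> x; rewrite in_itv/= => /andP[ax xb].
    have [] // := f_derive (_ : 0 < x < 1).
    by rewrite (le_lt_trans a0)//= (lt_le_trans xb).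
  + by apply: f_right => //; exact: lt_le_trans ab b1.
  + by apply: f_left => //; exact: le_lt_trans ab.
- move=> x; rewrite in_itv/= => /andP[ax xb]; rewrite derive1E.
  have hx : 0 < x < 1 by rewrite (le_lt_trans a0)//= (lt_le_trans xb).
  by have h := f_derive hx; rewrite derive_val.
Qed.

End CostDerivative.

(** * The running cost as an integral over levels *)

Section RunningCostTimeChange.
Context (R : realType).
Notation mu := (@lebesgue_measure R).

Lemma exponential_tail (rho a : R) : 0 < rho ->
  (\int[mu]_(t in `]a, +oo[) (expR (- rho * t))%:E = (expR (- rho * a) / rho)%:E)%E.
Proof.
move=> rho0; have rn0 : rho != 0 by rewrite gt_eqF.
have ce : continuous (fun t : R => expR (- rho * t)).
  by move=> t; apply: continuous_comp; [exact: mulrl_continuous|exact: continuous_expR].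
rewrite integral_itv_obnd_cbnd; last first.
  by apply/measurable_EFinP; apply: measurable_funTS; exact: continuous_measurable_fun.
have dF (t : R) : is_derive t 1 (fun t => - (expR (- rho * t) / rho)) (expR (- rho * t)).
  by apply: is_derive_eq; rewrite /GRing.scale/=; field.
rewrite (@ge0_continuous_FTC2y _ _ (fun t => - (expR (- rho * t) / rho)) a 0).
- by rewrite -EFinB sub0r opprK.
- by move=> t _; exact: expR_ge0.
- exact: continuous_subspaceT.
- rewrite -oppr0; apply: cvgN; rewrite -(mul0r rho^-1); apply: cvgM; last exact: cvg_cst.
  rewrite (_ : (fun t => _) = (fun u => expR (- u)) \o (fun t => t * rho)); last first.
    by apply/funext => t /=; rewrite mulNr mulrC.
  apply: cvg_comp; last exact: cvgr_expR.
  by apply: gt0_cvgMly => //; exact: cvg_id.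
- by move=> t _; have [] := dF t.
- by apply: cvg_at_right_filter; exact: (is_derive_continuous dF).
- by move=> t _; rewrite derive1E; have h := dF t; rewrite derive_val.
Unshelve. all: by end_near. Qed.

Variables (f : R -> R) (rho : R).
Hypothesis f_cost : convex_running_cost f.
Hypothesis rho0 : 0 < rho.
Variables (g : R -> R) (y : R).
Hypothesis hg : increasing_path g.
Hypothesis y01 : 0 <= y <= 1.
Hypothesis gy : forall t, 0 <= t -> g t <= y.

Let g' t := g (Num.max 0 t).
Let g'_nd : {homo g' : s t / s <= t}.
Proof.
move=> s t st; case: hg => _ gnd _; apply: gnd; first by rewrite le_max lexx.
by rewrite ge_max le_max lexx/= le_max st orbT.
Qed.
Let mg' : measurable_fun [set: measurableTypeR R] g'.
Proof. by apply: nondecreasing_measurable. Qed.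
Let f_nd : {homo f : a b / a <= b}. Proof. by case: f_cost. Qed.
Let f0 a : 0 <= f a. Proof. by case: f_cost. Qed.
Let df := cost_derive f.
Let mdf : measurable_fun [set: measurableTypeR R] df.
Proof. by apply: continuous_measurable_fun; exact: cost_derive_continuous f_cost. Qed.
Let df0 z : 0 <= df z. Proof. exact: cost_derive_ge0 f_cost z. Qed.
Let mexp : measurable_fun [set: measurableTypeR R] (fun t => expR (- rho * t)).
Proof. by apply: measurableT_comp => //; exact: measurable_funM. Qed.

(** Integrated over levels, [Q] gives the discounted cost saved at time [t], with
    [f y - f (y - g t)]; integrated over time, it gives the derivative of [f] at [z] times the
    discount accumulated after the level [z] is left. Tonelli equates the two. *)
Let Q (p : measurableTypeR R * measurableTypeR R) : R :=
  \1_(`[0, +oo[%classic : set R) p.1 * \1_(`]0, y[%classic : set R) p.2 *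
  (expR (- rho * p.1) * df p.2 * (if y - p.2 < g' p.1 then 1 else 0)).

Let Q0 p : 0 <= Q p.
Proof.
by rewrite mulr_ge0// ?mulr_ge0 ?indicE// ?expR_ge0//; case: ifP.
Qed.

Let mQ : measurable_fun setT Q.
Proof.
have mI (A : set (measurableTypeR R)) : measurable A ->
    measurable_fun [set: measurableTypeR R] (\1_A : measurableTypeR R -> R).
  by move=> mA; exact: measurable_indic.
apply: measurable_funM.
  apply: measurable_funM.
    exact: (measurableT_comp (mI `[0, +oo[%classic _) measurable_fst).
  exact: (measurableT_comp (mI `]0, y[%classic _) measurable_snd).
apply: measurable_funM.
  apply: measurable_funM.
    exact: (measurableT_comp mexp measurable_fst).
  exact: (measurableT_comp mdf measurable_snd).
apply: measurable_fun_ifT => //; apply: measurable_fun_ltr.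
  by apply: measurable_funB => //; exact: measurable_snd.
exact: (measurableT_comp mg' measurable_fst).
Qed.

Let Q_z t : (\int[mu]_z (Q (t, z))%:E)%E =
  (\1_(`[0, +oo[%classic : set R) t * (expR (- rho * t) * (f y - f (y - g' t))))%:E.
Proof.
have gt : 0 <= g' t <= y.
  have mt : 0 <= Num.max 0 t by rewrite le_max lexx.
  have [g0 gnd _] := hg.
  by rewrite /g' gy// andbT -[leLHS]g0; exact: gnd.
have /andP[gt0 gty] := gt; have /andP[y0 y1] := y01.
rewrite !EFinM.
rewrite -(cost_FTC f_cost (_ : 0 <= y - g' t) (_ : y - g' t <= y) y1) ?subr_ge0 ?gerBl//.
set c := (\1_ _ _ )%:E.
have c0 : (0 <= c * (expR (- rho * t))%:E)%E by rewrite /c -EFinM lee_fin mulr_ge0 ?indicE ?expR_ge0.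
rewrite muleA -ge0_integralZl//; last 2 first.
- by apply/measurable_EFinP; apply: measurable_funTS.
- by move=> z _; rewrite lee_fin; exact: df0.
rewrite [RHS]integral_mkcond; apply: eq_integral => z _.
rewrite patchE (_ : (z \in `](y - g' t)%R, y[%classic) = (y - g' t < z < y)%R); last first.
  by rewrite mem_setE in_itv.
rewrite /Q /c /= -!EFinM; have [zy|] := boolP (y - g' t < z < y); last first.
  move=> nz; congr EFin; rewrite (indicE _ `]0, y[%classic) mem_setE in_itv/=.
  case: ifPn => h; last by rewrite !mulr0.
  have -> : 0 < z < y = false; last by rewrite mulr0 mul0r.
  apply/negbTE; apply: contra nz => /andP[_ zy]; rewrite zy andbT.
  by rewrite ltrBlDr -ltrBlDl.
have /andP[z1 z2] := zy.
have -> : y - z < g' t by rewrite ltrBlDr -ltrBlDl.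
have z0 : 0 < z by apply: le_lt_trans z1; rewrite subr_ge0.
rewrite (indicE _ `]0, y[%classic) mem_setE in_itv/= z0 z2/= !mulr1.
by congr EFin; rewrite mulrA.
Qed.

Let weight z : R := if passage g (y - z) is r%:E then expR (- rho * r) / rho else 0.

Let Q_t z : (\int[mu]_t (Q (t, z))%:E)%E =
  (\1_(`]0, y[%classic : set R) z * (df z * weight z))%:E.
Proof.
rewrite indicE mem_setE in_itv/=; have [/andP[z0 zy]|nz] := boolP (0 < z < y); last first.
  rewrite mul0r; apply: integral0_eq => t _.
  by rewrite /Q /= (indicE _ `]0, y[%classic) mem_setE in_itv/= (negbTE nz) mulr0 mul0r.
rewrite mul1r.
have QE t : Q (t, z) = \1_(`[0, +oo[%classic : set R) t *
    (expR (- rho * t) * df z * (if y - z < g' t then 1 else 0)).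
  by rewrite /Q/= (indicE _ `]0, y[%classic) mem_setE in_itv/= z0 zy mulr1.
have yz0 : 0 <= y - z by rewrite subr_ge0 ltW.
have gE t : 0 <= t -> (y - z < g' t) = (passage g (y - z) < t%:E)%E.
  by move=> t0; rewrite passage_lt// /g' (max_idPr t0).
have p0 := passage_ge0 g (y - z).
rewrite /weight; move: gE p0; case: (passage g (y - z)) => [r||]// gE p0; last first.
  rewrite mulr0; apply: integral0_eq => t _; rewrite QE indicE mem_setE in_itv/= andbT.
  by have [t0|_] := boolP (0 <= t); rewrite ?mul0r// (gE _ t0) ltNge leey/= !mulr0.
rewrite EFinM -(exponential_tail r rho0) -ge0_integralZl//; last 2 first.
- by apply/measurable_EFinP; apply: measurable_funTS.
- by rewrite lee_fin.
rewrite [RHS]integral_mkcond; apply: eq_integral => t _.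
rewrite patchE (_ : (t \in `]r, +oo[%classic) = (r < t)%R); last by rewrite mem_setE in_itv/= andbT.
rewrite QE indicE mem_setE in_itv/= andbT; rewrite lee_fin in p0.
have [t0|] := boolP (0 <= t); last first.
  by rewrite -ltNge => t0; rewrite [(r < t)%R]ltNge (le_trans (ltW t0) p0) mul0r.
by rewrite (gE _ t0) lte_fin mul1r; case: ifP => _; rewrite ?mulr0// mulr1 mulrC EFinM.
Qed.

(** Stated as a sum of two nonnegative integrals, so that both are seen to be finite before any
    subtraction in the extended reals. *)
Lemma running_cost_time_change :
  (\int[mu]_(t in `[0%R, +oo[) (expR (- rho * t) * f (y - g t))%:E +
   \int[mu]_(z in `]0%R, y[) (df z * weight z)%:E = (f y / rho)%:E)%E.
Proof.
have mQ' : measurable_fun setT (EFin \o Q) by exact/measurable_EFinP.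
have Q0' p : (0 <= (EFin \o Q) p)%E by rewrite lee_fin.
have h := @fubini_tonelli1 _ _ _ _ R mu mu _ mQ' Q0'.
rewrite (@fubini_tonelli2 _ _ _ _ R mu mu _ mQ' Q0') /fubini_F /fubini_G in h.
have hz : (\int[mu]_(z in `]0%R, y[) (df z * weight z)%:E =
    \int[mu]_(t in `[0%R, +oo[) (expR (- rho * t) * (f y - f (y - g t)))%:E)%E.
  transitivity (\int[mu]_z \int[mu]_t (EFin \o Q) (t, z))%E.
    rewrite integral_mkcond; apply: eq_integral => z _; rewrite Q_t patchE indicE mem_setE.
    by case: ifP => _; rewrite ?mul1r ?mul0r.
  rewrite h [RHS]integral_mkcond; apply: eq_integral => t _; rewrite Q_z patchE indicE mem_setE.
  case: ifPn => [|_]; last by rewrite mul0r.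
  rewrite mul1r in_itv/= andbT => t0.
  by rewrite /g' (max_idPr t0).
rewrite {}hz {h mQ' Q0'}.
have mf : measurable_fun [set: R] f by exact: nondecreasing_measurable.
have mfg : measurable_fun (`[0, +oo[%classic : set (measurableTypeR R)) (fun t => f (y - g t)).
  apply: (eq_measurable_fun (fun t => f (y - g' t))).
    by move=> t; rewrite inE/= in_itv/= andbT => t0; rewrite /g' (max_idPr t0).
  apply: measurable_funTS; apply: (measurableT_comp mf); exact: measurable_funB.
have mexp' : measurable_fun (`[0, +oo[%classic : set (measurableTypeR R)) (fun t => expR (- rho * t)).
  exact: measurable_funTS.
transitivity (\int[mu]_(t in `[0%R, +oo[) ((f y)%:E * (expR (- rho * t))%:E))%E.
  rewrite -[LHS](@ge0_integralD _ _ R mu `[0, +oo[%classic _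
    (fun t => (expR (- rho * t) * f (y - g t))%:E)
    (fun t => (expR (- rho * t) * (f y - f (y - g t)))%:E)).
  - by apply: eq_integral => t _; rewrite -EFinD -EFinM; congr EFin; ring.
  - exact: measurable_itv.
  - by move=> t _; rewrite lee_fin mulr_ge0 ?expR_ge0.
  - by apply/measurable_EFinP; apply: measurable_funM.
  - move=> t /=; rewrite in_itv/= andbT => t0; rewrite lee_fin mulr_ge0 ?expR_ge0// subr_ge0.
    by apply: f_nd; rewrite gerBl; have [g0 gnd _] := hg; rewrite -g0; exact: gnd.
  - by apply/measurable_EFinP; apply: measurable_funM => //; apply: measurable_funB.
rewrite ge0_integralZl//=; last 2 first.
- exact/measurable_EFinP.
- by rewrite lee_fin.
rewrite -integral_itv_obnd_cbnd; last first.
  by apply/measurable_EFinP; apply: measurable_funTS.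
by rewrite exponential_tail// mulr0 expR0 mul1r -EFinM.
Qed.

End RunningCostTimeChange.

Lemma add_ge0_fin_num (R : realType) (a b : \bar R) (r : R) : (0 <= a)%E -> (0 <= b)%E ->
  (a + b = r%:E)%E -> a \is a fin_num /\ b \is a fin_num.
Proof. by case: a b => [a||] [b||]. Qed.

(** * Fubini under an integrable bound *)

Section BoundedFubini.
Context d (Omega : measurableType d) (R : realType) (P : probability Omega R).
Notation mu := (@lebesgue_measure R).

Lemma bounded_fubini (y : R) (Psi : measurableTypeR R * Omega -> R) (dom : Omega -> R) :
  measurable_fun setT Psi ->
  (forall z w, `|Psi (z, w)| <= \1_(`]0, y[%classic : set R) z * dom w) -> L1 P dom ->
  [/\ mu.-integrable setT (fun z => \int[P]_w (Psi (z, w))%:E)%E,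
      P.-integrable setT (fun w => \int[mu]_z (Psi (z, w))%:E)%E &
      (\int[mu]_z \int[P]_w (Psi (z, w))%:E = \int[P]_w \int[mu]_z (Psi (z, w))%:E)%E].
Proof.
move=> mPsi PsiD iD.
have mP : measurable_fun setT (EFin \o Psi) by exact/measurable_EFinP.
have iP : (mu \x P)%E.-integrable setT (EFin \o Psi).
  apply/integrable12ltyP => //.
  have mI : measurable_fun [set: measurableTypeR R] (\1_(`]0, y[%classic) : measurableTypeR R -> R).
    exact: measurable_indic.
  apply: (@le_lt_trans _ _ (\int[mu]_z (\1_(`]0, y[%classic : set R) z * E P dom)%:E)%E).
    apply: ge0_le_integral => //.
    - by move=> z _; exact: integral_ge0.
    - apply: (@measurable_fun_fubini_tonelli_F _ _ _ _ _ P (fun p => `|(Psi p)%:E|%E)) => //.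
      by apply: measurableT_comp => //.
    - by apply/measurable_EFinP; exact: measurable_funM.
    - move=> z _; rewrite EFinM -(E_EFin iD) -integralZl//.
      apply: le_integral => //.
      + apply: (@le_integrable _ _ _ P _ measurableT _ (fun w => (\1_(`]0, y[%classic : set R) z)%:E * (dom w)%:E)%E).
        * apply: measurableT_comp => //; apply/measurable_EFinP.
          exact (measurable_fun_pair2 z mPsi).
        * move=> w _; rewrite -EFinM !abse_EFin lee_fin normr_id (le_trans (PsiD z w))//.
          exact: ler_norm.
        * by apply: integrableZl.
      + exact: integrableZl.
      + by move=> w _; rewrite -EFinM lee_fin; exact: PsiD.
  rewrite (_ : (fun z => _) = (EFin \o (fun=> E P dom)) \_ `]0, y[%classic); last first.
    by apply/funext => z; rewrite patchE indicE; case: ifP => _; rewrite ?mul1r ?mul0r.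
  rewrite -integral_mkcond integral_cst//= lebesgue_measure_itv/= lte_fin.
  by case: ifP => _; rewrite -?EFinB -?EFinM ltry.
split.
- exact: (integrable_fubini_F iP).
- apply: (@le_integrable _ _ _ P _ measurableT _ (fun w => (y * dom w)%:E)).
  + exact: (measurable_fubini_G iP).
  + move=> w _; apply: le_trans (le_abse_integral mu measurableT (measurable_fun_pair1 w mP)) _.
    have iI : (\int[mu]_z (\1_(`]0%R, y[%classic : set R) z)%:E <= `|y|%:E)%E.
      rewrite integral_indic// setIT -[X in (X <= _)%E]/(mu `]0, y[%classic).
      rewrite lebesgue_measure_itv/= lte_fin.
      by case: ifP => // _; rewrite -EFinB lee_fin subr0 ler_norm.
    apply: (@le_trans _ _ (\int[mu]_z (`|dom w|%:E * (\1_(`]0%R, y[%classic : set R) z)%:E))%E).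
      apply: ge0_le_integral => //.
      * apply: measurableT_comp => //; exact: (measurable_fun_pair1 w mP).
      * by apply: emeasurable_funM => //; apply/measurable_EFinP; exact: measurable_indic.
      * move=> z _; rewrite -EFinM lee_fin mulrC (le_trans (PsiD z w))//.
        by rewrite ler_wpM2l ?ler_norm ?indicE.
    rewrite ge0_integralZl//; last by apply/measurable_EFinP; exact: measurable_indic.
    by rewrite abse_EFin normrM muleC EFinM lee_wpmul2r ?lee_fin.
  + exact: (L1Z y iD).
- by rewrite (Fubini iP).
Qed.

End BoundedFubini.

Section PassageOptional.
Context d (Omega : measurableType d) (R : realType) (P : probability Omega R).
Variables (W : R -> Omega -> R) (eps : R -> Omega -> 'I_2).
Notation F := (augmented_filtration P W eps).
Notation FT t := (g_sigma_algebraType (genF P W eps t)).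

Lemma passage_optional (g : R -> Omega -> R) (l : R) (t : R) : adapted F g ->
  F t [set w | (passage (g ^~ w) l < t%:E)%E].
Proof.
move=> ag.
rewrite (_ : [set _ | _] = \bigcup_(q : rat)
    [set w | [/\ 0 <= (ratr q : R), l < g (ratr q) w & ((ratr q : R)%:E < t%:E)%E]]); last first.
  apply/seteqP; split=> w /=; first by move=> /passage_ltP[q [q0 q1 q2]]; exists q.
  by move=> [q _ [q0 q1 q2]]; apply/passage_ltP; exists q.
apply: (@bigcupT_measurable_rat _ (FT t)) => q.
have [q0|q0] := boolP (0 <= (ratr q : R)); last first.
  rewrite (_ : [set w | _] = set0); first exact: (@measurable0 _ (FT t)).
  by rewrite -subset0 => w /= [].
have [qt|qt] := boolP ((ratr q : R) < t); last first.
  rewrite (_ : [set w | _] = set0); first exact: (@measurable0 _ (FT t)).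
  by rewrite -subset0 => w /= [_ _]; rewrite lte_fin (negbTE qt).
have -> : [set w | [/\ true, l < g (ratr q) w & ((ratr q : R)%:E < t%:E)%E]] =
    g (ratr q) @^-1` `]l, +oo[.
  apply/seteqP; split=> w /=; rewrite in_itv/= andbT; first by case.
  by move=> lg; split; rewrite ?lte_fin.
by apply: (F_mono (ltW qt)); apply: ag.
Qed.

End PassageOptional.

Lemma measurable_finite_comp d (T : measurableType d) (R : realType) (tau : T -> \bar R)
    (Z : R -> T -> R) : measurable_fun setT tau -> (forall x, (0 <= tau x)%E) ->
  measurable_fun setT (fun x => Z (fine (tau x)) x) ->
  measurable_fun setT (fun x => if tau x is r%:E then Z r x else 0).
Proof.
move=> mtau tau0 mZ.
rewrite (_ : (fun x => _) = fun x => if (tau x < +oo)%E then Z (fine (tau x)) x else 0); last first.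
  by apply/funext => x; have := tau0 x; case: (tau x) => [r||]//= _; rewrite ltry.
apply: measurable_fun_ifT => //.
exact: measurable_fun_lte.
Qed.

(** * The objective as an integral over levels *)

Section Objective.
Context d (Omega : measurableType d) (R : realType) (P : probability Omega R).
Variables (W : R -> Omega -> R) (eps : R -> Omega -> 'I_2) (lambda : 'I_2 -> R).
Hypothesis P_complete : measure_is_complete P.
Hypothesis W_brownian : brownian_motion P W.
Hypothesis eps_markov : markov_chain P (generator lambda) eps.
Notation F := (augmented_filtration P W eps).
Notation mu := (@lebesgue_measure R).
Variables (sigma : 'I_2 -> R) (X : R -> R -> Omega -> R) (x C : R).
Let M t w := X x t w - x.
Hypothesis dfM : diffusion P W eps sigma M C.
Variables (rho c : R) (f : R -> R).
Hypothesis rho0 : 0 < rho.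
Hypothesis f_cost : convex_running_cost f.
Variables (G : Omega -> R).
Hypothesis iG : L1 P G.
Hypothesis GM : {ae P, forall w t, 0 <= t -> expR (- (rho / 2) * t) * `|M t w| <= G w}.
Variables (i : 'I_2) (y : R) (nu : R -> Omega -> R).
Hypothesis y01 : 0 <= y <= 1.
Hypothesis nu_admissible : admissible P W eps y nu.

Let D := initial_regime eps i.
Hypothesis D0 : (0 < P D)%E.
Let th z := c - cost_derive f z / rho.
Let tau z w := passage (nu ^~ w) (y - z).
Let rwd z := reward eps M rho (x - th z) (tau z) D (fun _ => id).

Let FD : F 0 D. Proof. exact (F_eps [set i] (lexx 0)). Qed.
Let mD : measurable D. Proof. exact: (F_measurable P_complete W_brownian eps_markov FD). Qed.

Let GM1 : {ae P, forall w t, 0 <= t -> expR (- rho * t) * `|M t w| <= G w}.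
Proof.
apply: filterS GM => w h t t0; apply: le_trans (h t t0).
rewrite ler_wpM2r// ler_expR !mulNr lerN2 ler_wpM2r//; have := rho0; lra.
Qed.

Let good w := [/\ increasing_path (nu ^~ w), forall t, 0 <= t -> nu t w <= y,
  {within `[0, +oo[, continuous (M ^~ w)} &
  forall t, 0 <= t -> expR (- rho * t) * `|M t w| <= G w].

Let good_ae : {ae P, forall w, good w}.
Proof.
have [_ nuA] := nu_admissible.
apply: filterS3 nuA (df_cont dfM) GM1 => w [hg h] cM gM; split=> // t t0.
by rewrite -subr_ge0; exact: h.
Qed.

Let mnu t : 0 <= t -> measurable_fun setT (nu t).
Proof.
move=> t0; apply: (Fmeas_measurable P_complete W_brownian eps_markov (t := t)).
by apply/FmeasP; case: nu_admissible => + _; exact.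
Qed.

Let cth : continuous th.
Proof.
move=> z; apply: cvgB; first exact: cvg_cst.
by apply: cvgM; [exact: cost_derive_continuous f_cost z|exact: cvg_cst].
Qed.

Let Kth := `|c| + cost_derive f 1 / rho.
Let thK z : `|th z| <= Kth.
Proof.
have d0 := cost_derive_ge0 f_cost z; have d1 := cost_derive_le f_cost z.
apply: (le_trans (ler_normB _ _)); rewrite lerD2l ger0_norm ?divr_ge0// ?(ltW rho0)//.
by rewrite ler_pM2r ?invr_gt0.
Qed.

Let e1 t : 0 <= t -> expR (- rho * t) <= 1.
Proof. by move=> t0; rewrite -expR0 ler_expR mulNr oppr_le0 mulr_ge0// ltW. Qed.

Let J w : \bar R := (stieltjes_integral (fun t => expR (- rho * t) * (X x t w - c))%R (nu ^~ w)
    - \int[mu]_(t in `[0%R, +oo[) (expR (- rho * t) * f (y - nu t w))%:E)%E.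

(** The path [m] is a parameter because [M] is later replaced by a modification. *)
Let phi (m : R -> R) z w : R :=
  if tau z w is r%:E then expR (- rho * r) * (x - th z + m r) else 0.

(** At the time the level [z] is left, the two changes of variables contribute [X - c] and the
    derivative of [f] at [z] over [rho]; their sum is [X - theta z], whence the strike. *)
Let pathwise w : good w -> J w =
  (\int[mu]_(z in `]0%R, y[) (phi (M ^~ w) z w)%:E - (f y / rho)%:E)%E.
Proof.
move=> [hg gy cM gM]; have /andP[y0 y1] := y01.
pose h t := expR (- rho * t) * (X x t w - c).
have hE t : h t = expR (- rho * t) * (M t w + (x - c)) by rewrite /h /M; congr (_ * _); ring.
have hK t : 0 <= t -> `|h t| <= G w + `|x - c|.
  move=> t0; rewrite hE mulrDr (le_trans (ler_normD _ _))// !normrM ger0_norm ?expR_ge0// lerD ?gM//.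
  by rewrite ler_piMl// e1.
have mh : measurable_fun [set: measurableTypeR R] (fun t => h (Num.max 0 t)).
  apply: (@measurable_right_continuous_comp _ (measurableTypeR R) _ unit _ (fun t _ => h t)
    (fun t => Num.max 0 t) (fun=> tt)) => //.
  - move=> _ t t0; rewrite (_ : (fun s => h s) = fun s => expR (- rho * s) * (M s w + (x - c))); last first.
      by apply/funext => s; rewrite hE.
    rewrite hE; apply: cvgM.
      apply: cvg_at_right_filter; apply: continuous_comp; last exact: continuous_expR.
      exact: mulrl_continuous.
    by apply: cvgD; [exact: within_cvg_right|exact: cvg_cst].
  - by move=> t; rewrite le_max lexx.
  - exact: measurable_maxr.
have hrun := running_cost_time_change f_cost rho0 hg y01 gy.
rewrite /J (stieltjes_time_change hg y0 gy mh hK).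
pose wt z : R := if passage (nu ^~ w) (y - z) is r%:E then expR (- rho * r) / rho else 0.
rewrite -/wt in hrun.
have wt0 z : 0 <= wt z.
  by rewrite /wt; case: passage => // r; rewrite divr_ge0 ?expR_ge0// ltW.
have cd0 := cost_derive_ge0 f_cost.
have mtau : measurable_fun [set: measurableTypeR R] (fun z => tau z w).
  apply: (@measurable_passage R _ (measurableTypeR R) (fun _ => nu ^~ w)) => //.
  exact: measurable_funB.
have tau0 z : (0 <= tau z w)%E by exact: passage_ge0.
have b0 : (0 <= \int[mu]_(z in `]0%R, y[) (cost_derive f z * wt z)%:E)%E.
  by apply: integral_ge0 => z _; rewrite lee_fin mulr_ge0.
have a0 : (0 <= \int[mu]_(t in `[0%R, +oo[) (expR (- rho * t) * f (y - nu t w))%:E)%E.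
  by apply: integral_ge0 => t _; rewrite lee_fin mulr_ge0 ?expR_ge0//; case: f_cost.
have mwt : measurable_fun [set: measurableTypeR R] (fun z => cost_derive f z * wt z).
  apply: measurable_funM; first by apply: continuous_measurable_fun; exact: cost_derive_continuous.
  apply: (measurable_finite_comp (Z := fun r _ => expR (- rho * r) / rho) mtau tau0).
  apply: measurable_funM => //; apply: measurableT_comp => //; apply: measurable_funM => //.
  exact: measurableT_comp.
have split z : phi (M ^~ w) z w =
    (if passage (nu ^~ w) (y - z) is r%:E then h r else 0) + cost_derive f z * wt z.
  rewrite /phi /wt -/(tau z w); case: (tau z w) => [r||]; rewrite ?mulr0 ?addr0//.
  by rewrite hE /th; field; rewrite gt_eqF.
have ih : mu.-integrable `]0, y[%classic
    (fun z => (if passage (nu ^~ w) (y - z) is r%:E then h r else 0)%:E).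
  apply: measurable_bounded_integrable => //.
  - by rewrite /= lebesgue_measure_itv/= lte_fin; case: ifP => _; rewrite -?EFinB ltry.
  - apply: measurable_funTS; apply: (measurable_finite_comp (Z := fun r _ => h r) mtau tau0).
    rewrite (_ : (fun z => _) = (fun t => h (Num.max 0 t)) \o (fun z => fine (tau z w))); last first.
      by apply/funext => z /=; rewrite (max_idPr _)// fine_ge0.
    by apply: measurableT_comp => //; exact: measurableT_comp.
  - exists (G w + `|x - c|); split; first exact: num_real.
    move=> K hKK z _ /=; apply: le_trans (ltW hKK); case E : passage => [r||].
    + by apply: hK; rewrite -lee_fin -E; exact: passage_ge0.
    + by rewrite normr0 (le_trans _ (hK 0 _)).
    + by rewrite normr0 (le_trans _ (hK 0 _)).
have iw : mu.-integrable `]0, y[%classic (fun z => (cost_derive f z * wt z)%:E).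
  apply/integrableP; split; first by apply/measurable_EFinP; exact: measurable_funTS.
  rewrite (_ : (\int[_]_(_ in _) _)%E = (\int[mu]_(z in `]0%R, y[) (cost_derive f z * wt z)%:E)%E).
    by have [_ fb] := add_ge0_fin_num a0 b0 hrun; rewrite ltey_eq fb.
  by apply: eq_integral => z _; rewrite /= ger0_norm ?mulr_ge0.
have -> : (\int[mu]_(z in `]0%R, y[) (phi (M ^~ w) z w)%:E =
  \int[mu]_(z in `]0%R, y[) (if passage (nu ^~ w) (y - z) is r%:E then h r else 0)%:E +
  \int[mu]_(z in `]0%R, y[) (cost_derive f z * wt z)%:E)%E.
  by rewrite -integralD//; apply: eq_integral => z _; rewrite split EFinD.
rewrite -hrun.
have fh : (\int[mu]_(z in `]0%R, y[) (if passage (nu ^~ w) (y - z) is r%:E then h r else 0)%:E)%E \is a fin_num.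
  exact: integrable_fin_num.
have fw : (\int[mu]_(z in `]0%R, y[) (cost_derive f z * wt z)%:E)%E \is a fin_num.
  exact: integrable_fin_num.
have fr : (\int[mu]_(t in `[0%R, +oo[) (expR (- rho * t) * f (y - nu t w))%:E)%E \is a fin_num.
  by have [] := add_ge0_fin_num a0 b0 hrun.
rewrite -(fineK fh) -(fineK fw) -(fineK fr) -!(EFinB, EFinD); congr EFin; ring.
Qed.

Section Null.
Variable N : set Omega.
Hypothesis mN : measurable N.
Hypothesis N0 : P N = 0%E.
Hypothesis sN : ~` [set w | good w] `<=` N.

(** Setting [M] to zero on a null set makes all paths right-continuous, hence the integrand jointly
    measurable for Fubini. *)
Let Mt t w := \1_(~` N) w * M t w.
Let goodN w : ~ N w -> good w.
Proof. by move=> nN; apply: contrapT => h; apply: nN; exact: sN. Qed.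

Let Psi (p : measurableTypeR R * Omega) : R :=
  \1_(`]0, y[%classic : set R) p.1 * (\1_(~` N) p.2 * \1_D p.2 * phi (Mt ^~ p.2) p.1 p.2).

Let mPsi : measurable_fun setT Psi.
Proof.
have mI (A : set (measurableTypeR R)) : measurable A ->
    measurable_fun [set: measurableTypeR R] (\1_A : measurableTypeR R -> R).
  by move=> mA; exact: measurable_indic.
have mI' (A : set Omega) : measurable A -> measurable_fun setT (\1_A : Omega -> R).
  by move=> mA; exact: measurable_indic.
have mtau : measurable_fun setT (fun p : measurableTypeR R * Omega => tau p.1 p.2).
  apply: (@measurable_passage R _ _ (fun (p : measurableTypeR R * Omega) => nu ^~ p.2)).
    by move=> q q0; apply: (measurableT_comp (mnu q0)).
  by apply: measurable_funB => //; exact: measurable_fst.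
have mft : measurable_fun setT (fun p : measurableTypeR R * Omega => fine (tau p.1 p.2)).
  exact: measurableT_comp.
apply: measurable_funM.
  exact: (measurableT_comp (mI `]0, y[%classic _) measurable_fst).
apply: measurable_funM.
  apply: measurable_funM.
    exact: (measurableT_comp (mI' (~` N) (measurableC mN)) measurable_snd).
  exact: (measurableT_comp (mI' D mD) measurable_snd).
apply: (measurable_finite_comp (Z := fun r (p : measurableTypeR R * Omega) =>
  expR (- rho * r) * (x - th p.1 + Mt r p.2)) mtau); first by move=> p; exact: passage_ge0.
apply: measurable_funM.
  by apply: measurableT_comp => //; exact: measurable_funM.
apply: measurable_funD.
  apply: measurable_funB => //.
  exact: (measurableT_comp (continuous_measurable_fun cth) measurable_fst).
apply: (@measurable_right_continuous_comp _ _ _ Omega _ Mt _ snd) => //.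
- move=> t t0; apply: measurable_funM; first exact: mI' (measurableC mN).
  exact: (Fmeas_measurable P_complete W_brownian eps_markov (df_meas dfM t0)).
- move=> w t t0.
  have [wN|wN] := boolP (w \in N).
    have wNC : w \in ~` N = false by apply/negbTE; rewrite in_setC negbK.
    rewrite /Mt; under eq_fun do rewrite indicE wNC mul0r.
    by rewrite indicE wNC mul0r; exact: cvg_cst.
  have nN : ~ N w by move=> h; rewrite mem_set in wN.
  have [_ _ cM _] := goodN nN; apply: cvgM; first exact: cvg_cst.
  exact: within_cvg_right.
- by move=> p; rewrite fine_ge0// passage_ge0.
Qed.

Let dom w := `|x| + Kth + `|G w|.
Let idom : L1 P dom.
Proof. by apply: L1D; [exact: L1_cst|exact: L1_abs]. Qed.

Let Psi_dom z w : `|Psi (z, w)| <= \1_(`]0, y[%classic : set R) z * dom w.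
Proof.
rewrite normrM ger0_norm ?indicE//=; apply: ler_wpM2l => //.
have K0 : 0 <= Kth by exact: le_trans (normr_ge0 _) (thK 0).
have dom0 : 0 <= dom w by apply: addr_ge0 => //; exact: addr_ge0.
have [wN|wN] := boolP (w \in ~` N); last by rewrite !mul0r normr0.
rewrite mul1r normrM ger0_norm//; apply: (@le_trans _ _ `|phi (Mt ^~ w) z w|).
  by case: (w \in D); rewrite ?mul1r// mul0r.
rewrite /phi; have := passage_ge0 (nu ^~ w) (y - z); rewrite -/(tau z w).
case: (tau z w) => [r||] r0; rewrite ?normr0//; rewrite lee_fin in r0.
have [_ _ _ gM] : good w by apply: goodN; move: wN; rewrite inE.
rewrite /Mt indicE wN mul1r mulrDr (le_trans (ler_normD _ _))// !normrM ger0_norm ?expR_ge0//.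
apply: lerD; last by rewrite (le_trans (gM r r0))// ler_norm.
apply: (@le_trans _ _ `|x - th z|); first by rewrite ler_piMl// e1.
by apply: (le_trans (ler_normB _ _)); rewrite lerD2l.
Qed.

Let tau_optional z t : 0 <= t -> F t [set w | (tau z w < t%:E)%E].
Proof. by move=> _; apply: passage_optional; case: nu_admissible. Qed.

Lemma objective_integral_null : mu.-integrable `]0, y[%classic (fun z => (E P (rwd z))%:E) /\
  objective P eps X rho c f x y i nu =
  (\int[mu]_(z in `]0%R, y[) ((fine (P D))^-1 * E P (rwd z))%:E - (f y / rho)%:E)%E.
Proof.
have [h1 h2 h3] := bounded_fubini mPsi Psi_dom idom.
have L1r z : L1 P (rwd z).
  exact: (reward_L1 P_complete W_brownian eps_markov dfM rho0 iG GM _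
    (fun w => passage_ge0 (nu ^~ w) (y - z)) (@tau_optional z) FD).
have PsiE z : (\int[P]_w (Psi (z, w))%:E = ((fun z => (E P (rwd z))%:E) \_ `]0%R, y[) z)%E.
  rewrite patchE; case: ifPn => zI; last first.
    by apply: integral0_eq => w _; rewrite /Psi/= indicE (negbTE zI) mul0r.
  rewrite -(E_EFin (L1r z)); apply: ae_eq_integral => //.
  - by apply/measurable_EFinP; exact (measurable_fun_pair2 z mPsi).
  - exact: measurable_int (L1r z).
  - exists N; split=> // w /= h; apply: contrapT => wN; apply: h => _.
    rewrite /Psi/= indicE zI mul1r /rwd /reward /phi -/(tau z w) indicE mem_set// mul1r.
    by congr ((_ * _)%:E); case: (tau z w) => // r; rewrite /Mt indicE mem_set// mul1r.
have iE : mu.-integrable `]0, y[%classic (fun z => (E P (rwd z))%:E).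
  apply/integrable_mkcond; first exact: measurable_itv.
  by rewrite (_ : _ \_ _ = fun z => (\int[P]_w (Psi (z, w))%:E)%E)//; apply/funext => z; rewrite PsiE.
split=> //.
pose A w := (\int[mu]_z (Psi (z, w))%:E)%E.
pose B := (\int[mu]_(z in `]0%R, y[) (E P (rwd z))%:E)%E.
have fB : B \is a fin_num by exact: integrable_fin_num.
have AE : (\int[P]_(w in D) A w = B)%E.
  rewrite /B integral_mkcond [RHS]integral_mkcond; transitivity (\int[P]_w A w)%E.
    apply: eq_integral => w _; rewrite patchE; case: ifPn => // wD.
    by rewrite /A integral0_eq// => z _; rewrite /Psi/= [\1_D w]indicE (negbTE wD) mulr0 mul0r mulr0.
  by rewrite /A -h3; apply: eq_integral => z _; rewrite PsiE.
have JE : (\int[P]_(w in D) J w = B - (f y / rho * fine (P D))%:E)%E.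
  have iA : P.-integrable D A by exact: integrableS h2.
  have ic : P.-integrable D (fun=> (f y / rho)%:E).
    by apply: (integrableS measurableT) => //; exact: finite_measure_integrable_cst.
  have iAc : P.-integrable D (fun w => A w - (f y / rho)%:E)%E by exact: integrableB.
  transitivity (\int[P]_(w in D) (A w - (f y / rho)%:E))%E.
    rewrite integral_mkcond [RHS]integral_mkcond.
    have mAc : measurable_fun setT ((fun w => A w - (f y / rho)%:E)%E \_ D).
      by apply/(measurable_restrictT _ mD); exact: measurable_int iAc.
    have eqJ : ae_eq P setT ((fun w => A w - (f y / rho)%:E)%E \_ D) (J \_ D).
      exists N; split=> // w /= h; apply: contrapT => wN; apply: h => _.
      rewrite !patchE; case: ifPn => // wD.
      rewrite (pathwise (goodN wN)).
      suff -> : A w = (\int[mu]_(z in `]0%R, y[) (phi (M ^~ w) z w)%:E)%E by [].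
      rewrite /A [RHS]integral_mkcond.
      apply: eq_integral => z _; rewrite patchE /Psi/= indicE; case: ifP => _; rewrite ?mul0r// mul1r.
      rewrite 2!indicE wD mem_set// mul1r mul1r; congr EFin; rewrite /phi; case: (tau z w) => // r.
      by rewrite /Mt indicE mem_set// mul1r.
    apply: ae_eq_integral => //; first exact: (ae_measurable_fun P_complete eqJ mAc).
    by apply: filterS eqJ => w h /h.
  rewrite integralB// AE integral_cst//; congr (_ - _)%E.
  by rewrite [RHS]EFinM fineK// fin_num_measure.
have p0 : 0 < fine (P D) by rewrite fine_gt0// D0/= ltey_eq fin_num_measure.
rewrite /objective /cond_expectation -/D -/J JE.
rewrite (_ : (\int[mu]_(z in _) _)%E = ((fine (P D))^-1)%:E * B)%E; last first.
  by rewrite /B -integralZl.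
rewrite -(fineK fB) -EFinB -!EFinM -EFinB; congr EFin; field.
by rewrite !gt_eqF.
Qed.

End Null.

Lemma objective_integral : mu.-integrable `]0, y[%classic (fun z => (E P (rwd z))%:E) /\
  objective P eps X rho c f x y i nu =
  (\int[mu]_(z in `]0%R, y[) ((fine (P D))^-1 * E P (rwd z))%:E - (f y / rho)%:E)%E.
Proof. by have [N [mN N0 sN]] := good_ae; exact: (objective_integral_null mN N0 sN). Qed.

End Objective.

(** * The value of the stopping problem *)

Section RightContinuousPassage.
Context (R : realType).
Variable g : R -> R.
Hypothesis rc : forall t, 0 <= t -> g s @[s --> t^'+] --> g t.

Lemma passage_lt_ex l t : (passage g l < t%:E)%E <-> exists s, [/\ 0 <= s, s < t & l < g s].
Proof.
split=> [/passage_ltP[q [q0 lq]]|[s [s0 st ls]]].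
  by rewrite lte_fin => qt; exists (ratr q).
have [e /= e0 h] : \forall r \near s^'+, l < g r by exact: cvgr_gt (rc s0) _ ls.
have [q] := @rat_in_itvoo R s (Num.min t (s + e)) ltac:(by rewrite lt_min st ltrDl).
rewrite in_itv/= lt_min => /and3P[sq qt qe].
apply/passage_ltP; exists q; split; rewrite ?lte_fin//; first by rewrite (le_trans s0)// ltW.
by apply: h => //=; rewrite distrC gtr0_norm ?subr_gt0// ltrBlDl.
Qed.

Lemma passage_before l t : 0 <= t -> (t%:E < passage g l)%E -> g t <= l.
Proof.
move=> t0 tp; rewrite leNgt; apply/negP => lg.
have h t' : t < t' -> (passage g l < t'%:E)%E by move=> tt; apply/passage_lt_ex; exists t.
move: tp h; case: (passage g l) => [r||]//.
  by rewrite lte_fin => tr /(_ r tr); rewrite ltxx.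
by move=> _ /(_ (t + 1)); rewrite ltrDl ltr01 => /(_ isT).
Qed.

(** If [g r < l], right continuity keeps [g] below [l] just after [r] and delays the passage. *)
Lemma passage_at l r : passage g l = r%:E -> l <= g r.
Proof.
move=> pr; have r0 : 0 <= r by rewrite -lee_fin -pr passage_ge0.
rewrite leNgt; apply/negP => gl.
have [e /= e0 h] : \forall s \near r^'+, g s < l by exact: cvgr_lt (rc r0) _ gl.
have : (passage g l < (r + e)%:E)%E by rewrite pr lte_fin ltrDl.
move=> /passage_lt_ex[s [s0 se ls]].
have [sr|rs|sr] := ltgtP s r.
- have : (passage g l < r%:E)%E by apply/passage_lt_ex; exists s.
  by rewrite pr ltxx.
- have := h s; rewrite /= distrC gtr0_norm ?subr_gt0// ltrBlDl se => /(_ isT rs).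
  by rewrite ltNge ltW.
- by move: ls; rewrite sr ltNge ltW.
Qed.

End RightContinuousPassage.

Section CondExpectation.
Context d (Omega : measurableType d) (R : realType) (P : probability Omega R).
Hypothesis P_complete : measure_is_complete P.

Lemma cond_expectation_ae (D : set Omega) (Z : Omega -> \bar R) (U : Omega -> R) :
  measurable D -> L1 P U -> (forall w, ~ D w -> U w = 0) ->
  {ae P, forall w, D w -> Z w = (U w)%:E} ->
  cond_expectation P D Z = ((fine (P D))^-1 * E P U)%:E.
Proof.
move=> mD iU U0 ZU; rewrite /cond_expectation EFinM -(E_EFin iU) integral_mkcond.
have eqZ : ae_eq P setT (EFin \o U) (Z \_ D).
  apply: filterS ZU => w h _; rewrite patchE; case: ifPn => wD.
    by rewrite /= h//; move: wD; rewrite inE.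
  by rewrite /= U0// => h'; rewrite mem_set in wD.
congr (_ * _)%E; symmetry; apply: ae_eq_integral => //; first exact: measurable_int iU.
exact: (ae_measurable_fun P_complete eqZ (measurable_int _ iU)).
Qed.

End CondExpectation.

Section Optional.
Context d (Omega : measurableType d) (R : realType) (P : probability Omega R).
Variables (W : R -> Omega -> R) (eps : R -> Omega -> 'I_2).
Notation F := (augmented_filtration P W eps).
Notation FT t := (g_sigma_algebraType (genF P W eps t)).

Lemma stopping_optional (tau : Omega -> \bar R) : stopping_time F tau ->
  forall t, 0 <= t -> F t [set w | (tau w < t%:E)%E].
Proof.
move=> [tau0 Ftau] t t0.
rewrite (_ : [set _ | _] = \bigcup_n [set w | (tau w <= (t - n.+1%:R^-1)%:E)%E]); last first.
  apply/seteqP; split=> w /=; last first.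
    move=> [n _ /= h]; apply: (le_lt_trans h); rewrite lte_fin.
    by rewrite ltrBlDr ltrDl invr_gt0 ltr0n.
  move=> h; have : exists2 r, tau w = r%:E & r < t.
    by move: (tau0 w) h; case: (tau w) => // r _; rewrite lte_fin; exists r.
  move=> [r tr rt]; have := rt; rewrite -subr_gt0 => tr0.
  exists (Num.truncn (t - r)^-1) => //=; rewrite tr lee_fin lerBrDl -lerBrDr.
  by rewrite -[leRHS]invrK lef_pV2 ?posrE ?invr_gt0// ltW// Num.Theory.truncnS_gt.
apply: (@bigcupT_measurable _ (FT t)) => n.
have [h|h] := ltP (t - n.+1%:R^-1) 0.
  rewrite (_ : [set w | _] = set0); first exact: (@measurable0 _ (FT t)).
  by rewrite -subset0 => w /= h'; have := le_trans (tau0 w) h'; rewrite lee_fin leNgt h.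
by apply: F_mono (Ftau _ h); rewrite lerBlDr lerDl invr_ge0.
Qed.

(** The event [tau + a <= t] is the intersection of the events [tau < t - a + a / n], all known by
    time [t]: the delay stands in for right continuity of the filtration. *)
Lemma optional_shift (tau : Omega -> R) (a : R) : 0 < a -> (forall w, 0 <= tau w) ->
  (forall t, 0 <= t -> F t [set w | tau w < t]) ->
  stopping_time F (fun w => (tau w + a)%:E).
Proof.
move=> a0 tau0 Ftau; split=> [w|t t0]; first by rewrite lee_fin addr_ge0// ltW.
have [ta|at_] := ltP t a.
  rewrite (_ : [set w | _] = set0); first exact: (@measurable0 _ (FT t)).
  rewrite -subset0 => w /=; rewrite lee_fin => h.
  have := le_lt_trans h ta; rewrite ltNge lerDr => /negP; apply; exact: tau0.
rewrite (_ : [set w | _] = \bigcap_n [set w | tau w < t - a + a / n.+1%:R]); last first.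
  apply/seteqP; split=> w /=; rewrite lee_fin -lerBrDr.
    by move=> h n _ /=; apply: (le_lt_trans h); rewrite ltrDl divr_gt0.
  move=> h; apply/ler_addgt0Pr => e e0; apply: ltW.
  apply: (lt_le_trans (h (Num.truncn (a / e)) I)); rewrite lerD2l ler_pdivrMr//.
  by rewrite mulrC -ler_pdivrMr// ltW// Num.Theory.truncnS_gt.
apply: (@bigcapT_measurable _ (FT t)) => n.
have an : a / n.+1%:R <= a by rewrite ler_pdivrMr// ler_peMr ?ler1n// ltW.
have h0 : 0 <= t - a + a / n.+1%:R by rewrite addr_ge0 ?subr_ge0// divr_ge0// ltW.
by apply: F_mono (Ftau _ h0); rewrite -lerBrDl opprB addrC subrK.
Qed.

End Optional.

(** * The stopping value and its hitting time *)

Section StoppingValue.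
Context d (Omega : measurableType d) (R : realType) (P : probability Omega R).
Variables (W : R -> Omega -> R) (eps : R -> Omega -> 'I_2) (lambda : 'I_2 -> R).
Hypothesis P_complete : measure_is_complete P.
Hypothesis lambda0 : forall i, 0 < lambda i.
Hypothesis W_brownian : brownian_motion P W.
Hypothesis eps_markov : markov_chain P (generator lambda) eps.
Hypothesis W_eps_independent : independent_systems P
  (process_sigma measurable W `[0, +oo[) (process_sigma setT eps `[0, +oo[).
Notation F := (augmented_filtration P W eps).
Variables (sigma : 'I_2 -> R) (X : R -> R -> Omega -> R) (x C : R).
Let M t w := X x t w - x.
Hypothesis C0 : 0 < C.
Hypothesis dfM : diffusion P W eps sigma M C.
Variables (rho : R).
Hypothesis rho0 : 0 < rho.
Variables (G : Omega -> R).
Hypothesis iG : L1 P G.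
Hypothesis GM : {ae P, forall w t, 0 <= t -> expR (- (rho / 2) * t) * `|M t w| <= G w}.
Variables (b : 'I_2 -> R) (v dv Iv : 'I_2 -> R -> R) (L : R).
Hypothesis ss : stopping_solution rho sigma lambda b v dv Iv L.

Let GM1 : {ae P, forall w t, 0 <= t -> expR (- rho * t) * `|M t w| <= G w}.
Proof.
apply: filterS GM => w h t t0; apply: le_trans (h t t0).
rewrite ler_wpM2r// ler_expR !mulNr lerN2 ler_wpM2r//; have := rho0; lra.
Qed.

Let excess x0 w t := x0 + M t w - b (eps t w).
Definition hitting x0 w : \bar R := passage (excess x0 w) 0.

Lemma hitting_optional x0 t : 0 <= t -> F t [set w | (hitting x0 w < t%:E)%E].
Proof.
move=> t0; apply: (passage_optional (g := fun t w => excess x0 w t)) => s s0.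
apply/FmeasP; apply: (Fmeas_state dfM x0 (u := fun i y => y - b i) s0) => i.
exact: measurable_funB.
Qed.

(** One exceptional set serves all [x0], that is, all strikes: [optimal_passage] compares a
    continuum of levels on a single path. *)
Lemma excess_right_cont : {ae P, forall w x0 t, 0 <= t ->
  excess x0 w s @[s --> t^'+] --> excess x0 w t}.
Proof.
apply: filterS2 (mc_cadlag eps_markov) (df_cont dfM) => w ce cM x0 t t0.
apply: (regime_right_cont (e := eps ^~ w) (y := fun s => x0 + M s w) (u := fun i y => y - b i) ce _ t0).
  by move=> s; apply: cvgD; [exact: cvg_cst|exact: cM].
by move=> i s; apply: cvgB; [exact: cvg_id|exact: cvg_cst].
Qed.

Variable i : 'I_2.
Let D := initial_regime eps i.
Hypothesis D0 : (0 < P D)%E.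
Let FD : F 0 D. Proof. exact (F_eps [set i] (lexx 0)). Qed.
Let mD : measurable D. Proof. exact: (F_measurable P_complete W_brownian eps_markov FD). Qed.
Let p0 : 0 < fine (P D). Proof. by rewrite fine_gt0// D0/= ltey_eq fin_num_measure. Qed.

Lemma reward_hitting x0 : E P (reward eps M rho x0 (hitting x0) D (fun _ => id)) = v i x0 * fine (P D).
Proof.
apply: (reward_eq P_complete lambda0 W_brownian eps_markov W_eps_independent C0 dfM rho0 iG GM ss
  (fun w => passage_ge0 _ _) (@hitting_optional x0) FD (erefl _)).
- apply: filterS excess_right_cont => w rc t t0 h; rewrite -subr_le0.
  exact: (passage_before (rc x0) t0 h).
- apply: filterS excess_right_cont => w rc r h; rewrite -subr_ge0.
  exact: (passage_at (rc x0) h).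
Qed.

Variables (c : R) (f : R -> R) (y : R).
Let x0 := x - theta rho c f y.

Let stopping_value_le : (stopping_value P W eps X rho c f x i y <= (v i x0)%:E)%E.
Proof.
apply: ub_ereal_sup => _ [tau [st fin] <-].
have tau0 := st.1; have otau := stopping_optional st.
rewrite (@cond_expectation_ae _ _ _ P P_complete _ _ (reward eps M rho x0 tau D (fun _ => id)))//.
- rewrite lee_fin mulrC ler_pdivrMr//.
  exact: (reward_le P_complete lambda0 W_brownian eps_markov W_eps_independent C0 dfM rho0 iG GM ss
    x0 tau0 otau FD (erefl _)).
- exact: (reward_L1 P_complete W_brownian eps_markov dfM rho0 iG GM x0 tau0 otau FD).
- by move=> w wD; rewrite /reward indicE memNset// mul0r.
- apply: filterS fin => w h wD; rewrite /reward indicE mem_set// mul1r -(fineK (h wD))/=.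
  by congr ((_ * _)%:E); rewrite /x0 /M; ring.
Qed.

(* The hitting time need be neither finite nor a stopping time (only
   [{hitting < t}] is in F_t), so it is truncated and delayed by [1 / n]. *)
Let stopping_value_ge : ((v i x0)%:E <= stopping_value P W eps X rho c f x i y)%E.
Proof.
pose tau := hitting x0.
have tau0 w : (0 <= tau w)%E by exact: passage_ge0.
pose kap (T : nat) w := fine (Order.min (tau w) T%:R%:E).
have k0 T w : 0 <= kap T w by exact: truncated_ge0.
have ok T := truncated_optional tau0 (@hitting_optional x0) T.
pose U T a w := \1_D w * (expR (- rho * (kap T w + a)) * (x0 + M (kap T w + a) w)).
have mk T : measurable_fun setT (kap T).
  exact (optional_measurable P_complete W_brownian eps_markov (k0 T) (ok T)).
have gid (j : 'I_2) (z : R) : `|z| <= 1 * (1 + `|z|) by rewrite mul1r lerDr.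
have cid (j : 'I_2) : continuous (fun z : R => z) by move=> z; exact: cvg_id.
have iU T a : 0 <= a -> L1 P (U T a).
  move=> a0; apply: (stopped_L1 P_complete W_brownian eps_markov dfM rho0 iG GM x0 FD
    (u := fun _ z => z) cid ler01 gid (s := fun w => kap T w + a)).
  - by move=> w; rewrite addr_ge0.
  - exact: measurable_funD.
have cUn T : E P (U T n.+1%:R^-1) @[n --> \oo] --> E P (U T 0).
  have iV : L1 P (fun w => 1 * (1 + `|x0| + G w)) by apply: L1Z; apply: L1D => //; exact: L1_cst.
  have mU a : 0 <= a -> measurable_fun setT (U T a) by move=> a0; exact: L1_measurable (iU T a a0).
  have [] // := cvg_E_ae (U_ := fun n => U T n.+1%:R^-1) (U := U T 0) (fun n => mU _ _) (mU 0 (lexx 0)) iV _ _.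
  - apply: filterS (discount_state_bound eps rho0 x0 GM1 (u := fun _ z => z) ler01 gid) => w h n.
    rewrite /U normrM; apply: le_trans (h _ (_ : 0 <= kap T w + n.+1%:R^-1)); last first.
      by rewrite addr_ge0// invr_ge0.
    by rewrite ler_piMl// indicE; case: (_ \in _); rewrite ?normr0 ?normr1.
  - apply: filterS (df_cont dfM) => w cM; rewrite /U; apply: cvgM; first exact: cvg_cst.
    pose h t := expR (- rho * t) * (x0 + M t w).
    have rch : h s @[s --> (kap T w)^'+] --> h (kap T w).
      apply: cvgM.
        apply: cvg_at_right_filter; apply: continuous_comp; last exact: continuous_expR.
        exact: mulrl_continuous.
      by apply: cvgD; [exact: cvg_cst|exact: within_cvg_right].
    rewrite addr0 => A /rch [e /= e0 tA].
    have /cvgrPdist_lt /(_ _ e0) := @cvg_harmonic R; apply: filterS => n /=.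
    rewrite sub0r normrN => ne; apply: tA => /=; last by rewrite ltrDl invr_gt0.
    by rewrite opprD addrA subrr sub0r normrN.
have [_ cr] := reward_cvg P_complete W_brownian eps_markov dfM rho0 iG GM x0 tau0
  (@hitting_optional x0) FD (u := fun _ z => z) cid ler01 gid.
have ge T n : (((fine (P D))^-1 * E P (U T n.+1%:R^-1))%:E <= stopping_value P W eps X rho c f x i y)%E.
  have n0 : 0 < n.+1%:R^-1 :> R by rewrite invr_gt0.
  have st := optional_shift n0 (k0 T) (ok T).
  apply: ereal_sup_ubound; exists (fun w => (kap T w + n.+1%:R^-1)%:E).
    by split=> //; apply: aeW.
  apply: cond_expectation_ae => //.
  - exact: iU (ltW n0).
  - by move=> w wD; rewrite /U indicE memNset// mul0r.
  - apply: aeW => w wD; rewrite /U indicE mem_set// mul1r/=.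
    by congr ((_ * _)%:E); rewrite /x0 /M; ring.
move: ge; case: stopping_value => [s||] ge; last 2 first.
- by rewrite leey.
- by have := ge 0%N 0%N; rewrite leeNy_eq.
rewrite lee_fin -(ler_pM2r p0) -(reward_hitting x0).
have le_s T n : E P (U T n.+1%:R^-1) <= s * fine (P D).
  by have := ge T n; rewrite lee_fin mulrC ler_pdivrMr.
apply: (cvgr_to_le cr); apply: nearW => T.
have -> : E P (fun w => \1_D w * (expR (- rho * kap T w) * (x0 + M (kap T w) w))) = E P (U T 0).
  by congr (E P _); apply/funext => w; rewrite /U addr0.
by apply: (cvgr_to_le (cUn T)); apply: nearW => n.
Qed.

Lemma stopping_valueE : stopping_value P W eps X rho c f x i y = (v i x0)%:E.
Proof. by apply/le_anti; rewrite stopping_value_le stopping_value_ge. Qed.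

End StoppingValue.

(** * The optimal control *)

Section RunningInfimum.
Context (R : realType).
Variables (beta : R -> R) (y : R).
Hypothesis beta0 : forall s, 0 <= beta s.
Hypothesis y0 : 0 <= y.

(** One path of [optimal_control], for an arbitrary nonnegative boundary path [beta]. *)
Definition pushdown t := if t <= 0 then 0 else Num.max 0 (y - inf [set beta s | s in `[0, t[]).

Let lb t : has_lbound [set beta s | s in `[0, t[].
Proof. by exists 0 => _ [s _ <-]. Qed.

Let ne t : 0 < t -> [set beta s | s in `[0, t[] !=set0.
Proof. by move=> t0; exists (beta 0), 0 => //=; rewrite in_itv/= lexx. Qed.

Lemma pushdown_ge0 t : 0 <= pushdown t.
Proof. by rewrite /pushdown; case: ifP => // _; rewrite le_max lexx. Qed.

Lemma pushdown_le t : pushdown t <= y.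
Proof.
rewrite /pushdown; case: (leP t 0) => // t0; rewrite ge_max y0 lerBlDr lerDl/=.
by apply: lb_le_inf; [exact: ne|move=> _ [s _ <-]].
Qed.

(** A strict inequality turns the infimum into the existence of an earlier time. Monotonicity, left
    continuity and the comparison with hitting times all follow from this form. *)
Lemma pushdown_lt l t : 0 <= l ->
  l < pushdown t <-> exists s, [/\ 0 <= s, s < t & beta s < y - l].
Proof.
move=> l0; rewrite /pushdown; case: (leP t 0) => t0.
  split=> [|[s [s0 st _]]]; first by rewrite ltNge l0.
  by have := le_lt_trans s0 (lt_le_trans st t0); rewrite ltxx.
rewrite lt_max ltNge l0/= ltrBrDr addrC -ltrBrDr; split=> [h|[s [s0 st bs]]].
  have [_ [s /= + <-] bs] := inf_lt (ne t0) h.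
  by rewrite in_itv/= => /andP[s0 st]; exists s.
apply: le_lt_trans bs; apply: ge_inf => //; exists s => //=.
by rewrite in_itv/= s0.
Qed.

Lemma pushdown_path : increasing_path pushdown.
Proof.
have nd s t : s <= t -> pushdown s <= pushdown t.
  move=> st; rewrite leNgt; apply/negP => /(pushdown_lt _ (pushdown_ge0 t))[r [r0 rs br]].
  suff : pushdown t < pushdown t by rewrite ltxx.
  by apply/(pushdown_lt _ (pushdown_ge0 t)); exists r; split=> //; exact: lt_le_trans st.
split=> [|s t _|t t0]; [by rewrite /pushdown lexx|exact: nd|].
apply/cvgrPdist_lt => e e0.
have [l0|l0] := ltP (pushdown t - e) 0.
  near=> s; have st : s <= t by apply: ltW; near: s; exact: nbhs_left_lt.
  rewrite ger0_norm ?subr_ge0 ?nd//.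
  by have := pushdown_ge0 s; lra.
have /(pushdown_lt _ l0)[r [r0 rt br]] : pushdown t - e < pushdown t by rewrite ltrBlDr ltrDl.
near=> s; have st : s <= t by apply: ltW; near: s; exact: nbhs_left_lt.
rewrite ger0_norm ?subr_ge0 ?nd//.
rewrite ltrBlDr addrC -ltrBlDr; apply/(pushdown_lt _ l0); exists r; split=> //.
Unshelve. all: by end_near. Qed.

End RunningInfimum.

(** * Inverse of the boundaries *)

Section InverseBoundary.
Context (R : realType).
Variables (rho c : R) (sigma lambda : 'I_2 -> R) (f : R -> R).
Hypothesis rho0 : 0 < rho.
Hypothesis f_cost : convex_running_cost f.
Notation x_ := (x_star rho c sigma lambda f).
Notation b_ := (b_star rho c sigma lambda f).

Let th z := c - cost_derive f z / rho.

Lemma thetaE z : 0 <= z <= 1 -> theta rho c f z = th z.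
Proof. by move=> z01; rewrite /theta /th cost_deriveE. Qed.

Lemma x_star_decr i a b : 0 <= a -> a < b -> b <= 1 -> x_ i b < x_ i a.
Proof.
move=> a0 ab b1; rewrite !x_starE !thetaE; last 2 first.
- by rewrite a0/= (le_trans _ b1)// ltW.
- by rewrite b1 andbT (le_trans a0)// ltW.
rewrite ltrD2l ltrD2l ltrN2 ltr_pM2r ?invr_gt0//; exact: cost_derive_incr.
Qed.

Lemma x_star_continuous i : {within `[0, 1], continuous (x_ i)}.
Proof.
have c1 : continuous (fun z => threshold rho sigma lambda i + th z).
  move=> z; apply: cvgD; first exact: cvg_cst.
  apply: cvgB; first exact: cvg_cst.
  by apply: cvgM; [exact: cost_derive_continuous f_cost z|exact: cvg_cst].
apply: (@subspace_eq_continuous _ _ _ (fun z => threshold rho sigma lambda i + th z)).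
  by move=> z; rewrite inE/= in_itv/= => z01; rewrite /from_subspace/= x_starE thetaE.
exact: continuous_subspaceT.
Qed.

Lemma b_star_interior i xi : x_ i 1 < xi -> xi < x_ i 0 ->
  0 <= b_ i xi <= 1 /\ x_ i (b_ i xi) = xi.
Proof.
move=> h1 h0; rewrite /b_star [xi <= _]leNgt h1/= [_ <= xi]leNgt h0/=.
have [m m01 mxi] : exists2 m, m \in `[0, 1]%R & x_ i m = xi.
  apply: IVT => //; first exact: x_star_continuous.
  by rewrite ge_min (ltW h1) orbT le_max (ltW h0).
have im : (x_ i @` `[0, 1]%classic) xi by exists m.
split; last by apply: pinvK; rewrite inE.
have h := @surjpinv_image_sub _ _ (fun=> 0) `[0, 1]%classic (x_ i @` `[0, 1]%classic) (x_ i) (fun _ => id).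
by have : `[0, 1]%classic ('pinv_(fun=> 0) `[0, 1] (x_ i) xi) by apply: h; exists xi.
Qed.

Lemma b_star_ge0 i xi : 0 <= b_ i xi.
Proof.
have [h1|h1] := leP xi (x_ i 1); first by rewrite /b_star h1.
have [h0|h0] := leP (x_ i 0) xi; first by rewrite /b_star [xi <= _]leNgt h1 h0.
by have [/andP[]] := b_star_interior h1 h0.
Qed.

(** Strict comparison with a level in []0, 1]] is inverted exactly, also on the two plateaus of the
    boundary; this turns the control into hitting times of the stopping regions. *)
Lemma b_star_lt i xi z : 0 < z <= 1 -> (b_ i xi < z) = (x_ i z < xi).
Proof.
move=> /andP[z0 z1].
have le1 : x_ i 1 <= x_ i z.
  by move: z1; rewrite le_eqVlt => /predU1P[->//|z1]; apply/ltW/x_star_decr => //; exact: ltW.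
have lt0 : x_ i z < x_ i 0 by exact: x_star_decr.
have [h1|h1] := leP xi (x_ i 1).
  rewrite /b_star h1 [RHS]ltNge (le_trans h1 le1); by rewrite ltNge z1.
have [h0|h0] := leP (x_ i 0) xi.
  by rewrite /b_star [xi <= _]leNgt h1 h0/= z0 (lt_le_trans lt0).
have [/andP[b0 b1] {2}<-] := b_star_interior h1 h0.
set m := b_ i xi in b0 b1 *.
have [mz|zm|->] := ltgtP m z; last by rewrite ltxx.
  by rewrite x_star_decr.
by apply/esym/negbTE; rewrite -leNgt; apply/ltW/x_star_decr => //; exact: ltW.
Qed.

End InverseBoundary.

Lemma ereal_eq_lt (R : realType) (p q : \bar R) : (0 <= p)%E -> (0 <= q)%E ->
  (forall t : R, 0 <= t -> (p < t%:E)%E = (q < t%:E)%E) -> p = q.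
Proof.
case: p q => [r||] [s||]//; rewrite ?lee_fin => r0 s0 h.
- congr EFin; have [rs|sr|//] := ltgtP r s.
    by have := h s s0; rewrite !lte_fin rs ltxx.
  by have := h r r0; rewrite !lte_fin sr ltxx.
- by have := h (r + 1) (addr_ge0 r0 ler01); rewrite !lte_fin ltrDl ltr01.
- by have := h (s + 1) (addr_ge0 s0 ler01); rewrite !lte_fin ltrDl ltr01.
Qed.

(** * Optimality of the reflecting control *)

Section Optimal.
Context d (Omega : measurableType d) (R : realType) (P : probability Omega R).
Variables (W : R -> Omega -> R) (eps : R -> Omega -> 'I_2) (lambda : 'I_2 -> R).
Hypothesis P_complete : measure_is_complete P.
Hypothesis lambda0 : forall i, 0 < lambda i.
Hypothesis W_brownian : brownian_motion P W.
Hypothesis eps_markov : markov_chain P (generator lambda) eps.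
Hypothesis W_eps_independent : independent_systems P
  (process_sigma measurable W `[0, +oo[) (process_sigma setT eps `[0, +oo[).
Notation F := (augmented_filtration P W eps).
Notation FT t := (g_sigma_algebraType (genF P W eps t)).
Notation mu := (@lebesgue_measure R).
Variables (sigma : 'I_2 -> R) (X : R -> R -> Omega -> R) (x C : R).
Let M t w := X x t w - x.
Hypothesis C0 : 0 < C.
Hypothesis dfM : diffusion P W eps sigma M C.
Variables (rho c : R) (f : R -> R).
Hypothesis rho0 : 0 < rho.
Hypothesis f_cost : convex_running_cost f.
Variables (G : Omega -> R).
Hypothesis iG : L1 P G.
Hypothesis GM : {ae P, forall w t, 0 <= t -> expR (- (rho / 2) * t) * `|M t w| <= G w}.
Notation b := (threshold rho sigma lambda).
Variables (v dv Iv : 'I_2 -> R -> R) (L : R).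
Hypothesis ss : stopping_solution rho sigma lambda b v dv Iv L.
Variables (i : 'I_2) (y : R).
Hypothesis y01 : 0 <= y <= 1.
Let D := initial_regime eps i.
Hypothesis D0 : (0 < P D)%E.

Let th z := c - cost_derive f z / rho.
Let FD : F 0 D. Proof. exact (F_eps [set i] (lexx 0)). Qed.
Let mD : measurable D. Proof. exact: (F_measurable P_complete W_brownian eps_markov FD). Qed.
Let p0 : 0 < fine (P D). Proof. by rewrite fine_gt0// D0/= ltey_eq fin_num_measure. Qed.
Let y0 : 0 <= y. Proof. by case/andP: y01. Qed.
Let y1 : y <= 1. Proof. by case/andP: y01. Qed.

Let nu_star := optimal_control eps X (b_star rho c sigma lambda f) x y.

Let boundary w s := b_star rho c sigma lambda f (eps s w) (X x s w).
Let boundary0 w s : 0 <= boundary w s. Proof. exact: b_star_ge0. Qed.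
Let nu_starE w : nu_star ^~ w = pushdown (boundary w) y. Proof. by []. Qed.

(* The optimal control leaves the level [z = y - l] exactly at the optimal time
   of the stopping problem with strike [theta z]. *)
Lemma optimal_passage : {ae P, forall w l, 0 <= l -> l < y ->
  passage (nu_star ^~ w) l = hitting eps X x b (x - th (y - l)) w}.
Proof.
apply: filterS (excess_right_cont eps_markov dfM b) => w rc l l0 ly.
apply: ereal_eq_lt => [||t t0]; [exact: passage_ge0|exact: passage_ge0|].
rewrite nu_starE (passage_lt (pushdown_path y (boundary0 w)) l0 t0).
have z01 : 0 < y - l <= 1 by rewrite subr_gt0 ly/= lerBlDr (le_trans y1)// lerDl.
have E s : (boundary w s < y - l) =
    (0 < x - th (y - l) + (X x s w - x) - threshold rho sigma lambda (eps s w)).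
  rewrite /boundary b_star_lt// x_starE thetaE//; last first.
    by case/andP: z01 => /ltW -> ->.
  rewrite -/(th _) -subr_gt0; congr (0 < _); ring.
apply/idP/idP.
  move=> /(pushdown_lt y (boundary0 w) t l0)[s [s0 st bs]].
  by apply/(passage_lt_ex (rc _)); exists s; split=> //; rewrite -E.
move=> /(passage_lt_ex (rc _))[s [s0 st bs]].
by apply/(pushdown_lt y (boundary0 w) t l0); exists s; split=> //; rewrite E.
Qed.

Lemma optimal_admissible : admissible P W eps y nu_star.
Proof.
split; last first.
  apply: aeW => w; split; first exact: (pushdown_path y (boundary0 w)).
  by move=> t t0; rewrite subr_ge0; exact: (pushdown_le (boundary0 w) y0).
move=> t t0; apply/(FmeasP P W eps).
apply: (measurability _ (RGenOInfty.measurableE R)).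
move=> _ [_ [l ->] <-]; rewrite setTI.
rewrite (_ : _ @^-1` _ = [set w | l < nu_star t w]); last first.
  by apply/seteqP; split=> w /=; rewrite in_itv/= andbT.
have [l0|l0] := ltP l 0.
  rewrite (_ : [set w | _] = setT); first exact: (@measurableT _ (FT t)).
  apply/seteqP; split=> w //= _; apply: (lt_le_trans l0).
  exact: (pushdown_ge0 (boundary w) y).
have [yl|ly] := leP y l.
  rewrite (_ : [set w | _] = set0); first exact: (@measurable0 _ (FT t)).
  rewrite -subset0 => w /= h.
  by have := lt_le_trans h (le_trans (pushdown_le (boundary0 w) y0 t) yl); rewrite ltxx.
(* The control exceeds [l] at time [t] when the hitting time for the level [y - l] is before [t].
   The identity is almost sure, and the completed filtration absorbs the exceptional set. *)
apply: (F_ae_eq (hitting_optional dfM b (x - th (y - l)) t0)).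
apply: filterS optimal_passage => w h /=; rewrite -h//.
by rewrite (passage_lt (pushdown_path y (boundary0 w)) l0 t0).
Qed.

Let cth : continuous th.
Proof.
move=> z; apply: cvgB; first exact: cvg_cst.
by apply: cvgM; [exact: cost_derive_continuous f_cost z|exact: cvg_cst].
Qed.

Let cvth : continuous (fun z => v i (x - th z)).
Proof.
move=> z; apply: (@continuous_comp _ _ _ (fun z => x - th z) (v i)).
  by apply: cvgB; [exact: cvg_cst|exact: cth].
exact: (is_derive_continuous (ss_w ss i)).
Qed.

Let iv : mu.-integrable `]0, y[%classic (fun z => (v i (x - th z))%:E).
Proof.
apply: (@integrableS _ _ _ mu `[0, y]%classic) => //.
  by move=> z /=; rewrite !in_itv/= => /andP[/ltW -> /ltW ->].
apply: continuous_compact_integrable; first exact: segment_compact.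
exact: continuous_subspaceT.
Qed.

Let value := (\int[mu]_(z in `]0%R, y[) (v i (x - th z))%:E - (f y / rho)%:E)%E.

Lemma objective_le nu : admissible P W eps y nu -> (objective P eps X rho c f x y i nu <= value)%E.
Proof.
move=> adm.
have [iE ->] := objective_integral P_complete W_brownian eps_markov dfM c rho0 f_cost iG GM y01 adm D0.
apply: leeB => //; apply: le_integral => //.
  exact: (integrableZl _ _ iE).
move=> z; rewrite inE/= in_itv/= => /andP[z0 zy].
rewrite lee_fin mulrC ler_pdivrMr//.
apply: (reward_le P_complete lambda0 W_brownian eps_markov W_eps_independent C0 dfM rho0 iG GM ss
  _ (fun w => passage_ge0 _ _) _ FD (erefl _)).
by move=> t t0; apply: passage_optional; case: adm.
Qed.

Lemma objective_optimal : objective P eps X rho c f x y i nu_star = value.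
Proof.
have [iE ->] := objective_integral P_complete W_brownian eps_markov dfM c rho0 f_cost iG GM y01
  optimal_admissible D0.
congr (_ - _)%E; apply: eq_integral => z; rewrite inE/= in_itv/= => /andP[z0 zy].
have yz0 : 0 <= y - z by rewrite subr_ge0 ltW.
have yzy : y - z < y by rewrite ltrBlDr ltrDl.
have rw : E P (reward eps M rho (x - th z) (fun w => passage (nu_star ^~ w) (y - z)) D (fun _ => id)) =
    v i (x - th z) * fine (P D).
  rewrite -(reward_hitting P_complete lambda0 W_brownian eps_markov W_eps_independent C0 dfM rho0 iG GM ss i).
  apply: E_ae.
  - apply: L1_measurable; apply: (reward_L1 P_complete W_brownian eps_markov dfM rho0 iG GM _
      (fun w => passage_ge0 _ _) _ FD).
    by move=> t t0; apply: passage_optional; case: optimal_admissible.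
  - apply: L1_measurable; apply: (reward_L1 P_complete W_brownian eps_markov dfM rho0 iG GM _
      (fun w => passage_ge0 _ _) _ FD).
    by move=> t t0; exact (hitting_optional dfM b (x - th z) t0).
  - apply: filterS optimal_passage => w h; rewrite /reward (h _ yz0 yzy).
    have -> : y - (y - z) = z by ring.
    reflexivity.
by rewrite rw mulrCA mulVf ?mulr1// gt_eqF.
Qed.

Lemma candidate_valueE : candidate_value P W eps X rho c f x y i = value.
Proof.
rewrite /candidate_value; congr (_ - _)%E.
transitivity (\int[mu]_(z in `[0%R, y]) (v i (x - th z))%:E)%E.
  apply: eq_integral => z; rewrite inE/= in_itv/= => /andP[z0 zy].
  rewrite (stopping_valueE P_complete lambda0 W_brownian eps_markov W_eps_independent C0 dfM rho0 iG GM ss D0).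
  by rewrite thetaE// z0 (le_trans zy).
by rewrite integral_itv_bndoo//; exact: measurable_int iv.
Qed.

Lemma control_value_optimal : control_value P W eps X rho c f x y i = value.
Proof.
apply/le_anti/andP; split.
  by apply: ub_ereal_sup => _ [nu adm <-]; exact: objective_le.
rewrite -objective_optimal; apply: ereal_sup_ubound; exists nu_star => //.
exact: optimal_admissible.
Qed.

End Optimal.

(** Expectations given the initial regime are conditional expectations under one [P], so each regime
    has positive initial probability; the price is a family of processes indexed by the starting
    point. *)
Theorem theorem4p4 (R : realType) (d : measure_display)
  (Omega : measurableType d) (P : probability Omega R)
  (W : R -> Omega -> R) (eps : R -> Omega -> 'I_2)
  (sigma lambda : 'I_2 -> R) (rho c : R)
  (X : R -> R -> Omega -> R) (f : R -> R)
  (P_complete : measure_is_complete P)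
  (lambda_gt0 : forall i, 0 < lambda i)
  (sigma_gt0 : 0 < sigma reg1) (sigma_le : sigma reg1 <= sigma reg2)
  (rho_gt0 : 0 < rho) (c_gt0 : 0 < c)
  (W_brownian : brownian_motion P W)
  (eps_markov : markov_chain P (generator lambda) eps)
  (W_eps_independent : independent_systems P
     (process_sigma measurable W `[0, +oo[)
     (process_sigma setT eps `[0, +oo[))
  (eps_initial : forall i, (0 < P (initial_regime eps i))%E)
  (X_price : forall x,
     price_process P (augmented_filtration P W eps) W sigma eps x (X x))
  (f_cost : convex_running_cost f) :
  let V := control_value P W eps X rho c f in
  let J := objective P eps X rho c f in
  let F := candidate_value P W eps X rho c f in
  let nu_star := optimal_control eps X (b_star rho c sigma lambda f) in
  forall (x y : R) (i : 'I_2), 0 <= y <= 1 ->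
    [/\ admissible P W eps y (nu_star x y),
        V x y i = J x y i (nu_star x y) &
        F x y i = V x y i].
Proof.
move=> V J F nu_star x y i y01.
have [v [dv [Iv [L ss]]]] := stopping_solution_exists rho_gt0 lambda_gt0 sigma_gt0 sigma_le.
have [C C0 dfM] := price_diffusion P_complete lambda_gt0 W_brownian eps_markov W_eps_independent (X_price x).
(* Half of the discount rate is spent on dominating the price; the other half is kept for
   convergence at infinite times. *)
have [G [_ iG GM]] := diffusion_domination C0 dfM (divr_gt0 rho_gt0 (ltr0n R 2)).
have D0 := eps_initial i.
have VE := control_value_optimal P_complete lambda_gt0 W_brownian eps_markov W_eps_independent C0 dfM
  c rho_gt0 f_cost iG GM ss y01 D0.
split.
- first [exact (optimal_admissible eps_markov dfM c rho_gt0 f_cost y01)|exact (optimal_admissible P_complete W_brownian eps_markov dfM c rho_gt0 f_cost y01)].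
- rewrite /V VE /J /nu_star.
  by rewrite (objective_optimal P_complete lambda_gt0 W_brownian eps_markov W_eps_independent C0 dfM
    c rho_gt0 f_cost iG GM ss y01 D0).
- rewrite /V VE /F.
  by rewrite (candidate_valueE P_complete lambda_gt0 W_brownian eps_markov W_eps_independent C0 dfM
    c rho_gt0 f_cost iG GM ss y01 D0).
Qed.
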